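(* Consider the linear model $\mathbf{y}=\mathbf{X}\boldsymbol{\beta}+\boldsymbol{\varepsilon}$ and the standardized debiased Lasso statistics $\{z_j\}_{j=1}^p$ defined in the context, and assume conditions A1), A2) and A3) stated in the context. Let $s=p^{1-\eta}$ for some $\eta\in(0,1)$ and $t_\xi=\sqrt{2\xi\log p}$ for $\xi>0$. Assume $\xi>\min\{\eta,\gamma^*\}$. Then $$s^{-1}\left|\mathsf{FP}(t_\xi)-2p_0\Phi(-t_\xi)\right|=o_P(1)\qquad (p\to\infty).$$
   Context: Model. Asymptotics are as $p\to\infty$; $n$, $s$, $s_{max}$, $\boldsymbol\beta$, $\boldsymbol\Sigma$ etc. may depend on $p$. $\mathbf{y}=\mathbf{X}\boldsymbol\beta+\boldsymbol\varepsilon$ with $\mathbf{X}=[\mathbf{x}_1,\dots,\mathbf{x}_p]\in\mathbb{R}^{n\times p}$, $\boldsymbol\beta\in\mathbb{R}^p$, and, given $\mathbf{X}$, $\boldsymbol\varepsilon\sim\mathcal{N}_n(0,\sigma^2\mathbf{I})$, with $\sigma^2=O(1)$. $I_1=\{j:\beta_j\ne0\}$, $s=|I_1|$, $I_0=\{j:\beta_j=0\}$, $p_0=|I_0|$. $\Phi$ is the standard normal CDF. Debiased Lasso. $\hat{\boldsymbol\beta}=\arg\min_{\boldsymbol\beta\in\mathbb{R}^p}(\|\mathbf{y}-\mathbf{X}\boldsymbol\beta\|_2^2/n+2\lambda\|\boldsymbol\beta\|_1)$. With $\mathbf{X}_{-j}$ denoting $\mathbf{X}$ with its $j$th column removed,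 $\hat{\boldsymbol\gamma}_j=\arg\min_{\boldsymbol\gamma\in\mathbb{R}^{p-1}}(n^{-1}\|\mathbf{x}_j-\mathbf{X}_{-j}\boldsymbol\gamma\|_2^2+2\lambda_j\|\boldsymbol\gamma\|_1)$ with components $\hat\gamma_{j,k}$, $k\ne j$, and $\hat\tau_j^2=n^{-1}\|\mathbf{x}_j-\mathbf{X}_{-j}\hat{\boldsymbol\gamma}_j\|_2^2+2\lambda_j\|\hat{\boldsymbol\gamma}_j\|_1$. $\hat{\boldsymbol\Theta}$ is the $p\times p$ matrix with $\hat{\boldsymbol\Theta}_{jj}=\hat\tau_j^{-2}$ and $\hat{\boldsymbol\Theta}_{jk}=-\hat\tau_j^{-2}\hat\gamma_{j,k}$ for $k\neq j$. The debiased Lasso estimator is $\hat{\mathbf{b}}=\hat{\boldsymbol\beta}+n^{-1}\hat{\boldsymbol\Theta}\mathbf{X}^T(\mathbf{y}-\mathbf{X}\hat{\boldsymbol\beta})$. Put $\hat{\boldsymbol\Sigma}=n^{-1}\mathbf{X}^T\mathbf{X}$, $\hat{\boldsymbol\Omega}=\hat{\boldsymbol\Theta}\hat{\boldsymbol\Sigma}\hat{\boldsymbol\Theta}^T$, and $z_j=\sqrt{n}\,\hat b_j\,\sigma^{-1}\hat{\boldsymbol\Omega}_{jj}^{-1/2}$ for $1\le j\le p$. Precision matrix sparsity. $\boldsymbol\Theta=\boldsymbol\Sigma^{-1}$, $s_j=|\{k\ne j:\boldsymbol\Theta_{jk}\ne0\}|$, $s_{max}=\max_{1\le j\le p}s_j$.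 Conditions. A1) The rows of $\mathbf{X}$ are i.i.d. $\mathcal{N}_p(0,\boldsymbol\Sigma)$, where: (a) $\max_j\boldsymbol\Sigma_{jj}\le1$; (b) all eigenvalues of $\boldsymbol\Sigma$ lie in $[C_{min},C_{max}]$ for constants $0<C_{min}\le C_{max}<\infty$; (c) $\rho(\boldsymbol\Sigma,C_0s)\le\rho$ for some constant $\rho>0$, where $C_0=32C_{max}C_{min}^{-1}+1$ and $\rho(\mathbf{A},k)=\max_{T\subseteq\{1,\dots,p\},|T|\le k}\|(\mathbf{A}_{T,T})^{-1}\|_{1,\infty}$, $\mathbf{A}_{T,T}$ is the submatrix with rows and columns indexed by $T$, and $\|\cdot\|_{1,\infty}$ is the maximum $\ell_1$-norm of the rows. A2) $\lambda=8\sigma\sqrt{n^{-1}\log p}$, and $\lambda_j=\tilde\kappa\sqrt{n^{-1}\log p}$, $j=1,\dots,p$, for a suitably large universal constant $\tilde\kappa$. A3) $\max\{s,s_{max}\}=o(n/\log p)$, $\min\{s_{max},s\}=o(\sqrt{n}/\log p)$ and $s=o(n/(\log p)^2)$. Further definitions. $\gamma_1^*=2\eta-\min\{1,\frac{\log(n/s_{max})}{2\log p}\}$, $\gamma_2^*=2-2\eta-\frac{\log n}{2\log p}$, $\gamma^*=\max\{\gamma_1^*,\gamma_2^*\}$. For $t>0$, $\mathsf{FP}(t)=\sum_{j\in I_0}1_{\{|z_j|>t\}}$.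
   Formalization: In γ₁*, log(n/s_max) is undefined when s_max = 0 (diagonal Θ); there s_max is replaced by 1, since reading it as +∞ makes the claim false. Also s = p^{1-η} is read as s/p^{1-η} → 1, because s is an integer. *)

(* Defs.v *)
From HB Require Import structures.
From mathcomp Require Import all_boot all_order all_algebra.
From mathcomp Require Import all_classical all_reals all_analysis.

Set Implicit Arguments.
Unset Strict Implicit.
Unset Printing Implicit Defensive.

Import Order.TTheory GRing.Theory Num.Theory.
Import numFieldNormedType.Exports.

Local Open Scope classical_set_scope.
Local Open Scope ring_scope.

Section RandomMatrices.
Context (R : realType) (d : measure_display) (T : measurableType d).
Variable P : probability T R.

(* The Borel sigma-algebra of R^(m x k), generated by the coordinates. *)
Definition borel_mx (m k : nat) : set_system 'M[R]_(m, k) :=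
  <<s [set A | exists i, exists j, exists2 B : set R, measurable B &
               A = (fun M : 'M[R]_(m, k) => M i j) @^-1` B] >>.

Definition random_matrix (m k : nat) (Z : T -> 'M[R]_(m, k)) : Prop :=
  forall A, borel_mx A -> measurable (Z @^-1` A).

(* Mutual independence: taking some of the A i equal to setT yields the
   product rule for every subfamily. *)
Definition mutually_independent (I : finType) (m k : nat)
    (Z : I -> T -> 'M[R]_(m, k)) : Prop :=
  forall A : I -> set 'M[R]_(m, k), (forall i, borel_mx (A i)) ->
    (P (\bigcap_(i in [set: I]) (Z i @^-1` A i)) =
     \prod_(i : I) P (Z i @^-1` A i))%E.

Definition independent (m k m' k' : nat)
    (Y : T -> 'M[R]_(m, k)) (Z : T -> 'M[R]_(m', k')) : Prop :=
  forall A B, borel_mx A -> borel_mx B ->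
    (P ((Y @^-1` A) `&` (Z @^-1` B)) = P (Y @^-1` A) * P (Z @^-1` B))%E.

(* N(0, v) on the real line; the case v = 0 is separated because
   normal_prob m 0 is not the Dirac mass at m. *)
Definition centered_normal (v : R) (B : set R) : \bar R :=
  if v == 0 then dirac (0 : R) B else normal_prob 0 (Num.sqrt v) B.

(* Z ~ N_m(0, S): every linear combination a^T Z is N(0, a^T S a). *)
Definition gaussian_vector (m : nat) (Z : T -> 'cV[R]_m) (S : 'M[R]_m) : Prop :=
  [/\ random_matrix Z, S^T = S &
      forall (a : 'cV[R]_m) (B : set R), measurable B ->
        P [set w | B ((a^T *m Z w) 0 0)] =
        centered_normal ((a^T *m S *m a) 0 0) B].

Definition iid_gaussian_rows (n p : nat) (X : T -> 'M[R]_(n, p))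
    (S : 'M[R]_p) : Prop :=
  [/\ random_matrix X,
      (forall i, gaussian_vector (fun w => (row i (X w))^T) S) &
      mutually_independent (fun i w => row i (X w))].

(* "Given X, eps ~ N_n(0, sigma^2 I)": the conditional law does not depend
   on X, so eps has this law and is independent of X. *)
Definition gaussian_noise_given (n p : nat) (X : T -> 'M[R]_(n, p))
    (sigma : R) (eps : T -> 'cV[R]_n) : Prop :=
  gaussian_vector eps (sigma ^+ 2)%:M /\ independent X eps.

End RandomMatrices.

Definition oP1 (R : realType) (d : nat -> measure_display)
    (T : forall p, measurableType (d p)) (P : forall p, probability (T p) R)
    (Z : forall p, T p -> R) : Prop :=
  forall e : R, 0 < e ->
    P p [set w | e < `|Z p w|] @[p --> \oo] --> (0 : \bar R).

Definition Phi (R : realType) (x : R) : R := fine (normal_prob 0 1 `]-oo, x]).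

Section Sparsity.
Context (R : realType) (p : nat).
Implicit Types (beta : 'cV[R]_p) (Sigma A : 'M[R]_p).

Definition signals beta : {set 'I_p} := [set j | beta j 0 != 0].
Definition nulls beta : {set 'I_p} := [set j | beta j 0 == 0].

Definition row_sparsity A (j : 'I_p) : nat :=
  #|[set k : 'I_p | (k != j) && (A j k != 0)]|.

Definition s_max Sigma : nat := \max_(j < p) row_sparsity (invmx Sigma) j.

End Sparsity.

Section DesignConditions.
Context (R : realType).

Definition norm_1oo (m k : nat) (A : 'M[R]_(m, k)) : R :=
  \big[Num.max/0]_(i < m) \sum_(j < k) `|A i j|.

Definition principal_submx (p : nat) (A : 'M[R]_p) (S : {set 'I_p}) : 'M[R]_#|S| :=
  mxsub (fun i : 'I_#|S| => enum_val i) (fun i : 'I_#|S| => enum_val i) A.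

Definition rho_inv (p : nat) (A : 'M[R]_p) (k : R) : R :=
  \big[Num.max/0]_(S : {set 'I_p} | #|S|%:R <= k)
    norm_1oo (invmx (principal_submx A S)).

Definition covariance_condition (Cmin Cmax rho : R) (p s : nat)
    (Sigma : 'M[R]_p) : Prop :=
  [/\ forall j, Sigma j j <= 1,
      forall a, eigenvalue Sigma a -> Cmin <= a <= Cmax &
      rho_inv Sigma ((32 * Cmax * Cmin^-1 + 1) * s%:R) <= rho].

End DesignConditions.

Section DebiasedLasso.
Context (R : realType).

Definition sqnorm2 (m : nat) (v : 'cV[R]_m) : R := \sum_i v i 0 ^+ 2.
Definition norm1 (m : nat) (v : 'cV[R]_m) : R := \sum_i `|v i 0|.

Definition lasso_objective (n p : nat) (y : 'cV[R]_n) (X : 'M[R]_(n, p))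
    (lambda : R) (b : 'cV[R]_p) : R :=
  sqnorm2 (y - X *m b) / n%:R + 2 * lambda * norm1 b.

Definition is_lasso (n p : nat) (y : 'cV[R]_n) (X : 'M[R]_(n, p))
    (lambda : R) (b : 'cV[R]_p) : Prop :=
  forall b', lasso_objective y X lambda b <= lasso_objective y X lambda b'.

Context (n p : nat).
Implicit Types (X : 'M[R]_(n, p)) (y : 'cV[R]_n) (bhat : 'cV[R]_p).

(* gamma j is indexed by the p - 1 columns of col' j X, column k' of which is
   column lift j k' of X. *)
Implicit Types gamma : 'I_p -> 'cV[R]_(p.-1).

Definition tau2 X (lambda : R) gamma (j : 'I_p) : R :=
  lasso_objective (col j X) (col' j X) lambda (gamma j).

Definition Theta_hat X (lambda : R) gamma : 'M[R]_p :=
  \matrix_(j, k) match unlift j k with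
                 | None => (tau2 X lambda gamma j)^-1
                 | Some k' => - (tau2 X lambda gamma j)^-1 * gamma j k' 0
                 end.

Definition Sigma_hat X : 'M[R]_p := n%:R^-1 *: (X^T *m X).

Definition Omega_hat X (lambda : R) gamma : 'M[R]_p :=
  Theta_hat X lambda gamma *m Sigma_hat X *m (Theta_hat X lambda gamma)^T.

Definition debiased X y bhat (lambda : R) gamma : 'cV[R]_p :=
  bhat + n%:R^-1 *: (Theta_hat X lambda gamma *m X^T *m (y - X *m bhat)).

Definition zstat X y bhat (lambda : R) gamma (sigma : R) (j : 'I_p) : R :=
  Num.sqrt n%:R * debiased X y bhat lambda gamma j 0 * sigma^-1
    * (Num.sqrt (Omega_hat X lambda gamma j j))^-1.

Definition FP (beta : 'cV[R]_p) (z : 'I_p -> R) (t : R) : nat :=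
  \sum_(j in nulls beta) (t < `|z j|)%R.

End DebiasedLasso.

Section Exponents.
Context (R : realType).
Implicit Types (p n : nat) (eta : R).

Definition tuning (c : R) n p : R := c * Num.sqrt (n%:R^-1 * ln p%:R).

(* log (n / smax) is undefined when smax = 0 (a diagonal precision matrix);
   that case is given the value for smax = 1. *)
Definition gamma1 eta p n (smax : nat) : R :=
  2 * eta - Num.min 1 (ln (n%:R / (maxn 1 smax)%:R) / (2 * ln p%:R)).

Definition gamma2 eta p n : R := 2 - 2 * eta - ln n%:R / (2 * ln p%:R).

Definition gamma_star eta p n (smax : nat) : R :=
  Num.max (gamma1 eta p n smax) (gamma2 eta p n).

Definition t_level (xi : R) p : R := Num.sqrt (2 * xi * ln p%:R).

End Exponents.

(* Main.v *)
(** For a null coordinate j, z_j is a standard Gaussian score [U_j] plus a bias.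
    On an event of probability tending to one the bias is at most
    [b = O (log p / sqrt n * (sqrt smax + sqrt s + min (s, smax)))] outside an
    exceptional set of at most [om * s] coordinates, for any fixed [om > 0]. This
    follows from the optimality conditions of the Lasso and of the nodewise
    regressions, the curvature of the sample covariance along the relevant
    directions being transferred from that of Sigma by Maurey's sampling argument:
    an l1-bounded vector is a mean of sums of few atoms, and a union bound over
    those sums suffices. Hence FP(t) lies, up to [om * s], between the numbers of
    j with [|U_j| > t + b] and with [|U_j| > t - b].

    If [eta < xi], both FP(t) and [2 p0 Phi(-t)] are o(s), by Markov's inequality.
    Otherwise [gamma^* < xi], and Chebyshev's inequality is applied to the two
    counts. The covariance of the events [|U_j| > t] and [|U_k| > t] is at most of
    order [corr (U_j, U_k) ^ 2 (1 + t^2)^2 exp (- t^2 / 2)], the two first-order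
    terms cancelling by symmetry, and the sum of the squared correlations of the
    nodewise residuals is [O (p + p^2 smax log p / n)]. The condition on
    [gamma_1^*] makes the variance [o(s^2)], and both conditions together make the
    change of the mean between [t - b] and [t + b] [o(s)]. *)

Require Import Defs.
From HB Require Import structures.
From mathcomp Require Import all_boot all_order all_algebra.
From mathcomp Require Import all_classical all_reals all_analysis.
From mathcomp Require Import measurable_realfun.
From mathcomp Require Import ring lra.

Set Implicit Arguments.
Unset Strict Implicit.
Unset Printing Implicit Defensive.

Import Order.TTheory GRing.Theory Num.Theory.
Import numFieldNormedType.Exports.

Local Open Scope classical_set_scope.
Local Open Scope ring_scope.

Section WeightedTransfer.
Context (R : realType) (d1 d2 d : measure_display) (T1 : measurableType d1)
  (T2 : measurableType d2) (V : measurableType d).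
Variables (m1 : {measure set T1 -> \bar R}) (m2 : {measure set T2 -> \bar R}).
Variables (Y1 : T1 -> V) (Y2 : T2 -> V) (F1 : T1 -> R) (F2 : T2 -> R).
Hypotheses (mY1 : measurable_fun setT Y1) (mY2 : measurable_fun setT Y2).
Hypotheses (mF1 : measurable_fun setT F1) (mF2 : measurable_fun setT F2).
Hypotheses (F1ge0 : forall w, 0 <= F1 w) (F2ge0 : forall w, 0 <= F2 w).

Import HBNNSimple.

Let weighted_nnsfun (d' : measure_display) (T : measurableType d')
    (m : {measure set T -> \bar R}) (Y : T -> V) (F : T -> R)
    (g : {nnsfun V >-> R}) :
  measurable_fun setT Y -> measurable_fun setT F -> (forall w, 0 <= F w) ->
  (\int[m]_w (F w * g (Y w))%:E =
   \sum_(r \in range g) (r%:E * \int[m]_w (F w * \1_(g @^-1` [set r]) (Y w))%:E))%E.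
Proof.
move=> mY mF F0.
have mind r : measurable_fun setT (fun w => F w * \1_(g @^-1` [set r]) (Y w)).
  apply: measurable_funM => //.
  by apply: (measurableT_comp (f := (\1_(g @^-1` [set r]) : V -> R))) => //.
transitivity (\int[m]_w (\sum_(r \in range g)
    (r * (F w * \1_(g @^-1` [set r]) (Y w)))%:E))%E.
  apply: eq_integral => w _; rewrite fimfunE fsumEFin//.
  rewrite [F w * _]mulrC; congr (_%:E).
  rewrite !fsbig_finite//= mulr_suml; apply: eq_bigr => r _.
  by rewrite mulrAC -mulrA.
rewrite ge0_integral_fsum//; last 2 first.
- by move=> r; apply/measurable_EFinP; apply: measurable_funM.
- move=> r w _; rewrite lee_fin indicE mulrCA mulr_ge0//.
  case: (boolP (Y w \in _)); rewrite ?mulr0// inE => /= <-.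
  by rewrite mulr1.
apply: eq_fsbigr => r; rewrite inE => -[y _ yr].
under eq_integral do rewrite EFinM.
rewrite ge0_integralZl//.
- by apply/measurable_EFinP.
- by move=> w _; rewrite lee_fin mulr_ge0.
- by rewrite lee_fin -yr.
Qed.

Lemma ge0_weighted_integral (f : V -> R) :
  (forall B, measurable B -> (\int[m1]_w (F1 w * \1_B (Y1 w))%:E =
                              \int[m2]_w (F2 w * \1_B (Y2 w))%:E)%E) ->
  measurable_fun setT f -> (forall y, 0 <= f y) ->
  (\int[m1]_w (F1 w * f (Y1 w))%:E = \int[m2]_w (F2 w * f (Y2 w))%:E)%E.
Proof.
move=> H mf f0.
have mEf : measurable_fun setT (EFin \o f) by apply/measurable_EFinP.
pose f_ := nnsfun_approx measurableT mEf.
have approx (d' : measure_display) (T : measurableType d')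
    (m : {measure set T -> \bar R}) (Y : T -> V) (F : T -> R) :
    measurable_fun setT Y -> measurable_fun setT F -> (forall w, 0 <= F w) ->
    (\int[m]_w (F w * f (Y w))%:E =
     limn (fun n => \int[m]_w (F w * f_ n (Y w))%:E))%E.
  move=> mY mF F0; rewrite -monotone_convergence//=.
  - apply: eq_integral => w _; apply/esym/cvg_lim => //.
    rewrite EFinM; under eq_fun do rewrite EFinM.
    apply: cvgeZl => //.
    by apply: (cvg_nnsfun_approx measurableT mEf) => // x _; rewrite lee_fin.
  - move=> n; apply/measurable_EFinP; apply: measurable_funM => //.
    exact: (measurableT_comp (f := f_ n : V -> R)).
  - by move=> n x _; rewrite lee_fin mulr_ge0.
  - move=> x _ a b ab; rewrite lee_fin ler_wpM2l//.
    exact/lefP/nd_nnsfun_approx.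
rewrite !approx//; apply: congr_lim; apply/funext => n.
rewrite !weighted_nnsfun//; apply: eq_fsbigr => r _.
by rewrite H.
Qed.

End WeightedTransfer.

(** * Gaussian tails *)

Section Gauss1.
Context (R : realType).
Implicit Types (m s t a : R).
Local Notation mu := (@lebesgue_measure R).
Local Notation gam := (@normal_prob R 0 1).

Lemma ge0_integral_normal_prob m s (f : R -> R) :
  measurable_fun setT f -> (forall x, 0 <= f x) ->
  (\int[normal_prob m s]_x (f x)%:E =
   \int[mu]_x (normal_pdf m s x * f x)%:E)%E.
Proof.
move=> mf f0.
under eq_integral do rewrite -[f _]mul1r.
apply: (@ge0_weighted_integral R _ _ _ _ _ _ (normal_prob m s) mu id id
  (cst 1) (normal_pdf m s)) => //.
- exact: measurable_normal_pdf.
- by move=> w; exact: normal_pdf_ge0.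
move=> B mB; under eq_integral do rewrite mul1r.
rewrite integral_indic// setIT /normal_prob.
rewrite [LHS]integral_mkcond; apply: eq_integral => x _.
by rewrite patchE indicE; case: ifPn => _; rewrite ?mulr1 ?mulr0.
Qed.

Lemma ge0_integral_law (d : measure_display) (T : measurableType d)
    (P : probability T R) d' (V : measurableType d') (Y : T -> V)
    (nu : probability V R) (f : V -> R) :
  measurable_fun setT Y -> (forall B, measurable B -> P (Y @^-1` B) = nu B) ->
  measurable_fun setT f -> (forall x, 0 <= f x) ->
  (\int[P]_w (f (Y w))%:E = \int[nu]_x (f x)%:E)%E.
Proof.
move=> mY PY mf f0.
under eq_integral do rewrite -[f _]mul1r.
under [RHS]eq_integral do rewrite -[f _]mul1r.
apply: (@ge0_weighted_integral R _ _ _ _ _ _ P nu Y id (cst 1) (cst 1)) => //.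
move=> B mB; under eq_integral do rewrite mul1r.
under [RHS]eq_integral do rewrite mul1r.
rewrite [RHS]integral_indic// setIT; apply: etrans (PY B mB).
rewrite (_ : (fun x => _) = (fun x => (\1_(Y @^-1` B) x)%:E)) ?integral_indic//.
  by rewrite setIT.
by rewrite -[_ @^-1` _]setTI; exact: mY.
Qed.

Lemma normal_peak1_le1 : normal_peak (1 : R) <= 1.
Proof.
rewrite /normal_peak invf_le1 ?sqrtr_gt0; last first.
  by rewrite expr1n mul1r pmulrn_lgt0 ?pi_gt0.
rewrite -[leLHS]sqrtr1 ler_wsqrtr// expr1n mul1r mulr2n.
by have := @pi_ge2 R; lra.
Qed.

Let normal_tilt_exponent s th x (c : R) : s != 0 -> c != 0 ->
  c = 1 - 2 * th * s ^+ 2 ->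
  - x ^+ 2 / (s ^+ 2 *+ 2) + th * x ^+ 2 = - x ^+ 2 / (s ^+ 2 / c *+ 2).
Proof.
move=> s0 c0 cE; have -> : th = (1 - c) / (2 * s ^+ 2) by rewrite cE; field.
rewrite -(mulr_natr (s ^+ 2)) -(mulr_natr (s ^+ 2 / c)).
by field; rewrite ?s0 ?c0.
Qed.

Lemma integral_normal_expsq_mean m s (th : R) : 0 < s -> 2 * th * s ^+ 2 < 1 ->
  (\int[normal_prob m s]_x (expR (th * (x - m) ^+ 2))%:E =
   (Num.sqrt (1 - 2 * th * s ^+ 2))^-1%:E)%E.
Proof.
move=> s0 th1; set c := 1 - 2 * th * s ^+ 2.
have c0 : 0 < c by rewrite subr_gt0.
pose s' := s / Num.sqrt c.
have s'0 : 0 < s' by rewrite divr_gt0// sqrtr_gt0.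
have mf : measurable_fun setT (fun x : R => expR (th * (x - m) ^+ 2)).
  apply: measurableT_comp => //; apply: measurable_funM => //.
  by apply: measurable_funX; exact: measurable_funB.
rewrite ge0_integral_normal_prob//.
transitivity (\int[mu]_x ((Num.sqrt c)^-1%:E * (normal_pdf m s' x)%:E))%E.
  apply: eq_integral => x _; rewrite -EFinM !normal_pdfE ?gt_eqF//; congr (_%:E).
  rewrite /normal_fun -[LHS]mulrA -expRD [RHS]mulrA; congr (_ * expR _); last first.
    have -> : s' ^+ 2 = s ^+ 2 / c by rewrite expr_div_n sqr_sqrtr// ltW.
    by apply: normal_tilt_exponent; rewrite ?gt_eqF.
  rewrite /normal_peak /s' expr_div_n sqr_sqrtr ?ltW//.
  have -> : s ^+ 2 * pi *+ 2 = c * (s ^+ 2 / c * pi *+ 2).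
    rewrite -(mulr_natr (s ^+ 2 * pi)) -(mulr_natr (s ^+ 2 / c * pi)).
    by field; rewrite gt_eqF.
  by rewrite sqrtrM ?ltW// invfM.
rewrite ge0_integralZl//.
- by rewrite integral_normal_pdf mule1.
- by apply/measurable_EFinP; exact: measurable_normal_pdf.
- by move=> x _; rewrite lee_fin normal_pdf_ge0.
Qed.

Lemma integral_normal_expsq s (th : R) : 0 < s -> 2 * th * s ^+ 2 < 1 ->
  (\int[normal_prob 0 s]_x (expR (th * x ^+ 2))%:E =
   (Num.sqrt (1 - 2 * th * s ^+ 2))^-1%:E)%E.
Proof.
move=> s0 th1; rewrite -(integral_normal_expsq_mean 0 s0 th1).
by apply: eq_integral => x _; rewrite subr0.
Qed.

(* Chernoff with [th = 1/2 - 1 / (2 (1 + t^2))] and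
   [x^2 <= 4 (1 + t^2) exp (x^2 / (4 (1 + t^2)))]. *)
Lemma normal_second_moment_tail t : 0 <= t ->
  (\int[gam]_x ((t < `|x|)%R%:R * (1 + x ^+ 2))%:E <=
   (20 * (1 + t ^+ 2) ^+ 2 * expR (- (t ^+ 2 / 2)))%:E)%E.
Proof.
move=> t0; pose D := 1 + t ^+ 2; have DE : D = 1 + t ^+ 2 by [].
rewrite -DE; have D1 : 1 <= D by rewrite DE lerDl sqr_ge0.
have D0 : 0 < D by rewrite (lt_le_trans ltr01).
clearbody D; pose k := (4 * D)^-1; have kE : k = (4 * D)^-1 by [].
clearbody k; have k0 : 0 < k by rewrite kE invr_gt0 mulr_gt0.
pose th := 2^-1 - k; have thE : th = 2^-1 - k by [].
clearbody th.
have thk : 1 - 2 * th * 1 ^+ 2 = (2 * D)^-1.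
  by rewrite thE kE; field; rewrite gt_eqF.
pose th2 := 2^-1 - 2 * k; have th2E : th2 = 2^-1 - 2 * k by [].
clearbody th2.
have th20 : 0 <= th2.
  rewrite th2E kE subr_ge0 invfM mulrA.
  by rewrite (_ : 2 / 4 = 2^-1 :> R) ?ler_piMr ?invf_le1//; field.
have pw x : ((t < `|x|)%R%:R * (1 + x ^+ 2)) <=
    (5 * D * expR (- (th2 * t ^+ 2))) * expR (th * x ^+ 2).
  have [tx|_] := ltP; last by rewrite mul0r !mulr_ge0 ?expR_ge0// ltW.
  rewrite mul1r -mulrA -expRD.
  have tx2 : t ^+ 2 <= x ^+ 2.
    by rewrite -[leRHS]real_normK ?num_real// lerXn2r ?nnegrE//; exact: ltW.
  apply: (@le_trans _ _ (5 * D * expR (k * x ^+ 2))); last first.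
    rewrite ler_wpM2l ?ler_expR//; first by rewrite mulr_ge0// ltW.
    have -> : th = th2 + k by rewrite thE th2E; ring.
    by rewrite mulrDl; have := ler_wpM2l th20 tx2; lra.
  have := @expR_ge1Dx R (k * x ^+ 2); rewrite kE => h.
  have xk : x ^+ 2 <= 4 * D * (expR ((4 * D)^-1 * x ^+ 2) - 1).
    rewrite -[leLHS](@mulVKf _ (4 * D)) ?gt_eqF ?mulr_gt0//.
    by rewrite ler_wpM2l ?mulr_ge0 ?(ltW D0)//; lra.
  set E := expR _ in h xk *.
  have E1 : 1 <= E by rewrite (le_trans _ h)// lerDl mulr_ge0 ?sqr_ge0// -kE ltW.
  apply: (@le_trans _ _ (1 + 4 * D * (E - 1))); first by rewrite lerD2l.
  have : 1 <= D * E by rewrite -[1]mulr1 ler_pM.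
  by nra.
have mf : measurable_fun setT (fun x : R => expR (th * x ^+ 2)).
  by apply: measurableT_comp => //; apply: measurable_funM.
have mEf := mf; move/measurable_EFinP in mEf.
apply: (@le_trans _ _ (\int[gam]_x ((5 * D * expR (- (th2 * t ^+ 2)))%:E *
    (expR (th * x ^+ 2))%:E))%E).
  apply: ge0_le_integral => //.
    - by move=> x _; rewrite lee_fin mulr_ge0// addr_ge0// sqr_ge0.
  - apply/measurable_EFinP; apply: measurable_funM; last first.
      by apply: measurable_funD => //; exact: measurable_funX.
    rewrite (_ : (fun x => _) =
        (fun x => if t < `|x| then (1 : R) else 0)); last first.
      by apply/funext => x; case: ltP.
    by apply: measurable_fun_ifT => //; apply: measurable_fun_ltr => //;
      exact: normr_measurable.
  - apply/measurable_EFinP; exact: measurable_funM.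
  - by move=> x _; rewrite -EFinM lee_fin.
rewrite ge0_integralZl//; last by rewrite lee_fin !mulr_ge0 ?expR_ge0// ltW.
rewrite integral_normal_expsq//; last by rewrite -subr_gt0 thk invr_gt0 mulr_gt0.
rewrite thk sqrtrV ?invrK ?mulr_ge0 ?(ltW D0)// -EFinM lee_fin.
have sq : Num.sqrt (2 * D) <= 2 * D.
  rewrite -[leRHS]sqr_sqrtr ?mulr_ge0 ?(ltW D0)// expr2 ler_peMr ?sqrtr_ge0//.
  by rewrite -[leLHS]sqrtr1 ler_wsqrtr//; lra.
have ex : expR (- (th2 * t ^+ 2)) <= 2 * expR (- (t ^+ 2 / 2)).
  have -> : - (th2 * t ^+ 2) = 2 * k * t ^+ 2 + - (t ^+ 2 / 2).
    by rewrite th2E; field.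
  rewrite expRD ler_wpM2r ?expR_ge0//.
  have h2 : 2 * k * t ^+ 2 <= 2^-1.
    have -> : 2 * k * t ^+ 2 = (t ^+ 2 / D) / 2 by rewrite kE; field; rewrite gt_eqF.
    by rewrite ler_piMl// ler_pdivrMr// mul1r DE lerDr.
  apply: (le_trans (_ : _ <= expR (2^-1))); first by rewrite ler_expR.
  have : expR (- (2^-1 : R)) >= 2^-1 by have := @expR_ge1Dx R (-2^-1); lra.
  by rewrite expRN lef_pV2 ?posrE ?expR_gt0.
apply: (@le_trans _ _ (5 * D * (2 * expR (- (t ^+ 2 / 2))) * (2 * D))).
  apply: ler_pM => //; rewrite ?sqrtr_ge0 ?mulr_ge0 ?expR_ge0 ?(ltW D0)//.
  by rewrite ler_wpM2l// mulr_ge0// ltW.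
by rewrite le_eqVlt; apply/orP; left; apply/eqP; ring.
Qed.

End Gauss1.

Section Gauss2.
Context (R : realType).
Implicit Types (t x y : R).
Local Notation mu := (@lebesgue_measure R).
Local Notation gam := (@normal_prob R 0 1).
Local Notation pdf := (@normal_pdf R 0 1).

Lemma normal_pdf01E x : pdf x = normal_peak 1 * expR (- (x ^+ 2 / 2)).
Proof.
by rewrite normal_pdfE ?oner_eq0// /normal_fun subr0 expr1n -[1 *+ 2]/2%:R mulNr.
Qed.

Lemma normal_pdf01N x : pdf (- x) = pdf x.
Proof. by rewrite !normal_pdf01E sqrrN. Qed.

Let mEpdf D : measurable_fun D (fun x : R => (pdf x)%:E).
Proof. by apply/measurable_EFinP/measurable_funTS; exact: measurable_normal_pdf. Qed.

Let cpdf : continuous pdf.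
Proof. exact: continuous_normal_pdf (oner_neq0 R). Qed.

Lemma normal_prob_ray_closed t : gam `]-oo, t[ = gam `]-oo, t].
Proof.
by rewrite /normal_prob integral_itv_bndo_bndc//.
Qed.

Lemma normal_prob_rayN t : gam `]t, +oo[ = gam `]-oo, (- t)].
Proof.
rewrite /normal_prob; have -> := @ge0_integration_by_substitutionNy R pdf t.
- transitivity (\int[mu]_(x in `[t, +oo[) (pdf x)%:E)%E.
    by apply: integral_itv_obnd_cbnd; exact: mEpdf.
  by apply: eq_integral => x _ /=; rewrite normal_pdf01N.
- by apply: continuous_subspaceT.
- by move=> x _; exact: normal_pdf_ge0.
Qed.

Lemma PhiE t : (Phi t)%:E = gam `]-oo, t].
Proof. by rewrite /Phi fineK// fin_num_measure. Qed.

Lemma Phi_ge0 t : 0 <= Phi t.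
Proof. by rewrite -lee_fin PhiE. Qed.

Lemma measurable_abs_tail t : measurable [set x : R | t < `|x|].
Proof.
rewrite (_ : [set x | _] = (fun x : R => `|x|) @^-1` `]t, +oo[); last first.
  by apply/seteqP; split => x /=; rewrite in_itv/= andbT.
rewrite -[X in measurable X]setTI; exact: normr_measurable.
Qed.

Lemma Phi_sub (a b : R) : a <= b -> (Phi b - Phi a)%:E = gam `]a, b].
Proof.
move=> ab; rewrite EFinB !PhiE.
have -> : `]-oo, b]%classic = `]-oo, a] `|` `]a, b].
  apply/seteqP; split => x /=; rewrite !in_itv/=.
    by case: (leP x a) => h h2; [left|right].
  by move=> [|/andP[_ //]] h; exact: le_trans ab.
rewrite measureU//=; last first.
  apply/seteqP; split => // x /= []; rewrite !in_itv/= => h1 /andP[h2 _].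
  by have := lt_le_trans h2 h1; rewrite ltxx.
by rewrite [X in (X - _)%E]addrC; apply: addeK; exact: fin_num_measure.
Qed.


Lemma normal_abs_tail t : 0 <= t -> gam [set x | t < `|x|] = (2 * Phi (- t))%:E.
Proof.
move=> t0; have -> : [set x | t < `|x|] = `]-oo, (- t)[ `|` `]t, +oo[.
  apply/seteqP; split => x /=; rewrite !in_itv/= ?andbT.
    by rewrite ltr_normr => /orP[]; [right|left]; rewrite // ltrNr.
  by rewrite ltr_normr => -[|->//]; rewrite ltrNr orbC => ->.
rewrite measureU//=; last first.
  apply/seteqP; split => // x /= []; rewrite !in_itv/= andbT => h1 h2.
  by have := lt_trans h1 (le_lt_trans _ h2); lra.
by rewrite normal_prob_rayN normal_prob_ray_closed -PhiE -EFinD; congr (_%:E); ring.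
Qed.

Lemma Phi_tail t : 0 <= t ->
  2 * Phi (- t) <= 20 * (1 + t ^+ 2) ^+ 2 * expR (- (t ^+ 2 / 2)).
Proof.
move=> t0; rewrite -lee_fin -normal_abs_tail//.
apply: le_trans (normal_second_moment_tail t0).
rewrite -[[set x | _]]setIT -integral_indic//; last exact: measurable_abs_tail.
apply: ge0_le_integral => //.
- by apply/measurable_EFinP; apply: measurable_indic; exact: measurable_abs_tail.
- apply/measurable_EFinP; apply: measurable_funM; last first.
    by apply: measurable_funD => //; exact: measurable_funX.
  rewrite (_ : (fun x => _) = \1_[set x : R | t < `|x|]).
    by apply: measurable_indic; exact: measurable_abs_tail.
  apply/funext => x; rewrite indicE/=; case: ltP => h; first by rewrite mem_set.
  by rewrite memNset//=; apply/negP; rewrite -leNgt.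
- move=> x _; rewrite lee_fin indicE; case: (boolP (_ \in _)) => h.
    by move: h; rewrite inE/= => ->; rewrite mul1r lerDl sqr_ge0.
  by rewrite mulr_ge0// addr_ge0// sqr_ge0.
Qed.

Lemma normal_itv_le (a b c : R) : a <= b -> (forall x, a <= x <= b -> pdf x <= c) ->
  (gam `]a, b] <= ((b - a) * c)%:E)%E.
Proof.
move=> ab H; apply: (@le_trans _ _ (\int[mu]_(x in `]a, b]) (cst c%:E) x)%E).
  apply: ge0_le_integral => //.
  - by move=> x _; rewrite lee_fin normal_pdf_ge0.
  - exact: mEpdf.
  - move=> x; rewrite /= in_itv/= => /andP[ax xb].
    by rewrite lee_fin H// xb ltW.
rewrite integral_cst//= lebesgue_measure_itv/= lte_fin.
case: ltP => [_|ba]; first by rewrite -EFinB -EFinM mulrC.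
by rewrite mule0 lee_fin (le_anti (introT andP (conj ab ba))) subrr mul0r.
Qed.

Lemma normal_itv_ge (a b c : R) : 0 <= c -> a <= b ->
  (forall x, a <= x <= b -> c <= pdf x) ->
  (((b - a) * c)%:E <= gam `]a, b])%E.
Proof.
move=> c0 ab H; apply: (@le_trans _ _ (\int[mu]_(x in `]a, b]) (cst c%:E) x)%E).
  rewrite integral_cst//= lebesgue_measure_itv/= lte_fin.
  case: ltP => [_|ba]; first by rewrite -EFinB -EFinM mulrC.
  by rewrite mule0 lee_fin (le_anti (introT andP (conj ab ba))) subrr mul0r.
apply: ge0_le_integral => //.
- exact: mEpdf.
- move=> x; rewrite /= in_itv/= => /andP[ax xb].
  by rewrite lee_fin H// xb ltW.
Qed.

Lemma Phi_lipschitz s t : 0 <= s -> s <= t ->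
  0 <= Phi (- s) - Phi (- t) <= (t - s) * expR (- (s ^+ 2 / 2)).
Proof.
move=> s0 st; have ts : - t <= - s by rewrite lerN2.
rewrite -!lee_fin Phi_sub// measure_ge0/=.
have -> : t - s = - s - - t by ring.
apply: normal_itv_le => // x /andP[tx xs].
rewrite normal_pdf01E -[leRHS]mul1r ler_pM ?normal_peak_ge0 ?expR_ge0//.
  exact: normal_peak1_le1.
by rewrite ler_expR lerN2 ler_pM2r// -[leRHS]sqrrN ler_sqr ?nnegrE; lra.
Qed.

Let expsq_diff (a b : R) : 0 <= a ->
  expR (- (a ^+ 2 / 2)) - expR (- (b ^+ 2 / 2)) <= 3 * `|b - a|.
Proof.
move=> a0; have e0 (z : R) : 0 < expR z by exact: expR_gt0.
have ea1 : expR (- (a ^+ 2 / 2)) <= 1.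
  by rewrite -expR0 ler_expR oppr_le0 divr_ge0 ?sqr_ge0.
have [ab|ab] := leP 1 (`|b - a|).
  by have := e0 (- (b ^+ 2 / 2)); lra.
have ba : b ^+ 2 - a ^+ 2 <= `|b - a| * (2 * a + 1).
  have : b - a <= `|b - a| by rewrite ler_norm.
  have : - (b - a) <= `|b - a| by rewrite -normrN ler_norm.
  have : 0 <= `|b - a| by [].
  rewrite -subr_ge0 in ab *; nra.
have h1 : expR (- (a ^+ 2 / 2)) - expR (- (b ^+ 2 / 2)) <=
    expR (- (a ^+ 2 / 2)) * ((b ^+ 2 - a ^+ 2) / 2).
  have -> : - (b ^+ 2 / 2) = - (a ^+ 2 / 2) + - ((b ^+ 2 - a ^+ 2) / 2) by field.
  rewrite expRD -{1}[expR (- (a ^+ 2 / 2))]mulr1 -mulrBr ler_wpM2l ?(ltW (e0 _))//.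
  by have := @expR_ge1Dx R (- ((b ^+ 2 - a ^+ 2) / 2)); lra.
apply: (le_trans h1).
apply: (@le_trans _ _ (expR (- (a ^+ 2 / 2)) * (`|b - a| * (2 * a + 1) / 2))).
  by rewrite ler_wpM2l ?(ltW (e0 _))//; lra.
have h2 : expR (- (a ^+ 2 / 2)) * (2 * a + 1) <= 6.
  have h3 := @expR_ge1Dx R (a ^+ 2 / 2).
  rewrite expRN mulrC ler_pdivrMr//.
  by apply: (@le_trans _ _ (6 * (1 + a ^+ 2 / 2))); [nra|rewrite ler_wpM2l].
have := normr_ge0 (b - a); set N := `|_|; move=> N0.
by have := ler_wpM2l N0 h2; lra.
Qed.

Let pdf_diff (a b : R) : `|pdf a - pdf b| <= 3 * `|a - b|.
Proof.
have P0 := normal_peak_ge0 (1 : R); have P1 := normal_peak1_le1 R.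
wlog : a b / pdf b <= pdf a.
  move=> W; case: (leP (pdf b) (pdf a)) => [|/ltW] h; first exact: W.
  by rewrite distrC [`|a - b|]distrC; exact: W.
wlog a0 : a b / 0 <= a.
  move=> W h; case: (leP 0 a) => [|/ltW] a0; first exact: W.
  have := W (- a) (- b); rewrite !normal_pdf01N -opprD normrN; apply => //; lra.
move=> h; rewrite ger0_norm ?subr_ge0// !normal_pdf01E -mulrBr.
have d0 : 0 <= expR (- (a ^+ 2 / 2)) - expR (- (b ^+ 2 / 2)).
  move: h; rewrite !normal_pdf01E ler_pM2l ?subr_ge0//.
  by rewrite normal_peak_gt0 ?oner_eq0.
rewrite distrC -[leRHS]mul1r ler_pM//.
exact: expsq_diff.
Qed.

(* The shift [y] moves mass in through one end of [-t, t] and out through the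
   other, so that the first-order terms cancel. *)
Lemma normal_abs_tail_shift t y : 0 <= t ->
  fine (gam [set x | t < `|y + x|]) <= 2 * Phi (- t) + 6 * y ^+ 2.
Proof.
move=> t0.
have -> : gam [set x | t < `|y + x|] = (Phi (- t + y) + Phi (- t - y))%:E.
  rewrite (_ : [set x | _] = `]-oo, (- t - y)[ `|` `](t - y), +oo[).
    rewrite measureU//=; last first.
      apply/seteqP; split => // x /= []; rewrite !in_itv/= andbT => h1 h2; lra.
    rewrite normal_prob_rayN normal_prob_ray_closed EFinD !PhiE [RHS]addeC opprB.
    by rewrite [- t + y]addrC.
  apply/seteqP; split => x /=; rewrite !in_itv/= ?andbT ltr_normr.
    by case/orP => h; [right|left]; lra.
  by case=> h; apply/orP; [right|left]; lra.
rewrite /=; wlog y0 : y / 0 <= y.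
  move=> W; case: (leP 0 y) => [|/ltW] y0; first exact: W.
  by have := W (- y); rewrite oppr_ge0 sqrrN opprK addrC; apply.
pose c := pdf (- t).
have ty : - t <= - t + y by lra.
have yt : - t - y <= - t by lra.
have h1 : Phi (- t + y) - Phi (- t) <= (- t + y - - t) * (c + 3 * y).
  rewrite -lee_fin Phi_sub//; apply: normal_itv_le => // x /andP[x1 x2].
  have := le_trans (ler_norm _) (pdf_diff x (- t)).
  by rewrite ger0_norm ?subr_ge0//; rewrite -/c; lra.
have h2 : (- t - (- t - y)) * (c - 3 * y) <= Phi (- t) - Phi (- t - y).
  have [c0|c0] := leP 0 (c - 3 * y); last first.
    apply: (@le_trans _ _ 0); last by rewrite -lee_fin Phi_sub.
    by rewrite mulr_ge0_le0//; lra.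
  rewrite -lee_fin Phi_sub//; apply: normal_itv_ge => // x /andP[x1 x2].
  have := le_trans (ler_norm _) (pdf_diff (- t) x).
  by rewrite ger0_norm ?subr_ge0//; rewrite -/c; lra.
by nra.
Qed.

End Gauss2.

(** * Pairs of correlated Gaussian variables *)

Section GaussFourier.
Context (R : realType).
Implicit Types (a x y : R).
Local Notation mu := (@lebesgue_measure R).
Local Notation gam := (@normal_prob R 0 1).
Local Notation pdf := (@normal_pdf R 0 1).

Let is_derive_mull a x : is_derive x 1 (fun y : R => a * y) a.
Proof.
apply/is_derive1_caratheodory; exists (fun=> a); split => //.
- by move=> z; rewrite -mulrBr.
- exact: cvg_cst.
Qed.

Let is_derive_mulr a x : is_derive x 1 (fun y : R => y * a) a.
Proof.
have -> : (fun y => y * a) = (fun y => a * y) by apply/funext => y; rewrite mulrC.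
exact: is_derive_mull.
Qed.

Let is_derive_halfsq (c : R) x : is_derive x 1 (fun y : R => c * (y ^+ 2 / 2)) (c * x).
Proof.
apply/is_derive1_caratheodory; exists (fun y => c * ((y + x) / 2)); split => //.
- by move=> z; field.
- apply: cvgM; first exact: cvg_cst.
  apply: cvgM; last exact: cvg_cst.
  by apply: (@cvgD _ R^o); [exact: cvg_id|exact: cvg_cst].
- by field.
Qed.

Lemma is_derive_normal_pdf01 x : is_derive x 1 pdf (- x * pdf x).
Proof.
have -> : pdf = normal_peak 1 *: (expR \o (fun y => -1 * (y ^+ 2 / 2))).
  by apply/funext => y; rewrite normal_pdf01E -[- (y ^+ 2 / 2)]mulN1r.
have h := @is_derive1_comp R expR _ x _ _ (is_derive_expR _) (is_derive_halfsq (-1) x).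
apply: is_derive_eq; rewrite mulN1r /= !fctE /= [LHS]mulrA mulrC.
by rewrite !mulN1r.
Qed.

Let absx_pdf_le x : `|x| * pdf x <= 2 * (normal_peak 1 * expR (- (4^-1 * x ^+ 2))).
Proof.
rewrite normal_pdf01E mulrCA [leRHS]mulrCA ler_wpM2l ?normal_peak_ge0//.
have -> : - (x ^+ 2 / 2) = - (4^-1 * x ^+ 2) + - (4^-1 * x ^+ 2) by field.
rewrite expRD mulrA ler_wpM2r ?expR_ge0// expRN ler_pdivrMr ?expR_gt0//.
have h := @expR_ge1Dx R (4^-1 * x ^+ 2).
have : x ^+ 2 = `|x| ^+ 2 by rewrite real_normK ?num_real.
by have : 0 <= `|x| by []; nra.
Qed.

Let absx_pdf_le2 x : `|x| * pdf x <= 2.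
Proof.
apply: (le_trans (absx_pdf_le x)); rewrite -[leRHS]mulr1 ler_wpM2l//.
rewrite -[leRHS]mulr1 ler_pM ?normal_peak_ge0 ?expR_ge0 ?normal_peak1_le1//.
by rewrite -expR0 ler_expR oppr_le0 mulr_ge0 ?sqr_ge0.
Qed.

Let cpdf : continuous pdf.
Proof. exact: continuous_normal_pdf (oner_neq0 R). Qed.

Let mpdf : measurable_fun setT pdf.
Proof. exact: measurable_normal_pdf. Qed.

Let G y := 2 * Num.sqrt 2 * normal_pdf 0 (Num.sqrt 2) y : R.

Let absx_pdf_G x : `|x| * pdf x <= G x.
Proof.
have s20 : (0 : R) < Num.sqrt 2 by rewrite sqrtr_gt0.
apply: (le_trans (absx_pdf_le x)); rewrite /G -mulrA ler_wpM2l//.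
rewrite normal_pdfE ?gt_eqF// [leRHS]mulrA ler_pM ?normal_peak_ge0 ?expR_ge0//.
  rewrite /normal_peak expr1n sqr_sqrtr// mul1r -[2 * pi *+ 2]mulrnAr sqrtrM//.
  by rewrite invfM mulrA mulfV ?gt_eqF// mul1r.
rewrite /normal_fun subr0 sqr_sqrtr// ler_expR -[2 *+ 2]/(2 + 2 : R) mulNr lerN2.
by rewrite le_eqVlt; apply/orP; left; apply/eqP; field.
Qed.

Let integrableG : mu.-integrable setT (EFin \o G).
Proof.
have -> : EFin \o G = (fun x => (2 * Num.sqrt 2)%:E * (normal_pdf 0 (Num.sqrt 2) x)%:E)%E.
  by apply/funext => x /=; rewrite -EFinM.
by apply: integrableZl => //; exact: integrable_normal_pdf.
Qed.

Let integrable_dom (f : R -> R) (g : R -> R) : measurable_fun setT f ->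
  mu.-integrable setT (EFin \o g) -> (forall x, `|f x| <= g x) ->
  mu.-integrable setT (EFin \o f).
Proof.
move=> mf ig H; apply: le_integrable ig => //.
- exact/measurable_EFinP.
- by move=> x _ /=; rewrite lee_fin (le_trans (H x))// ler_norm.
Qed.

Let integrable_bdd_pdf (f : R -> R) : measurable_fun setT f ->
  (forall x, `|f x| <= 1) -> mu.-integrable setT (EFin \o (fun y => f y * pdf y)).
Proof.
move=> mf f1; apply: (integrable_dom (g := pdf)).
- exact: measurable_funM.
- exact: integrable_normal_pdf.
- move=> x; rewrite normrM (ger0_norm (normal_pdf_ge0 _ _ _)).
  by rewrite ler_piMl ?normal_pdf_ge0.
Qed.

Let mcos a : measurable_fun setT (fun y : R => cos (a * y)).
Proof.
apply: continuous_measurable_fun => x.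
apply: (continuous_comp (f := fun y => a * y) (g := cos)).
  by apply: cvgM; [exact: cvg_cst|exact: cvg_id].
exact: continuous_cos.
Qed.

Let msin a : measurable_fun setT (fun y : R => sin (a * y)).
Proof.
apply: continuous_measurable_fun => x.
apply: (continuous_comp (f := fun y => a * y) (g := sin)).
  by apply: cvgM; [exact: cvg_cst|exact: cvg_id].
exact: continuous_sin.
Qed.

Lemma integral_derive_eq0 (K k : R -> R) : (forall x, is_derive x 1 K (k x)) ->
  continuous k -> mu.-integrable setT (EFin \o k) ->
  K n%:R @[n --> \oo] --> (0 : R) -> K (- n%:R) @[n --> \oo] --> (0 : R) ->
  \int[mu]_x k x = 0.
Proof.
move=> dK ck ik K0 KN0.
have cK : continuous K.
  by move=> x; apply/differentiable_continuous/derivable1_diffP; case: (dK x).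
pose f_ (n : nat) x := (k x * \1_`[- n.+1%:R, n.+1%:R] x)%:E.
have mk : measurable_fun setT k by exact: continuous_measurable_fun.
have mf n : measurable_fun setT (f_ n).
  by apply/measurable_EFinP; apply: measurable_funM => //; exact: measurable_indic.
have If n : (\int[mu]_x f_ n x = (K n.+1%:R - K (- n.+1%:R))%:E)%E.
  rewrite EFinB -(@continuous_FTC2 _ k)//.
  - rewrite [RHS]integral_mkcond; apply: eq_integral => x _.
    by rewrite /f_ patchE indicE; case: ifP; rewrite ?mulr1 ?mulr0.
  - by rewrite -subr_gt0 opprK addr_gt0.
  - exact: continuous_subspaceT.
  - split.
    + by move=> x _; case: (dK x).
    + by apply: cvg_at_right_filter; exact: cK.
    + by apply: cvg_at_left_filter; exact: cK.
  - by move=> x _; rewrite derive1E; case: (dK x).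
have c1 : (\int[mu]_x f_ n x @[n --> \oo] --> \int[mu]_x (k x)%:E)%E.
  apply: (@dominated_cvg _ _ _ mu setT measurableT f_ (EFin \o k) (EFin \o (fun x => `|k x|))) => //.
  - move=> x _; apply: cvg_EFin; first exact: nearW.
    apply: cvg_near_cst; near=> n.
    rewrite /= indicE mem_set ?mulr1//= in_itv/= -ler_norml.
    apply: (@le_trans _ _ n%:R); last by rewrite ler_nat.
    by near: n; exact: nbhs_infty_ger.
  - apply: le_integrable ik => //; last by move=> x _ /=; rewrite normr_id.
    by apply/measurable_EFinP; exact: measurableT_comp.
  - move=> n x _; rewrite lee_fin normrM indicE.
    by case: (_ \in _); rewrite ?normr1 ?mulr1 ?normr0 ?mulr0.
have c2 : (\int[mu]_x f_ n x @[n --> \oo] --> 0%:E)%E.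
  under eq_fun do rewrite If.
  apply: cvg_EFin; first exact: nearW.
  rewrite /= -[X in _ --> X](subrr 0); apply: cvgB.
    by have := K0; rewrite -(cvg_shiftS (fun n => K n%:R)).
  by have := KN0; rewrite -(cvg_shiftS (fun n => K (- n%:R))).
rewrite /Rintegral (_ : (\int[mu]_x (k x)%:E)%E = 0%:E)//.
exact: (cvg_unique _ c1 c2).
Unshelve. all: by end_near.
Qed.

Let pdf_cvg0 (f : R -> R) (u : nat -> R) : (forall x, `|f x| <= 1) ->
  (forall n, `|u n| = n%:R) -> f (u n) * pdf (u n) @[n --> \oo] --> (0 : R).
Proof.
move=> f1 un; rewrite -(cvg_shiftS (fun n => f (u n) * pdf (u n))).
apply/norm_cvg0P; apply: (@squeeze_cvgr _ _ _ _ (cst 0) (fun n : nat => 2 * n.+1%:R^-1)).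
- near=> n; rewrite normr_ge0/= normrM (ger0_norm (normal_pdf_ge0 _ _ _)).
  rewrite ler_pdivlMr//.
  apply: le_trans (absx_pdf_le2 (u n.+1)); rewrite un [leRHS]mulrC ler_wpM2r//.
  by rewrite ler_piMl ?normal_pdf_ge0.
- exact: cvg_cst.
- rewrite -[X in _ --> X](mulr0 2); apply: cvgM; first exact: cvg_cst.
  exact: cvg_harmonic.
Unshelve. all: by end_near.
Qed.

Let F a := \int[mu]_y (cos (a * y) * pdf y).

Let Fpart a : \int[mu]_y (- y * sin (a * y) * pdf y) = - a * F a.
Proof.
have msn y : `|sin y| <= 1 by rewrite ler_norml sin_geN1 sin_le1.
have mcn y : `|cos y| <= 1 by rewrite ler_norml cos_geN1 cos_le1.
have i1 : mu.-integrable setT (EFin \o (fun y => - y * sin (a * y) * pdf y)).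
  apply: (integrable_dom _ integrableG) => [|x].
    by apply: measurable_funM => //; apply: measurable_funM => //; exact: measurable_funN.
  rewrite !normrM normrN (ger0_norm (normal_pdf_ge0 _ _ _)).
  apply: le_trans (absx_pdf_G x); rewrite ler_wpM2r ?normal_pdf_ge0//.
  by rewrite ler_piMr.
have i2 : mu.-integrable setT (EFin \o (fun y => a * (cos (a * y) * pdf y))).
  have -> : EFin \o (fun y => a * (cos (a * y) * pdf y)) =
      (fun y => a%:E * (cos (a * y) * pdf y)%:E)%E.
    by apply/funext => y /=; rewrite -EFinM.
  by apply: integrableZl => //; apply: integrable_bdd_pdf.
have : \int[mu]_y (- y * sin (a * y) * pdf y + a * (cos (a * y) * pdf y)) = 0.
  apply: (@integral_derive_eq0 ((sin \o (fun y => a * y)) * pdf)).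
  - move=> x; have h1 := is_derive1_comp (is_derive_sin (a * x)) (is_derive_mull a x).
    have h2 := is_derive_normal_pdf01 x.
    apply: is_derive_eq; rewrite /= /GRing.scale/=; ring.
  - move=> x; apply: (@cvgD _ R^o).
      apply: cvgM; last exact: cpdf.
      apply: cvgM; first by apply: (@cvgN _ R^o); exact: cvg_id.
      apply: (continuous_comp (f := fun y => a * y) (g := sin)).
        by apply: cvgM; [exact: cvg_cst|exact: cvg_id].
      exact: continuous_sin.
    apply: cvgM; first exact: cvg_cst.
    apply: cvgM; last exact: cpdf.
    apply: (continuous_comp (f := fun y => a * y) (g := cos)).
      by apply: cvgM; [exact: cvg_cst|exact: cvg_id].
    exact: continuous_cos.
  - exact: (integrableD measurableT i1 i2).
  - by apply: (pdf_cvg0 (f := fun x => sin (a * x))) => // n; rewrite ger0_norm.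
  - by apply: (pdf_cvg0 (f := fun x => sin (a * x))) => // n; rewrite normrN ger0_norm.
rewrite RintegralD// RintegralZl//; first by move/eqP; rewrite addr_eq0 mulNr => /eqP.
by apply: integrable_bdd_pdf.
Qed.

Let is_derive_F a : is_derive a 1 F (- a * F a).
Proof.
pose f x y := cos (x * y) * pdf y.
have msn y : `|sin y| <= 1 by rewrite ler_norml sin_geN1 sin_le1.
have mcn y : `|cos y| <= 1 by rewrite ler_norml cos_geN1 cos_le1.
have df x y : is_derive x 1 (f ^~ y) (- y * sin (x * y) * pdf y).
  have h1 := @is_derive1_comp R cos (fun z => z * y) x _ _ (is_derive_cos (x * y)) (is_derive_mulr y x).
  have -> : f ^~ y = (cos \o (fun z => z * y)) * cst (pdf y) by [].
  by apply: is_derive_eq; rewrite /= /GRing.scale/= mulr0 add0r; ring.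
have pf x y : partial1of2 f x y = - y * sin (x * y) * pdf y.
  by rewrite partial1of2E; case: (df x y).
have Ia : `]a - 1, a + 1[%classic a by rewrite /= in_itv/=; apply/andP; split; lra.
have H1 x : `]a - 1, a + 1[%classic x -> mu.-integrable setT (EFin \o f x).
  by move=> _; apply: integrable_bdd_pdf.
have H2 x y : `]a - 1, a + 1[%classic x -> setT y -> derivable (f ^~ y) x 1.
  by move=> _ _; case: (df x y).
have H3 y : 0 <= G y by rewrite !mulr_ge0 ?normal_pdf_ge0 ?sqrtr_ge0.
have H4 x y : `]a - 1, a + 1[%classic x -> setT y -> `|partial1of2 f x y| <= G y.
  move=> _ _; rewrite pf !normrM normrN (ger0_norm (normal_pdf_ge0 _ _ _)).
  apply: le_trans (absx_pdf_G y); rewrite ler_wpM2r ?normal_pdf_ge0//.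
  by rewrite ler_piMr.
apply: DeriveDef; first exact: (derivable_under_integral measurableT Ia H1 H2 H3 integrableG H4).
rewrite -derive1E (differentiation_under_integral measurableT Ia H1 H2 H3 integrableG H4).
by under eq_Rintegral do rewrite pf; exact: Fpart.
Qed.

Let FE a : F a = expR (- (a ^+ 2 / 2)).
Proof.
pose H := F * (expR \o (fun y => 1 * (y ^+ 2 / 2))).
have dH x : is_derive x 1 H 0.
  have h := @is_derive1_comp R expR _ x _ _ (is_derive_expR _) (is_derive_halfsq 1 x).
  have h2 := is_derive_F x.
  by apply: is_derive_eq; rewrite /= /GRing.scale/=; ring.
have := @is_derive_0_is_cst R H a 0 dH.
rewrite /H !fctE/= !mul1r expr0n/= mul0r expR0 mulr1 => E.
have F0 : F 0 = 1.
  rewrite /F; under eq_Rintegral do rewrite mul0r cos0 mul1r.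
  by rewrite /Rintegral integral_normal_pdf.
by rewrite expRN -[RHS]mul1r -{1}F0 -E mulfK// gt_eqF ?expR_gt0.
Qed.

Lemma integral_normal_cos1 a :
  (\int[gam]_y (1 + cos (a * y))%:E = (1 + expR (- (a ^+ 2 / 2)))%:E)%E.
Proof.
have mcn y : `|cos y| <= 1 by rewrite ler_norml cos_geN1 cos_le1.
rewrite ge0_integral_normal_prob; last 2 first.
- exact: measurable_funD.
- by move=> x; have := cos_geN1 (a * x); lra.
rewrite (_ : (fun x => _) = (fun x => (pdf x)%:E + (cos (a * x) * pdf x)%:E)%E); last first.
  by apply/funext => x /=; rewrite -EFinD mulrDr mulr1 mulrC.
rewrite integralD//; last 2 first.
- exact: integrable_normal_pdf.
- exact: integrable_bdd_pdf.
rewrite integral_normal_pdf -FE EFinD /F /Rintegral fineK//.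
by apply: integrable_fin_num => //; exact: integrable_bdd_pdf.
Qed.

End GaussFourier.

Lemma fine_probability_setC (R : realType) (d : measure_display)
    (T : measurableType d) (Q : probability T R) (A : set T) : measurable A ->
  1 - fine (Q A) = fine (Q (~` A)).
Proof. by move=> mA; rewrite probability_setC// fineB ?fin_num_measure. Qed.

Section FourierUniqueness.
Context (R : realType) (d : measure_display) (T : measurableType d)
  (P : probability T R).
Local Notation mu := (@lebesgue_measure R).
Local Notation gam := (@normal_prob R 0 1).
Variables (U Y1 Y2 : T -> R) (C : R).
Hypotheses (mU : measurable_fun setT U).
Hypotheses (mY1 : measurable_fun setT Y1) (mY2 : measurable_fun setT Y2).
Hypotheses (Y1b : forall w, 0 <= Y1 w <= C) (Y2b : forall w, 0 <= Y2 w <= C).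
Hypothesis HF : forall a c : R,
  (\int[P]_w (Y1 w * (1 + cos (a * (U w - c))))%:E =
   \int[P]_w (Y2 w * (1 + cos (a * (U w - c))))%:E)%E.

Let bdd (Y g : T -> R) c : measurable_fun setT Y -> (forall w, 0 <= Y w <= C) ->
  measurable_fun setT g -> (forall w, 0 <= g w <= c) ->
  (\int[P]_w (Y w * g w)%:E \is a fin_num)%E.
Proof.
move=> mY Yb mg gb; apply: integrable_fin_num => //.
apply: (@le_integrable _ _ _ P _ measurableT _ (EFin \o cst (C * c))) => //.
- by apply/measurable_EFinP; exact: measurable_funM.
- move=> w _ /=; rewrite lee_fin; have [/andP[y0 y1] /andP[g0 g1]] := (Yb w, gb w).
  by rewrite (ger0_norm (mulr_ge0 _ _))// (le_trans _ (ler_norm _))// ler_pM.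
- exact: finite_measure_integrable_cst.
Qed.

Let HF0 : (\int[P]_w (Y1 w * 1)%:E = \int[P]_w (Y2 w * 1)%:E)%E.
Proof.
have := HF 0 0.
have E (Y : T -> R) : measurable_fun setT Y -> (forall w, 0 <= Y w <= C) ->
    (\int[P]_w (Y w * (1 + cos (0 * (U w - 0))))%:E = 2%:E * \int[P]_w (Y w * 1)%:E)%E.
  move=> mY Yb; rewrite -ge0_integralZl//.
  - by apply: eq_integral => w _; rewrite mul0r cos0 -EFinM mulr1 mulrC.
  - by apply/measurable_EFinP; exact: measurable_funM.
  - by move=> w _; rewrite lee_fin mulr1; case/andP: (Yb w).
rewrite !E//.
have f1 := @bdd Y1 (cst 1) 1 mY1 Y1b (measurable_cst _) (fun _ => introT andP (conj ler01 (lexx _))).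
have f2 := @bdd Y2 (cst 1) 1 mY2 Y2b (measurable_cst _) (fun _ => introT andP (conj ler01 (lexx _))).
rewrite -(fineK f1) -(fineK f2) -!EFinM => -[] /mulfI -> //.
Qed.

Let mcosU s c (Y : T -> R) : measurable_fun setT Y ->
  measurable_fun [set: T * measurableTypeR R]
    (fun z : T * measurableTypeR R => (Y z.1 * (1 + cos ((U z.1 - c) / s * z.2)))%:E).
Proof.
move=> mY; apply/measurable_EFinP; apply: measurable_funM.
  exact: measurableT_comp.
apply: measurable_funD => //; apply: measurableT_comp.
  by apply: continuous_measurable_fun; exact: continuous_cos.
apply: measurable_funM => //; apply: measurable_funM => //.
by apply: measurable_funB => //; exact: measurableT_comp.
Qed.

Let gauss_bump s c : 0 < s ->
  (\int[P]_w (Y1 w * normal_pdf (U w) s c)%:E =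
   \int[P]_w (Y2 w * normal_pdf (U w) s c)%:E)%E.
Proof.
move=> s0; pose E w := expR (- (((U w - c) / s) ^+ 2 / 2)).
have mE : measurable_fun setT E.
  apply: measurableT_comp => //; apply: measurableT_comp => //.
  apply: measurable_funM => //; apply: measurable_funX.
  by apply: measurable_funM => //; exact: measurable_funB.
have E01 w : 0 <= E w <= 1.
  by rewrite expR_ge0 /E -expR0 ler_expR oppr_le0 divr_ge0 ?sqr_ge0.
have tonelli (Y : T -> R) : measurable_fun setT Y -> (forall w, 0 <= Y w <= C) ->
    (\int[gam]_y \int[P]_w (Y w * (1 + cos (y / s * (U w - c))))%:E =
     \int[P]_w (Y w * 1)%:E + \int[P]_w (Y w * E w)%:E)%E.
  move=> mY Yb; have Y0 w : 0 <= Y w by case/andP: (Yb w).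
  rewrite -ge0_integralD//; last 4 first.
  - by move=> w _; rewrite lee_fin mulr1.
  - by apply/measurable_EFinP; exact: measurable_funM.
  - by move=> w _; rewrite lee_fin mulr_ge0// expR_ge0.
  - by apply/measurable_EFinP; exact: measurable_funM.
  have h1 z : 0 <= 1 + cos z :> R by have := @cos_geN1 R z; lra.
  transitivity (\int[gam]_y \int[P]_w (Y w * (1 + cos ((U w - c) / s * y)))%:E)%E.
    by apply: eq_integral => y _; apply: eq_integral => w _; congr ((_ * (1 + cos _))%:E); ring.
  rewrite -(@fubini_tonelli _ _ _ _ R P gam
    (fun z => (Y z.1 * (1 + cos ((U z.1 - c) / s * z.2)))%:E)).
  - apply: eq_integral => w _ /=; rewrite -EFinD -mulrDr EFinM /E.
    rewrite -integral_normal_cos1; under eq_integral do rewrite EFinM.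
    rewrite ge0_integralZl//.
    + apply/measurable_EFinP; apply: measurable_funD => //.
      apply: measurableT_comp; last exact: measurable_funM.
      by apply: continuous_measurable_fun; exact: continuous_cos.
    + by rewrite lee_fin.
  - exact: mcosU.
  - by move=> z; rewrite lee_fin mulr_ge0.
have h : (\int[P]_w (Y1 w * E w)%:E = \int[P]_w (Y2 w * E w)%:E)%E.
  have : (\int[P]_w (Y1 w * 1)%:E + \int[P]_w (Y1 w * E w)%:E =
          \int[P]_w (Y2 w * 1)%:E + \int[P]_w (Y2 w * E w)%:E)%E.
    by rewrite -(tonelli _ mY1 Y1b) -(tonelli _ mY2 Y2b); apply: eq_integral => y _; exact: HF.
  have f0 := @bdd Y2 (cst 1) 1 mY2 Y2b (measurable_cst _) (fun _ => introT andP (conj ler01 (lexx _))).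
  have f1 := bdd mY1 Y1b mE E01; have f2 := bdd mY2 Y2b mE E01.
  rewrite HF0 -(fineK f0) -(fineK f1) -(fineK f2) -!EFinD.
  by move=> [] /addrI ->.
have K (Y : T -> R) : measurable_fun setT Y -> (forall w, 0 <= Y w <= C) ->
    (\int[P]_w (Y w * normal_pdf (U w) s c)%:E =
     (normal_peak s)%:E * \int[P]_w (Y w * E w)%:E)%E.
  move=> mY Yb; have Y0 w : 0 <= Y w by case/andP: (Yb w).
  rewrite -ge0_integralZl//; last 3 first.
  - by apply/measurable_EFinP; exact: measurable_funM.
  - by move=> w _; rewrite lee_fin mulr_ge0// expR_ge0.
  - by rewrite lee_fin normal_peak_ge0.
  apply: eq_integral => w _; rewrite -EFinM normal_pdfE ?gt_eqF// mulrCA.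
  congr ((_ * (_ * expR _))%:E).
  by rewrite -(mulr_natr (s ^+ 2)) mulNr; congr (- _); field; rewrite gt_eqF.
by rewrite !K// h.
Qed.

Let mjoint s (Y : T -> R) (B : set (measurableTypeR R)) : s != 0 ->
  measurable_fun setT Y -> measurable B ->
  measurable_fun [set: T * measurableTypeR R]
    (fun z : T * measurableTypeR R => (Y z.1 * normal_pdf (U z.1) s z.2 * \1_B z.2)%:E).
Proof.
move=> s0 mY mB; apply/measurable_EFinP; apply: measurable_funM; last first.
  by apply: (measurableT_comp (f := (\1_B : measurableTypeR R -> R))) => //.
apply: measurable_funM; first exact: measurableT_comp.
rewrite (_ : (fun z => _) = (fun z : T * measurableTypeR R =>
  normal_peak s * expR (- (z.2 - U z.1) ^+ 2 / (s ^+ 2 *+ 2)))); last first.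
  by apply/funext => z; rewrite normal_pdfE.
apply: measurable_funM => //; apply: measurableT_comp => //.
apply: measurable_funM => //; apply: measurableT_comp => //.
apply: measurable_funX; apply: measurable_funB => //.
exact: measurableT_comp.
Qed.

Let mnormal_itv s (B : set (measurableTypeR R)) : s != 0 -> measurable B ->
  measurable_fun setT (fun w => normal_prob (U w) s B).
Proof.
move=> s0 mB; have := mjoint s0 (measurable_cst (1 : R)) mB.
move=> /measurable_fun_fubini_tonelli_F/(_ _).
rewrite (_ : (fun w => _) = fubini_F mu (fun z : T * measurableTypeR R =>
    (1 * normal_pdf (U z.1) s z.2 * \1_B z.2)%:E)); last first.
  apply/funext => w; rewrite /normal_prob /fubini_F [LHS]integral_mkcond.
  apply: eq_integral => x _; rewrite patchE indicE /= mul1r.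
  by case: ifP => _; rewrite ?mulr1 ?mulr0.
apply => z; rewrite lee_fin mul1r mulr_ge0 ?normal_pdf_ge0//.
Qed.

Let gauss_itv s (al be : R) : 0 < s ->
  (\int[P]_w ((Y1 w)%:E * normal_prob (U w) s `]al, be]%classic) =
   \int[P]_w ((Y2 w)%:E * normal_prob (U w) s `]al, be]%classic))%E.
Proof.
move=> s0.
have K (Y : T -> R) : measurable_fun setT Y -> (forall w, 0 <= Y w <= C) ->
    (\int[P]_w ((Y w)%:E * normal_prob (U w) s `]al, be]%classic) =
     \int[mu]_(c in `]al, be]) \int[P]_w (Y w * normal_pdf (U w) s c)%:E)%E.
  move=> mY Yb; have Y0 w : 0 <= Y w by case/andP: (Yb w).
  pose f (z : T * measurableTypeR R) :=
    (Y z.1 * normal_pdf (U z.1) s z.2 * \1_`]al, be] z.2)%:E.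
  transitivity (\int[P]_w \int[mu]_c f (w, c))%E.
    apply: eq_integral => w _; rewrite /normal_prob -ge0_integralZl//; last 3 first.
    - by apply/measurable_EFinP/measurable_funTS; exact: measurable_normal_pdf.
    - by move=> x _; rewrite lee_fin normal_pdf_ge0.
    - by rewrite lee_fin.
    rewrite [LHS]integral_mkcond; apply: eq_integral => x _.
    rewrite /f/= patchE indicE; case: ifP => _; rewrite ?mulr1 ?mulr0//.
  rewrite fubini_tonelli; last 2 first.
  - by apply: mjoint => //; rewrite gt_eqF.
  - by move=> z; rewrite lee_fin !mulr_ge0// normal_pdf_ge0.
  rewrite [RHS]integral_mkcond; apply: eq_integral => c _.
  rewrite patchE /f/= indicE; case: ifP => _.
    by apply: eq_integral => w _; rewrite mulr1.
  by rewrite integral0_eq// => w _; rewrite mulr0.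
by rewrite (K _ mY1 Y1b) (K _ mY2 Y2b); apply: eq_integral => c _; exact: gauss_bump.
Qed.

Let normal_conc (m s r : R) (A : set (measurableTypeR R)) : 0 < s -> 0 < r ->
  measurable A -> (forall x, A x -> r <= `|x - m|) ->
  fine (normal_prob m s A) <= 8 * (s / r) ^+ 2.
Proof.
move=> s0 r0 mA HA; rewrite -lee_fin fineK ?fin_num_measure//.
pose th := (4 * s ^+ 2)^-1.
have sn0 : s != 0 by rewrite gt_eqF.
have rn0 : r != 0 by rewrite gt_eqF.
have th0 : 0 < th by rewrite invr_gt0 mulr_gt0// exprn_gt0.
have the : 1 - 2 * th * s ^+ 2 = 2^-1 by rewrite /th; field.
have mf : measurable_fun setT (fun x : R => expR (th * (x - m) ^+ 2)).
  apply: measurableT_comp => //; apply: measurable_funM => //.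
  by apply: measurable_funX; exact: measurable_funB.
apply: (@le_trans _ _ (\int[normal_prob m s]_x
   ((expR (- (th * r ^+ 2)))%:E * (expR (th * (x - m) ^+ 2))%:E))%E).
  rewrite -[A]setIT -integral_indic//; apply: ge0_le_integral => //.
  - by apply/measurable_EFinP; exact: measurable_indic.
  - by apply/measurable_EFinP; exact: measurable_funM.
  - move=> x _; rewrite -EFinM -expRD lee_fin indicE.
    have [xA|_] := boolP (x \in A); last exact: expR_ge0.
    rewrite -expR0 ler_expR addrC -mulrBr mulr_ge0 ?(ltW th0)// subr_ge0.
    rewrite -[leRHS]real_normK ?num_real// lerXn2r ?nnegrE ?(ltW r0)//.
    by apply: HA; rewrite inE in xA.
rewrite ge0_integralZl//; last exact/measurable_EFinP.
rewrite integral_normal_expsq_mean//; last by rewrite -subr_gt0 the.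
rewrite the -EFinM lee_fin.
have h1 : (Num.sqrt (2^-1 : R))^-1 <= 2.
  rewrite -[leRHS]invrK lef_pV2 ?posrE ?sqrtr_gt0//.
  rewrite -[leLHS]ger0_norm// -sqrtr_sqr ler_wsqrtr//.
  by rewrite expr2 ler_piMr// invf_le1//; lra.
have h2 : expR (- (th * r ^+ 2)) <= (th * r ^+ 2)^-1.
  have q0 : 0 < th * r ^+ 2 by rewrite mulr_gt0// exprn_gt0.
  rewrite expRN lef_pV2 ?posrE ?expR_gt0//.
  by have := expR_ge1Dx (th * r ^+ 2); lra.
have -> : 8 * (s / r) ^+ 2 = (th * r ^+ 2)^-1 * 2.
  by rewrite /th; field; rewrite sn0 rn0.
by rewrite ler_pM ?expR_ge0 ?invr_ge0 ?sqrtr_ge0.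
Qed.

Let cvg_normal_itv (u al be : R) :
  normal_prob u (n.+1%:R^-1 ^+ 2) `](al + 2 * n.+1%:R^-1), (be + 2 * n.+1%:R^-1)]%classic
    @[n --> \oo] --> ((\1_`]al, be]%classic u)%:E : \bar R).
Proof.
set I := fun n : nat => `](al + 2 * n.+1%:R^-1), (be + 2 * n.+1%:R^-1)]%classic.
have mI n : measurable (I n : set (measurableTypeR R)) by exact: measurable_itv.
rewrite (_ : (fun n => _) =
  (fun n => (fine (normal_prob u (n.+1%:R^-1 ^+ 2) (I n)))%:E)); last first.
  by apply/funext => n; rewrite fineK// fin_num_measure.
apply: cvg_EFin; first exact: nearW.
rewrite /=; apply/cvgrPdist_le => /= e e0.
have s0 n : (0 : R) < n.+1%:R^-1 ^+ 2 by rewrite exprn_gt0 ?invr_gt0.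
have small : \forall n \near \oo, (8 : R) * (n.+1%:R^-1) <= e.
  have : (8 : R) * (n.+1%:R^-1) @[n --> \oo] --> (8 * 0 : R).
    by apply: cvgM; [exact: cvg_cst|exact: cvg_harmonic].
  rewrite mulr0 => /cvgrPdist_le/(_ _ e0); apply: filterS => n.
  by rewrite sub0r normrN ger0_norm// mulr_ge0.
have conc n (A : set (measurableTypeR R)) : measurable A -> (forall x : R, A x -> n.+1%:R^-1 <= `|x - u|) ->
    fine (normal_prob u (n.+1%:R^-1 ^+ 2) A) <= 8 * n.+1%:R^-1.
  move=> mA HA; apply: (le_trans (normal_conc (s0 n) _ mA HA)); first by rewrite invr_gt0.
  rewrite ler_wpM2l// expr2 mulfK ?gt_eqF ?invr_gt0//.
  by rewrite ler_piMr ?invr_ge0// invf_le1 ?ler1n.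
have gap (x : R) : 0 < x -> \forall n \near \oo, (4 : R) * (n.+1%:R^-1) <= x.
  move=> x0; have : (4 : R) * (n.+1%:R^-1) @[n --> \oo] --> (4 * 0 : R).
    by apply: cvgM; [exact: cvg_cst|exact: cvg_harmonic].
  rewrite mulr0 => /cvgrPdist_le/(_ _ x0); apply: filterS => n.
  by rewrite sub0r normrN ger0_norm// mulr_ge0.
rewrite indicE; have [uin|out] := boolP (al < u <= be).
  rewrite mem_set/=; last by rewrite in_itv.
  move: uin => /andP[au ub].
  have := gap _ (_ : 0 < u - al); rewrite subr_gt0 => /(_ au) gapn.
  near=> n; have n0 : (0 : R) < n.+1%:R^-1 by rewrite invr_gt0.
  have g : (4 : R) * (n.+1%:R^-1) <= u - al by near: n.
  have -> : 1%:R - fine (normal_prob u (n.+1%:R^-1 ^+ 2) (I n)) =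
      fine (normal_prob u (n.+1%:R^-1 ^+ 2) (~` I n)).
    exact: (fine_probability_setC (normal_prob u (n.+1%:R^-1 ^+ 2)) (mI n)).
  rewrite ger0_norm; last by rewrite fine_ge0.
  apply: (@le_trans _ _ (8 * n.+1%:R^-1)); last by near: n.
  apply: conc; first exact: measurableC.
  move=> x; rewrite /I /setC /= in_itv/= => /negP; rewrite negb_and -!leNgt -ltNge.
  have : x - u <= `|x - u| by exact: ler_norm.
  have : - (x - u) <= `|x - u| by rewrite -normrN ler_norm.
  move: n0 g; move: (n.+1%:R^-1) => nu n0 g.
  by move=> h1 h2 /orP[] h3; lra.
rewrite memNset/=; last by rewrite in_itv/=; exact/negP.
move: out; rewrite negb_and -leNgt -ltNge => out.
have gapn : \forall n \near \oo, forall x, I n x -> n.+1%:R^-1 <= `|x - u|.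
  case/orP: out => h.
    near=> n; move=> x; rewrite /I/= in_itv/= => /andP[h1 h2].
    have n0 : (0 : R) < n.+1%:R^-1 by rewrite invr_gt0.
    have : x - u <= `|x - u| by exact: ler_norm.
    by move: n0 h1; move: (n.+1%:R^-1) => nu n0 h1; lra.
  have := gap _ (_ : 0 < u - be); rewrite subr_gt0 => /(_ h) gapn.
  near=> n; move=> x; rewrite /I/= in_itv/= => /andP[h1 h2].
  have n0 : (0 : R) < n.+1%:R^-1 by rewrite invr_gt0.
  have g : (4 : R) * (n.+1%:R^-1) <= u - be by near: n.
  have : - (x - u) <= `|x - u| by rewrite -normrN ler_norm.
  by move: n0 h2 g; move: (n.+1%:R^-1) => nu n0 h2 g; lra.
near=> n; rewrite sub0r normrN ger0_norm; last by rewrite fine_ge0.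
apply: (@le_trans _ _ (8 * n.+1%:R^-1)); last by near: n.
by apply: conc => //; near: n.
Unshelve. all: by end_near.
Qed.

Let indic_ocitv (al be : R) :
  (\int[P]_w (Y1 w * \1_`]al, be]%classic (U w))%:E =
   \int[P]_w (Y2 w * \1_`]al, be]%classic (U w))%:E)%E.
Proof.
pose I (n : nat) : set (measurableTypeR R) :=
  `](al + 2 * n.+1%:R^-1), (be + 2 * n.+1%:R^-1)]%classic.
pose f (Y : T -> R) n w := ((Y w)%:E * normal_prob (U w) (n.+1%:R^-1 ^+ 2) (I n))%E.
have s0 n : (0 : R) < n.+1%:R^-1 ^+ 2 by rewrite exprn_gt0 ?invr_gt0.
have K (Y : T -> R) : measurable_fun setT Y -> (forall w, 0 <= Y w <= C) ->
   (\int[P]_w f Y n w)%E @[n --> \oo] -->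
     (\int[P]_w (Y w * \1_`]al, be]%classic (U w))%:E)%E.
  move=> mY Yb; have Y0 w : 0 <= Y w by case/andP: (Yb w).
  apply: (@dominated_cvg _ _ _ P setT measurableT _ _ (cst C%:E)) => //.
  - move=> n; apply: emeasurable_funM; first exact/measurable_EFinP.
    by apply: mnormal_itv; [rewrite gt_eqF|exact: measurable_itv].
  - move=> w _; rewrite EFinM; apply: cvgeZl => //; exact: cvg_normal_itv.
  - exact: finite_measure_integrable_cst.
  - move=> n w _; rewrite gee0_abs ?mule_ge0 ?lee_fin//.
    rewrite -[leRHS]mule1 lee_pmul ?lee_fin//; first by case/andP: (Yb w).
    by apply: probability_le1; exact: measurable_itv.
have k1 := K _ mY1 Y1b; have k2 := K _ mY2 Y2b.
move: k1; rewrite (_ : (fun n => _) = (fun n => \int[P]_w f Y2 n w)%E).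
  by move=> k1; exact: (cvg_unique _ k1 k2).
by apply/funext => n; rewrite /f; exact: gauss_itv.
Qed.

Let mind (Y : T -> R) (B : set (measurableTypeR R)) : measurable_fun setT Y ->
  measurable B -> measurable_fun setT (fun w => Y w * \1_B (U w)).
Proof.
move=> mY mB; apply: measurable_funM => //.
by apply: (measurableT_comp (f := (\1_B : measurableTypeR R -> R))) => //.
Qed.

Theorem fourier_unique (B : set (measurableTypeR R)) : measurable B ->
  (\int[P]_w (Y1 w * \1_B (U w))%:E = \int[P]_w (Y2 w * \1_B (U w))%:E)%E.
Proof.
pose Pr (B : set (measurableTypeR R)) :=
  (\int[P]_w (Y1 w * \1_B (U w))%:E = \int[P]_w (Y2 w * \1_B (U w))%:E)%E.
have Y10 w : 0 <= Y1 w by case/andP: (Y1b w).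
have Y20 w : 0 <= Y2 w by case/andP: (Y2b w).
have i01 (S : set (measurableTypeR R)) w : 0 <= (\1_S (U w) : R) <= 1.
  by rewrite indicE; case: (_ \in _); rewrite ?lexx ?ler01.
have mi (S : set (measurableTypeR R)) : measurable S -> measurable_fun setT (fun w => \1_S (U w) : R).
  by move=> mS; apply: (measurableT_comp (f := (\1_S : measurableTypeR R -> R))) => //.
have T1 (Y : T -> R) : measurable_fun setT Y ->  (forall w, 0 <= Y w <= C) ->
    forall S, measurable S ->
    (\int[P]_w (Y w * \1_(~` S) (U w))%:E =
     \int[P]_w (Y w * 1)%:E - \int[P]_w (Y w * \1_S (U w))%:E)%E.
  move=> mY Yb S mS; have Y0 w : 0 <= Y w by case/andP: (Yb w).
  have f1 := bdd mY Yb (mi _ mS) (i01 S).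
  have -> : (\int[P]_w (Y w * 1)%:E = \int[P]_w (Y w * \1_(~` S) (U w))%:E
     + \int[P]_w (Y w * \1_S (U w))%:E)%E.
    rewrite -ge0_integralD//; last 4 first.
    - by move=> w _; rewrite lee_fin mulr_ge0//; case/andP: (i01 (~` S) w).
    - by apply/measurable_EFinP/mind => //; exact: measurableC.
    - by move=> w _; rewrite lee_fin mulr_ge0//; case/andP: (i01 S w).
    - by apply/measurable_EFinP/mind.
    apply: eq_integral => w _; rewrite -EFinD -mulrDr !indicE in_setC.
    by case: (_ \in _); rewrite ?add0r ?addr0.
  by rewrite addeK.
have := @dynkin_induction _ (measurableTypeR R) (@ocitv R) Pr erefl (@ocitvI R).
apply.
- rewrite /Pr; have := HF0; rewrite /Pr.
  have E (Y : T -> R) : (\int[P]_w (Y w * \1_[set: measurableTypeR R] (U w))%:E =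
      \int[P]_w (Y w * 1)%:E)%E.
    by apply: eq_integral => w _; rewrite indicT.
  by rewrite !E.
- by move=> _ [[a b] _ <-]; exact: indic_ocitv.
- move=> S mS PS; rewrite /Pr (T1 _ mY1 Y1b _ mS) (T1 _ mY2 Y2b _ mS).
  by rewrite HF0 PS.
- move=> F mF tF PF; rewrite /Pr.
  have E (Y : T -> R) : measurable_fun setT Y -> (forall w, 0 <= Y w) ->
     (\int[P]_w (Y w * \1_(\bigcup_k F k) (U w))%:E =
      \sum_(0 <= k <oo) \int[P]_w (Y w * \1_(F k) (U w))%:E)%E.
    move=> mY Y0; rewrite -integral_nneseries//; last 2 first.
    - by move=> k; apply/measurable_EFinP/mind.
    - move=> k w _; rewrite lee_fin mulr_ge0//; by case/andP: (i01 (F k) w).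
    apply: eq_integral => w _; rewrite EFinM indic_bigcup//.
    under [RHS]eq_eseriesr do rewrite EFinM.
    by rewrite nneseriesZl ?lee_fin.
  by rewrite !E//; apply: eq_eseriesr => k _; exact: PF.
Qed.

End FourierUniqueness.

Section RealIntegrands.
Context (R : realType) (d : measure_display) (T : measurableType d)
  (m : {measure set T -> \bar R}).
Implicit Types (f g : T -> R).

Lemma ge0_integralZ_EFin (k : R) f : measurable_fun setT f ->
  (forall w, 0 <= f w) -> 0 <= k ->
  (\int[m]_w (k * f w)%:E = k%:E * \int[m]_w (f w)%:E)%E.
Proof.
move=> mf f0 k0; under eq_integral do rewrite EFinM.
apply: ge0_integralZl => //; first exact/measurable_EFinP.
by move=> w _; rewrite lee_fin.
Qed.

Lemma ge0_integralD_EFin f g : measurable_fun setT f -> measurable_fun setT g ->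
  (forall w, 0 <= f w) -> (forall w, 0 <= g w) ->
  (\int[m]_w (f w + g w)%:E = \int[m]_w (f w)%:E + \int[m]_w (g w)%:E)%E.
Proof.
move=> mf mg f0 g0; under eq_integral do rewrite EFinD.
apply: ge0_integralD => //; try exact/measurable_EFinP.
- by move=> w _; rewrite lee_fin.
- by move=> w _; rewrite lee_fin.
Qed.

Lemma ge0_le_integral_EFin f g : measurable_fun setT f -> measurable_fun setT g ->
  (forall w, 0 <= f w) -> (forall w, f w <= g w) ->
  (\int[m]_w (f w)%:E <= \int[m]_w (g w)%:E)%E.
Proof.
move=> mf mg f0 fg; apply: ge0_le_integral => //.
- by move=> w _; rewrite lee_fin.
- exact/measurable_EFinP.
- exact/measurable_EFinP.
- by move=> w _; rewrite lee_fin.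
Qed.

Lemma integral_indic_EFin (A : set T) : measurable A ->
  (\int[m]_w (\1_A w)%:E = m A)%E.
Proof. by move=> mA; rewrite integral_indic// setIT. Qed.

End RealIntegrands.

Section JointLaw.
Context (R : realType) (d d1 d2 : measure_display) (T : measurableType d)
  (T1 : measurableType d1) (T2 : measurableType d2) (P : probability T R).

Lemma joint_law (Y : T -> T1) (Z : T -> T2) (mu1 : probability T1 R)
    (mu2 : probability T2 R) :
  measurable_fun setT Y -> measurable_fun setT Z ->
  (forall A B, measurable A -> measurable B ->
    P [set w | A (Y w) /\ B (Z w)] = mu1 A * mu2 B)%E ->
  forall D : set (T1 * T2), measurable D ->
  P [set w | D (Y w, Z w)] = (\int[mu1]_y mu2 [set z | D (y, z)])%E.
Proof.
move=> mY mZ H D mD.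
have mYZ : measurable_fun setT (fun w => (Y w, Z w) : (T1 * T2)%type).
  by apply/measurable_fun_pairP.
have := @product_measure_unique _ _ T1 T2 R mu1 mu2 (distribution P (mfun_Sub (mem_set mYZ))).
move=> /(_ _ D mD) => E; transitivity ((mu1 \x mu2)%E D).
  by rewrite E// => A B mA mB; rewrite -H.
apply: eq_integral => y _; rewrite /=; congr (mu2 _).
by apply/seteqP; split => z; rewrite /xsection /= inE.
Qed.

End JointLaw.

Section GaussPair.
Context (R : realType) (d : measure_display) (T : measurableType d)
  (P : probability T R).
Local Notation gam := (@normal_prob R 0 1).

Let bint (f : T -> R) c : measurable_fun setT f -> (forall w, `|f w| <= c) ->
  P.-integrable setT (EFin \o f).
Proof.
move=> mf fc; apply: (@le_integrable _ _ _ P _ measurableT _ (EFin \o cst c)) => //.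
- exact/measurable_EFinP.
- by move=> w _ /=; rewrite lee_fin (le_trans (fc w))// ler_norm.
- exact: finite_measure_integrable_cst.
Qed.

Let cos1 (x : R) : `|cos x| <= 1.
Proof. by rewrite ler_norml cos_geN1 cos_le1. Qed.
Let sin1 (x : R) : `|sin x| <= 1.
Proof. by rewrite ler_norml sin_geN1 sin_le1. Qed.

Let mcosT (f : T -> R) : measurable_fun setT f -> measurable_fun setT (fun w => cos (f w)).
Proof.
move=> mf; apply: (measurableT_comp (f := cos)) => //.
by apply: continuous_measurable_fun; exact: continuous_cos.
Qed.
Let msinT (f : T -> R) : measurable_fun setT f -> measurable_fun setT (fun w => sin (f w)).
Proof.
move=> mf; apply: (measurableT_comp (f := sin)) => //.
by apply: continuous_measurable_fun; exact: continuous_sin.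
Qed.

Lemma EFin_Rintegral (f : T -> R) : P.-integrable setT (EFin \o f) ->
  (\int[P]_w (f w)%:E = (\int[P]_w f w)%:E)%E.
Proof. by move=> fi; rewrite /Rintegral fineK//; exact: integrable_fin_num. Qed.

Let Rint1 : \int[P]_w (1 : R) = 1.
Proof. by rewrite Rintegral_cst// mul1r; have /= -> := probability_setT P. Qed.

Section Law.
Variables (U Z : T -> R).
Hypotheses (mU : measurable_fun setT U) (mZ : measurable_fun setT Z).
Hypothesis HUZ : forall a b : R, a ^+ 2 + b ^+ 2 = 1 ->
  forall B : set (measurableTypeR R), measurable B ->
  P [set w | B (a * U w + b * Z w)] = gam B.

Let mW a b : measurable_fun setT (fun w => a * U w + b * Z w).
Proof. by apply: measurable_funD; exact: measurable_funM. Qed.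

Lemma gauss_pair_cos a b th :
  \int[P]_w cos (a * U w + b * Z w + th) = cos th * expR (- ((a ^+ 2 + b ^+ 2) / 2)).
Proof.
have key : \int[P]_w cos (a * U w + b * Z w) = expR (- ((a ^+ 2 + b ^+ 2) / 2)) /\
           \int[P]_w sin (a * U w + b * Z w) = 0.
  pose r := Num.sqrt (a ^+ 2 + b ^+ 2).
  have r2 : r ^+ 2 = a ^+ 2 + b ^+ 2 by rewrite sqr_sqrtr// addr_ge0 ?sqr_ge0.
  have [r0|r0] := eqVneq r 0.
    have [a0 b0] : a = 0 /\ b = 0.
      move: r2; rewrite r0 expr0n/= => /esym/eqP.
      rewrite paddr_eq0 ?sqr_ge0// !sqrf_eq0 => /andP[/eqP ? /eqP ?].
      by split.
    split.
      transitivity (\int[P]_w (1 : R)).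
        by apply: eq_Rintegral => w _; rewrite a0 b0 !mul0r addr0 cos0.
      by rewrite Rint1 a0 b0 expr0n addr0 mul0r oppr0 expR0.
    transitivity (\int[P]_w (0 : R)).
      by apply: eq_Rintegral => w _; rewrite a0 b0 !mul0r addr0 sin0.
    by rewrite Rintegral_cst// mul0r.
  have law e (f : R -> R) : e ^+ 2 = 1 -> measurable_fun setT f ->
      (forall x, 0 <= f x) ->
      (\int[P]_w (f (e * (a * U w + b * Z w)))%:E = \int[gam]_y (f (r * y))%:E)%E.
    move=> e2 mf f0.
    rewrite -(@ge0_integral_law R _ T P _ (measurableTypeR R) (fun w => (e * a / r) * U w + (e * b / r) * Z w)
       (normal_prob 0 1) (fun y => f (r * y)))//.
    - apply: eq_integral => w _; congr ((f _)%:E); rewrite mulrDr.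
      by field.
    - exact: mW.
    - move=> B mB; apply: (HUZ _ mB); rewrite !expr_div_n r2 -mulrDl !exprMn e2 !mul1r.
      by rewrite -r2 mulfV// sqrf_eq0.
    - apply: measurableT_comp => //; exact: measurable_funM.
  have bi1 c (f : T -> R) : measurable_fun setT f -> (forall w, `|f w| <= c) ->
      (\int[P]_w (1 + f w)%:E = (1 + \int[P]_w f w)%:E)%E.
    move=> mf fc; rewrite EFin_Rintegral; last first.
      apply: (bint (c := 1 + c)); first exact: measurable_funD.
      by move=> w; rewrite (le_trans (ler_normD _ _))// normr1 lerD2l.
    rewrite RintegralD//; last 2 first.
    - by apply: (bint (f := cst 1) (c := 1)) => // w; rewrite normr1.
    - exact: bint fc.
    by rewrite Rint1.
  split.
    have := @law 1 (fun x => 1 + cos x) (expr1n _ _) _ _.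
    rewrite integral_normal_cos1 r2 => H.
    have mc : measurable_fun setT (fun x : R => 1 + cos x).
      apply: measurable_funD => //; apply: continuous_measurable_fun; exact: continuous_cos.
    have c0 (x : R) : 0 <= 1 + cos x by have := @cos_geN1 R x; lra.
    have := H mc c0; under eq_integral do rewrite mul1r.
    rewrite (bi1 1)//; last exact: mcosT.
    by move=> [] /addrI.
  have ms : measurable_fun setT (fun x : R => 1 + sin x).
    apply: measurable_funD => //; apply: continuous_measurable_fun; exact: continuous_sin.
  have s0 (x : R) : 0 <= 1 + sin x by have := @sin_geN1 R x; lra.
  have := @law 1 (fun x => 1 + sin x) (expr1n _ _) ms s0.
  have e1 : (-1 : R) ^+ 2 = 1 by rewrite sqrrN expr1n.
  rewrite -(@law (-1) (fun x => 1 + sin x) e1 ms s0).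
  under eq_integral do rewrite mul1r.
  under [RHS]eq_integral do rewrite mulN1r sinN.
  rewrite (bi1 1)//; last exact: msinT.
  rewrite (bi1 1); last 2 first.
  - by apply: measurable_funN; exact: msinT.
  - by move=> w; rewrite normrN.
  move=> [] /addrI.
  have -> : \int[P]_w (- sin (a * U w + b * Z w)) = - \int[P]_w sin (a * U w + b * Z w).
    under eq_Rintegral do rewrite -mulN1r.
    by rewrite RintegralZl ?mulN1r//; apply: (bint (c := 1)) => //; exact: msinT.
  by move=> h; lra.
under eq_Rintegral do rewrite cosD.
have iC : P.-integrable setT (EFin \o (fun w => cos (a * U w + b * Z w))).
  by apply: (bint (c := 1)) => //; exact: mcosT.
have iS : P.-integrable setT (EFin \o (fun w => sin (a * U w + b * Z w))).
  by apply: (bint (c := 1)) => //; exact: msinT.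
rewrite RintegralB//; last 2 first.
- apply: (bint (c := 1)); first by apply: measurable_funM => //; exact: mcosT.
  by move=> w; rewrite normrM mulr_ile1.
- apply: (bint (c := 1)); first by apply: measurable_funM => //; exact: msinT.
  by move=> w; rewrite normrM mulr_ile1.
rewrite !RintegralZr//; case: key => -> ->.
by rewrite mul0r subr0 mulrC.
Qed.

Let icos a b th : P.-integrable setT (EFin \o (fun w => cos (a * U w + b * Z w + th))).
Proof. by apply: (bint (c := 1)) => //; apply: mcosT; exact: measurable_funD. Qed.

Let law_cos_prod a c b e :
  (\int[P]_w ((1 + cos (b * (Z w - e))) * (1 + cos (a * (U w - c))))%:E =
   ((1 + cos (b * e) * expR (- (b ^+ 2 / 2))) *
    (1 + cos (a * c) * expR (- (a ^+ 2 / 2))))%:E)%E.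
Proof.
pose f w := (1 + cos (a * U w + 0 * Z w + - (a * c)) +
  (cos (0 * U w + b * Z w + - (b * e)) +
   (2^-1 * cos (a * U w + b * Z w + - (a * c + b * e)) +
    2^-1 * cos (a * U w + (- b) * Z w + (b * e - a * c))))).
transitivity (\int[P]_w (f w)%:E)%E.
  apply: eq_integral => w _; congr (_%:E); rewrite /f !mul0r addr0 add0r.
  have -> : a * U w - a * c = a * (U w - c) by ring.
  have -> : b * Z w - b * e = b * (Z w - e) by ring.
  have -> : a * U w + b * Z w - (a * c + b * e) = a * (U w - c) + b * (Z w - e) by ring.
  have -> : a * U w + - b * Z w + (b * e - a * c) = a * (U w - c) - b * (Z w - e) by ring.
  by rewrite cosD cosB; field.
have i1 : P.-integrable setT (EFin \o (fun=> 1 : R)).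
  by apply: (bint (f := cst 1) (c := 1)) => // w; rewrite normr1.
have iZ a' b' th : P.-integrable setT (EFin \o (fun w => 2^-1 * cos (a' * U w + b' * Z w + th))).
  by apply: (bint (c := 2^-1)) => [|w]; [apply: measurable_funM => //; apply: mcosT; exact: measurable_funD|rewrite normrM ger0_norm// ler_piMr].
have iD (g h : T -> R) : P.-integrable setT (EFin \o g) -> P.-integrable setT (EFin \o h) ->
    P.-integrable setT (EFin \o (fun w => g w + h w)).
  by move=> ig ih; exact: (integrableD measurableT ig ih).
rewrite EFin_Rintegral; last by apply: (iD _ _ (iD _ _ _ _) (iD _ _ _ (iD _ _ _ _))).
rewrite /f RintegralD//; [|exact: iD|exact: (iD _ _ _ (iD _ _ _ _))].
rewrite (RintegralD _ i1)// (RintegralD _ (icos _ _ _))//; last exact: iD.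
rewrite (RintegralD _ (iZ _ _ _))// !RintegralZl//.
rewrite Rint1 !gauss_pair_cos.
congr (_%:E); rewrite expr0n/= addr0 add0r sqrrN !cosN.
have -> : b * e - a * c = - (a * c - b * e) by ring.
have -> : - ((a ^+ 2 + b ^+ 2) / 2) = - (a ^+ 2 / 2) + - (b ^+ 2 / 2) by field.
by rewrite expRD cosN cosB cosD; field.
Qed.

Lemma gauss_pair_indep (A B : set (measurableTypeR R)) :
  measurable A -> measurable B ->
  P [set w | A (U w) /\ B (Z w)] = (P [set w | A (U w)] * P [set w | B (Z w)])%E.
Proof.
move=> mA mB.
have mUA : measurable [set w | A (U w)] by rewrite -[X in measurable X]setTI; exact: mU.
have mZB : measurable [set w | B (Z w)] by rewrite -[X in measurable X]setTI; exact: mZ.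
have EA : (fun w => \1_A (U w) : R) = \1_[set w | A (U w)] by [].
have EB : (fun w => \1_B (Z w) : R) = \1_[set w | B (Z w)] by [].
have mIA : measurable_fun setT (fun w => \1_A (U w) : R) by rewrite EA; exact: measurable_indic.
have mIB : measurable_fun setT (fun w => \1_B (Z w) : R) by rewrite EB; exact: measurable_indic.
have IA : (\int[P]_w (\1_A (U w))%:E = P [set w | A (U w)])%E.
  by under eq_integral do rewrite -[\1_A _]/(\1_[set w | A (U w)] _); rewrite integral_indic// setIT.
have IB : (\int[P]_w (\1_B (Z w))%:E = P [set w | B (Z w)])%E.
  by under eq_integral do rewrite -[\1_B _]/(\1_[set w | B (Z w)] _); rewrite integral_indic// setIT.
have fA : P [set w | A (U w)] \is a fin_num by exact: fin_num_measure.
have pA : (fine (P [set w | A (U w)]))%:E = P [set w | A (U w)] by rewrite fineK.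
set p := fine _ in pA.
have p0 : 0 <= p by rewrite fine_ge0.
have p1 : p <= 1 by rewrite -lee_fin pA probability_le1.
have c2 (x : R) : 0 <= 1 + cos x <= 2.
  by apply/andP; split; [have := @cos_geN1 R x|have := @cos_le1 R x]; lra.
pose k b e : R := 1 + cos (b * e) * expR (- (b ^+ 2 / 2)).
have kb b e : 0 <= k b e <= 2.
  have /andP[x0 x1] : 0 <= expR (- (b ^+ 2 / 2)) <= 1.
    by rewrite expR_ge0 -expR0 ler_expR oppr_le0 divr_ge0 ?sqr_ge0.
  have := cos_geN1 (b * e); have := cos_le1 (b * e).
  by rewrite /k; set x := expR _ in x0 x1 *; set y := cos _; move=> y1 y2; apply/andP; split; nra.
have mcZ b e : measurable_fun setT (fun w => 1 + cos (b * (Z w - e))).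
  by apply: measurable_funD => //; apply: mcosT; apply: measurable_funM => //; exact: measurable_funB.
have mcU b e : measurable_fun setT (fun w => 1 + cos (b * (U w - e))).
  by apply: measurable_funD => //; apply: mcosT; apply: measurable_funM => //; exact: measurable_funB.
have k0 b e : 0 <= k b e by case/andP: (kb b e).
have cU0 b e w : 0 <= 1 + cos (b * (U w - e)) by case/andP: (c2 (b * (U w - e))).
have cZ0 b e w : 0 <= 1 + cos (b * (Z w - e)) by case/andP: (c2 (b * (Z w - e))).
have S1 b e : (\int[P]_w ((1 + cos (b * (Z w - e))) * \1_A (U w))%:E =
    \int[P]_w (k b e * \1_A (U w))%:E)%E.
  apply: (@fourier_unique _ _ _ P U _ _ 2) => //.
  move=> a c; rewrite law_cos_prod.
  have := law_cos_prod a c 0 0.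
  rewrite expr0n/= !mul0r oppr0 expR0 cos0 mul1r => h.
  rewrite ge0_integralZ_EFin//.
  have : ((1 + 1)%:E * \int[P]_w (1 + cos (a * (U w - c)))%:E = (1 + 1)%:E * (k a c)%:E)%E.
    rewrite -ge0_integralZ_EFin//.
    rewrite -EFinM -h; apply: eq_integral => w _.
    by rewrite mul0r cos0.
  have fi : (\int[P]_w (1 + cos (a * (U w - c)))%:E)%E \is a fin_num.
    apply: integrable_fin_num => //; apply: (bint (c := 2)) => //.
    by move=> w; have /andP[h1 h2] := c2 (a * (U w - c)); rewrite ger0_norm.
  rewrite -(fineK fi) -!EFinM => -[h2].
  have n2 : (1 + 1 : R) != 0 by rewrite -[1 + 1]/(2%:R : R) pnatr_eq0.
  by rewrite (mulfI n2 h2).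
have F : (\int[P]_w (\1_A (U w) * \1_B (Z w))%:E =
    \int[P]_w (p * \1_B (Z w))%:E)%E; last first.
  move: F; rewrite ge0_integralZ_EFin// IB pA => <-.
  rewrite -integral_indic_EFin; last exact: measurableI.
  apply: eq_integral => w _; congr (_%:E).
  rewrite -[\1_A _]/(\1_[set w | A (U w)] w) -[\1_B _]/(\1_[set w | B (Z w)] w).
  by rewrite -[X in \1_X]/([set w | A (U w)] `&` [set w | B (Z w)]) indicI.
apply: (@fourier_unique _ _ _ P Z (fun w => \1_A (U w)) (cst p) 1) => //.
- by move=> w; rewrite indicE; case: (_ \in _); rewrite ?lexx ?ler01.
- by move=> w; rewrite p0 p1.
- move=> b e; rewrite (eq_integral (fun w => ((1 + cos (b * (Z w - e))) * \1_A (U w))%:E)); last first.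
    by move=> w _; rewrite mulrC.
  rewrite S1 ge0_integralZ_EFin//.
  rewrite IA -pA ge0_integralZ_EFin//.
  suff -> : (\int[P]_w (1 + cos (b * (Z w - e)))%:E = (k b e)%:E)%E by rewrite muleC.
  have := law_cos_prod 0 0 b e.
  rewrite expr0n/= !mul0r oppr0 expR0 cos0 mul1r => h.
  have : ((1 + 1)%:E * \int[P]_w (1 + cos (b * (Z w - e)))%:E = (1 + 1)%:E * (k b e)%:E)%E.
    rewrite -ge0_integralZ_EFin//.
    rewrite -EFinM [X in _ = X%:E]mulrC -h; apply: eq_integral => w _.
    by rewrite mul0r cos0 mulrC.
  have fi : (\int[P]_w (1 + cos (b * (Z w - e)))%:E)%E \is a fin_num.
    apply: integrable_fin_num => //; apply: (bint (c := 2)) => //.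
    by move=> w; have /andP[h1 h2] := c2 (b * (Z w - e)); rewrite ger0_norm.
  rewrite -(fineK fi) -!EFinM => -[h2].
  have n2 : (1 + 1 : R) != 0 by rewrite -[1 + 1]/(2%:R : R) pnatr_eq0.
  by rewrite (mulfI n2 h2).
Qed.


Lemma gauss_pair_law (D : set (measurableTypeR R * measurableTypeR R)) :
  measurable D -> P [set w | D (U w, Z w)] = (\int[gam]_u gam [set z | D (u, z)])%E.
Proof.
have lU (B : set (measurableTypeR R)) : measurable B -> P [set w | B (U w)] = gam B.
  move=> mB; rewrite -(HUZ (a := 1) (b := 0) _ mB) ?expr1n ?expr0n ?addr0//.
  by congr (P _); apply/seteqP; split => w /=; rewrite mul1r mul0r addr0.
have lZ (B : set (measurableTypeR R)) : measurable B -> P [set w | B (Z w)] = gam B.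
  move=> mB; rewrite -(HUZ (a := 0) (b := 1) _ mB) ?expr1n ?expr0n ?add0r//.
  by congr (P _); apply/seteqP; split => w /=; rewrite mul1r mul0r add0r.
move=> mD; apply: (joint_law (T1 := measurableTypeR R) (T2 := measurableTypeR R)) => //.
by move=> A B mA mB; rewrite gauss_pair_indep// lU// lZ.
Qed.

End Law.

Lemma gauss_pair_tails (U V : T -> R) (r t : R) : measurable_fun setT U ->
  measurable_fun setT V -> `|r| <= 1 -> 0 <= t ->
  (forall a b : R, a ^+ 2 + b ^+ 2 + 2 * r * a * b = 1 ->
    forall B : set (measurableTypeR R), measurable B ->
    P [set w | B (a * U w + b * V w)] = gam B) ->
  (P [set w | (t < `|U w|)%R /\ (t < `|V w|)%R] <=
   ((2 * Phi (- t)) ^+ 2 +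
    160 * r ^+ 2 * ((1 + t ^+ 2) ^+ 2 * expR (- (t ^+ 2 / 2))))%:E)%E.
Proof.
move=> mU mV r1 t0 HUV.
pose Q := (1 + t ^+ 2) ^+ 2 * expR (- (t ^+ 2 / 2)).
have Q0 : 0 <= Q by rewrite mulr_ge0 ?sqr_ge0 ?expR_ge0.
have mtU : measurable [set w | t < `|U w|].
  have := measurable_abs_tail t; rewrite -[X in _ -> measurable X]setTI.
  by move=> mt; exact: (mU measurableT _ mt).
have mtV : measurable [set w | t < `|V w|].
  have := measurable_abs_tail t; rewrite -[X in _ -> measurable X]setTI.
  by move=> mt; exact: (mV measurableT _ mt).
have lU : P [set w | t < `|U w|] = (2 * Phi (- t))%:E.
  have n1 : (1 : R) ^+ 2 + 0 ^+ 2 + 2 * r * 1 * 0 = 1 by ring.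
  have := HUV 1 0 n1 _ (measurable_abs_tail t); rewrite normal_abs_tail// => <-.
  by congr (P _); apply/seteqP; split => w /=; rewrite mul1r mul0r addr0.
have r20 : 0 <= r ^+ 2 by rewrite sqr_ge0.
have [r4|r4] := leP (r ^+ 2) 4^-1; last first.
  apply: (@le_trans _ _ (P [set w | t < `|U w|])).
    by apply: le_measure; rewrite ?inE//; [exact: measurableI|move=> w []].
  rewrite lU lee_fin; apply: (@le_trans _ _ (160 * r ^+ 2 * Q)); last by rewrite lerDr sqr_ge0.
  have := Phi_tail t0; rewrite -mulrA -/Q => h; apply: (le_trans h).
  by rewrite ler_wpM2r//; lra.
pose s := Num.sqrt (1 - r ^+ 2).
have s2 : s ^+ 2 = 1 - r ^+ 2 by rewrite sqr_sqrtr//; lra.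
have s0 : 0 < s by rewrite sqrtr_gt0; lra.
have sn0 : s != 0 by rewrite gt_eqF.
pose Z w := (V w - r * U w) / s.
have mZ : measurable_fun setT Z.
  apply: measurable_funM => //; apply: measurable_funB => //; exact: measurable_funM.
have VE w : V w = r * U w + s * Z w by rewrite /Z; field.
have HUZ (a b : R) : a ^+ 2 + b ^+ 2 = 1 ->
    forall B : set (measurableTypeR R), measurable B ->
    P [set w | B (a * U w + b * Z w)] = gam B.
  move=> ab B mB; have n1 : (a - b * r / s) ^+ 2 + (b / s) ^+ 2 +
      2 * r * (a - b * r / s) * (b / s) = 1.
    rewrite -[RHS]ab; have -> : b ^+ 2 = b ^+ 2 * (1 - r ^+ 2) / s ^+ 2.
      by rewrite s2 mulfK//; apply/eqP; lra.
    by field.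
  rewrite -(HUV _ _ n1 _ mB); congr (P _); apply/seteqP.
  by split => w /=; congr (B _); rewrite /Z; field.
pose D : set (measurableTypeR R * measurableTypeR R) :=
  [set z | t < `|z.1|] `&` [set z | t < `|r * z.1 + s * z.2|].
have mD : measurable D.
  apply: measurableI.
    have := measurable_abs_tail t; rewrite -[X in _ -> measurable X]setTI.
    by move=> mt; exact: (measurable_fst measurableT _ mt).
  have mg : measurable_fun setT (fun z : measurableTypeR R * measurableTypeR R => r * z.1 + s * z.2).
    by apply: measurable_funD; exact: measurable_funM.
  have := measurable_abs_tail t; rewrite -[X in _ -> measurable X]setTI.
  by move=> mt; exact: (mg measurableT _ mt).
have -> : [set w | t < `|U w| /\ t < `|V w|] = [set w | D (U w, Z w)].
  by apply/seteqP; split => w [h1 h2]; split => //=; rewrite ?VE// -VE.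
rewrite (gauss_pair_law mU mZ HUZ mD).
have mtail : measurable_fun setT (fun u : measurableTypeR R => (t < `|u|)%R%:R : R).
  rewrite (_ : (fun u => _) = \1_[set x : R | t < `|x|]).
    by apply: measurable_indic; exact: measurable_abs_tail.
  apply/funext => x; rewrite indicE/=; case: ltP => h; first by rewrite mem_set.
  by rewrite memNset//=; apply/negP; rewrite -leNgt.
have tail0 (u : R) : 0 <= (t < `|u|)%R%:R :> R by [].
have P0 := Phi_ge0 (- t).
have mx2 : measurable_fun setT (fun u : measurableTypeR R => 1 + u ^+ 2 : R).
  by apply: measurable_funD => //; exact: measurable_funX.
have x20 (u : R) : 0 <= 1 + u ^+ 2 by rewrite addr_ge0 ?sqr_ge0.
have mx3 : measurable_fun setT (fun u : measurableTypeR R => (t < `|u|)%R%:R * (1 + u ^+ 2) : R).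
  exact: measurable_funM.
apply: (@le_trans _ _ (\int[gam]_u (2 * Phi (- t) * (t < `|u|)%R%:R +
    8 * r ^+ 2 * ((t < `|u|)%R%:R * (1 + u ^+ 2)))%:E)%E).
  apply: ge0_le_integral => //.
  - rewrite (_ : (fun x => _) = (fun x => gam (xsection D x))).
      exact: measurable_fun_xsection.
    apply/funext => x; congr (gam _).
    by apply/seteqP; split => z; rewrite /xsection /= inE.
  - apply/measurable_EFinP; apply: measurable_funD; exact: measurable_funM.
  move=> u _; case: (ltP t `|u|) => tu; last first.
    rewrite (_ : [set z | _] = set0) ?measure0 ?lee_fin ?mul0r ?mulr0 ?addr0//.
    by apply/seteqP; split => // z [/= h]; rewrite ltNge tu in h.
  rewrite mulr1 mul1r.
  have -> : [set z | D (u, z)] = [set z | t / s < `|r * u / s + z|].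
    have E (z : R) : `|r * u / s + z| * s = `|r * u + s * z|.
      by rewrite -{2}(gtr0_norm s0) -normrM; congr `|_|; field.
    apply/seteqP; split => z /=; rewrite ltr_pdivrMr// E; first by case.
    by split.
  have ts0 : 0 <= t / s by rewrite divr_ge0// ltW.
  have mS : measurable [set z : R | t / s < `|r * u / s + z|].
    have mg : measurable_fun setT (fun z : measurableTypeR R => r * u / s + z).
      exact: measurable_funD.
    have := measurable_abs_tail (t / s); rewrite -[X in _ -> measurable X]setTI.
    by move=> mt; exact: (mg measurableT _ mt).
  rewrite -[leLHS]fineK ?fin_num_measure// lee_fin.
  apply: (le_trans (normal_abs_tail_shift (r * u / s) ts0)).
  have s1 : s <= 1 by rewrite -[leRHS]sqrtr1 ler_wsqrtr//; lra.
  have tts : t <= t / s by rewrite ler_pdivlMr// ler_piMr.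
  have h1 : Phi (- (t / s)) <= Phi (- t).
    by have /andP[] := Phi_lipschitz t0 tts; rewrite subr_ge0.
  have h2 : 6 * (r * u / s) ^+ 2 <= 8 * r ^+ 2 * (1 + u ^+ 2).
    rewrite !exprMn exprVn s2 mulrA ler_pdivrMr; last by lra.
    have -> : 8 * r ^+ 2 * (1 + u ^+ 2) * (1 - r ^+ 2) =
        r ^+ 2 * (1 + u ^+ 2) * (8 * (1 - r ^+ 2)) by ring.
    apply: (@le_trans _ _ (r ^+ 2 * (1 + u ^+ 2) * 6)); first by lra.
    by apply: ler_wpM2l; [exact: mulr_ge0|lra].
  lra.
rewrite ge0_integralD_EFin//; last 4 first.
- exact: measurable_funM.
- exact: measurable_funM.
- by move=> u; apply: mulr_ge0 => //; exact: mulr_ge0.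
- by move=> u; apply: mulr_ge0; exact: mulr_ge0.
rewrite ge0_integralZ_EFin//; last by rewrite mulr_ge0.
rewrite ge0_integralZ_EFin//; last 2 first.
- by move=> u; rewrite mulr_ge0.
- by rewrite mulr_ge0.
have -> : (\int[gam]_u ((t < `|u|)%R%:R)%:E = (2 * Phi (- t))%:E)%E.
  rewrite -normal_abs_tail// -integral_indic_EFin; last exact: measurable_abs_tail.
  apply: eq_integral => x _; rewrite indicE/=; case: ltP => h; first by rewrite mem_set.
  by rewrite memNset//=; apply/negP; rewrite -leNgt.
rewrite -EFinM EFinD -expr2 leeD2l//.
apply: (@le_trans _ _ ((8 * r ^+ 2)%:E * (20 * Q)%:E)%E).
  apply: lee_wpmul2l; first by rewrite lee_fin mulr_ge0.
  by rewrite /Q mulrA; exact: normal_second_moment_tail.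
by rewrite -EFinM lee_fin -/Q; lra.
Qed.

End GaussPair.

(** * Random matrices and concentration *)

Section RandomMatrix.
Context (R : realType).

Definition coord_sets (m k : nat) : set_system 'M[R]_(m, k) :=
  [set A | exists i, exists j, exists2 B : set R, measurable B &
               A = (fun M : 'M[R]_(m, k) => M i j) @^-1` B].

Arguments coord_sets : clear implicits.
Notation mxT m k := (g_sigma_algebraType (coord_sets m k)).

Lemma measurable_coord (m k : nat) i j :
  measurable_fun setT (fun M : mxT m k => M i j).
Proof.
move=> _ B mB; rewrite setTI; apply: sub_sigma_algebra.
by exists i, j, B.
Qed.

Lemma measurable_mxP (m k : nat) (d : measure_display) (T : measurableType d)
    (Z : T -> mxT m k) :
  measurable_fun setT Z <-> forall i j, measurable_fun setT (fun w => Z w i j).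
Proof.
split=> [mZ i j|H].
  exact: (measurableT_comp (measurable_coord i j) mZ).
apply: (@measurability _ _ _ _ setT Z (coord_sets m k)) => //.
move=> _ [_ [i [j [B mB ->]] <-]]; rewrite setTI.
by have := H i j measurableT B mB; rewrite setTI.
Qed.

Lemma random_matrixP (m k : nat) (d : measure_display) (T : measurableType d)
    (Z : T -> 'M[R]_(m, k)) :
  random_matrix Z <-> measurable_fun setT (Z : T -> mxT m k).
Proof.
split=> H.
  by move=> _ B mB; rewrite setTI; exact: H.
by move=> A mA; rewrite -[_ @^-1` _]setTI; exact: (H measurableT).
Qed.

Lemma random_matrix_coordP (m k : nat) (d : measure_display) (T : measurableType d)
    (Z : T -> 'M[R]_(m, k)) :
  random_matrix Z <-> forall i j, measurable_fun setT (fun w => Z w i j).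
Proof. by rewrite random_matrixP; exact: measurable_mxP. Qed.

Section Ops.
Context (d : measure_display) (T : measurableType d).

Lemma measurable_fun_bigsum (I : finType) (Q : pred I) (f : I -> T -> R) :
  (forall i, measurable_fun setT (f i)) ->
  measurable_fun setT (fun w => \sum_(i | Q i) f i w).
Proof. by move=> mf; under eq_fun do rewrite -big_filter; exact: measurable_sum. Qed.

Lemma measurable_fun_bigprod (I : finType) (Q : pred I) (f : I -> T -> R) :
  (forall i, measurable_fun setT (f i)) ->
  measurable_fun setT (fun w => \prod_(i | Q i) f i w).
Proof. by move=> mf; under eq_fun do rewrite -big_filter; exact: measurable_prod. Qed.

Lemma measurable_mulmx (m k l : nat) (A : T -> mxT m k) (B : T -> mxT k l) :
  measurable_fun setT A -> measurable_fun setT B ->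
  measurable_fun setT ((fun w => A w *m B w) : T -> mxT m l).
Proof.
move=> /measurable_mxP mA /measurable_mxP mB; apply/measurable_mxP => i j.
under eq_fun do rewrite mxE; apply: measurable_fun_bigsum => h.
exact: measurable_funM.
Qed.

Lemma measurable_trmx (m k : nat) (A : T -> mxT m k) :
  measurable_fun setT A -> measurable_fun setT ((fun w => (A w)^T) : T -> mxT k m).
Proof.
move=> /measurable_mxP mA; apply/measurable_mxP => i j.
by under eq_fun do rewrite mxE; exact: mA.
Qed.

End Ops.
End RandomMatrix.

Arguments coord_sets : clear implicits.
Notation mxT R m k := (g_sigma_algebraType (coord_sets R m k)).

Section Independence.
Context (R : realType) (d : measure_display) (T : measurableType d)
  (P : probability T R).
Local Notation gam := (@normal_prob R 0 1).

(* The factors are replaced one at a time: indicators are allowed from index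
   [k] on, and both sides are measures in the set carried by factor [k]. *)
Let indep_prod_rec (n m k : nat) (Z : 'I_n -> T -> 'M[R]_(m, k)) (l : nat) :
  (forall i, random_matrix (Z i)) -> mutually_independent P Z ->
  forall (G : 'I_n -> mxT R m k -> R) (e : 'I_n -> R),
  (forall i, measurable_fun setT (G i)) -> (forall i M, 0 <= G i M) ->
  (forall i, (\int[P]_w (G i (Z i w))%:E = (e i)%:E)%E) ->
  (forall i : 'I_n, (l <= i)%N -> exists2 A : set (mxT R m k), measurable A & G i = \1_A) ->
  (\int[P]_w (\prod_i G i (Z i w))%:E = (\prod_i e i)%:E)%E.
Proof.
move=> rZ iZ; have mZ i : measurable_fun setT (Z i : T -> mxT R m k) by apply/random_matrixP.
have mpre i (A : set (mxT R m k)) : measurable A -> measurable (Z i @^-1` A).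
  by move=> mA; rewrite -[_ @^-1` _]setTI; exact: mZ.
elim: l => [|l IHl] G e mG G0 Ge Gl.
  have /choice[A HA] : forall i, exists A : set (mxT R m k), measurable A /\ G i = \1_A.
    by move=> i; have [A mA GA] := Gl i (leq0n _); exists A.
  have mA i : measurable (A i) by case: (HA i).
  have GA i : G i = \1_(A i) by case: (HA i).
  have eA i : P (Z i @^-1` A i) = (e i)%:E.
    rewrite -Ge -integral_indic_EFin; last exact: mpre.
    by apply: eq_integral => w _; rewrite GA.
  rewrite (_ : (\prod_i e i)%:E = (\prod_i (e i)%:E)%E); last first.
    by elim/big_rec2 : _ => // i x y _ <-; rewrite EFinM.
  under [RHS]eq_bigr do rewrite -eA.
  rewrite -(iZ A)// -integral_indic_EFin; last first.
    by apply: fin_bigcap_measurable => // i _; exact: mpre.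
  apply: eq_integral => w _; congr (_%:E); rewrite indicE.
  have [|] := boolP (w \in _).
    rewrite inE => wA; rewrite big1// => i _; rewrite GA indicE mem_set//.
    exact: wA.
  rewrite notin_setE => wA; apply/eqP/prodf_eq0.
  have [i Ai] : exists i, ~ A i (Z i w).
    by apply/existsNP => H; apply: wA => i _; exact: H.
  by exists i => //; rewrite GA indicE memNset.
case: (ltnP l n) => [ln|nl]; last first.
  apply: IHl => // i li; apply: Gl; by have := leq_trans (ltn_ord i) (leq_trans nl li); rewrite ltnn.
pose j := Ordinal ln.
have mGZ i : measurable_fun setT (fun w => G i (Z i w)).
  exact: (measurableT_comp (mG i) (mZ i)).
have e0 i : 0 <= e i.
  by rewrite -lee_fin -Ge; apply: integral_ge0 => w _; rewrite lee_fin.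
transitivity (\int[P]_w (\prod_(i | i != j) G i (Z i w) * G j (Z j w))%:E)%E.
  by apply: eq_integral => w _; rewrite [in LHS](bigD1 j)//= mulrC.
transitivity (\int[P]_w (\prod_(i | i != j) e i * G j (Z j w))%:E)%E; last first.
  rewrite ge0_integralZ_EFin ?Ge// ?prodr_ge0//.
  by rewrite -EFinM [in RHS](bigD1 j)//= mulrC.
apply: (@ge0_weighted_integral R _ _ _ T T (mxT R m k) P P (Z j) (Z j)
  (fun w => \prod_(i | i != j) G i (Z i w)) (cst (\prod_(i | i != j) e i))) => //.
- exact: measurable_fun_bigprod.
- by move=> w; apply: prodr_ge0.
- by move=> w; apply: prodr_ge0.
move=> B mB; have fB : P (Z j @^-1` B) \is a fin_num by apply: fin_num_measure; exact: mpre.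
pose G' i := if i == j then \1_B else G i.
pose e' i := if i == j then fine (P (Z j @^-1` B)) else e i.
have iB : (\int[P]_w (\1_B (Z j w))%:E = P (Z j @^-1` B))%E.
  by rewrite -integral_indic_EFin//; exact: mpre.
have mI : measurable_fun setT (\1_B : mxT R m k -> R) by exact: measurable_indic.
transitivity (\int[P]_w (\prod_i G' i (Z i w))%:E)%E.
  apply: eq_integral => w _; rewrite [in RHS](bigD1 j)//= /G' eqxx mulrC.
  by congr ((_ * _)%:E); apply: eq_bigr => i /negbTE ->.
rewrite (IHl G' e'); first last.
- move=> i; rewrite leq_eqVlt => /orP[/eqP li|li].
    by exists B => //; rewrite /G' -val_eqE/= -li eqxx.
  have [A mA GA] := Gl i li; exists A => //.
  by rewrite /G'; case: eqP => // ij; move: li; rewrite ij ltnn.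
- by move=> i; rewrite /G' /e'; case: eqP => [->|_]; rewrite ?fineK.
- by move=> i M; rewrite /G'; case: eqP => // _; rewrite indicE.
- by move=> i; rewrite /G'; case: eqP.
rewrite (bigD1 j)//= /e' eqxx EFinM fineK// -iB muleC -ge0_integralZ_EFin; last first.
- by apply: prodr_ge0 => i /negbTE ->.
- by move=> w; rewrite indicE.
- exact: (measurableT_comp mI (mZ j)).
apply: eq_integral => w _; congr ((_ * _)%:E).
by apply: eq_bigr => i /negbTE ->.
Qed.

Lemma mutually_independent_prod (n m k : nat) (Z : 'I_n -> T -> 'M[R]_(m, k))
    (G : 'I_n -> mxT R m k -> R) (e : 'I_n -> R) :
  (forall i, random_matrix (Z i)) -> mutually_independent P Z ->
  (forall i, measurable_fun setT (G i)) -> (forall i M, 0 <= G i M) ->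
  (forall i, (\int[P]_w (G i (Z i w))%:E = (e i)%:E)%E) ->
  (\int[P]_w (\prod_i G i (Z i w))%:E = (\prod_i e i)%:E)%E.
Proof.
move=> rZ iZ mG G0 Ge; apply: (indep_prod_rec (l := n)) => // i.
by rewrite leqNgt ltn_ord.
Qed.

Lemma gaussian_vector_std (m : nat) (Z : T -> 'cV[R]_m) (S : 'M[R]_m) (a : 'cV[R]_m) :
  gaussian_vector P Z S -> (a^T *m S *m a) 0 0 = 1 ->
  forall B : set (measurableTypeR R), measurable B ->
  P [set w | B ((a^T *m Z w) 0 0)] = gam B.
Proof.
move=> [_ _ H] a1 B mB; rewrite H// a1 /centered_normal oner_eq0.
by rewrite sqrtr1.
Qed.

Lemma gaussian_vector_expsq (m : nat) (Z : T -> 'cV[R]_m) (S : 'M[R]_m) (a : 'cV[R]_m)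
    (th : R) :
  gaussian_vector P Z S -> (a^T *m S *m a) 0 0 = 1 -> 2 * th < 1 ->
  (\int[P]_w (expR (th * (a^T *m Z w) 0 0 ^+ 2))%:E =
   (Num.sqrt (1 - 2 * th))^-1%:E)%E.
Proof.
move=> gZ a1 th1; have rZ : random_matrix Z by case: gZ.
have := @integral_normal_expsq R 1 th ltr01; rewrite expr1n mulr1 => <-//.
apply: (@ge0_integral_law R d T P _ (measurableTypeR R)
  (fun w => (a^T *m Z w) 0 0) (normal_prob 0 1) (fun y => expR (th * y ^+ 2))).
- move/random_matrixP : rZ => mZ.
  have := @measurable_mulmx R _ T _ _ _ (cst a^T) _ (measurable_cst _) mZ.
  by move=> /measurable_mxP H; exact: H.
- by move=> B mB; exact: (gaussian_vector_std gZ a1 mB).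
- apply: measurableT_comp => //; apply: measurable_funM => //; exact: measurable_funX.
- by move=> x; exact: expR_ge0.
Qed.

End Independence.

Section ChiSquare.
Context (R : realType).

Let inv_sqrt_exp (th : R) : - 8^-1 <= th <= 8^-1 ->
  (Num.sqrt (1 - 2 * th))^-1 <= expR (th + 2 * th ^+ 2).
Proof.
move=> /andP[t1 t2].
have [p1 p2] : 0 < 1 - 2 * th /\ 0 <= expR (th + 2 * th ^+ 2) by split; [lra|exact: expR_ge0].
have -> : expR (th + 2 * th ^+ 2) = Num.sqrt (expR (th + 2 * th ^+ 2) ^+ 2).
  by rewrite sqrtr_sqr ger0_norm.
rewrite -sqrtrV ?(ltW p1)// ler_wsqrtr//.
rewrite -div1r ler_pdivrMr//.
pose z := th + 2 * th ^+ 2.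
have z1 : 0 <= 1 + z by rewrite /z; nra.
apply: (@le_trans _ _ ((1 + z) ^+ 2 * (1 - 2 * th))).
  have -> : (1 + z) ^+ 2 * (1 - 2 * th) =
    1 + th ^+ 2 * (1 - 6 * th - 4 * th ^+ 2 - 8 * th ^+ 3) by rewrite /z; ring.
  rewrite lerDl mulr_ge0 ?sqr_ge0//.
  have h2 : th ^+ 2 <= 8^-1 by nra.
  have h3 : th ^+ 3 <= 64^-1.
    have -> : th ^+ 3 = th * th ^+ 2 by ring.
    have : 0 <= th ^+ 2 by rewrite sqr_ge0.
    have : th ^+ 2 <= 64^-1 by nra.
    by nra.
  by have : th ^+ 2 <= 64^-1; nra.
apply: ler_wpM2r; first exact: ltW.
by rewrite lerXn2r ?nnegrE//; exact: expR_ge1Dx.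
Qed.

Context (d : measure_display) (T : measurableType d) (P : probability T R).

Let chi2_onesided (n p : nat) (X : T -> 'M[R]_(n, p)) (S : 'M[R]_p) (a : 'cV[R]_p)
    (x s : R) :
  iid_gaussian_rows P X S -> (a^T *m S *m a) 0 0 = 1 -> 0 <= x <= 1 -> s ^+ 2 = 1 ->
  let A := [set w | n%:R * x < s * (\sum_i ((X w *m a) i 0) ^+ 2 - n%:R)] in
  measurable A /\ (P A <= (expR (- (n%:R * x ^+ 2 / 16)))%:E)%E.
Proof.
move=> [rX gX iX] a1 /andP[x0 x1] s2 A.
have mX : measurable_fun setT (X : T -> mxT R n p) by apply/random_matrixP.
have mXa i : measurable_fun setT (fun w => (X w *m a) i 0).
  have := @measurable_mulmx R _ T _ _ _ _ (cst a) mX (measurable_cst _).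
  by move=> /measurable_mxP H; exact: H.
have mS : measurable_fun setT (fun w => \sum_i ((X w *m a) i 0) ^+ 2).
  by apply: measurable_fun_bigsum => i; exact: measurable_funX.
have mA : measurable A.
  rewrite (_ : A = (fun w => s * (\sum_i ((X w *m a) i 0) ^+ 2 - n%:R)) @^-1` `]n%:R * x, +oo[).
    rewrite -[X in measurable X]setTI.
    have mg : measurable_fun setT (fun w => s * (\sum_i ((X w *m a) i 0) ^+ 2 - n%:R)).
      by apply: measurable_funM => //; exact: measurable_funB.
    by apply: mg => //; exact: measurable_itv.
  by apply/seteqP; split => w; rewrite /A /= in_itv/= andbT.
split => //.
pose th := s * x / 8.
have sb : -1 <= s <= 1 by rewrite -ler_norml -(@expr_le1 _ 2)// -normrX s2 normr1.
have thb : - 8^-1 <= th <= 8^-1 by rewrite /th; case/andP: sb => s1 s3; apply/andP; split; nra.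
have th1 : 2 * th < 1 by case/andP: thb; lra.
pose G (i : 'I_n) (M : mxT R 1 p) := expR (th * ((M *m a) 0 0) ^+ 2).
have rowE i w : ((X w *m a) i 0) = ((row i (X w) *m a) 0 0) by rewrite -row_mul [RHS]mxE.
have tE i w : (row i (X w) *m a) 0 0 = (a^T *m (row i (X w))^T) 0 0.
  by rewrite -trmx_mul [RHS]mxE.
have rrow i : random_matrix (fun w => row i (X w)).
  apply/random_matrix_coordP => i' j; under eq_fun do rewrite mxE.
  by move/measurable_mxP : mX; exact.
have mG i : measurable_fun setT (G i).
  apply: measurableT_comp => //; apply: measurable_funM => //; apply: measurable_funX.
  have := @measurable_mulmx R _ (mxT R 1 p) _ _ _ id (cst a) (@measurable_id _ _ setT) (measurable_cst _).
  by move=> /measurable_mxP H; exact: H.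
pose q := (Num.sqrt (1 - 2 * th))^-1.
have EG i : (\int[P]_w (G i (row i (X w)))%:E = q%:E)%E.
  rewrite -(gaussian_vector_expsq (gX i) a1 th1).
  by apply: eq_integral => w _; rewrite /G tE.
have := mutually_independent_prod (G := G) (e := fun=> q) rrow iX mG (fun _ _ => expR_ge0 _) EG.
rewrite prodr_const card_ord => E.
have E2 : (\int[P]_w (expR (th * \sum_i ((X w *m a) i 0) ^+ 2))%:E = (q ^+ n)%:E)%E.
  rewrite -E; apply: eq_integral => w _; rewrite mulr_sumr expR_sum; congr (_%:E).
  by apply: eq_bigr => i _; rewrite /G -rowE.
pose c := expR (- (th * n%:R) - n%:R * x ^+ 2 / 8).
have mexp : measurable_fun setT (fun w => expR (th * \sum_i ((X w *m a) i 0) ^+ 2)).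
  by apply: measurableT_comp => //; exact: measurable_funM.
apply: (@le_trans _ _ (\int[P]_w (c * expR (th * \sum_i ((X w *m a) i 0) ^+ 2))%:E)%E).
  rewrite -integral_indic_EFin//; apply: ge0_le_integral_EFin => //.
    exact: measurable_funM.
  move=> w; rewrite indicE; have [|_] := boolP (w \in A); last by rewrite mulr_ge0 ?expR_ge0.
  rewrite inE /A /= => h; rewrite -expRD; apply: le_trans (expR_ge1Dx _); rewrite lerDl.
  set Q := \sum_i _ in h *.
  have : 0 <= x / 8 * (s * (Q - n%:R) - n%:R * x) by rewrite mulr_ge0 ?divr_ge0// subr_ge0 ltW.
  by rewrite /th expr2; lra.
rewrite ge0_integralZ_EFin//; last exact: expR_ge0.
rewrite E2 -EFinM lee_fin.
apply: (@le_trans _ _ (c * expR (th + 2 * th ^+ 2) ^+ n)).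
  rewrite ler_wpM2l ?expR_ge0// lerXn2r ?nnegrE ?invr_ge0 ?sqrtr_ge0 ?expR_ge0//.
  exact: inv_sqrt_exp.
rewrite -expRM_natr /c -expRD ler_expR.
have -> : th ^+ 2 = x ^+ 2 / 64 by rewrite /th exprMn exprVn exprMn s2 mul1r; field.
rewrite -mulr_natl; have n0 : 0 <= n%:R :> R by [].
by have := mulr_ge0 n0 (sqr_ge0 x); lra.
Qed.

Lemma chi2_concentration (n p : nat) (X : T -> 'M[R]_(n, p)) (S : 'M[R]_p)
    (a : 'cV[R]_p) (x : R) :
  iid_gaussian_rows P X S -> (0 < n)%N -> 0 <= x <= 1 ->
  (a = 0 \/ 0 < (a^T *m S *m a) 0 0) ->
  let A := [set w | x * (a^T *m S *m a) 0 0 <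
     `|(a^T *m Sigma_hat (X w) *m a) 0 0 - (a^T *m S *m a) 0 0|] in
  measurable A /\ (P A <= (2 * expR (- (n%:R * x ^+ 2 / 16)))%:E)%E.
Proof.
move=> iX n0 x01 [->|v0] A.
  have -> : A = set0.
    by apply/seteqP; split => // w; rewrite /A /= !mulmx0 mxE mulr0 subrr normr0 ltxx.
  by split => //; rewrite measure0 lee_fin mulr_ge0 ?expR_ge0.
set v := (a^T *m S *m a) 0 0 in v0 A *.
pose b := (Num.sqrt v)^-1 *: a.
have sv0 : 0 < Num.sqrt v by rewrite sqrtr_gt0.
have sv2 : Num.sqrt v * Num.sqrt v = v by rewrite -expr2 sqr_sqrtr// ltW.
have b1 : (b^T *m S *m b) 0 0 = 1.
  have -> : b^T = (Num.sqrt v)^-1 *: a^T by rewrite /b linearZ.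
  rewrite -scalemxAl -scalemxAr -scalemxAl [LHS]mxE [X in _ * X]mxE -/v mulrA -invfM sv2.
  by rewrite mulVf// gt_eqF.
have nR : 0 < n%:R :> R by rewrite ltr0n.
have SE w : \sum_i ((X w *m b) i 0) ^+ 2 =
    n%:R * ((a^T *m Sigma_hat (X w) *m a) 0 0 / v).
  have -> : (a^T *m Sigma_hat (X w) *m a) 0 0 = n%:R^-1 * \sum_i ((X w *m a) i 0) ^+ 2.
    rewrite /Sigma_hat -scalemxAr -scalemxAl mxE mulmxA -trmx_mul -mulmxA mxE.
    by congr (_ * _); apply: eq_bigr => i _; rewrite mxE expr2.
  rewrite /b -scalemxAr -mulrA mulVKf ?gt_eqF//.
  rewrite mulr_suml; apply: eq_bigr => i _; rewrite mxE exprMn exprVn mulrC.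
  by rewrite -[in RHS]sv2 -expr2.
have [m1 p1] := chi2_onesided iX b1 x01 (expr1n _ 2).
have s2 : (-1) ^+ 2 = 1 :> R by rewrite sqrrN expr1n.
have [m2 p2] := chi2_onesided iX b1 x01 s2.
have AE : A = [set w | n%:R * x < 1 * (\sum_i ((X w *m b) i 0) ^+ 2 - n%:R)] `|`
              [set w | n%:R * x < -1 * (\sum_i ((X w *m b) i 0) ^+ 2 - n%:R)].
  have E (q : R) : x * v < q - v <-> n%:R * x < 1 * (n%:R * (q / v) - n%:R).
    have -> : 1 * (n%:R * (q / v) - n%:R) = n%:R * ((q - v) / v).
      by rewrite mul1r mulrBl divff ?gt_eqF// mulrBr mulr1.
    by rewrite ltr_pM2l// ltr_pdivlMr.
  have E' (q : R) : x * v < - (q - v) <-> n%:R * x < -1 * (n%:R * (q / v) - n%:R).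
    have -> : -1 * (n%:R * (q / v) - n%:R) = n%:R * (- (q - v) / v).
      by rewrite mulN1r mulNr mulrBl divff ?gt_eqF// mulrN mulrBr mulr1.
    by rewrite ltr_pM2l// ltr_pdivlMr.
  apply/seteqP; split => w; rewrite /A /= SE ltr_normr.
    by move=> /orP[/E|/E'] h; [left|right].
  by move=> [/E h|/E' h]; apply/orP; [left|right].
rewrite AE; split; first exact: measurableU.
apply: (le_trans (measureU2 _ m1 m2)).
by rewrite mulrDl mul1r EFinD leeD.
Qed.

End ChiSquare.

Section UnionBound.
Context (R : realType) (d : measure_display) (T : measurableType d)
  (P : probability T R).

Lemma finite_union_bound (I : finType) (A : I -> set T) (c : R) :
  (forall i, measurable (A i)) -> (forall i, P (A i) <= c%:E)%E ->
  measurable [set w | exists i, A i w] /\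
  (P [set w | exists i, A i w] <= (#|I|%:R * c)%:E)%E.
Proof.
move=> mA PA; have mU (s : seq I) : measurable [set w | exists2 i, i \in s & A i w].
  rewrite (_ : [set w | _] = \bigcup_(i in [set` s]) A i).
    by apply: fin_bigcup_measurable.
  by apply/seteqP; split => w [i ? ?]; exists i.
have H (s : seq I) : (P [set w | exists2 i, i \in s & A i w] <= ((size s)%:R * c)%:E)%E.
  elim: s => [|i s IH].
    rewrite (_ : [set w | _] = set0) ?measure0 ?mul0r//.
    by apply/seteqP; split => // w [].
  rewrite (_ : [set w | _] = A i `|` [set w | exists2 i, i \in s & A i w]); last first.
    apply/seteqP; split => w.
      by move=> [j]; rewrite inE => /predU1P[->|js] Aj; [left|right; exists j].
    by move=> [Ai|[j js Aj]]; [exists i; rewrite // mem_head|exists j; rewrite // inE js orbT].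
  apply: (le_trans (measureU2 _ (mA i) (mU s))).
  by rewrite /= -natr1 mulrDl mul1r EFinD addeC leeD.
have E : [set w | exists i, A i w] = [set w | exists2 i, i \in enum I & A i w].
  by apply/seteqP; split => w [i]; [exists i; rewrite ?mem_enum|exists i].
by rewrite E cardE; split.
Qed.

Lemma independent_cond_bound (m k m' k' : nat) (Y : T -> 'M[R]_(m, k))
    (Z : T -> 'M[R]_(m', k')) (A : set (mxT R m k))
    (D : set (mxT R m k * mxT R m' k')) (c : R) : 0 <= c ->
  random_matrix Y -> random_matrix Z -> independent P Y Z ->
  measurable A -> measurable D ->
  (forall y, A y -> P [set w | D (y, Z w)] <= c%:E)%E ->
  measurable [set w | A (Y w) /\ D (Y w, Z w)] /\
  (P [set w | A (Y w) /\ D (Y w, Z w)] <= c%:E)%E.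
Proof.
move=> c0 /random_matrixP mY /random_matrixP mZ iYZ mA mD H.
pose D' : set (mxT R m k * mxT R m' k') := (fst @^-1` A) `&` D.
have mD' : measurable D'.
  apply: measurableI => //; rewrite -[X in measurable X]setTI.
  exact: (measurable_fst measurableT).
have mYZ : measurable_fun setT (fun w => (Y w, Z w) : mxT R m k * mxT R m' k').
  by apply/measurable_fun_pairP.
have E : [set w | A (Y w) /\ D (Y w, Z w)] = [set w | D' (Y w, Z w)] by [].
rewrite E; split.
  by rewrite -[X in measurable X]setTI; exact: (mYZ measurableT _ mD').
have J := @joint_law R d _ _ T (mxT R m k) (mxT R m' k') P Y Z
  (distribution P (mfun_Sub (mem_set mY))) (distribution P (mfun_Sub (mem_set mZ))) mY mZ.
rewrite J//.
apply: (@le_trans _ _ (\int[distribution P (mfun_Sub (mem_set mY))]_y (cst c%:E) y)%E).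
  apply: ge0_le_integral => //.
  - rewrite (_ : (fun x => _) = (fun x => distribution P (mfun_Sub (mem_set mZ)) (xsection D' x))).
      exact: measurable_fun_xsection.
    by apply/funext => y; congr (distribution _ _ _); apply/seteqP; split => z; rewrite /xsection/= inE.
  - move=> y _ /=; rewrite /distribution /pushforward /=.
    have [Ay|nAy] := pselect (A y).
      apply: le_trans (H y Ay); apply: le_measure; rewrite ?inE.
      + rewrite -[X in measurable X]setTI; apply: (mZ measurableT).
        rewrite (_ : [set z | _] = xsection D' y); first exact: measurable_xsection.
        by apply/seteqP; split => z; rewrite /xsection/= inE.
      + rewrite (_ : [set w | _] = Z @^-1` (xsection D y)).
          by rewrite -[X in measurable X]setTI; apply: (mZ measurableT); exact: measurable_xsection.
        by apply/seteqP; split => z; rewrite /xsection/= inE.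
      + by move=> w [_].
    rewrite (_ : _ @^-1` _ = set0) ?measure0 ?lee_fin//.
    by apply/seteqP; split => // w [].
rewrite integral_cst//= /distribution /pushforward/= preimage_setT.
by have /= -> := probability_setT P; rewrite mule1.
Qed.

End UnionBound.

(** * Quadratic forms and Maurey sparsification *)

Section QuadraticForms.
Context (R : realType) (p : nat).
Implicit Types (A : 'M[R]_p) (u v w : 'cV[R]_p).

Definition bform A u v : R := (u^T *m A *m v) 0 0.

Lemma bformDl A u u' v : bform A (u + u') v = bform A u v + bform A u' v.
Proof. by rewrite /bform linearD /= !mulmxDl mxE. Qed.

Lemma bformDr A u v v' : bform A u (v + v') = bform A u v + bform A u v'.
Proof. by rewrite /bform !mulmxDr mxE. Qed.

Lemma bformZl A c u v : bform A (c *: u) v = c * bform A u v.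
Proof. by rewrite /bform linearZ /= -!scalemxAl mxE. Qed.

Lemma bformZr A c u v : bform A u (c *: v) = c * bform A u v.
Proof. by rewrite /bform -!scalemxAr mxE. Qed.

Lemma bformNl A u v : bform A (- u) v = - bform A u v.
Proof. by rewrite -scaleN1r bformZl mulN1r. Qed.

Lemma bformNr A u v : bform A u (- v) = - bform A u v.
Proof. by rewrite -scaleN1r bformZr mulN1r. Qed.

Lemma bformBm A A' u v : bform (A - A') u v = bform A u v - bform A' u v.
Proof. by rewrite /bform mulmxBr mulmxBl !mxE. Qed.

Lemma bformZm A c u v : bform (c *: A) u v = c * bform A u v.
Proof. by rewrite /bform -scalemxAr -scalemxAl mxE. Qed.

Lemma bform0r A u : bform A u 0 = 0.
Proof. by rewrite /bform mulmx0 mxE. Qed.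

Lemma bform0l A u : bform A 0 u = 0.
Proof. by rewrite /bform trmx0 !mul0mx mxE. Qed.

Lemma bform_suml (I : finType) A (f : I -> 'cV[R]_p) v :
  bform A (\sum_i f i) v = \sum_i bform A (f i) v.
Proof. by elim/big_ind2 : _ => [|? ? ? ? <- <-|//]; rewrite ?bform0l ?bformDl. Qed.

Lemma bform_sumr (I : finType) A (f : I -> 'cV[R]_p) v :
  bform A v (\sum_i f i) = \sum_i bform A v (f i).
Proof. by elim/big_ind2 : _ => [|? ? ? ? <- <-|//]; rewrite ?bform0r ?bformDr. Qed.

Lemma bformC A u v : A^T = A -> bform A u v = bform A v u.
Proof.
by move=> sA; rewrite /bform -[in LHS](trmxK (u^T *m A *m v)) mxE !trmx_mul trmxK sA mulmxA.
Qed.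

Lemma bform_sq_add A u v : A^T = A ->
  bform A (u + v) (u + v) = bform A u u + 2 * bform A u v + bform A v v.
Proof. by move=> sA; rewrite bformDl !bformDr (bformC v u sA); ring. Qed.

Lemma bform1 u : bform 1%:M u u = sqnorm2 u.
Proof. by rewrite /bform mulmx1 mxE; apply: eq_bigr => i _; rewrite mxE expr2. Qed.

Lemma bformE A u v : bform A u v = \sum_i u i 0 * (A *m v) i 0.
Proof. by rewrite /bform -mulmxA mxE; apply: eq_bigr => i _; rewrite mxE. Qed.

Lemma bform_delta A u k : bform A (delta_mx k 0) u = (A *m u) k 0.
Proof. by rewrite /bform trmx_delta -mulmxA -rowE mxE. Qed.

End QuadraticForms.

Section Eigenvalues.
Context (R : realType) (p : nat).
Implicit Types (A S : 'M[R]_p) (v : 'cV[R]_p).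

Lemma sqnorm2_ge0 (m : nat) (v : 'cV[R]_m) : 0 <= sqnorm2 v.
Proof. by apply: sumr_ge0 => i _; exact: sqr_ge0. Qed.

Lemma coord_sqnorm2 (m : nat) (v : 'cV[R]_m) i : v i 0 ^+ 2 <= sqnorm2 v.
Proof. by rewrite /sqnorm2 (bigD1 i)//= lerDl; apply: sumr_ge0 => j _; exact: sqr_ge0. Qed.

Lemma bform_le_entries A v :
  `|bform A v v| <= (\sum_i \sum_j `|A i j|) * sqnorm2 v.
Proof.
rewrite bformE; apply: le_trans (ler_norm_sum _ _ _) _; rewrite mulr_suml.
apply: ler_sum => i _; rewrite mxE normrM.
apply: le_trans (ler_wpM2l (normr_ge0 _) (ler_norm_sum _ _ _)) _.
rewrite mulr_sumr mulr_suml; apply: ler_sum => j _; rewrite normrM mulrCA.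
apply: ler_wpM2l => //; rewrite -normrM.
have := coord_sqnorm2 v i; have := coord_sqnorm2 v j.
set x := v i 0; set y := v j 0; set q := sqnorm2 v => yq xq.
have := sqr_ge0 (x - y); have := sqr_ge0 (x + y).
by rewrite ler_norml !expr2 in yq xq * => ? ?; apply/andP; split; lra.
Qed.

(* The supremum of the [t] with [S - t] positive semidefinite is an eigenvalue:
   a positive semidefinite [A] with inverse [B] satisfies
   [|v|^2 = <B v, A v> <= (K <A v, v> + K^-1 <B v, v>) / 2], hence
   [A >= K^-1]. *)
Lemma eigenvalue_lower_bound S (c : R) v :
  S^T = S -> (forall a, eigenvalue S a -> c <= a) -> c * sqnorm2 v <= bform S v v.
Proof.
move=> sS eS; have [v0|v0] := eqVneq (sqnorm2 v) 0.
  rewrite v0 mulr0 (_ : v = 0) ?bform0r//; apply/colP => i; rewrite mxE.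
  by apply/eqP; rewrite -sqrf_eq0 eq_le sqr_ge0 andbT -v0 coord_sqnorm2.
have vp : 0 < sqnorm2 v by rewrite lt_neqAle eq_sym v0 sqnorm2_ge0.
pose T := [set t : R | forall u, t * sqnorm2 u <= bform S u u].
have T0 : T (- (\sum_i \sum_j `|S i j|)).
  by move=> u; rewrite mulNr; have := bform_le_entries S u; rewrite ler_norml => /andP[].
have Tub : has_ubound T.
  by exists (bform S v v / sqnorm2 v) => t /(_ v) ht; rewrite ler_pdivlMr.
have hT : has_sup T by split => //; exists (- (\sum_i \sum_j `|S i j|)).
pose mu := sup T.
have Tmu : T mu.
  move=> u; have [u0|u0] := eqVneq (sqnorm2 u) 0.
    by have := T0 u; rewrite u0 !mulr0.
  have up : 0 < sqnorm2 u by rewrite lt_neqAle eq_sym u0 sqnorm2_ge0.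
  rewrite -ler_pdivlMr//; apply: ge_sup; first by case: hT.
  by move=> t /(_ u) ht; rewrite ler_pdivlMr.
pose A := S - mu%:M.
have AE u : bform A u u = bform S u u - mu * sqnorm2 u.
  by rewrite /A bformBm -scalemx1 bformZm bform1.
have sA : A^T = A by rewrite /A linearB /= sS tr_scalar_mx.
have A0 u : 0 <= bform A u u by rewrite AE subr_ge0; exact: Tmu.
have [uA|nA] := boolP (A \in unitmx); last first.
  apply: le_trans (Tmu v); apply: ler_wpM2r; first exact: sqnorm2_ge0.
  apply: eS; apply/eigenvalueP; move: nA; rewrite unitmxE unitfE negbK => /det0P[u u0 uA].
  exists u => //; move: uA; rewrite /A mulmxBr mul_mx_scalar => /eqP.
  by rewrite subr_eq0 => /eqP.
exfalso; pose B := invmx A; pose K := 1 + \sum_i \sum_j `|B i j|.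
have Kp : 0 < K by rewrite ltr_wpDr// sumr_ge0// => i _; rewrite sumr_ge0.
have sB : B^T = B by rewrite /B trmx_inv sA.
suff : T (mu + K^-1).
  move=> TK; have := ub_le_sup Tub TK; rewrite -/mu leNgt ltrDl invr_gt0 Kp.
  by [].
move=> u; suff : K^-1 * sqnorm2 u <= bform A u u by rewrite AE mulrDl; lra.
rewrite mulrC ler_pdivrMr//.
have E1 : bform A (B *m u) u = sqnorm2 u.
  by rewrite -bform1 /bform trmx_mul sB -!mulmxA (mulmxA B) mulVmx// !mul1mx.
have E2 : bform A (B *m u) (B *m u) = bform B u u.
  by rewrite /bform trmx_mul sB -!mulmxA (mulmxA A) mulmxV// mul1mx.
have hB : bform B u u <= K * sqnorm2 u.
  apply: le_trans (ler_norm _) _; apply: le_trans (bform_le_entries B u) _.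
  by apply: ler_wpM2r; [exact: sqnorm2_ge0|rewrite /K lerDr].
have := A0 (B *m u - K *: u); rewrite bform_sq_add// bformNr bformNl bformNr.
rewrite !bformZr bformZl E1 E2 opprK => h.
have : 0 <= K * (K * bform A u u - sqnorm2 u) by lra.
by rewrite pmulr_rge0// subr_ge0 mulrC.
Qed.

End Eigenvalues.

Section Maurey.
Context (R : realType) (p : nat) (I : finType).
Variables (a : I -> 'cV[R]_p).
Implicit Types (A : 'M[R]_p) (v : 'cV[R]_p).

(* The left-hand side is [m ^ 2] times the mean of the quadratic form at the
   average of [m] independent atoms drawn with probabilities [w], up to the
   shift [v]. *)
Let maurey A (w : I -> R) (m : nat) h v : A^T = A -> (forall i, 0 <= w i) -> \sum_i w i = 1 ->
  h = \sum_i w i *: a i ->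
  (forall s : seq I, size s = m ->
     0 <= bform A (v + \sum_(i <- s) a i) (v + \sum_(i <- s) a i)) ->
  0 <= bform A v v + 2 * m%:R * bform A v h + m%:R * (m%:R - 1) * bform A h h
       + m%:R * \sum_i w i * bform A (a i) (a i).
Proof.
move=> sA w0 w1 hE H; elim: m v H => [|m IH] v H.
  by have := H [::] erefl; rewrite big_nil addr0 !(mul0r, mulr0) !addr0.
set q := \sum_i _ in IH *.
have {}IH i : 0 <= bform A (v + a i) (v + a i) + 2 * m%:R * bform A (v + a i) h +
   m%:R * (m%:R - 1) * bform A h h + m%:R * q.
  by apply: IH => s sm; have := H (i :: s); rewrite big_cons addrA /= sm; apply.
have := sumr_ge0 (P := xpredT) (index_enum I) (fun i _ => mulr_ge0 (w0 i) (IH i)).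
congr (0 <= _).
transitivity (\sum_i (w i * (bform A v v + 2 * m%:R * bform A v h +
     m%:R * (m%:R - 1) * bform A h h + m%:R * q) + 2 * (w i * bform A v (a i)) +
     w i * bform A (a i) (a i) + 2 * m%:R * (w i * bform A (a i) h))).
  by apply: eq_bigr => i _; rewrite bform_sq_add// bformDl; ring.
rewrite !big_split/= -mulr_suml w1 -!mulr_sumr -/q.
have -> : \sum_i w i * bform A v (a i) = bform A v h.
  by rewrite hE bform_sumr; apply: eq_bigr => i _; rewrite bformZr.
have -> : \sum_i w i * bform A (a i) h = bform A h h.
  by rewrite [in RHS]hE bform_suml -hE; apply: eq_bigr => i _; rewrite bformZl.
by rewrite -natr1; ring.
Qed.

Lemma maurey_lower_bound A (w : I -> R) (m : nat) (B : R) h : A^T = A -> (forall i, 0 <= w i) -> (1 < m)%N ->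
  (forall s : seq I, size s = m -> 0 <= bform A (\sum_(i <- s) a i) (\sum_(i <- s) a i)) ->
  (forall i, bform A (a i) (a i) <= B) ->
  h = \sum_i w i *: a i ->
  0 <= bform A h h + (\sum_i w i) ^+ 2 / (m%:R - 1) * B.
Proof.
move=> sA w0 m1 H aB hE; set L := \sum_i w i.
have m1R : 0 < m%:R - 1 :> R by rewrite subr_gt0 ltr1n.
have mR : 0 < m%:R :> R by rewrite ltr0n (ltnW m1).
have L0 : 0 <= L by apply: sumr_ge0.
have [L1|L1] := eqVneq L 0.
  rewrite L1 expr0n/= !mul0r addr0 (_ : h = 0) ?bform0r// hE.
  apply: big1 => i _; move/eqP : L1; rewrite psumr_eq0// => /allP/(_ i (mem_index_enum _))/eqP ->.
  by rewrite scale0r.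
have Lp : 0 < L by rewrite lt_neqAle eq_sym L1.
have : 0 <= m%:R * (m%:R - 1) * (L^-1 * (L^-1 * bform A h h)) +
    m%:R * \sum_i (w i / L) * bform A (a i) (a i).
  have hL : L^-1 *: h = \sum_i (w i / L) *: a i.
    by rewrite hE scaler_sumr; apply: eq_bigr => i _; rewrite scalerA mulrC.
  have w0' i : 0 <= w i / L by rewrite divr_ge0.
  have w1' : \sum_i w i / L = 1 by rewrite -mulr_suml divff.
  have := @maurey A (fun i => w i / L) m _ 0 sA w0' w1' hL.
  rewrite bform0l bform0l mulr0 !add0r bformZl bformZr; apply => s sm.
  by rewrite add0r; exact: H.
have : \sum_i w i / L * bform A (a i) (a i) <= B.
  apply: (@le_trans _ _ (\sum_i w i / L * B)).
    by apply: ler_sum => i _; apply: ler_wpM2l => //; rewrite divr_ge0.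
  by rewrite -mulr_suml -mulr_suml divff// mul1r.
set q := \sum_i _; move=> qB; rewrite -mulrA -mulrDr pmulr_rge0// => h1.
have : 0 <= (m%:R - 1) * (L^-1 * (L^-1 * bform A h h)) + B by lra.
have -> : bform A h h + L ^+ 2 / (m%:R - 1) * B =
  L ^+ 2 / (m%:R - 1) * ((m%:R - 1) * (L^-1 * (L^-1 * bform A h h)) + B).
  by field; rewrite L1 gt_eqF.
by move=> h2; rewrite mulr_ge0// divr_ge0 ?sqr_ge0// ltW.
Qed.

Definition signed_atom (i : I * bool) : 'cV[R]_p := if i.2 then a i.1 else - a i.1.

End Maurey.

Section Concentrated.
Context (R : realType) (p : nat) (I : finType).
Variables (a : I -> 'cV[R]_p) (S M : 'M[R]_p).
Hypotheses (sS : S^T = S) (sM : M^T = M).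

(* The relative concentration of [M] is only required on the finitely many sums
   of [m] signed atoms, which is within reach of a union bound. *)
Definition atom_sums_bounded (m : nat) (x : R) : Prop :=
  forall s : seq (I * bool), size s = m ->
    let v := \sum_(i <- s) signed_atom a i in `|bform M v v| <= x * bform S v v.

Hypothesis atomS : forall i, bform S (a i) (a i) <= 1.

Lemma atom_sums_single (m : nat) (x : R) i : (0 < m)%N -> 0 <= x ->
  atom_sums_bounded m x -> `|bform M (a i) (a i)| <= x.
Proof.
move=> m0 x0 /(_ (nseq m (i, true))); rewrite size_nseq => /(_ erefl) /=.
rewrite big_nseq -[iter _ _ _]/(iter m (+%R (a i)) 0) iter_addr_0 -scaler_nat.
have mR : 0 < m%:R :> R by rewrite ltr0n.
have mm : 0 <= m%:R * m%:R :> R by rewrite mulr_ge0.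
rewrite !bformZl !bformZr mulrA normrM (ger0_norm mm) => h.
have : m%:R * m%:R * `|bform M (a i) (a i)| <= m%:R * m%:R * (x * bform S (a i) (a i)).
  by apply: le_trans h _; rewrite le_eqVlt; apply/orP; left; apply/eqP; ring.
rewrite ler_pM2l ?mulr_gt0// => {}h; apply: le_trans h _.
by rewrite ler_piMr.
Qed.

Lemma atom_sums_pair (x : R) i j : 0 <= x ->
  atom_sums_bounded 2 x -> `|bform M (a i) (a j)| <= x.
Proof.
move=> x0 H.
have h1 := H [:: (i, true); (j, true)] erefl.
have h2 := H [:: (i, true); (j, false)] erefl.
move: h1 h2 => /=; rewrite !big_cons !big_nil /signed_atom /= !addr0.
rewrite !bform_sq_add// !bformNr !bformNl opprK.
have := atomS i; have := atomS j.
set b := bform M (a i) (a j); set si := bform S (a i) (a i); set sj := bform S (a j) (a j).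
move=> sj1 si1; rewrite opprK !ler_norml => /andP[h1 h2] /andP[h3 h4].
by apply/andP; split; nra.
Qed.

Lemma maurey_norm_bound (m : nat) (x L : R) (c : I -> R) (h : 'cV[R]_p) :
  (1 < m)%N -> 0 <= x -> atom_sums_bounded m x ->
  h = \sum_i c i *: a i -> \sum_i `|c i| <= L ->
  `|bform M h h| <= x * (bform S h h + 2 * L ^+ 2 / (m%:R - 1)).
Proof.
move=> m1 x0 H hE cL.
have m1R : 0 < m%:R - 1 :> R by rewrite subr_gt0 ltr1n.
pose w (k : I * bool) : R := if k.2 then Num.max (c k.1) 0 else Num.max (- c k.1) 0.
have w0 k : 0 <= w k by rewrite /w; case: k.2; rewrite le_max lexx orbT.
have wpair (V : lmodType R) (f : I -> V) :
    \sum_k w k *: (if k.2 then f k.1 else - f k.1) = \sum_i c i *: f i.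
  rewrite -(pair_big xpredT xpredT (fun i b => w (i, b) *: (if b then f i else - f i)))/=.
  apply: eq_bigr => i _; rewrite big_bool /w /= scalerN -scalerBl; congr (_ *: _).
  by rewrite /Num.max; case: ltP => ?; case: ltP => ?; lra.
have w1 : \sum_k w k = \sum_i `|c i|.
  rewrite -(pair_big xpredT xpredT (fun i b => w (i, b)))/=.
  apply: eq_bigr => i _; rewrite big_bool /w /=.
  rewrite /Num.max; case: ltP => ?; case: ltP => ?; case: (ger0P (c i)) => ?; lra.
have hw : h = \sum_k w k *: signed_atom a k by rewrite hE -wpair.
have key (s : R) : `|s| = 1 -> 0 <= x * bform S h h - s * bform M h h + L ^+ 2 / (m%:R - 1) * (2 * x).
  move=> s1; pose A := x *: S - s *: M.
  have AE u : bform A u u = x * bform S u u - s * bform M u u.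
    by rewrite /A bformBm !bformZm.
  have sA : A^T = A by rewrite /A linearB /= !linearZ /= sS sM.
  have := @maurey_lower_bound R p _ (signed_atom a) A w m (2 * x) h sA w0 m1.
  rewrite AE => /(_ _ _ hw) => h1.
  apply: le_trans (h1 _ _) _.
  - move=> t tm; rewrite AE subr_ge0; apply: le_trans (H t tm).
    by rewrite (le_trans (ler_norm _))// normrM s1 mul1r.
  - move=> [i b]; have -> : bform A (signed_atom a (i, b)) (signed_atom a (i, b)) = bform A (a i) (a i).
      by rewrite /signed_atom /=; case: b => //; rewrite bformNl bformNr opprK.
    rewrite AE; have := atomS i; have := @atom_sums_single m x i (ltnW m1) x0 H.
    have : - (s * bform M (a i) (a i)) <= `|bform M (a i) (a i)|.
      by rewrite (le_trans (ler_norm _))// normrN normrM s1 mul1r.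
    move=> ? ? ?; have : x * bform S (a i) (a i) <= x by rewrite ler_piMr.
    lra.
  rewrite lerD2l; apply: ler_wpM2r; first by rewrite mulr_ge0.
  apply: ler_wpM2r; first by rewrite invr_ge0 ltW.
  by rewrite w1 lerXn2r ?nnegrE// ?(le_trans _ cL)// sumr_ge0.
have k1 := key 1 (normr1 _); have k2 := key (-1) (normrN1 _).
have -> : 2 * L ^+ 2 / (m%:R - 1) = 2 * (L ^+ 2 / (m%:R - 1)) by rewrite mulrA.
move: k1 k2; set q := L ^+ 2 / _ => k1 k2.
by rewrite ler_norml; apply/andP; split; lra.
Qed.

End Concentrated.

(** * Lasso and nodewise regressions on a good design *)

Section Lasso.
Context (R : realType).

Lemma sum_normM_le (I : finType) (f g : I -> R) (c : R) :
  (forall i, `|g i| <= c) -> `|\sum_i f i * g i| <= c * \sum_i `|f i|.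
Proof.
move=> gc; apply: le_trans (ler_norm_sum _ _ _) _; rewrite mulr_sumr.
by apply: ler_sum => i _; rewrite normrM mulrC; apply: ler_wpM2r.
Qed.

Lemma sqr_sum_le (I : finType) (A : pred I) (f : I -> R) :
  (\sum_(i | A i) f i) ^+ 2 <= #|A|%:R * \sum_(i | A i) f i ^+ 2.
Proof.
have -> : (\sum_(i | A i) f i) ^+ 2 = \sum_(i | A i) \sum_(j | A j) f i * f j.
  by rewrite expr2 mulr_suml; apply: eq_bigr => i _; rewrite mulr_sumr.
have -> : #|A|%:R * \sum_(i | A i) f i ^+ 2 =
    \sum_(i | A i) \sum_(j | A j) (f i ^+ 2 + f j ^+ 2) / 2.
  transitivity (\sum_(i | A i) \sum_(j | A j) f i ^+ 2 / 2 +
                \sum_(i | A i) \sum_(j | A j) f j ^+ 2 / 2).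
    rewrite [in X in _ = _ + X]exchange_big /= -big_split mulr_sumr.
    by apply: eq_bigr => i _; rewrite /= !sumr_const -(mulr_natl (f i ^+ 2 / 2)); field.
  rewrite -big_split /=; apply: eq_bigr => i _; rewrite -big_split /=.
  by apply: eq_bigr => j _; rewrite mulrDl.
apply: ler_sum => i _; apply: ler_sum => j _.
by have := sqr_ge0 (f i - f j); rewrite !expr2; lra.
Qed.

Lemma sqnorm2B (m : nat) (u v : 'cV[R]_m) :
  sqnorm2 (u - v) = sqnorm2 u - 2 * (u^T *m v) 0 0 + sqnorm2 v.
Proof.
rewrite -!bform1 bform_sq_add ?tr_scalar_mx// !bformNr bformNl opprK.
by rewrite /bform !mulmx1; ring.
Qed.

Lemma norm1_ge0 (m : nat) (v : 'cV[R]_m) : 0 <= norm1 v.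
Proof. exact: sumr_ge0. Qed.

Lemma norm1D (m : nat) (u v : 'cV[R]_m) : norm1 (u + v) <= norm1 u + norm1 v.
Proof. by rewrite /norm1 -big_split; apply: ler_sum => i _; rewrite mxE ler_normD. Qed.

Lemma norm1Z (m : nat) c (v : 'cV[R]_m) : norm1 (c *: v) = `|c| * norm1 v.
Proof. by rewrite /norm1 mulr_sumr; apply: eq_bigr => i _; rewrite mxE normrM. Qed.

Lemma norm1_delta (m : nat) (k : 'I_m) : norm1 (delta_mx k 0 : 'cV[R]_m) = 1.
Proof.
rewrite /norm1 (bigD1 k)//= mxE !eqxx normr1 big1 ?addr0// => i /negbTE ik.
by rewrite mxE ik normr0.
Qed.

Section Optimality.
Context (n p : nat) (X : 'M[R]_(n, p)) (y : 'cV[R]_n) (l : R) (b : 'cV[R]_p).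
Hypotheses (l0 : 0 <= l) (lb : is_lasso y X l b).
Let r := y - X *m b.

Lemma lasso_variational (c : 'cV[R]_p) :
  (r^T *m X *m c) 0 0 / n%:R <= l * (norm1 (b + c) - norm1 b).
Proof.
have H t : 0 < t <= 1 -> (r^T *m X *m c) 0 0 / n%:R <=
    t * (sqnorm2 (X *m c) / n%:R / 2) + l * (norm1 (b + c) - norm1 b).
  move=> /andP[t0 t1]; have := lb (b + t *: c); rewrite /lasso_objective.
  have -> : y - X *m (b + t *: c) = r - t *: (X *m c).
    by rewrite mulmxDr -scalemxAr opprD addrA.
  rewrite -/r (sqnorm2B r) => h.
  have e1 : (r^T *m (t *: (X *m c))) 0 0 = t * (r^T *m X *m c) 0 0.
    by rewrite -scalemxAr mxE mulmxA.
  have e2 : sqnorm2 (t *: (X *m c)) = t ^+ 2 * sqnorm2 (X *m c).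
    by rewrite /sqnorm2 mulr_sumr; apply: eq_bigr => i _; rewrite mxE exprMn.
  have e3 : norm1 (b + t *: c) <= (1 - t) * norm1 b + t * norm1 (b + c).
    have -> : b + t *: c = (1 - t) *: b + t *: (b + c).
      by rewrite scalerDr addrA -scalerDl subrK scale1r.
    by apply: le_trans (norm1D _ _) _; rewrite !norm1Z !ger0_norm ?subr_ge0// ltW.
  rewrite -(ler_pM2l t0); move: h; rewrite e1 e2 => h.
  set A := (r^T *m X *m c) 0 0 in h *; set Q := sqnorm2 (X *m c) in h *.
  set nu := n%:R^-1 in h *; set N1 := norm1 (b + t *: c) in h e3 *.
  have := ler_wpM2l l0 e3; lra.
apply/ler_addgt0Pr => e e0.
set Q := sqnorm2 (X *m c) / n%:R / 2 in H.
have Q0 : 0 <= Q by rewrite !divr_ge0// sqnorm2_ge0.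
pose t := Num.min 1 (e / (1 + Q)).
have Q1 : 0 < 1 + Q by lra.
have tp : 0 < t <= 1 by rewrite /t lt_min ltr01 divr_gt0//= ge_min lexx.
apply: le_trans (H t tp) _; rewrite addrC lerD2l.
have : t <= e / (1 + Q) by rewrite /t ge_min lexx orbT.
by rewrite ler_pdivlMr//; case/andP: tp => ? ?; nra.
Qed.

Lemma lasso_dual (k : 'I_p) : `|(r^T *m X) 0 k / n%:R| <= l.
Proof.
have h1 := lasso_variational (delta_mx k 0).
have h2 := lasso_variational (- delta_mx k 0).
have n1 := norm1D b (delta_mx k 0); have n2 := norm1D b (- delta_mx k 0).
have e : norm1 (- delta_mx k 0 : 'cV[R]_p) = 1.
  by rewrite -scaleN1r norm1Z normrN1 norm1_delta mulr1.
rewrite norm1_delta in n1; rewrite e in n2.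
move: h1 h2; rewrite mulmxN -!colE mxE [in X in _ -> X]mxE [in X in _ -> X]mxE.
set q := (r^T *m X) 0 k => h1 h2.
have {}h1 : q / n%:R <= l by apply: le_trans h1 _; rewrite ler_piMr//; lra.
have {}h2 : - q / n%:R <= l by apply: le_trans h2 _; rewrite ler_piMr//; lra.
by rewrite ler_norml; apply/andP; split; lra.
Qed.

Lemma lasso_complementary : (r^T *m X *m b) 0 0 / n%:R = l * norm1 b.
Proof.
have h1 := lasso_variational b; have h2 := lasso_variational (- b).
apply/eqP; rewrite eq_le; apply/andP; split.
  by apply: le_trans h1 _; rewrite -mulr2n -scaler_nat norm1Z normr_nat; nra.
move: h2; rewrite subrr mulmxN [in X in X -> _]mxE /norm1 big1 => [|i _]; last by rewrite mxE normr0.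
by rewrite -/(norm1 b); lra.
Qed.

Lemma lasso_strong_convexity (b' : 'cV[R]_p) :
  lasso_objective y X l b + sqnorm2 (X *m (b' - b)) / n%:R <= lasso_objective y X l b'.
Proof.
have bb : b + (b' - b) = b' by rewrite addrC subrK.
have := lasso_variational (b' - b); rewrite bb /lasso_objective => h.
have -> : y - X *m b' = r - X *m (b' - b).
  by rewrite mulmxBr opprB addrA subrK.
rewrite (sqnorm2B r) mulmxA; lra.
Qed.

End Optimality.

(* The standard cone argument with the compatibility condition in quadratic
   form, which involves no square roots. *)
Lemma lasso_rates (n p : nat) (X : 'M[R]_(n, p)) (y : 'cV[R]_n) (l : R)
    (b b0 : 'cV[R]_p) (m : nat) (kap c : R) :
  let del := b - b0 in
  0 < l -> is_lasso y X l b ->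
  (forall k, `|((y - X *m b0)^T *m X) 0 k / n%:R| <= l / 2) ->
  (#|signals b0| <= m)%N -> 0 < kap -> 0 <= c -> 32 * m%:R * c <= kap ->
  (forall v, kap * sqnorm2 v - c * norm1 v ^+ 2 <= sqnorm2 (X *m v) / n%:R) ->
  [/\ norm1 del <= 12 * m%:R * l / kap,
      sqnorm2 (X *m del) / n%:R <= 9 / 2 * m%:R * l ^+ 2 / kap,
      sqnorm2 del <= 9 * m%:R * l ^+ 2 / kap ^+ 2 &
      forall k, `|(del^T *m X^T *m X) 0 k / n%:R| <= 3 / 2 * l].
Proof.
move=> del l0 lb noise card kap0 c0 small curv.
set e := y - X *m b0 in noise.
have rE : y - X *m b = e - X *m del by rewrite /e /del mulmxBr opprB addrA subrK.
pose A := signals b0; pose a := \sum_(k in A) `|del k 0|.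
pose cc := \sum_(k | k \notin A) `|del k 0|.
have N1 : norm1 del = a + cc by rewrite /norm1 (bigID (mem A)).
have dl : norm1 b0 - norm1 b <= a - cc.
  have dE k : b k 0 = b0 k 0 + del k 0 by rewrite /del !mxE; ring.
  rewrite /norm1 -sumrB (bigID (mem A))/= /a /cc -sumrN; apply: lerD; apply: ler_sum => k.
    by move=> _; rewrite dE; have := ler_normB (b0 k 0 + del k 0) (del k 0); rewrite addrK; lra.
  by rewrite inE negbK dE => /eqP ->; rewrite add0r normr0 sub0r.
have tB : (e - X *m del)^T = e^T - (X *m del)^T.
  by apply/matrixP => i j; rewrite !mxE.
have B00 k (M N : 'rV[R]_k) j : (M - N) 0 j = M 0 j - N 0 j by rewrite !mxE.
set Q := sqnorm2 (X *m del) / n%:R.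
have main : Q <= 3 / 2 * l * a - l / 2 * cc.
  have bb : b + (b0 - b) = b0 by rewrite addrC subrK.
  have := lasso_variational (ltW l0) lb (b0 - b).
  have nb : b0 - b = - del by rewrite opprB.
  have N00 (M : 'M[R]_1) : (- M) 0 0 = - M 0 0 by rewrite mxE.
  rewrite bb nb rE mulmxN N00 mulNr.
  have -> : ((e - X *m del)^T *m X *m del) 0 0 / n%:R = (e^T *m X *m del) 0 0 / n%:R - Q.
    rewrite tB !mulmxBl B00 mulrBl; congr (_ - _).
    by rewrite /Q -(bform1 (X *m del)) /bform mulmx1 mulmxA.
  have : `|(e^T *m X *m del) 0 0 / n%:R| <= l / 2 * norm1 del.
    rewrite mxE mulr_suml (eq_bigr (fun k => del k 0 * ((e^T *m X) 0 k / n%:R))).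
      exact: sum_normM_le.
    by move=> k _; ring.
  rewrite N1 ler_norml => /andP[_ h1] h2.
  have := ler_wpM2l (ltW l0) dl; lra.
have a0 : 0 <= a by exact: sumr_ge0.
have cc0 : 0 <= cc by exact: sumr_ge0.
have Q0 : 0 <= Q by rewrite divr_ge0// sqnorm2_ge0.
have cone : cc <= 3 * a by rewrite -(ler_pM2l l0); lra.
set q := sqnorm2 del; have q0 : 0 <= q by exact: sqnorm2_ge0.
have CS : a ^+ 2 <= m%:R * q.
  apply: le_trans (sqr_sum_le _ _) _.
  have -> : #|(mem A : pred 'I_p)| = #|A| by apply: eq_card.
  apply: (@le_trans _ _ (m%:R * \sum_(k in A) `|del k 0| ^+ 2)).
    by apply: ler_wpM2r; [apply: sumr_ge0 => k _; exact: sqr_ge0|rewrite ler_nat].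
  apply: ler_wpM2l => //; rewrite /q /sqnorm2 [leRHS](bigID (mem A))/=.
  rewrite (eq_bigr (fun k => del k 0 ^+ 2)); last by move=> k _; rewrite real_normK ?num_real.
  by rewrite lerDl; apply: sumr_ge0 => k _; exact: sqr_ge0.
have N2 : norm1 del ^+ 2 <= 16 * (m%:R * q).
  apply: (@le_trans _ _ (16 * a ^+ 2)); last by rewrite ler_pM2l.
  have -> : 16 * a ^+ 2 = (4 * a) ^+ 2 by ring.
  by rewrite lerXn2r ?nnegrE ?norm1_ge0 ?mulr_ge0// N1; lra.
have m0 : 0 <= m%:R :> R by [].
have low : kap / 2 * q <= Q.
  have := curv del; rewrite -/q -/Q.
  have := ler_wpM2l c0 N2; have := ler_wpM2r q0 small; lra.
have Qa : Q <= 3 / 2 * l * a.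
  have : 0 <= l / 2 * cc by rewrite mulr_ge0// divr_ge0// ltW.
  lra.
have qa : kap * q <= 3 * l * a by lra.
have ale : a <= 3 * m%:R * l / kap.
  rewrite ler_pdivlMr//; have [->|an0] := eqVneq a 0; first by rewrite mul0r !mulr_ge0// ltW.
  have ap : 0 < a by rewrite lt_neqAle eq_sym an0.
  rewrite -(ler_pM2l ap).
  have := ler_wpM2l m0 qa; have := ler_wpM2l (ltW kap0) CS.
  by rewrite expr2; lra.
split.
- have -> : 12 * m%:R * l / kap = 4 * (3 * m%:R * l / kap) by ring.
  rewrite N1; lra.
- apply: le_trans Qa _; have := ler_wpM2l (ltW l0) ale.
  have -> : 9 / 2 * m%:R * l ^+ 2 / kap = 3 / 2 * (l * (3 * m%:R * l / kap)) by ring.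
  lra.
- have -> : 9 * m%:R * l ^+ 2 / kap ^+ 2 = (3 * l * (3 * m%:R * l / kap)) / kap.
    by field; rewrite gt_eqF.
  rewrite ler_pdivlMr// mulrC; apply: le_trans qa _.
  by apply: ler_wpM2l ale; rewrite mulr_ge0// ltW.
- move=> k; have := lasso_dual (ltW l0) lb k; have := noise k; rewrite rE.
  have -> : ((e - X *m del)^T *m X) 0 k / n%:R = (e^T *m X) 0 k / n%:R - (del^T *m X^T *m X) 0 k / n%:R.
    by rewrite tB trmx_mul mulmxBl B00 mulrBl.
  by rewrite !ler_norml => /andP[? ?] /andP[? ?]; apply/andP; split; lra.
Qed.

End Lasso.

Section NodewiseVector.
Context (R : realType).

Lemma sum_lift (p : nat) (j : 'I_p) (F : 'I_p -> R) :
  \sum_k F k = F j + \sum_(k < p.-1) F (lift j k).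
Proof. by case: p j F => [[]//|p] j F; rewrite (bigD1_ord j). Qed.

Definition nodewise_vec (p : nat) (j : 'I_p) (g : 'cV[R]_p.-1) : 'cV[R]_p :=
  \col_k match unlift j k with None => 1 | Some k' => - g k' 0 end.

Context (n p : nat) (X : 'M[R]_(n, p)) (j : 'I_p).
Implicit Types g : 'cV[R]_p.-1.

Lemma nodewise_vec_self g : nodewise_vec j g j 0 = 1.
Proof. by rewrite mxE unlift_none. Qed.

Lemma nodewise_vec_lift g k : nodewise_vec j g (lift j k) 0 = - g k 0.
Proof. by rewrite mxE liftK. Qed.

Lemma mul_nodewise_vec g : X *m nodewise_vec j g = col j X - col' j X *m g.
Proof.
apply/colP => i; rewrite mxE (sum_lift j) nodewise_vec_self mulr1 mxE; congr (_ + _).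
  by rewrite mxE.
rewrite 2!mxE -sumrN; apply: eq_bigr => k _; rewrite nodewise_vec_lift mxE; ring.
Qed.

Lemma norm1_nodewise_vec g : norm1 (nodewise_vec j g) = 1 + norm1 g.
Proof.
rewrite /norm1 (sum_lift j) nodewise_vec_self normr1; congr (_ + _).
by apply: eq_bigr => k _; rewrite nodewise_vec_lift normrN.
Qed.

Definition embed_coef g : 'cV[R]_p :=
  \col_k match unlift j k with None => 0 | Some k' => g k' 0 end.

Lemma embed_coef_self g : embed_coef g j 0 = 0.
Proof. by rewrite mxE unlift_none. Qed.

Lemma embed_coef_lift g k : embed_coef g (lift j k) 0 = g k 0.
Proof. by rewrite mxE liftK. Qed.

Lemma norm1_embed_coef g : norm1 (embed_coef g) = norm1 g.
Proof.
rewrite /norm1 (sum_lift j) embed_coef_self normr0 add0r.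
by apply: eq_bigr => k _; rewrite embed_coef_lift.
Qed.

Lemma sqnorm2_embed_coef g : sqnorm2 (embed_coef g) = sqnorm2 g.
Proof.
rewrite /sqnorm2 (sum_lift j) embed_coef_self expr0n add0r.
by apply: eq_bigr => k _; rewrite embed_coef_lift.
Qed.

Lemma mul_embed_coef g : X *m embed_coef g = col' j X *m g.
Proof.
apply/colP => i; rewrite !mxE (sum_lift j) embed_coef_self mulr0 add0r.
by apply: eq_bigr => k _; rewrite embed_coef_lift mxE.
Qed.

Lemma nodewise_vec_embed g g' : nodewise_vec j g = nodewise_vec j g' - embed_coef (g - g').
Proof.
apply/colP => k; rewrite [RHS]mxE [X in _ + X]mxE.
case: (unliftP j k) => [k' ->|->]; last by rewrite !nodewise_vec_self embed_coef_self subr0.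
by rewrite !nodewise_vec_lift embed_coef_lift !mxE; ring.
Qed.

End NodewiseVector.

Section Population.
Context (R : realType) (p : nat) (S : 'M[R]_p) (c : R).
Hypotheses (c0 : 0 < c) (sS : S^T = S) (Sc : forall v, c * sqnorm2 v <= bform S v v).
Hypothesis S1 : forall j, S j j <= 1.
Let Th := invmx S.

Let sqnorm2_eq0 (v : 'cV[R]_p) : sqnorm2 v = 0 -> v = 0.
Proof.
move=> v0; apply/colP => i; rewrite mxE; apply/eqP.
by rewrite -sqrf_eq0 eq_le sqr_ge0 andbT -v0 coord_sqnorm2.
Qed.

Lemma pd_unitmx : S \in unitmx.
Proof.
rewrite unitmxE unitfE; apply/negP => /det0P[u u0 uS]; move/negP: u0; apply.
have := Sc u^T; rewrite /bform trmxK uS mul0mx mxE => h.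
rewrite -[u]trmxK; apply/eqP; rewrite [u^T]sqnorm2_eq0 ?trmx0//.
by apply/eqP; rewrite eq_le sqnorm2_ge0 andbT -(ler_pM2l c0) mulr0.
Qed.

Let bform_col_inv j v : bform S (col j Th) v = v j 0.
Proof.
rewrite bformC// /bform -mulmxA colE (mulmxA S) mulmxV ?pd_unitmx// mul1mx.
by rewrite -colE !mxE.
Qed.

Lemma invmx_diag_gt0 j : 0 < Th j j.
Proof.
have := Sc (col j Th); rewrite bform_col_inv [in X in _ <= X -> _]mxE.
apply: lt_le_trans; rewrite mulr_gt0// lt_neqAle sqnorm2_ge0 andbT eq_sym.
apply/eqP => /sqnorm2_eq0 h; have := bform_col_inv j (delta_mx j 0).
by rewrite h bform0l mxE !eqxx => /eqP; rewrite eq_sym oner_eq0.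
Qed.

(* [X *m pop_vec j] is the population residual of the regression of column [j]
   on the other columns. *)
Definition pop_vec j : 'cV[R]_p := (invmx S j j)^-1 *: col j (invmx S).

Lemma pop_vec_bform j v : bform S (pop_vec j) v = (Th j j)^-1 * v j 0.
Proof. by rewrite /pop_vec bformZl bform_col_inv. Qed.

Lemma pop_vec_self j : pop_vec j j 0 = 1.
Proof. by rewrite !mxE mulVf// gt_eqF// invmx_diag_gt0. Qed.

Lemma pop_vec_sqnorm j : bform S (pop_vec j) (pop_vec j) = (Th j j)^-1.
Proof. by rewrite pop_vec_bform pop_vec_self mulr1. Qed.

Lemma invmx_diag_inv_le1 j : 0 < (Th j j)^-1 <= 1.
Proof.
rewrite invr_gt0 invmx_diag_gt0/=.
have := Sc (pop_vec j - delta_mx j 0).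
rewrite bform_sq_add// bformNr bformNl bformNr pop_vec_sqnorm pop_vec_bform mxE !eqxx opprK /= mulr1.
rewrite bform_delta -colE mxE => h.
have : 0 <= c * sqnorm2 (pop_vec j - delta_mx j 0) by rewrite mulr_ge0 ?sqnorm2_ge0// ltW.
have := S1 j; lra.
Qed.

Lemma bform_delta_le1 j : bform S (delta_mx j 0) (delta_mx j 0) <= 1.
Proof. by rewrite bform_delta -colE mxE. Qed.

Lemma pop_vec_sqnorm2 j : sqnorm2 (pop_vec j) <= c^-1.
Proof.
rewrite -(ler_pM2l c0) mulfV ?gt_eqF//; apply: le_trans (Sc _) _.
by rewrite pop_vec_sqnorm; case/andP: (invmx_diag_inv_le1 j).
Qed.

Definition pop_coef j : 'cV[R]_p.-1 := \col_k - pop_vec j (lift j k) 0.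

Lemma nodewise_pop j : nodewise_vec j (pop_coef j) = pop_vec j.
Proof.
apply/colP => k; case: (unliftP j k) => [k' ->|->]; last first.
  by rewrite nodewise_vec_self pop_vec_self.
by rewrite nodewise_vec_lift mxE opprK.
Qed.

Lemma pop_coef_sparse j : (#|signals (pop_coef j)| <= s_max S)%N.
Proof.
apply: leq_trans (leq_bigmax j); rewrite /row_sparsity -(card_imset _ (@lift_inj p j)).
apply: subset_leq_card; apply/fintype.subsetP => k /imsetP[k' + ->]; rewrite !inE.
rewrite mxE oppr_eq0 !mxE mulf_eq0 negb_or => /andP[_ h].
rewrite /= eq_sym neq_lift/=; apply: contra h => /eqP h.
have sT : (invmx S)^T = invmx S by rewrite trmx_inv sS.
by rewrite -[invmx S]sT mxE h.
Qed.

End Population.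

Section Design.
Context (R : realType) (n p : nat) (X : 'M[R]_(n, p)) (S : 'M[R]_p) (c : R).
Hypotheses (n0 : (0 < n)%N) (c0 : 0 < c) (c1 : c <= 1).
Hypotheses (sS : S^T = S) (Sc : forall v, c * sqnorm2 v <= bform S v v).
Hypothesis S1 : forall j, S j j <= 1.
Let Sh := Sigma_hat X.
Let M := Sh - S.

Definition design_atom (S : 'M[R]_p) (i : 'I_p + 'I_p) : 'cV[R]_p :=
  match i with inl k => delta_mx k 0 | inr j => pop_vec S j end.

Local Notation bounded := (atom_sums_bounded (design_atom S) S M).

Lemma design_atom_le1 i : bform S (design_atom S i) (design_atom S i) <= 1.
Proof.
case: i => j /=; first exact: bform_delta_le1.
by rewrite (pop_vec_sqnorm c0)//; case/andP: (invmx_diag_inv_le1 c0 sS Sc S1 j).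
Qed.

Lemma Sigma_hat_sym : Sh^T = Sh.
Proof. by rewrite /Sh /Sigma_hat linearZ /= trmx_mul trmxK. Qed.

Let sM : M^T = M.
Proof. by rewrite /M linearB /= sS Sigma_hat_sym. Qed.

Lemma bform_Sigma_hat u v : bform Sh u v = ((X *m u)^T *m (X *m v)) 0 0 / n%:R.
Proof. by rewrite /Sh /Sigma_hat bformZm mulrC /bform trmx_mul !mulmxA. Qed.

Lemma bform_Sigma_hat_sq u : bform Sh u u = sqnorm2 (X *m u) / n%:R.
Proof. by rewrite bform_Sigma_hat -bform1 /bform mulmx1. Qed.

Lemma bform_Sigma_hat_delta u k : bform Sh u (delta_mx k 0) = ((X *m u)^T *m X) 0 k / n%:R.
Proof. by rewrite bform_Sigma_hat mulmxA -colE mxE. Qed.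

Let ShE u v : bform Sh u v = bform S u v + bform M u v.
Proof. by rewrite /M bformBm addrC subrK. Qed.

Let sumE (f : 'I_p + 'I_p -> 'cV[R]_p) :
  \sum_i f i = \sum_k f (inl k) + \sum_j f (inr j).
Proof. by rewrite big_sumType. Qed.

Let sumER (f : 'I_p + 'I_p -> R) : \sum_i f i = \sum_k f (inl k) + \sum_j f (inr j).
Proof. by rewrite big_sumType. Qed.

Let cV_sum_delta (v : 'cV[R]_p) : v = \sum_k v k 0 *: delta_mx k 0.
Proof.
apply/colP => i; rewrite summxE (bigD1 i)//= big1 => [|k /negbTE ki]; last first.
  by rewrite !mxE eq_sym ki mulr0.
by rewrite !mxE !eqxx mulr1 addr0.
Qed.

Lemma design_norm_bound (m : nat) (x L : R) (v h : 'cV[R]_p) (a : 'I_p -> R) :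
  (1 < m)%N -> 0 <= x -> bounded m x -> norm1 v + \sum_j `|a j| <= L ->
  h = v + \sum_j a j *: pop_vec S j ->
  `|bform M h h| <= x * (bform S h h + 2 * L ^+ 2 / (m%:R - 1)).
Proof.
move=> m1 x0 H hL hE.
apply: (@maurey_norm_bound _ _ _ (design_atom S) S M sS sM design_atom_le1 m x L
  (fun i => match i with inl k => v k 0 | inr j => a j end)) => //.
  by rewrite sumE /= -cV_sum_delta.
by rewrite sumER.
Qed.

Lemma design_curvature (m : nat) (x : R) v : (1 < m)%N -> 0 <= x <= 1 / 2 -> bounded m x ->
  let e := 2 * x / (m%:R - 1) * norm1 v ^+ 2 in
  c / 2 * sqnorm2 v - e <= sqnorm2 (X *m v) / n%:R /\
  bform S v v <= 2 * (sqnorm2 (X *m v) / n%:R + e).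
Proof.
move=> m1 /andP[x0 x1] H e.
have := @design_norm_bound m x (norm1 v) v v (fun=> 0) m1 x0 H.
rewrite big1 => [|i _]; last by rewrite normr0.
rewrite addr0 => /(_ (lexx _)); rewrite big1 => [|i _]; last by rewrite scale0r.
rewrite addr0 => /(_ erefl); rewrite -bform_Sigma_hat_sq ShE ler_norml => /andP[h _].
have eE : x * (2 * norm1 v ^+ 2 / (m%:R - 1)) = e by rewrite /e; ring.
rewrite mulrDr eE in h.
have s0 : 0 <= bform S v v by apply: le_trans (Sc v); rewrite mulr_ge0 ?sqnorm2_ge0// ltW.
have xs : x * bform S v v <= 1 / 2 * bform S v v by exact: ler_wpM2r.
have := Sc v; split; lra.
Qed.

Lemma design_cross_bound (x : R) i j : 0 <= x -> bounded 2 x ->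
  `|bform M (design_atom S i) (design_atom S j)| <= x.
Proof. by move=> x0; exact: (atom_sums_pair sS sM design_atom_le1). Qed.

Lemma design_entry_le2 (x : R) j k : 0 <= x <= 1 -> bounded 2 x ->
  `|bform Sh (delta_mx j 0) (delta_mx k 0)| <= 2.
Proof.
move=> /andP[x0 x1] H; rewrite ShE; apply: le_trans (ler_normD _ _) _.
have := @design_cross_bound x (inl j) (inl k) x0 H => /= h.
have : `|bform S (delta_mx j 0) (delta_mx k 0)| <= 1.
  have hp := Sc (delta_mx j 0 + delta_mx k 0); have hm := Sc (delta_mx j 0 - delta_mx k 0).
  have := bform_delta_le1 S1 j; have := bform_delta_le1 S1 k.
  have pp : 0 <= c * sqnorm2 (delta_mx j 0 + delta_mx k 0 : 'cV[R]_p) by rewrite mulr_ge0 ?sqnorm2_ge0// ltW.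
  have pm : 0 <= c * sqnorm2 (delta_mx j 0 - delta_mx k 0 : 'cV[R]_p) by rewrite mulr_ge0 ?sqnorm2_ge0// ltW.
  move: (le_trans pp hp) (le_trans pm hm).
  rewrite !bform_sq_add// !bformNr bformNl opprK => ? ? ? ?.
  by rewrite ler_norml; apply/andP; split; lra.
lra.
Qed.

Section Nodewise.
Variables (m : nat) (x2 x l : R).
Hypotheses (m0 : (0 < m)%N) (sm : (s_max S < m)%N).
Hypotheses (x20 : 0 <= x2 <= 1) (H2 : bounded 2 x2) (l2 : 2 * x2 <= l) (l0 : 0 < l).
Hypotheses (x0 : 0 <= x) (xc : x <= (c / 100) ^+ 2) (Hm : bounded m.+1 x).
Hypothesis ml : m%:R * l ^+ 2 <= c.

Let x12 : 0 <= x <= 1 / 2.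
Proof.
rewrite x0/=; apply: le_trans xc _.
by move: c0 c1 => ? ?; rewrite expr2; nra.
Qed.


Lemma nodewise_rates (j : 'I_p) (g : 'cV[R]_p.-1) :
  is_lasso (col j X) (col' j X) l g ->
  let u := nodewise_vec j g in
  [/\ exists2 del : 'cV[R]_p, u = pop_vec S j - del &
        del j 0 = 0 /\ norm1 del <= 24 * m%:R * l / c,
      norm1 u ^+ 2 <= 1154 * m%:R / c,
      sqnorm2 u <= 74 / c &
      c / 4 <= sqnorm2 (X *m u) / n%:R].
Proof.
move=> lg u; pose g0 := pop_coef S j.
have pE : nodewise_vec j g0 = pop_vec S j by exact: (nodewise_pop c0 sS Sc).
have c2 : 0 < c / 2 by rewrite divr_gt0.
have mp : 0 < m%:R :> R by rewrite ltr0n.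
have m1E : m.+1%:R - 1 = m%:R :> R by rewrite -natr1 addrK.
pose cc := 2 * x / m%:R.
have cc0 : 0 <= cc by rewrite /cc divr_ge0// ?mulr_ge0// ltW.
have xcc : x <= c / 128.
  apply: (le_trans xc); rewrite expr2.
  by move: c0 c1 => ? ?; nra.
have := @lasso_rates R n p.-1 (col' j X) (col j X) l g g0 m (c / 2) cc l0 lg.
rewrite /=; case => //.
- move=> k; rewrite -(mul_nodewise_vec X j g0) pE.
  have -> : ((X *m pop_vec S j)^T *m col' j X) 0 k = ((X *m pop_vec S j)^T *m X) 0 (lift j k).
    by rewrite !mxE; apply: eq_bigr => i _; rewrite !mxE.
  rewrite -bform_Sigma_hat_delta ShE (pop_vec_bform c0 sS Sc) mxE.
  rewrite (negbTE (neq_lift j k)) /= mulr0 add0r.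
  case/andP: x20 => x20' _; have := @design_cross_bound x2 (inr j) (inl (lift j k)) x20' H2.
  by move=> h; apply: (le_trans h); move: l2; lra.
- by apply: leq_trans (pop_coef_sparse sS j) _; rewrite ltnW.
- rewrite (_ : 32 * m%:R * cc = 64 * x); last by rewrite /cc; field; rewrite gt_eqF.
  lra.
- move=> v; have [h _] := @design_curvature m.+1 x (embed_coef j v) m0 x12 Hm.
  by move: h; rewrite sqnorm2_embed_coef norm1_embed_coef mul_embed_coef m1E.
set del := g - g0 => r1 r2 r3 _.
have uE : u = pop_vec S j - embed_coef j del by rewrite /u (nodewise_vec_embed j g g0) pE.
have {}r1 : norm1 (embed_coef j del) <= 24 * m%:R * l / c.
  rewrite norm1_embed_coef; apply: le_trans r1 _.
  by rewrite le_eqVlt; apply/orP; left; apply/eqP; field; rewrite gt_eqF.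
have {}r3 : sqnorm2 (embed_coef j del) <= 36 * m%:R * l ^+ 2 / c ^+ 2.
  rewrite sqnorm2_embed_coef; apply: le_trans r3 _.
  by rewrite le_eqVlt; apply/orP; left; apply/eqP; field; rewrite gt_eqF.
have p2 := pop_vec_sqnorm2 c0 sS Sc S1 j.
have p1 : norm1 (pop_vec S j) ^+ 2 <= m%:R / c.
  have -> : norm1 (pop_vec S j) = \sum_(k | pop_vec S j k 0 != 0) `|pop_vec S j k 0|.
    rewrite /norm1 (bigID (fun k => pop_vec S j k 0 != 0))/= [X in _ + X]big1 ?addr0//.
    by move=> k /negPn/eqP ->; rewrite normr0.
  apply: le_trans (sqr_sum_le _ _) _.
  apply: ler_pM => //; first by apply: sumr_ge0 => k _; exact: sqr_ge0.
    rewrite ler_nat; apply: (@leq_trans (#|signals g0|.+1)); last first.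
      by apply: leq_trans sm; rewrite ltnS; exact: pop_coef_sparse.
    rewrite -(card_imset _ (@lift_inj p j)).
    apply: (@leq_trans #|(j |: (lift j) @: signals g0)%SET|).
      apply: subset_leq_card; apply/fintype.subsetP => k kP; rewrite !inE.
      move: kP; rewrite unfold_in; case: (unliftP j k) => [k' ->|->]; last by rewrite eqxx.
      rewrite -pE nodewise_vec_lift oppr_eq0 => h; apply/orP; right.
      by apply/imsetP; exists k' => //; rewrite inE.
    by rewrite cardsU1; case: (_ \notin _); rewrite ?add1n ?add0n.
  apply: le_trans p2; rewrite /sqnorm2 [leRHS](bigID (fun k => pop_vec S j k 0 != 0))/=.
  rewrite (eq_bigr (fun k => pop_vec S j k 0 ^+ 2)) ?lerDl; last by move=> k _; rewrite real_normK ?num_real.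
  by apply: sumr_ge0 => k _; exact: sqr_ge0.
have nu : norm1 u ^+ 2 <= 1154 * m%:R / c.
  have h1 : norm1 u <= norm1 (pop_vec S j) + norm1 (embed_coef j del).
    rewrite uE; apply: le_trans (norm1D _ _) _; rewrite lerD2l -scaleN1r norm1Z normrN1 mul1r.
    exact: lexx.
  have h2 : norm1 u ^+ 2 <= 2 * norm1 (pop_vec S j) ^+ 2 + 2 * norm1 (embed_coef j del) ^+ 2.
    have := norm1_ge0 u; set a := norm1 (pop_vec S j) in h1 *; set b := norm1 (embed_coef j del) in h1 *.
    move=> u0; apply: (@le_trans _ _ ((a + b) ^+ 2)).
      by rewrite lerXn2r ?nnegrE ?addr_ge0 ?norm1_ge0.
    by have := sqr_ge0 (a - b); rewrite !expr2; lra.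
  have h3 : norm1 (embed_coef j del) ^+ 2 <= 576 * (m%:R / c).
    apply: (@le_trans _ _ ((24 * m%:R * l / c) ^+ 2)).
      by rewrite lerXn2r ?nnegrE ?norm1_ge0// !divr_ge0 ?mulr_ge0// ltW.
    have -> : (24 * m%:R * l / c) ^+ 2 = 576 * (m%:R / c) * (m%:R * l ^+ 2 / c).
      by field; rewrite gt_eqF.
    apply: ler_piMr; first by apply: mulr_ge0; [exact: ler0n|exact: divr_ge0 (ltW mp) (ltW c0)].
    by rewrite ler_pdivrMr// mul1r.
  apply: le_trans h2 _; have -> : 1154 * m%:R / c = 1154 * (m%:R / c) by ring.
  lra.
have su : sqnorm2 u <= 74 / c.
  have h3 : sqnorm2 (embed_coef j del) <= 36 / c.
    apply: le_trans r3 _; have -> : 36 * m%:R * l ^+ 2 / c ^+ 2 = 36 / c * (m%:R * l ^+ 2 / c).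
      by field; rewrite gt_eqF.
    by rewrite ler_piMr ?divr_ge0 ?(ltW c0)// ler_pdivrMr// mul1r.
  have h4 : sqnorm2 u <= 2 * sqnorm2 (pop_vec S j) + 2 * sqnorm2 (embed_coef j del).
    rewrite uE /sqnorm2 !mulr_sumr -big_split; apply: ler_sum => k _ /=; rewrite [in leLHS]mxE [X in (_ + X) ^+ 2]mxE.
    set a := pop_vec S j k 0; set b := embed_coef j del k 0.
    by have := sqr_ge0 (a + b); rewrite !expr2; lra.
  have -> : 74 / c = 2 * c^-1 + 2 * (36 / c) by field; rewrite gt_eqF.
  lra.
split => //.
  by exists (embed_coef j del) => //; rewrite embed_coef_self.
have [h _] := @design_curvature m.+1 x u m0 x12 Hm; apply: le_trans h; rewrite m1E.
have u1 : 1 <= sqnorm2 u by have := coord_sqnorm2 u j; rewrite nodewise_vec_self expr1n.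
have : 2 * x / m%:R * norm1 u ^+ 2 <= 2308 * (x / c).
  have -> : 2308 * (x / c) = 2 * x / m%:R * (1154 * m%:R / c).
    by field; rewrite !gt_eqF.
  by apply: ler_wpM2l => //; exact: cc0.
have : x / c <= c / 100 / 100.
  rewrite ler_pdivrMr//; apply: le_trans xc _.
  by rewrite le_eqVlt; apply/orP; left; apply/eqP; field.
have : c / 2 * 1 <= c / 2 * sqnorm2 u by apply: ler_wpM2l => //; exact: ltW.
lra.
Qed.

Lemma nodewise_score (j : 'I_p) (g : 'cV[R]_p.-1) :
  is_lasso (col j X) (col' j X) l g ->
  let u := nodewise_vec j g in
  [/\ forall k, k != j -> `|bform Sh u (delta_mx k 0)| <= l,
      bform Sh u (delta_mx j 0) = sqnorm2 (X *m u) / n%:R + l * norm1 g &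
      0 <= bform Sh u (delta_mx j 0) <= 2].
Proof.
move=> lg u; have lw := ltW l0.
have XuE : X *m u = col j X - col' j X *m g by exact: mul_nodewise_vec.
have qjj : bform Sh u (delta_mx j 0) = sqnorm2 (X *m u) / n%:R + l * norm1 g.
  have -> : delta_mx j 0 = u + embed_coef j g.
    apply/colP => k; rewrite [LHS]mxE eqxx andbT [RHS]mxE; case: (unliftP j k) => [k' ->|->].
      by rewrite nodewise_vec_lift embed_coef_lift eq_sym (negbTE (neq_lift j k')) addNr.
    by rewrite nodewise_vec_self embed_coef_self eqxx addr0.
  rewrite bformDr bform_Sigma_hat_sq; congr (_ + _).
  by rewrite bform_Sigma_hat mul_embed_coef XuE mulmxA (lasso_complementary lw lg).
split => //.
  move=> k kj; rewrite bform_Sigma_hat_delta; case: (unliftP j k) kj => [k' -> _|->]; last by rewrite eqxx.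
  have := lasso_dual lw lg k'; rewrite -XuE.
  have -> : ((X *m u)^T *m col' j X) 0 k' = ((X *m u)^T *m X) 0 (lift j k').
    by rewrite !mxE; apply: eq_bigr => i _; rewrite !mxE.
  by [].
rewrite qjj; apply/andP; split.
  by rewrite addr_ge0 ?divr_ge0 ?mulr_ge0 ?norm1_ge0 ?sqnorm2_ge0.
have := lg 0; rewrite /lasso_objective -XuE mulmx0 subr0.
have -> : norm1 (0 : 'cV[R]_p.-1) = 0 by rewrite /norm1 big1// => i _; rewrite mxE normr0.
have -> : sqnorm2 (col j X) / n%:R = bform Sh (delta_mx j 0) (delta_mx j 0).
  by rewrite bform_Sigma_hat_sq colE.
have := design_entry_le2 j j x20 H2; rewrite ler_norml => /andP[_].
have : 0 <= l * norm1 g by rewrite mulr_ge0 ?norm1_ge0.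
lra.
Qed.

Lemma nodewise_cross_sum (g : 'I_p -> 'cV[R]_p.-1) :
  (forall j, is_lasso (col j X) (col' j X) l (g j)) ->
  \sum_j \sum_(k | k != j)
      bform Sh (nodewise_vec j (g j)) (nodewise_vec k (g k)) ^+ 2 <=
    592 * p%:R / c + 2308 * p%:R ^+ 2 * m%:R * l ^+ 2 / c.
Proof.
move=> lg; pose u j := nodewise_vec j (g j).
change (\sum_j \sum_(k | k != j) bform Sh (u j) (u k) ^+ 2 <=
    592 * p%:R / c + 2308 * p%:R ^+ 2 * m%:R * l ^+ 2 / c).
rewrite (exchange_big_dep xpredT) //=.
have B j k : j != k -> bform Sh (u j) (u k) ^+ 2 <= 8 * u k j 0 ^+ 2 + 2 * l ^+ 2 * norm1 (u k) ^+ 2.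
  move=> jk; have [q1 _ q2] := nodewise_score (lg j); rewrite -/(u j) in q1 q2.
  have -> : bform Sh (u j) (u k) = u k j 0 * bform Sh (u j) (delta_mx j 0) +
      \sum_(i | i != j) u k i 0 * bform Sh (u j) (delta_mx i 0).
    by rewrite {1}(cV_sum_delta (u k)) bform_sumr (bigD1 j)//= bformZr; congr (_ + _); apply: eq_bigr => i _; rewrite bformZr.
  set a := u k j 0 * _; set b := \sum_(i | _) _.
  have ha : `|a| <= 2 * `|u k j 0|.
    by rewrite normrM mulrC; apply: ler_wpM2r => //; case/andP: q2 => q20 q22; rewrite ger0_norm.
  have hb : `|b| <= l * norm1 (u k).
    apply: le_trans (ler_norm_sum _ _ _) _; rewrite /norm1 [in leRHS](bigID (fun i => i != j))/= mulrDr.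
    rewrite ler_wpDr ?mulr_ge0 ?sumr_ge0//; first exact: ltW.
    rewrite mulr_sumr; apply: ler_sum => i ij; rewrite normrM mulrC; apply: ler_wpM2r => //.
    exact: q1.
  have a2 : a ^+ 2 <= 4 * u k j 0 ^+ 2.
    rewrite -(real_normK (num_real a)) -(real_normK (num_real (u k j 0))).
    have -> : 4 * `|u k j 0| ^+ 2 = (2 * `|u k j 0|) ^+ 2 by ring.
    by rewrite lerXn2r ?nnegrE ?mulr_ge0.
  have b2 : b ^+ 2 <= l ^+ 2 * norm1 (u k) ^+ 2.
    rewrite -(real_normK (num_real b)) -exprMn.
    by rewrite lerXn2r ?nnegrE ?mulr_ge0 ?norm1_ge0// ltW.
  by have := sqr_ge0 (a - b); rewrite !expr2 in a2 b2 *; lra.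
apply: (@le_trans _ _ (\sum_(k < p) (592 / c + 2308 * p%:R * m%:R * l ^+ 2 / c))); last first.
  rewrite sumr_const card_ord -(mulr_natl (_ + _)) le_eqVlt; apply/orP; left; apply/eqP.
  by field; rewrite gt_eqF.
apply: ler_sum => k _; have [_ nu su _] := nodewise_rates (lg k); rewrite -/(u k) in nu su.
apply: (@le_trans _ _ (\sum_j (8 * u k j 0 ^+ 2 + 2 * l ^+ 2 * norm1 (u k) ^+ 2))).
  rewrite [leRHS](bigID (fun j => k != j))/= ler_wpDr//.
    apply: sumr_ge0 => j _; move: (u k j 0) => q; move: (norm1 (u k)) => q'.
    have := sqr_ge0 q; have := sqr_ge0 (l * q'); rewrite exprMn; lra.
  by apply: ler_sum => j kj; apply: B; rewrite eq_sym.
rewrite big_split -mulr_sumr -/(sqnorm2 (u k)) sumr_const card_ord /= -(mulr_natl (_ * _)).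
apply: lerD; first by rewrite (_ : 592 / c = 8 * (74 / c)); [apply: ler_wpM2l|field; rewrite gt_eqF].
have -> : 2308 * p%:R * m%:R * l ^+ 2 / c = p%:R * (2 * l ^+ 2 * (1154 * m%:R / c)).
  by field; rewrite gt_eqF.
by apply: ler_wpM2l => //; apply: ler_wpM2l => //; rewrite mulr_ge0// sqr_ge0.
Qed.

End Nodewise.
End Design.

Section DebiasedDecomposition.
Context (R : realType) (n p : nat) (X : 'M[R]_(n, p)).

Lemma zstat_decomposition (beta bhat : 'cV[R]_p) (eps : 'cV[R]_n) (l sigma : R)
    (g : 'I_p -> 'cV[R]_p.-1) (j : 'I_p) :
  let u := nodewise_vec j (g j) in
  let h := bhat - beta in
  let r := sqnorm2 (X *m u) in
  (0 < n)%N -> 0 < sigma -> 0 <= l -> 0 < r -> beta j 0 = 0 ->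
  is_lasso (col j X) (col' j X) l (g j) ->
  zstat X (X *m beta + eps) bhat l g sigma j =
    ((X *m u)^T *m eps) 0 0 / (sigma * Num.sqrt r)
    + Num.sqrt n%:R / (sigma * Num.sqrt (r / n%:R)) *
      (l * norm1 (g j) * h j 0
       - (bform (Sigma_hat X) u h - bform (Sigma_hat X) u (delta_mx j 0) * h j 0)).
Proof.
move=> u h r n0 s0 l0 r0 bj lg.
have nR : 0 < n%:R :> R by rewrite ltr0n.
have XuE : X *m u = col j X - col' j X *m g j by exact: mul_nodewise_vec.
pose t := tau2 X l g j.
have tE : t = r / n%:R + 2 * l * norm1 (g j).
  by rewrite /t /tau2 /lasso_objective -XuE.
have t0 : 0 < t by rewrite tE ltr_pwDl ?divr_gt0// !mulr_ge0 ?norm1_ge0.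
have rowE : row j (Theta_hat X l g) = t^-1 *: u^T.
  apply/rowP => k; rewrite !mxE; case: (unlift j k) => [k'|]; last by rewrite mulr1.
  by rewrite mulNr mulrN.
have rowT (q : 'cV[R]_p) : (Theta_hat X l g *m q) j 0 = t^-1 * (u^T *m q) 0 0.
  transitivity ((row j (Theta_hat X l g) *m q) 0 0); first by rewrite -row_mul [RHS]mxE.
  by rewrite rowE -scalemxAl mxE.
have OE : Omega_hat X l g j j = t^-1 ^+ 2 * (r / n%:R).
  transitivity ((row j (Theta_hat X l g) *m Sigma_hat X *m (row j (Theta_hat X l g))^T) 0 0).
    rewrite /Omega_hat -row_mul tr_row !mxE; apply: eq_bigr => i _; congr (_ * _).
      by rewrite [RHS]mxE.
    by rewrite [RHS]mxE.
  have -> : (row j (Theta_hat X l g))^T = t^-1 *: u.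
    by rewrite rowE linearZ /= trmxK.
  rewrite rowE -scalemxAl -scalemxAl -scalemxAr [LHS]mxE [X in _ * X]mxE -/(bform _ _ _).
  by rewrite bform_Sigma_hat_sq -/r; ring.
have sO : Num.sqrt (Omega_hat X l g j j) = t^-1 * Num.sqrt (r / n%:R).
  rewrite OE sqrtrM ?sqr_ge0// sqrtr_sqr ger0_norm// invr_ge0 ltW//.
have dE : debiased X (X *m beta + eps) bhat l g j 0 =
    h j 0 + t^-1 * (((X *m u)^T *m eps) 0 0 / n%:R - bform (Sigma_hat X) u h).
  rewrite /debiased [LHS]mxE; congr (_ + _); first by rewrite /h !mxE bj subr0.
  rewrite [LHS]mxE -mulmxA rowT mulrCA; congr (_ * _).
  have -> : X *m beta + eps - X *m bhat = eps - X *m h.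
    by rewrite /h mulmxBr opprB addrCA addrA.
  rewrite bform_Sigma_hat mulmxA -trmx_mul mulmxBr.
  rewrite [in LHS]mxE [X in _ * (_ + X)]mxE; ring.
have qjj : bform (Sigma_hat X) u (delta_mx j 0) = r / n%:R + l * norm1 (g j).
  have -> : delta_mx j 0 = u + embed_coef j (g j).
    apply/colP => k; rewrite [LHS]mxE eqxx andbT [RHS]mxE; case: (unliftP j k) => [k' ->|->].
      by rewrite nodewise_vec_lift embed_coef_lift eq_sym (negbTE (neq_lift j k')) addNr.
    by rewrite nodewise_vec_self embed_coef_self eqxx addr0.
  rewrite bformDr bform_Sigma_hat_sq -/r; congr (_ + _).
  by rewrite bform_Sigma_hat mul_embed_coef XuE mulmxA (lasso_complementary l0 lg).
rewrite /zstat sO dE qjj.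
set N := ((X *m u)^T *m eps) 0 0; set Q := bform _ u h; set hj := h j 0.
have sn : Num.sqrt (r / n%:R) = Num.sqrt r / Num.sqrt n%:R.
  by rewrite sqrtrM ?ltW// sqrtrV ?ltW.
have sn0 : 0 < Num.sqrt n%:R :> R by rewrite sqrtr_gt0.
have sr0 : 0 < Num.sqrt r by rewrite sqrtr_gt0.
have sn2 : n%:R = Num.sqrt n%:R ^+ 2 :> R by rewrite sqr_sqrtr// ltW.
rewrite sn.
have -> : r / n%:R + l * norm1 (g j) = t - l * norm1 (g j) by rewrite tE; ring.
move: t0 sn0 sr0 s0 sn2; move: (norm1 (g j)) => G; move: (Num.sqrt n%:R) (Num.sqrt r) => a b.
move: t {tE rowE rowT OE sO dE} => t t0 a0 b0 s0 ->.
by field; rewrite !gt_eqF.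
Qed.

End DebiasedDecomposition.

Section LassoError.
Context (R : realType) (n p : nat) (X : 'M[R]_(n, p)) (S : 'M[R]_p) (c : R).
Hypotheses (n0 : (0 < n)%N) (c0 : 0 < c) (c1 : c <= 1).
Hypotheses (sS : S^T = S) (Sc : forall v, c * sqnorm2 v <= bform S v v).
Hypothesis S1 : forall j, S j j <= 1.
Let Sh := Sigma_hat X.
Let M := Sh - S.
Local Notation bounded := (atom_sums_bounded (design_atom S) S M).
Variables (beta bhat : 'cV[R]_p) (eps : 'cV[R]_n) (lam xL : R).
Let s := #|signals beta|.
Let h := bhat - beta.
Hypotheses (s0 : (0 < s)%N) (lam0 : 0 < lam) (xL0 : 0 < xL) (xLc : xL <= (c / 100) ^+ 2).
Hypothesis HL : bounded s.+1 xL.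
Hypothesis lb : is_lasso (X *m beta + eps) X lam bhat.
Hypothesis noise : forall k, `|(eps^T *m X) 0 k / n%:R| <= lam / 2.

Lemma lasso_error_rates :
  [/\ norm1 h <= 24 * s%:R * lam / c,
      bform S h h <= 19 * s%:R * lam ^+ 2 / c &
      forall k, `|bform Sh h (delta_mx k 0)| <= 3 / 2 * lam].
Proof.
have c2 : 0 < c / 2 by rewrite divr_gt0.
have sp : 0 < s%:R :> R by rewrite ltr0n.
have s1E : s.+1%:R - 1 = s%:R :> R by rewrite -natr1 addrK.
pose cc := 2 * xL / s%:R.
have cc0 : 0 <= cc by rewrite /cc divr_ge0// ?mulr_ge0// ltW.
have xcc : xL <= c / 100 / 100 /\ xL <= c / 128.
  move: xLc c0 c1; rewrite expr2 => xLc' c0' c1'.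
  have : c / 100 * (c / 100) <= c / 100 * (1 / 100).
    by apply: ler_wpM2l; [rewrite divr_ge0// ltW|lra].
  by split; lra.
case: xcc => xcc1 xcc2.
have x12 : 0 <= xL <= 1 / 2 by move: c1 xL0 => ? ?; apply/andP; split; lra.
have := @lasso_rates R n p X (X *m beta + eps) lam bhat beta s (c / 2) cc lam0 lb.
rewrite /= -/h; case => //.
- by move=> k; rewrite addrC addKr.
- rewrite (_ : 32 * s%:R * cc = 64 * xL); last by rewrite /cc; field; rewrite gt_eqF.
  lra.
- move=> v; have [q _] := @design_curvature R n p X S c c0 sS Sc S1 s.+1 xL v s0 x12 HL.
  by move: q; rewrite s1E.
move=> r1 r2 _ r4; split.
- apply: le_trans r1 _.
  by rewrite le_eqVlt; apply/orP; left; apply/eqP; field; rewrite gt_eqF.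
- have [_] := @design_curvature R n p X S c c0 sS Sc S1 s.+1 xL h s0 x12 HL.
  rewrite s1E -/cc => q; apply: (le_trans q).
  have e1 : sqnorm2 (X *m h) / n%:R <= 9 * (s%:R * lam ^+ 2 / c).
    apply: le_trans r2 _.
    by rewrite le_eqVlt; apply/orP; left; apply/eqP; field; rewrite gt_eqF.
  have r1' : norm1 h <= 24 * s%:R * lam / c.
    apply: le_trans r1 _.
    by rewrite le_eqVlt; apply/orP; left; apply/eqP; field; rewrite gt_eqF.
  have e2 : cc * norm1 h ^+ 2 <= 1152 * (xL / c) * (s%:R * lam ^+ 2 / c).
    have -> : 1152 * (xL / c) * (s%:R * lam ^+ 2 / c) = cc * (24 * s%:R * lam / c) ^+ 2.
      by rewrite /cc; field; rewrite !gt_eqF.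
    apply: ler_wpM2l => //; rewrite lerXn2r ?nnegrE ?norm1_ge0//.
    by rewrite divr_ge0 ?mulr_ge0// ltW.
  have e3 : xL / c <= 1 / 100 / 100 by rewrite ler_pdivrMr//; lra.
  have W0 : 0 <= s%:R * lam ^+ 2 / c by rewrite divr_ge0 ?mulr_ge0 ?sqr_ge0// ltW.
  have e4 := ler_wpM2r W0 e3.
  have -> : 19 * s%:R * lam ^+ 2 / c = 19 * (s%:R * lam ^+ 2 / c) by ring.
  move: e1 e2 e4 W0; set W := s%:R * _ / c; set Y := xL / c * W.
  have -> : 1152 * (xL / c) * W = 1152 * Y by rewrite /Y; ring.
  lra.
- move=> k; rewrite bform_Sigma_hat_delta trmx_mul; exact: r4.
Qed.

Lemma lasso_large_coords (K om : R) : 0 < om -> 24 / (om * c) <= K ->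
  #|[pred j | K * lam < `|h j 0|]|%:R <= om * s%:R.
Proof.
move=> om0 hK; have [r1 _ _] := lasso_error_rates.
have K0 : 0 < K by apply: lt_le_trans hK; rewrite divr_gt0// mulr_gt0.
have : #|[pred j | K * lam < `|h j 0|]|%:R * (K * lam) <= norm1 h.
  rewrite /norm1 [leRHS](bigID [pred j | K * lam < `|h j 0|])/= ler_wpDr ?sumr_ge0//.
  rewrite mulr_natl -sumr_const; apply: ler_sum => j; rewrite inE; exact: ltW.
move=> /le_trans/(_ r1) q; rewrite -(ler_pM2r (mulr_gt0 K0 lam0)); apply: (le_trans q).
have : 24 / (om * c) * (om * s%:R * lam) <= K * (om * s%:R * lam).
  by apply: ler_wpM2r => //; rewrite !mulr_ge0// ltW.
have -> : 24 / (om * c) * (om * s%:R * lam) = 24 * s%:R * lam / c by field; rewrite !gt_eqF.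
by move/le_trans; apply; rewrite le_eqVlt; apply/orP; left; apply/eqP; ring.
Qed.

(* Averaging the population residual vectors over the exceptional coordinates,
   with signs, gives a vector [u] of small [S]-norm; the quadratic bound at
   [h + a u] and [- h + a u] then controls [u^T M h]. *)
Lemma lasso_large_scores (K om : R) : 0 < om <= 1 -> 200 / (om * c ^+ 2) <= K ->
  #|[pred j | K * xL * lam < `|bform M (pop_vec S j) h|]|%:R <= om * s%:R.
Proof.
move=> /andP[om0 om1] hK; have [r1 r2 _] := lasso_error_rates.
have [E EP] : exists E : pred 'I_p,
    forall j, E j = (K * xL * lam < `|bform M (pop_vec S j) h|) by eexists.
rewrite (_ : #|_| = #|E|); last by apply: eq_card => j; rewrite !inE unfold_in EP.
set k := #|E|; rewrite leNgt; apply/negP => kbig.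
have cE (x : R) : \sum_(j | E j) x = k%:R * x.
  by rewrite mulr_natl /k -sumr_const; apply: eq_bigl.
have sp : 0 < s%:R :> R by rewrite ltr0n.
have s1E : s.+1%:R - 1 = s%:R :> R by rewrite -natr1 addrK.
have kp : 0 < k%:R :> R by apply: le_lt_trans kbig; rewrite mulr_ge0// ltW.
pose sg j := Num.sg (bform M (pop_vec S j) h).
pose al := 24 * s%:R * lam / c.
have al0 : 0 < al by rewrite /al divr_gt0// !mulr_gt0.
pose a j := if E j then sg j / k%:R else 0.
pose u := \sum_j a j *: pop_vec S j.
have a1 : \sum_j `|a j| <= 1.
  rewrite (bigID E)/= [X in _ + X]big1 ?addr0; last by move=> j /negbTE Ej; rewrite /a Ej normr0.
  apply: (@le_trans _ _ (\sum_(j | E j) k%:R^-1)).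
    apply: ler_sum => j Ej; rewrite /a Ej normrM normfV (ger0_norm (ltW kp)).
    apply: ler_piMl; first by rewrite invr_ge0 ltW.
    by rewrite /sg normr_sg; case: (_ == 0).
  by rewrite cE mulfV// gt_eqF.
have uMh : K * xL * lam <= bform M u h.
  rewrite /u bform_suml (bigID E)/= [X in _ + X]big1 ?addr0; last first.
    by move=> j /negbTE Ej; rewrite bformZl /a Ej mul0r.
  apply: (@le_trans _ _ (\sum_(j | E j) k%:R^-1 * (K * xL * lam))).
    by rewrite cE mulVKf// gt_eqF.
  apply: ler_sum => j Ej; rewrite bformZl /a Ej.
  have -> : sg j / k%:R * bform M (pop_vec S j) h = k%:R^-1 * `|bform M (pop_vec S j) h|.
    by rewrite normrEsg -/(sg j) mulrCA mulrA.
  apply: ler_wpM2l; first by rewrite invr_ge0 ltW.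
  by move: Ej; rewrite EP => /ltW.
have uSu : bform S u u <= (k%:R * c)^-1.
  have kc : 0 < k%:R * c by rewrite mulr_gt0.
  have h1 : bform S u u <= \sum_(j | E j) k%:R^-1 * `|u j 0|.
    rewrite {1}/u bform_suml (bigID E)/= [X in _ + X]big1 ?addr0; last first.
      by move=> j /negbTE Ej; rewrite bformZl /a Ej mul0r.
    apply: ler_sum => j Ej; rewrite bformZl /a Ej (pop_vec_bform c0 sS Sc).
    apply: le_trans (ler_norm _) _; rewrite !normrM normfV (ger0_norm (ltW kp)).
    rewrite mulrAC mulrC; apply: ler_wpM2l; first by rewrite invr_ge0 ltW.
    have /andP[i0 i1] := invmx_diag_inv_le1 c0 sS Sc S1 j.
    rewrite (ger0_norm (ltW i0)) mulrA; apply: ler_piMl => //.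
    rewrite -[leRHS](mulr1 1); apply: ler_pM => //; first exact: ltW.
    by rewrite /sg normr_sg; case: (_ == 0).
  have h2 : \sum_(j | E j) k%:R^-1 * `|u j 0| <= c / 2 * sqnorm2 u + (k%:R * c)^-1 / 2.
    apply: (@le_trans _ _ (\sum_(j | E j) (c / 2 * u j 0 ^+ 2 + k%:R^-1 * ((k%:R * c)^-1 / 2)))).
      apply: ler_sum => j _; set x := u j 0.
      have -> : c / 2 * x ^+ 2 + k%:R^-1 * ((k%:R * c)^-1 / 2) =
          k%:R^-1 * `|x| + c / 2 * (`|x| - (k%:R * c)^-1) ^+ 2.
        rewrite -(real_normK (num_real x)); move: `|x| => y; by field; rewrite !gt_eqF.
      by rewrite lerDl mulr_ge0 ?sqr_ge0// divr_ge0// ltW.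
    rewrite big_split /=; apply: lerD.
      rewrite /sqnorm2 mulr_sumr [leRHS](bigID E)/= ler_wpDr//.
      by apply: sumr_ge0 => j _; rewrite mulr_ge0 ?sqr_ge0// divr_ge0// ltW.
    by rewrite cE mulVKf// gt_eqF.
  have := Sc u; lra.
have B (e : R) : `|e| = 1 ->
    `|bform M (e *: h + al *: u) (e *: h + al *: u)| <=
    xL * (bform S (e *: h + al *: u) (e *: h + al *: u) + 2 * (2 * al) ^+ 2 / s%:R).
  move=> e1; rewrite -s1E.
  apply: (@design_norm_bound R n p X S c c0 sS Sc S1 s.+1 xL (2 * al) (e *: h)
    (e *: h + al *: u) (fun j => al * a j)) => //; first exact: ltW.
    rewrite norm1Z e1 mul1r.
    have -> : \sum_j `|al * a j| = al * \sum_j `|a j|.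
      by rewrite mulr_sumr; apply: eq_bigr => j _; rewrite normrM (ger0_norm (ltW al0)).
    have := ler_wpM2l (ltW al0) a1; move: r1; rewrite -/al; lra.
  by rewrite /u scaler_sumr; congr (_ + _); apply: eq_bigr => j _; rewrite scalerA.
have sM : M^T = M by rewrite /M linearB /= sS Sigma_hat_sym.
have := B 1 (normr1 _); have := B (-1) (normrN1 _).
rewrite scale1r scaleN1r !(bform_sq_add h _ sM) !(bform_sq_add h _ sS).
rewrite !(bform_sq_add (- h) _ sM) !(bform_sq_add (- h) _ sS).
rewrite !bformNr !bformNl !opprK !bformZr !bformZl.
rewrite (bformC h u sM) (bformC h u sS).
set Mh := bform M h h; set Mu := bform M u u; set Sh' := bform S h h; set Su := bform S u u.
set C := bform M u h in uMh *; set D := bform S u h.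
rewrite !ler_norml => /andP[q1 _] /andP[_ q2].
have q : 4 * al * C <= xL * (2 * al ^+ 2 * Su + 2 * Sh' + 16 * al ^+ 2 / s%:R).
  have -> : xL * (2 * al ^+ 2 * Su + 2 * Sh' + 16 * al ^+ 2 / s%:R) =
   xL * (Sh' + 2 * - (al * D) + al * (al * Su) + 2 * (2 * al) ^+ 2 / s%:R) +
   xL * (Sh' + 2 * (al * D) + al * (al * Su) + 2 * (2 * al) ^+ 2 / s%:R) by ring.
  lra.
have T1 : 2 * al ^+ 2 * Su <= 1152 * (s%:R * lam ^+ 2) / (om * c ^+ 3).
  apply: (@le_trans _ _ (2 * al ^+ 2 * (om * s%:R * c)^-1)).
    apply: ler_wpM2l; first by rewrite mulr_ge0 ?sqr_ge0.
    apply: (le_trans uSu); rewrite lef_pV2 ?posrE ?mulr_gt0// ler_pM2r//; exact: ltW.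
  by rewrite /al le_eqVlt; apply/orP; left; apply/eqP; field; rewrite !gt_eqF.
have T2 : 2 * Sh' <= 38 * (s%:R * lam ^+ 2) / c.
  apply: (@le_trans _ _ (2 * (19 * s%:R * lam ^+ 2 / c))); first by apply: ler_wpM2l.
  by rewrite le_eqVlt; apply/orP; left; apply/eqP; ring.
have T3 : 16 * al ^+ 2 / s%:R = 96 * 96 * (s%:R * lam ^+ 2) / c ^+ 2.
  by rewrite /al; field; rewrite !gt_eqF.
have T4 : 4 * al * (K * xL * lam) <= 4 * al * C by apply: ler_wpM2l => //; rewrite mulr_ge0// ltW.
have T5 : xL * (2 * al ^+ 2 * Su + 2 * Sh' + 16 * al ^+ 2 / s%:R) <=
   xL * (1152 * (s%:R * lam ^+ 2) / (om * c ^+ 3) + 38 * (s%:R * lam ^+ 2) / c +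
         96 * 96 * (s%:R * lam ^+ 2) / c ^+ 2).
  by apply: ler_wpM2l; [exact: ltW|rewrite T3 lerD2r lerD].
have := le_trans T4 (le_trans q T5).
have -> : 4 * al * (K * xL * lam) = xL * ((s%:R * lam ^+ 2) * (96 * K / c)).
  by rewrite /al; field; rewrite gt_eqF.
rewrite ler_pM2l//.
have -> : 1152 * (s%:R * lam ^+ 2) / (om * c ^+ 3) + 38 * (s%:R * lam ^+ 2) / c +
         96 * 96 * (s%:R * lam ^+ 2) / c ^+ 2 = (s%:R * lam ^+ 2) *
   (96 / c * (12 / (om * c ^+ 2) + 38 / 96 + 96 / c)) by field; rewrite !gt_eqF.
have -> : 96 * K / c = 96 / c * K by ring.
rewrite ler_pM2l ?mulr_gt0 ?exprn_gt0// ler_pM2l ?divr_gt0// => /(le_trans hK).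
set Z := (om * c ^+ 2)^-1.
have Z1 : 1 <= Z.
  rewrite /Z -[leLHS]invr1 lef_pV2 ?posrE ?ltr01 ?mulr_gt0 ?exprn_gt0//.
  by apply: mulr_ile1; rewrite ?(ltW om0) ?sqr_ge0 ?expr_le1 ?(ltW c0).
have Z2 : c^-1 <= Z.
  rewrite /Z lef_pV2 ?posrE ?mulr_gt0 ?exprn_gt0//.
  rewrite expr2 mulrA; apply: ler_piMl; first exact: ltW.
  by apply: mulr_ile1; rewrite ?(ltW om0) ?(ltW c0).
lra.
Qed.

Section Bias.
Variables (m : nat) (x2 x l K : R).
Hypotheses (m0 : (0 < m)%N) (sm : (s_max S < m)%N).
Hypotheses (x20 : 0 <= x2 <= 1) (H2 : bounded 2 x2) (l2 : 2 * x2 <= l) (l0 : 0 < l).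
Hypotheses (x0 : 0 <= x) (xc : x <= (c / 100) ^+ 2) (Hm : bounded m.+1 x).
Hypothesis ml : m%:R * l ^+ 2 <= c.
Hypothesis K1 : 1 <= K.

Lemma bias_bound (j : 'I_p) (g : 'cV[R]_p.-1) (u : 'cV[R]_p) :
  u = nodewise_vec j g ->
  is_lasso (col j X) (col' j X) l g -> `|h j 0| <= K * lam ->
  `|bform M (pop_vec S j) h| <= K * xL * lam ->
  `|l * norm1 g * h j 0 - (bform Sh u h - bform Sh u (delta_mx j 0) * h j 0)| <=
    K * lam * (34 * l * Num.sqrt m%:R / c +
      Num.min (24 * s%:R * l / c) (xL + x2 + 84 * m%:R * l / c)).
Proof.
move=> ug lg hj sj.
have [[del uE [delj ndel]] nu _ _] :=
  nodewise_rates c0 c1 sS Sc S1 m0 sm x20 H2 l2 l0 x0 xc Hm ml lg.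
have [q1 _ q2] := nodewise_score c0 sS Sc S1 x20 H2 l0 lg.
rewrite -ug in uE nu q1 q2.
have [r1 _ r3] := lasso_error_rates.
have mp : 0 < m%:R :> R by rewrite ltr0n.
have Kl : 0 < K * lam by rewrite mulr_gt0// (lt_le_trans ltr01).
have ShE v w : bform Sh v w = bform S v w + bform M v w by rewrite /M bformBm addrC subrK.
apply: le_trans (ler_normB _ _) _; rewrite mulrDr; apply: lerD.
  have nu1 : norm1 g <= 34 * Num.sqrt m%:R / c.
    apply: (@le_trans _ _ (norm1 u)); first by rewrite ug norm1_nodewise_vec lerDr.
    rewrite -(@ler_pXn2r _ 2) ?nnegrE ?norm1_ge0//; last by rewrite divr_ge0 ?mulr_ge0 ?sqrtr_ge0// ltW.
    apply: (le_trans nu); rewrite exprMn exprMn sqr_sqrtr ?(ltW mp)// exprVn.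
    have -> : 34 ^+ 2 * m%:R * (c ^+ 2)^-1 = 1156 * (m%:R / c) / c by field; rewrite gt_eqF.
    rewrite ler_pdivlMr// -mulrA.
    have -> : 1154 * (m%:R / c) * c = 1154 * m%:R by field; rewrite gt_eqF.
    have : m%:R <= m%:R / c by rewrite ler_pdivlMr// ler_piMr// ltW.
    have : 0 <= m%:R / c by rewrite divr_ge0// ltW.
    lra.
  rewrite !normrM (ger0_norm (ltW l0)) (ger0_norm (norm1_ge0 _)).
  have -> : K * lam * (34 * l * Num.sqrt m%:R / c) = l * (34 * Num.sqrt m%:R / c) * (K * lam) by ring.
  by apply: ler_pM => //; [rewrite mulr_ge0 ?norm1_ge0// ltW|rewrite ler_pM2l].
have [le1|le2] := leP (24 * s%:R * l / c) (xL + x2 + 84 * m%:R * l / c).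
  have -> : bform Sh u h - bform Sh u (delta_mx j 0) * h j 0 =
      \sum_(k | k != j) h k 0 * bform Sh u (delta_mx k 0).
    have hs : h = \sum_k h k 0 *: delta_mx k 0.
      apply/colP => i; rewrite summxE (bigD1 i)//= big1 => [|k /negbTE ki]; last first.
        by rewrite !mxE eq_sym ki mulr0.
      by rewrite [in RHS]mxE [X in _ * X]mxE !eqxx mulr1 addr0.
    rewrite [in X in X - _]hs bform_sumr (bigD1 j)//= bformZr [bform Sh u (delta_mx j 0) * _]mulrC addrAC subrr add0r.
    by apply: eq_bigr => k _; rewrite bformZr.
  apply: (@le_trans _ _ (l * norm1 h)).
    apply: le_trans (ler_norm_sum _ _ _) _.
    rewrite /norm1 mulr_sumr [leRHS](bigID (fun k => k != j))/= ler_wpDr//.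
      by apply: sumr_ge0 => k _; rewrite mulr_ge0// ltW.
    by apply: ler_sum => k kj; rewrite normrM mulrC; apply: ler_wpM2r => //; exact: q1.
  apply: (@le_trans _ _ (l * (24 * s%:R * lam / c))); first by rewrite ler_pM2l.
  have -> : l * (24 * s%:R * lam / c) = lam * (24 * s%:R * l / c) by ring.
  apply: ler_wpM2r; first by rewrite divr_ge0 ?mulr_ge0// ltW.
  by rewrite ler_peMl// ltW.
have delta_bound w (a : R) : (forall k, `|bform Sh w (delta_mx k 0)| <= a) -> `|bform Sh del w| <= a * norm1 del.
  move=> wa; rewrite bformE; apply: sum_normM_le => k.
  by rewrite -bform_delta bformC; [exact: wa|exact: Sigma_hat_sym].
have -> : bform Sh u h - bform Sh u (delta_mx j 0) * h j 0 =
    (bform M (pop_vec S j) h - bform M (pop_vec S j) (delta_mx j 0) * h j 0)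
    - (bform Sh del h - bform Sh del (delta_mx j 0) * h j 0).
  have d1 : (delta_mx j 0 : 'cV[R]_p) j 0 = 1 by rewrite mxE !eqxx.
  rewrite uE !bformDl !bformNl !(ShE (pop_vec S j)) !(pop_vec_bform c0 sS Sc) d1; ring.
have b1 : `|bform M (pop_vec S j) (delta_mx j 0) * h j 0| <= x2 * (K * lam).
  rewrite normrM; apply: ler_pM => //; case/andP: x20 => x20' _.
  by have := @design_cross_bound R n p X S c c0 sS Sc S1 x2 (inr j) (inl j) x20' H2.
have b2 : `|bform Sh del h| <= 3 / 2 * lam * norm1 del by exact: delta_bound.
have b3 : `|bform Sh del (delta_mx j 0) * h j 0| <= 2 * norm1 del * (K * lam).
  rewrite normrM; apply: ler_pM => //; apply: delta_bound => k.
  exact: (design_entry_le2 c0 sS Sc S1 j k x20 H2).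
have nd : norm1 del * (K * lam) <= 24 * m%:R * l / c * (K * lam) by rewrite ler_pM2r.
have b4 : 3 / 2 * lam * norm1 del <= 3 / 2 * (24 * m%:R * l / c * (K * lam)).
  have -> : 3 / 2 * lam * norm1 del = 3 / 2 * (norm1 del * lam) by ring.
  apply: ler_wpM2l => //; apply: le_trans nd; apply: ler_wpM2l; first exact: norm1_ge0.
  by rewrite ler_peMl// ltW.
have -> : K * lam * (xL + x2 + 84 * m%:R * l / c) =
  K * xL * lam + x2 * (K * lam) + (3 / 2 * (24 * m%:R * l / c * (K * lam)) +
  2 * (24 * m%:R * l / c * (K * lam))) by field; rewrite gt_eqF.
apply: le_trans (ler_normB _ _) _; apply: lerD.
  by apply: le_trans (ler_normB _ _) _; apply: lerD.
apply: le_trans (ler_normB _ _) _; apply: lerD; first exact: le_trans b2 b4.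
by apply: (le_trans b3); rewrite -mulrA; apply: ler_wpM2l.
Qed.

End Bias.
End LassoError.

(** * Counts of large Gaussian scores *)

Section ContinuousFactor.
Context (R : realType) (d : measure_display) (T : measurableType d).
Context (m k : nat) (Y : T -> 'M[R]_(m, k)).

Definition continuous_factor (f : T -> R) : Prop :=
  forall w (e : R), 0 < e -> exists2 eta, 0 < eta &
    forall w', (forall i j, `|Y w' i j - Y w i j| <= eta) -> `|f w' - f w| < e.

Let box (cq : 'M[rat]_(m, k) * nat) : set (mxT R m k) :=
  [set M | forall i j, `|M i j - ratr (cq.1 i j)| < cq.2.+1%:R^-1].

Let measurable_box cq : measurable (box cq).
Proof.
rewrite (_ : box cq = \bigcap_(i in [set: 'I_m]) \bigcap_(j in [set: 'I_k])
    [set M : mxT R m k | `|M i j - ratr (cq.1 i j)| < cq.2.+1%:R^-1]); last first.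
  by apply/seteqP; split => [M H i _ j _|M H i j]; [exact: H|exact: H].
apply: fin_bigcap_measurable => // i _; apply: fin_bigcap_measurable => // j _.
have mf : measurable_fun setT (fun M : mxT R m k => `|M i j - ratr (cq.1 i j)|).
  apply: measurableT_comp => //; apply: measurable_funB => //; exact: measurable_coord.
have := mf measurableT `]-oo, cq.2.+1%:R^-1[%classic (measurable_itv _).
by rewrite setTI; congr (measurable _).
Qed.

Lemma measurable_continuous_factor (f : T -> R) : continuous_factor f ->
  measurable_fun setT (f : g_sigma_algebra_preimageType (Y : T -> mxT R m k) -> R).
Proof.
move=> cf; apply: (measurability _ (RGenOInfty.measurableE R)) => // _ [_ [a ->] <-].
rewrite setTI; pose ok cq := `[< forall w', box cq (Y w') -> a < f w' >].
exists (\bigcup_cq (if ok cq then box cq else set0)).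
  apply: countable_bigcupT_measurable => [|cq]; first exact: countableP.
  by case: ifP => // _; exact: measurable_box.
rewrite setTI; apply/seteqP; split => w /=.
  move=> [cq _]; case: ifP => // /asboolP H /H; by rewrite in_itv/= andbT.
rewrite in_itv/= andbT => aw; have [eta eta0 H] := cf w (f w - a) (ltac:(by rewrite subr_gt0)).
have [q hq] : exists q : nat, q.+1%:R^-1 <= eta / 2.
  have e2 : 0 < 2 / eta by rewrite divr_gt0.
  exists (Num.truncn (2 / eta)); rewrite -[leRHS]invrK lef_pV2 ?posrE ?invr_gt0 ?divr_gt0 ?ltr0Sn//.
  by rewrite invf_div ltW// truncnS_gt.
have q0 : 0 < q.+1%:R^-1 :> R by rewrite invr_gt0 ltr0Sn.
have /choice[c hc] : forall ij : 'I_m * 'I_k, exists c : rat,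
    `|Y w ij.1 ij.2 - ratr c| < q.+1%:R^-1.
  have key (y nu : R) : 0 < nu -> exists c : rat, `|y - ratr c| < nu.
    move=> nu0; have yy : y - nu < y + nu by lra.
    have [c] := rat_in_itvoo yy; rewrite in_itv/= => /andP[c1 c2]; exists c.
    by rewrite ltr_norml /=; apply/andP; split; lra.
  by move=> ij; exact: (key _ _ q0).
exists (\matrix_(i, j) c (i, j), q) => //.
have close (y y' z nu : R) : nu <= eta / 2 -> `|y - z| < nu -> `|y' - z| < nu -> `|y' - y| <= eta.
  rewrite !ltr_norml !ler_norml => ? /andP[? ?] /andP[? ?].
  by apply/andP; split; lra.
have bw (w' : T) : box (\matrix_(i, j) c (i, j), q) (Y w') -> a < f w'.
  move=> bx; have := H w'; rewrite ltr_norml => h.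
  have : `|f w' - f w| < f w - a.
    apply: H => i j; have := bx i j; have := hc (i, j); rewrite /= mxE.
    move: hq; exact: close.
  by rewrite ltr_norml => /andP[? ?]; lra.
rewrite ifT; last exact/asboolP.
by move=> i j; rewrite mxE; exact: (hc (i, j)).
Qed.

Context (P : probability T R).

Lemma independent_continuous_factor (m1 k1 m2 k2 : nat)
    (V : T -> 'M[R]_(m1, k1)) (Z : T -> 'M[R]_(m2, k2)) :
  random_matrix Y -> (forall i j, continuous_factor (fun w => V w i j)) ->
  independent P Y Z -> random_matrix V /\ independent P V Z.
Proof.
move=> rY cV iYZ.
have /measurable_mxP mV : forall i j, measurable_fun setT
    ((fun w => V w i j) : g_sigma_algebra_preimageType (Y : T -> mxT R m k) -> R).
  by move=> i j; exact: measurable_continuous_factor.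
have fac A : borel_mx A -> exists2 A', borel_mx A' & V @^-1` A = Y @^-1` A'.
  move=> mA; have := mV measurableT A mA; rewrite setTI => -[A' mA']; rewrite setTI => <-.
  by exists A'.
split => [A /fac[A' mA' ->]|A B /fac[A' mA' ->] mB]; first exact: rY.
exact: iYZ.
Qed.

End ContinuousFactor.

Section ResidualContinuity.
Context (R : realType) (n p : nat) (j : 'I_p) (l : R).
Hypotheses (n0 : (0 < n)%N) (l0 : 0 < l).

Let res_close (x x' : 'M[R]_(n, p)) (g g' : 'cV[R]_p.-1) (eta : R) :
  is_lasso (col j x) (col' j x) l g -> is_lasso (col j x') (col' j x') l g' ->
  0 < eta <= 1 -> (forall i k, `|x' i k - x i k| <= eta) ->
  let A := \sum_i \sum_k `|x i k| in
  let N := 1 + (\sum_i (`|x i j| + 1) ^+ 2) / n%:R / (2 * l) in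
  let C := N ^+ 2 * (2 * A + 1) in
  forall i, `|(x' *m nodewise_vec j g') i 0 - (x *m nodewise_vec j g) i 0| <=
    (N + Num.sqrt (2 * n%:R * C)) * Num.sqrt eta.
Proof.
move=> lg lg' /andP[e0 e1] cl A N C i.
have nR : 0 < n%:R :> R by rewrite ltr0n.
have A0 : 0 <= A by apply: sumr_ge0 => ? _; exact: sumr_ge0.
have n1 (z : 'M[R]_(n, p)) ga : is_lasso (col j z) (col' j z) l ga ->
    (forall i, `|z i j| <= `|x i j| + 1) -> norm1 (nodewise_vec j ga) <= N.
  move=> lz zx; rewrite norm1_nodewise_vec lerD2l ler_pdivlMr ?mulr_gt0//.
  have := lz 0; rewrite /lasso_objective mulmx0 subr0.
  have -> : norm1 (0 : 'cV[R]_p.-1) = 0 by rewrite /norm1 big1// => ? _; rewrite mxE normr0.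
  have : sqnorm2 (col j z) / n%:R <= (\sum_i (`|x i j| + 1) ^+ 2) / n%:R.
    apply: ler_wpM2r; first by rewrite invr_ge0 ltW.
    apply: ler_sum => i' _; rewrite mxE -(real_normK (num_real (z i' j))).
    by rewrite lerXn2r ?nnegrE ?addr_ge0.
  have : 0 <= sqnorm2 (col j z - col' j z *m ga) / n%:R by rewrite divr_ge0 ?sqnorm2_ge0// ltW.
  rewrite [norm1 ga * _]mulrC; lra.
have N1 : norm1 (nodewise_vec j g) <= N by apply: (n1 _ _ lg) => i'; rewrite lerDl.
have N2 : norm1 (nodewise_vec j g') <= N.
  apply: (n1 _ _ lg') => i'; have := cl i' j; have := ler_normB (x' i' j - x i' j) (- x i' j).
  rewrite opprK subrK normrN; lra.
have N0 : 0 <= N by apply: le_trans N1; exact: norm1_ge0.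
have dif u i' : norm1 u <= N -> `|(x' *m u) i' 0 - (x *m u) i' 0| <= eta * N.
  move=> uN; have -> : (x' *m u) i' 0 - (x *m u) i' 0 = \sum_k u k 0 * (x' i' k - x i' k).
    by rewrite !mxE -sumrB; apply: eq_bigr => k' _; ring.
  by apply: le_trans (sum_normM_le _ (cl i')) _; apply: ler_wpM2l => //; exact: ltW.
have siz u i' : norm1 u <= N -> `|(x *m u) i' 0| <= A * N.
  move=> uN; have -> : (x *m u) i' 0 = \sum_k u k 0 * x i' k.
    by rewrite mxE; apply: eq_bigr => k' _; rewrite mulrC.
  have xA k' : `|x i' k'| <= A.
    rewrite /A (bigD1 i')//= (bigD1 k')//= -addrA lerDl addr_ge0 ?sumr_ge0// => ? _.
    exact: sumr_ge0.
  by apply: le_trans (sum_normM_le _ xA) _; exact: ler_wpM2l.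
have sqd u : norm1 u <= N -> `|sqnorm2 (x' *m u) / n%:R - sqnorm2 (x *m u) / n%:R| <= eta * C.
  move=> uN; rewrite -mulrBl normrM (ger0_norm (_ : 0 <= n%:R^-1)); last by rewrite invr_ge0 ltW.
  rewrite ler_pdivrMr// /sqnorm2 -sumrB; apply: le_trans (ler_norm_sum _ _ _) _.
  apply: (@le_trans _ _ (\sum_(i < n) eta * C)); last first.
    by rewrite [leRHS]mulr_natr sumr_const card_ord lexx.
  apply: ler_sum => i' _; have := dif u i' uN; have := siz u i' uN.
  move: ((x *m u) i' 0) ((x' *m u) i' 0) => a b sa sb.
  have -> : b ^+ 2 - a ^+ 2 = (b - a) * (2 * a + (b - a)) by ring.
  have -> : eta * C = eta * N * (2 * (A * N) + N) by rewrite /C; ring.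
  rewrite normrM; apply: ler_pM => //; apply: le_trans (ler_normD _ _) _.
  rewrite normrM (ger0_norm (_ : 0 <= 2 :> R))//; apply: lerD; first by rewrite ler_pM2l.
  by apply: (le_trans sb); rewrite ler_piMl.
have oE (z : 'M[R]_(n, p)) ga : lasso_objective (col j z) (col' j z) l ga =
    sqnorm2 (z *m nodewise_vec j ga) / n%:R + 2 * l * norm1 ga.
  by rewrite /lasso_objective mul_nodewise_vec.
have sc := lasso_strong_convexity (ltW l0) lg g'; have := lg' g; rewrite !oE in sc *.
have := sqd _ N1; have := sqd _ N2; rewrite !ler_norml => /andP[q1 q2] /andP[q3 q4] q5.
have C0 : 0 <= C by rewrite mulr_ge0 ?sqr_ge0// addr_ge0// mulr_ge0.
have q6 : sqnorm2 (col' j x *m (g' - g)) <= 2 * n%:R * C * eta.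
  have : sqnorm2 (col' j x *m (g' - g)) / n%:R <= 2 * (eta * C) by lra.
  by rewrite ler_pdivrMr//; lra.
have xu : x *m nodewise_vec j g' = x *m nodewise_vec j g - col' j x *m (g' - g).
  by rewrite (nodewise_vec_embed j g' g) mulmxBr mul_embed_coef.
have q7 : `|(x *m nodewise_vec j g') i 0 - (x *m nodewise_vec j g) i 0| <=
    Num.sqrt (2 * n%:R * C) * Num.sqrt eta.
  have <- : Num.sqrt (2 * n%:R * C * eta) = Num.sqrt (2 * n%:R * C) * Num.sqrt eta.
    by rewrite sqrtrM// mulr_ge0// mulr_ge0// ltW.
  rewrite -sqrtr_sqr; apply: ler_wsqrtr.
  have -> : (x *m nodewise_vec j g') i 0 - (x *m nodewise_vec j g) i 0 =
      - (col' j x *m (g' - g)) i 0 by rewrite xu [X in X - _]mxE [X in _ + X - _]mxE; ring.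
  by rewrite sqrrN; apply: le_trans (coord_sqnorm2 _ i) q6.
have q8 := dif _ i N2.
have q9 : eta <= Num.sqrt eta.
  rewrite -{1}(sqr_sqrtr (ltW e0)) expr2 ler_piMl ?sqrtr_ge0//.
  by rewrite -sqrtr1; apply: ler_wsqrtr.
have q10 := ler_wpM2r N0 q9.
have := ler_distD ((x *m nodewise_vec j g') i 0) ((x' *m nodewise_vec j g') i 0) ((x *m nodewise_vec j g) i 0).
rewrite -ler_norml; lra.
Qed.

Context (d : measure_display) (T : measurableType d).

Lemma lasso_residual_continuous (X : T -> 'M[R]_(n, p)) (g : T -> 'cV[R]_p.-1) i :
  (forall w, is_lasso (col j (X w)) (col' j (X w)) l (g w)) ->
  continuous_factor X (fun w => (X w *m nodewise_vec j (g w)) i 0).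
Proof.
move=> lg w e e0; have := fun w' eta => @res_close (X w) (X w') (g w) (g w') eta (lg w) (lg w').
move=> /=; set N := 1 + _; set C := N ^+ 2 * _; set B := N + _ => H.
have B0 : 0 <= B.
  rewrite addr_ge0 ?sqrtr_ge0// addr_ge0// divr_ge0 ?mulr_ge0 ?(ltW l0)//.
  by rewrite sumr_ge0// => ? _; exact: sqr_ge0.
pose t := Num.min 1 (e / (2 * (B + 1))).
have t0 : 0 < t by rewrite lt_min ltr01 divr_gt0// mulr_gt0// ltr_wpDl.
have t1 : t <= 1 by rewrite ge_min lexx.
exists (t ^+ 2); first by rewrite exprn_gt0.
move=> w' cl; have tt : 0 < t ^+ 2 <= 1 by rewrite exprn_gt0//= expr_le1// ltW.
apply: le_lt_trans (H w' _ tt cl i) _; rewrite sqrtr_sqr (ger0_norm (ltW t0)).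
have : t <= e / (2 * (B + 1)) by rewrite ge_min lexx orbT.
rewrite ler_pdivlMr ?mulr_gt0 ?ltr_wpDl// => h.
have := mulr_ge0 B0 (ltW t0); lra.
Qed.

End ResidualContinuity.

Section GaussianCounts.
Context (R : realType) (d : measure_display) (T : measurableType d)
  (P : probability T R).
Local Notation gam := (@normal_prob R 0 1).

Let tail_nat (U : T -> R) t w : ((t < `|U w|)%R%:R : R) = \1_[set w | t < `|U w|] w.
Proof.
rewrite indicE; case: ltP => h; first by rewrite mem_set.
by rewrite memNset//=; apply/negP; rewrite -leNgt.
Qed.

Section Counts.
Variables (I : finType) (Q : pred I) (U : I -> T -> R) (t : R).
Hypotheses (mU : forall i, measurable_fun setT (U i)) (t0 : 0 <= t).
Hypothesis lawU : forall i, Q i -> forall B : set (measurableTypeR R), measurable B ->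
  P [set w | B (U i w)] = gam B.
Let mu : R := 2 * Phi (- t).
Let N w : R := \sum_(i | Q i) (t < `|U i w|)%R%:R.

Let mtail i : measurable [set w | t < `|U i w|].
Proof.
have := measurable_abs_tail t; rewrite -[X in _ -> measurable X]setTI.
by move=> mt; exact: (@mU i measurableT _ mt).
Qed.

Let Ptail i : Q i -> P [set w | (t < `|U i w|)%R] = mu%:E.
Proof.
by move=> Qi; rewrite (lawU Qi (measurable_abs_tail t)) normal_abs_tail.
Qed.

Let mind i : measurable_fun setT (fun w => (t < `|U i w|)%R%:R : R).
Proof. by under eq_fun do rewrite tail_nat; exact: measurable_indic. Qed.

Lemma measurable_tail_count : measurable_fun setT N.
Proof. by apply: measurable_fun_bigsum. Qed.

Let N0 w : 0 <= N w. Proof. by apply: sumr_ge0. Qed.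

Let mu0 : 0 <= mu. Proof. by rewrite mulr_ge0 ?Phi_ge0. Qed.

Let int_sum (J : finType) (S : pred J) (f : J -> T -> R) :
  (forall j, measurable_fun setT (f j)) -> (forall j w, 0 <= f j w) ->
  (\int[P]_w (\sum_(j | S j) f j w)%:E = \sum_(j | S j) \int[P]_w (f j w)%:E)%E.
Proof.
move=> mf f0; rewrite -[RHS]big_filter -ge0_integral_sum//=.
- by apply: eq_integral => w _; rewrite big_filter sumEFin.
- by move=> j; exact/measurable_EFinP.
- by move=> j w _; rewrite lee_fin.
Qed.

Lemma tail_count_mean : (\int[P]_w (N w)%:E = (#|Q|%:R * mu)%:E)%E.
Proof.
rewrite int_sum//; rewrite (eq_bigr (fun=> mu%:E)).
  by rewrite sumEFin sumr_const mulr_natl.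
move=> i Qi; rewrite -(Ptail Qi) -integral_indic_EFin//.
by apply: eq_integral => w _; rewrite tail_nat.
Qed.

Lemma tail_count_markov (y : R) : 0 < y ->
  (P [set w | (y < N w)%R] <= (#|Q|%:R * mu / y)%:E)%E.
Proof.
move=> y0; have my : measurable [set w | y < N w].
  have := measurable_tail_count measurableT (measurable_itv `]y, +oo[).
  by rewrite setTI; congr (measurable _); apply/seteqP; split => w; rewrite /= in_itv/= andbT.
rewrite -integral_indic_EFin//.
have -> : ((#|Q|%:R * mu / y)%:E = \int[P]_w (y^-1 * N w)%:E)%E.
  rewrite ge0_integralZ_EFin//; first by rewrite tail_count_mean -EFinM mulrC.
  - exact: measurable_tail_count.
  - by rewrite invr_ge0 ltW.
apply: ge0_le_integral_EFin => //.
  by apply: measurable_funM => //; exact: measurable_tail_count.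
move=> w; rewrite indicE; have [|_] := boolP (w \in _).
  by rewrite inE /= mulrC ler_pdivlMr// mul1r => /ltW.
by rewrite mulr_ge0// invr_ge0 ltW.
Qed.

Variable rho : I -> I -> R.
Hypothesis rho1 : forall i j, i != j -> `|rho i j| <= 1.
Hypothesis lawUU : forall i j, Q i -> Q j -> i != j ->
  forall a b : R, a ^+ 2 + b ^+ 2 + 2 * rho i j * a * b = 1 ->
  forall B : set (measurableTypeR R), measurable B ->
  P [set w | B (a * U i w + b * U j w)] = gam B.

Lemma tail_count_chebyshev (y c : R) : 0 < y ->
  \sum_i \sum_(j | j != i) rho i j ^+ 2 <= c ->
  (P [set w | (y < `|N w - #|Q|%:R * mu|)%R] <=
   ((#|Q|%:R * mu + 160 * c * ((1 + t ^+ 2) ^+ 2 * expR (- (t ^+ 2 / 2)))) / y ^+ 2)%:E)%E.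
Proof.
move=> y0 hc; set q := #|Q|%:R * mu; set W := (1 + t ^+ 2) ^+ 2 * _.
have W0 : 0 <= W by rewrite mulr_ge0 ?sqr_ge0 ?expR_ge0.
have q0 : 0 <= q by rewrite mulr_ge0.
have mN := measurable_tail_count.
have mNq : measurable_fun setT (fun w => (N w - q) ^+ 2).
  by apply: measurable_funX; exact: measurable_funB.
have N2 : (\int[P]_w (N w ^+ 2)%:E <= (q + q ^+ 2 + 160 * c * W)%:E)%E.
  have -> : (\int[P]_w (N w ^+ 2)%:E = \sum_(i | Q i) \sum_(j | Q j)
      \int[P]_w ((t < `|U i w|)%R%:R * (t < `|U j w|)%R%:R)%:E)%E.
    transitivity (\int[P]_w (\sum_(i | Q i) \sum_(j | Q j)
      (t < `|U i w|)%R%:R * (t < `|U j w|)%R%:R)%:E)%E.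
      apply: eq_integral => w _; rewrite expr2 /N mulr_suml; congr (_%:E).
      by apply: eq_bigr => i _; rewrite mulr_sumr.
    rewrite int_sum.
    - by apply: eq_bigr => i _; rewrite int_sum// => j; exact: measurable_funM.
    - by move=> i; apply: measurable_fun_bigsum => j; exact: measurable_funM.
    - by move=> i w; apply: sumr_ge0 => j _; rewrite mulr_ge0.
  have E2 i j : Q i -> Q j -> i != j -> (\int[P]_w ((t < `|U i w|)%R%:R * (t < `|U j w|)%R%:R)%:E
      <= (mu ^+ 2 + 160 * rho i j ^+ 2 * W)%:E)%E.
    move=> Qi Qj ij.
    have := gauss_pair_tails (mU i) (mU j) (rho1 ij) t0 (lawUU Qi Qj ij).
    apply: le_trans; rewrite le_eqVlt; apply/orP; left; apply/eqP.
    have mI := measurableI _ _ (mtail i) (mtail j).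
    transitivity (P ([set w | t < `|U i w|] `&` [set w | t < `|U j w|])); last by [].
    rewrite -integral_indic_EFin//.
    by apply: eq_integral => w _; congr (_%:E); rewrite !tail_nat indicI.
  have E1 i : Q i -> (\int[P]_w ((t < `|U i w|)%R%:R * (t < `|U i w|)%R%:R)%:E = mu%:E)%E.
    move=> Qi; rewrite -(Ptail Qi) -integral_indic_EFin//; apply: eq_integral => w _.
    by rewrite tail_nat indicE; case: (_ \in _); rewrite ?mulr1 ?mulr0.
  apply: (@le_trans _ _ (\sum_(i | Q i) \sum_(j | Q j)
     ((i == j)%:R * mu + (mu ^+ 2 + (j != i)%:R * (160 * rho i j ^+ 2 * W)))%:E)%E).
    apply: lee_sum => i Qi; apply: lee_sum => j Qj.
    have [<-|ij] := eqVneq i j; first by rewrite E1// mul1r mul0r addr0 lee_fin lerDl sqr_ge0.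
    by rewrite mul0r add0r mul1r; exact: E2.
  under eq_bigr do rewrite sumEFin.
  rewrite sumEFin lee_fin.
  under eq_bigr do rewrite big_split big_split/=.
  rewrite big_split big_split /= -addrA; apply: lerD; [|apply: lerD].
  - rewrite (eq_bigr (fun=> mu)); first by rewrite sumr_const -mulr_natl.
    move=> i Qi; rewrite (bigD1 i)//= eqxx mul1r big1 ?addr0// => j /andP[_ /negbTE ji].
    by rewrite eq_sym ji mul0r.
  - rewrite sumr_const sumr_const /q -mulrnA -(mulr_natl (mu ^+ 2)) natrM.
    by rewrite le_eqVlt; apply/orP; left; apply/eqP; ring.
  - apply: (@le_trans _ _ (160 * W * \sum_i \sum_(j | j != i) rho i j ^+ 2)); last first.
      have -> : 160 * c * W = 160 * W * c by ring.
      by apply: ler_wpM2l => //; rewrite mulr_ge0.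
    rewrite mulr_sumr [leRHS](bigID Q)/= ler_wpDr//.
      apply: sumr_ge0 => i _; apply: mulr_ge0; first by rewrite mulr_ge0.
      by apply: sumr_ge0 => j _; exact: sqr_ge0.
    apply: ler_sum => i _; rewrite mulr_sumr [leRHS]big_mkcond [leRHS](bigID Q)/= ler_wpDr//.
      apply: sumr_ge0 => j _; case: ifP => // _; apply: mulr_ge0; last exact: sqr_ge0.
      by rewrite mulr_ge0.
    apply: ler_sum => j _; case: ifP => _; last by rewrite mul0r.
    by rewrite mul1r mulrAC.
have V : (\int[P]_w ((N w - q) ^+ 2)%:E <= (q + 160 * c * W)%:E)%E.
  have E : (\int[P]_w ((N w - q) ^+ 2)%:E + (2 * q ^+ 2)%:E =
            \int[P]_w (N w ^+ 2)%:E + (q ^+ 2)%:E)%E.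
    have -> : ((2 * q ^+ 2)%:E = \int[P]_w (2 * q * N w)%:E)%E.
      rewrite ge0_integralZ_EFin//; last by rewrite mulr_ge0.
      rewrite tail_count_mean -/q -EFinM.
      by congr (_%:E); ring.
    have -> : ((q ^+ 2)%:E = \int[P]_w (cst (q ^+ 2)%:E) w)%E.
      by rewrite integral_cst//= probability_setT mule1.
    rewrite -ge0_integralD_EFin//; first last.
    - by move=> w; rewrite mulr_ge0// mulr_ge0.
    - by move=> w; exact: sqr_ge0.
    - exact: measurable_funM.
    rewrite -ge0_integralD_EFin//.
    - by apply: eq_integral => w _; congr (_%:E); rewrite /=; ring.
    - exact: measurable_funX.
    - by move=> w; exact: sqr_ge0.
    - by move=> w; exact: sqr_ge0.
  have h : (\int[P]_w ((N w - q) ^+ 2)%:E + (2 * q ^+ 2)%:E <= (q + 160 * c * W)%:E + (2 * q ^+ 2)%:E)%E.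
    rewrite E; apply: (@le_trans _ _ ((q + q ^+ 2 + 160 * c * W)%:E + (q ^+ 2)%:E)%E).
      exact: leeD.
    by rewrite -!EFinD lee_fin; lra.
  by move: h; rewrite leeD2rE.
have my : measurable [set w | y < `|N w - q|].
  have mm : measurable_fun setT (fun w => `|N w - q|).
    by apply: measurableT_comp => //; exact: measurable_funB.
  have := mm measurableT _ (measurable_itv `]y, +oo[).
  by rewrite setTI; congr (measurable _); apply/seteqP; split => w; rewrite /= in_itv/= andbT.
rewrite -integral_indic_EFin//.
apply: (@le_trans _ _ (\int[P]_w ((y ^+ 2)^-1 * (N w - q) ^+ 2)%:E)%E).
  apply: ge0_le_integral_EFin => //; first exact: measurable_funM.
  move=> w; rewrite indicE; have [|_] := boolP (w \in _); last by rewrite mulr_ge0 ?invr_ge0 ?sqr_ge0.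
  rewrite inE /= => h; rewrite mulrC ler_pdivlMr ?exprn_gt0// mul1r -(real_normK (num_real (N w - q))).
  by rewrite lerXn2r ?nnegrE// ltW.
rewrite ge0_integralZ_EFin//; first last.
- by rewrite invr_ge0 sqr_ge0.
- by move=> w; exact: sqr_ge0.
rewrite mulrC EFinM; apply: lee_wpmul2l => //.
by rewrite lee_fin invr_ge0 sqr_ge0.
Qed.

End Counts.
End GaussianCounts.

Section MeasurableStatistics.
Context (R : realType) (d : measure_display) (T : measurableType d).

Lemma measurable_fun_ltr_set (f g : T -> R) : measurable_fun setT f -> measurable_fun setT g ->
  measurable [set w | f w < g w].
Proof.
move=> mf mg; have mh : measurable_fun setT (fun w => g w - f w) by exact: measurable_funB.
have := mh measurableT _ (measurable_itv `]0, +oo[); rewrite setTI; congr (measurable _).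
by apply/seteqP; split => w; rewrite /= in_itv/= andbT subr_gt0.
Qed.

Lemma measurable_fun_ler_set (f g : T -> R) : measurable_fun setT f -> measurable_fun setT g ->
  measurable [set w | f w <= g w].
Proof.
move=> mf mg; rewrite (_ : [set w | _] = ~` [set w | g w < f w]).
  by apply: measurableC; exact: measurable_fun_ltr_set.
by apply/seteqP; split => w /=; [move=> h; apply/negP; rewrite -leNgt|move/negP; rewrite -leNgt].
Qed.

Lemma measurable_fun_ltr_nat (f g : T -> R) : measurable_fun setT f -> measurable_fun setT g ->
  measurable_fun setT (fun w => ((f w < g w)%R%:R : R)).
Proof.
move=> mf mg; rewrite (_ : (fun w => _) = \1_[set w | f w < g w]).
  by apply: measurable_indic; exact: measurable_fun_ltr_set.
apply/funext => w; rewrite indicE; case: ltP => h; first by rewrite mem_set.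
by rewrite memNset//=; apply/negP; rewrite -leNgt.
Qed.

Lemma measurable_fun_sqrt (f : T -> R) : measurable_fun setT f ->
  measurable_fun setT (fun w => Num.sqrt (f w)).
Proof.
move=> mf; apply: (measurableT_comp _ mf).
by apply: continuous_measurable_fun => x; exact: sqrt_continuous.
Qed.

Lemma measurable_fun_inv (f : T -> R) : measurable_fun setT f ->
  measurable_fun setT (fun w => (f w)^-1).
Proof.
move=> mf; apply: (measurability _ (RGenOInfty.measurableE R)) => // _ [_ [a ->] <-].
rewrite setTI (_ : _ @^-1` _ =
    ([set w | 0 < f w] `&` [set w | a * f w < 1]) `|`
    (([set w | f w < 0] `&` [set w | 1 < a * f w]) `|`
     ([set w | f w <= 0] `&` [set w | 0 <= f w] `&` [set w | a < 0]))).
  have m0 : measurable_fun setT (fun _ : T => 0 : R) by exact: measurable_cst.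
  have m1 : measurable_fun setT (fun _ : T => 1 : R) by exact: measurable_cst.
  have ma : measurable_fun setT (fun _ : T => a : R) by exact: measurable_cst.
  have maf : measurable_fun setT (fun w => a * f w) by exact: measurable_funM.
  apply: measurableU; first by apply: measurableI; exact: measurable_fun_ltr_set.
  apply: measurableU; first by apply: measurableI; exact: measurable_fun_ltr_set.
  apply: measurableI; last exact: measurable_fun_ltr_set.
  by apply: measurableI; exact: measurable_fun_ler_set.
apply/seteqP; split => w; rewrite /= in_itv/= andbT.
  have [f0|f0|f0] := ltgtP 0 (f w).
  - by move=> h; left; split => //; rewrite -ltr_pdivlMr// div1r.
  - move=> h; right; left; split => //.
    by rewrite -(mulVf (ltr0_neq0 f0)) ltr_nM2r.
  - by rewrite -f0 invr0 => h; right; right; split.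
move=> [[f0 h]|[[f0 h]|[[f0 f0'] h]]].
- by rewrite -div1r ltr_pdivlMr.
- by rewrite -(@ltr_nM2r _ (f w))// mulVf// ltr0_neq0.
- by have -> : f w = 0; [apply/eqP; rewrite eq_le f0 f0'|rewrite invr0].
Qed.

Lemma measurable_sqnorm2 (m : nat) (v : T -> mxT R m 1) : measurable_fun setT v ->
  measurable_fun setT (fun w => sqnorm2 (v w)).
Proof.
by move=> /measurable_mxP mv; apply: measurable_fun_bigsum => i; exact: measurable_funX.
Qed.

Lemma measurable_norm1 (m : nat) (v : T -> mxT R m 1) : measurable_fun setT v ->
  measurable_fun setT (fun w => norm1 (v w)).
Proof.
by move=> /measurable_mxP mv; apply: measurable_fun_bigsum => i; exact: measurableT_comp.
Qed.

Lemma measurable_addmx (m k : nat) (u v : T -> mxT R m k) : measurable_fun setT u ->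
  measurable_fun setT v -> measurable_fun setT ((fun w => u w + v w) : T -> mxT R m k).
Proof.
move=> /measurable_mxP mu /measurable_mxP mv; apply/measurable_mxP => i j.
by under eq_fun do rewrite mxE; exact: measurable_funD.
Qed.

Lemma measurable_scalemx (m k : nat) (a : T -> R) (v : T -> mxT R m k) :
  measurable_fun setT a -> measurable_fun setT v ->
  measurable_fun setT ((fun w => a w *: v w) : T -> mxT R m k).
Proof.
move=> ma /measurable_mxP mv; apply/measurable_mxP => i j.
by under eq_fun do rewrite mxE; exact: measurable_funM.
Qed.

Lemma measurable_submx (m k : nat) (v : T -> mxT R m k) : measurable_fun setT v ->
  measurable_fun setT ((fun w => - v w) : T -> mxT R m k).
Proof.
move=> /measurable_mxP mv; apply/measurable_mxP => i j.
by under eq_fun do rewrite mxE; exact: measurableT_comp.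
Qed.

Lemma measurable_colmx (m k : nat) j (v : T -> mxT R m k) : measurable_fun setT v ->
  measurable_fun setT ((fun w => col j (v w)) : T -> mxT R m 1).
Proof.
move=> /measurable_mxP mv; apply/measurable_mxP => i k'.
by under eq_fun do rewrite mxE; exact: mv.
Qed.

Lemma measurable_col'mx (m k : nat) j (v : T -> mxT R m k) : measurable_fun setT v ->
  measurable_fun setT ((fun w => col' j (v w)) : T -> mxT R m k.-1).
Proof.
move=> /measurable_mxP mv; apply/measurable_mxP => i k'.
by under eq_fun do rewrite mxE; exact: mv.
Qed.

Context (n p : nat) (X : T -> 'M[R]_(n, p)) (y : T -> 'cV[R]_n) (b : T -> 'cV[R]_p).
Context (g : 'I_p -> T -> 'cV[R]_p.-1) (l sigma : R).
Hypotheses (rX : random_matrix X) (ry : random_matrix y) (rb : random_matrix b).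
Hypothesis rg : forall j, random_matrix (g j).

Let mX : measurable_fun setT (X : T -> mxT R n p). Proof. exact/random_matrixP. Qed.
Let my : measurable_fun setT (y : T -> mxT R n 1). Proof. exact/random_matrixP. Qed.
Let mb : measurable_fun setT (b : T -> mxT R p 1). Proof. exact/random_matrixP. Qed.
Let mg j : measurable_fun setT (g j : T -> mxT R p.-1 1). Proof. exact/random_matrixP. Qed.

Let mtau j : measurable_fun setT (fun w => tau2 (X w) l (fun j => g j w) j).
Proof.
apply: measurable_funD.
  apply: measurable_funM => //; apply: measurable_sqnorm2; apply: measurable_addmx.
    exact: measurable_colmx.
  by apply: measurable_submx; apply: measurable_mulmx => //; exact: measurable_col'mx.
by apply: measurable_funM => //; exact: measurable_norm1.
Qed.

Let mTheta : measurable_fun setT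
  ((fun w => Theta_hat (X w) l (fun j => g j w)) : T -> mxT R p p).
Proof.
apply/measurable_mxP => i j; under eq_fun do rewrite mxE.
case: (unlift i j) => [k|]; last exact: measurable_fun_inv.
apply: measurable_funM; last by move/measurable_mxP : (mg i); exact.
by apply: measurableT_comp => //; exact: measurable_fun_inv.
Qed.

Lemma measurable_zstat j : measurable_fun setT
  (fun w => zstat (X w) (y w) (b w) l (fun j => g j w) sigma j).
Proof.
have mSig : measurable_fun setT ((fun w => Sigma_hat (X w)) : T -> mxT R p p).
  apply: measurable_scalemx => //; apply: measurable_mulmx => //; exact: measurable_trmx.
have mOm : measurable_fun setT ((fun w => Omega_hat (X w) l (fun j => g j w)) : T -> mxT R p p).
  apply: measurable_mulmx; last exact: measurable_trmx.
  exact: measurable_mulmx.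
have mD : measurable_fun setT ((fun w => debiased (X w) (y w) (b w) l (fun j => g j w)) : T -> mxT R p 1).
  apply: measurable_addmx => //; apply: measurable_scalemx => //.
  apply: measurable_mulmx; first by apply: measurable_mulmx => //; exact: measurable_trmx.
  by apply: measurable_addmx => //; apply: measurable_submx; exact: measurable_mulmx.
apply: measurable_funM; last first.
  by apply: measurable_fun_inv; apply: measurable_fun_sqrt; move/measurable_mxP : mOm; exact.
apply: measurable_funM => //; apply: measurable_funM => //.
by move/measurable_mxP : mD; exact.
Qed.

Lemma measurable_FP (beta : 'cV[R]_p) (t : R) : measurable_fun setT
  (fun w => (FP beta (zstat (X w) (y w) (b w) l (fun j => g j w) sigma) t)%:R : R).
Proof.
rewrite /FP; under eq_fun do rewrite natr_sum; apply: measurable_fun_bigsum => j.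
by apply: measurable_fun_ltr_nat => //; apply: measurableT_comp => //; exact: measurable_zstat.
Qed.

End MeasurableStatistics.

Section ProbabilityBounds.
Context (R : realType) (d : measure_display) (T : measurableType d)
  (P : probability T R).

Lemma Phi_nondecreasing (s t : R) : 0 <= s <= t -> Phi (- t) <= Phi (- s).
Proof. by move=> /andP[s0 st]; have /andP[] := Phi_lipschitz s0 st; rewrite subr_ge0. Qed.

Lemma gaussian_vector_tail (m : nat) (Z : T -> 'cV[R]_m) (sigma : R) (a : 'cV[R]_m) (b t : R) :
  gaussian_vector P Z (sigma ^+ 2)%:M -> 0 < sigma -> sqnorm2 a <= b ^+ 2 -> 0 < b -> 0 <= t ->
  measurable [set w | (sigma * b * t < `|(a^T *m Z w) 0 0|)%R] /\
  (P [set w | (sigma * b * t < `|(a^T *m Z w) 0 0|)%R] <= (2 * Phi (- t))%:E)%E.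
Proof.
move=> gZ s0 ab b0 t0; have rZ : random_matrix Z by case: gZ.
have mZ : measurable_fun setT (fun w => (a^T *m Z w) 0 0).
  move/random_matrixP : rZ => mZ.
  have := @measurable_mulmx R _ T _ _ _ (cst a^T) _ (measurable_cst _) mZ.
  by move=> /measurable_mxP H; exact: H.
have mE : measurable [set w | sigma * b * t < `|(a^T *m Z w) 0 0|].
  by apply: measurable_fun_ltr_set => //; exact: measurableT_comp.
split => //; have [a0|a0] := eqVneq (sqnorm2 a) 0.
  rewrite (_ : [set w | _] = set0) ?measure0 ?lee_fin ?mulr_ge0 ?Phi_ge0//.
  apply/seteqP; split => // w /=; have -> : a = 0.
    by apply/colP => i; rewrite mxE; apply/eqP; rewrite -sqrf_eq0 eq_le sqr_ge0 andbT -a0 coord_sqnorm2.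
  by rewrite trmx0 mul0mx mxE normr0 ltNge !mulr_ge0// ltW.
have ap : 0 < sqnorm2 a by rewrite lt_neqAle eq_sym a0 sqnorm2_ge0.
pose N := Num.sqrt (sqnorm2 a).
have N0 : 0 < N by rewrite sqrtr_gt0.
have N2 : N ^+ 2 = sqnorm2 a by rewrite sqr_sqrtr// ltW.
have Nb : N <= b by rewrite -(@ler_pXn2r _ 2) ?nnegrE ?(ltW N0) ?(ltW b0)// N2.
pose a' := (sigma * N)^-1 *: a.
have sN : 0 < sigma * N by rewrite mulr_gt0.
have a1 : (a'^T *m (sigma ^+ 2)%:M *m a') 0 0 = 1.
  rewrite -/(bform _ a' a') -scalemx1 bformZm bform1.
  have -> : sqnorm2 a' = (sigma * N)^-1 ^+ 2 * sqnorm2 a.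
    by rewrite /sqnorm2 mulr_sumr; apply: eq_bigr => i _; rewrite mxE exprMn.
  by rewrite -N2; field; rewrite !gt_eqF.
rewrite -normal_abs_tail// -(gaussian_vector_std gZ a1 (measurable_abs_tail t)).
apply: le_measure; rewrite ?inE//.
  have ma' : measurable_fun setT (fun w => (a'^T *m Z w) 0 0).
    move/random_matrixP : rZ => mZ'.
    have := @measurable_mulmx R _ T _ _ _ (cst a'^T) _ (measurable_cst _) mZ'.
    by move=> /measurable_mxP H; exact: H.
  by apply: measurable_fun_ltr_set => //; exact: measurableT_comp.
move=> w /=; have -> : (a'^T *m Z w) 0 0 = (sigma * N)^-1 * (a^T *m Z w) 0 0.
  have -> : a'^T = (sigma * N)^-1 *: a^T by rewrite /a' linearZ.
  by rewrite -scalemxAl mxE.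
move=> h; rewrite normrM normfV (ger0_norm (ltW sN)) mulrC ltr_pdivlMr//.
apply: le_lt_trans h; rewrite mulrC; apply: ler_wpM2r => //.
by rewrite ler_pM2l.
Qed.

Lemma atom_sums_probability (n p m : nat) (X : T -> 'M[R]_(n, p)) (S : 'M[R]_p)
    (I : finType) (a : I -> 'cV[R]_p) (c x : R) :
  iid_gaussian_rows P X S -> (0 < n)%N -> 0 <= x <= 1 ->
  0 < c -> (forall v, c * sqnorm2 v <= bform S v v) ->
  exists E : set T, [/\ measurable E,
    (P E <= ((#|I|%:R * 2) ^+ m * (2 * expR (- (n%:R * x ^+ 2 / 16))))%:E)%E &
    forall w, ~ E w -> atom_sums_bounded a S (Sigma_hat (X w) - S) m x].
Proof.
move=> iX n0 x01 c0 Sc; pose v (s : m.-tuple (I * bool)) := \sum_(i <- s) signed_atom a i.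
have vS (u : 'cV[R]_p) : u = 0 \/ 0 < (u^T *m S *m u) 0 0.
  have [u0|u0] := eqVneq (sqnorm2 u) 0.
    left; apply/colP => i; rewrite mxE; apply/eqP.
    by rewrite -sqrf_eq0 eq_le sqr_ge0 andbT -u0 coord_sqnorm2.
  right; apply: lt_le_trans (Sc u); rewrite mulr_gt0// lt_neqAle eq_sym u0.
  exact: sqnorm2_ge0.
have H (s : m.-tuple (I * bool)) := chi2_concentration iX n0 x01 (vS (v s)).
have [mE PE] := finite_union_bound (fun s => (H s).1) (fun s => (H s).2).
exists [set w | exists s, x * ((v s)^T *m S *m v s) 0 0 <
  `|((v s)^T *m Sigma_hat (X w) *m v s) 0 0 - ((v s)^T *m S *m v s) 0 0|]; split => //.
  by move: PE; rewrite card_tuple card_prod card_bool natrX natrM.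
move=> w nE s sm /=; rewrite leNgt; apply/negP => h; apply: nE.
have ss : size s == m by rewrite sm.
exists (Tuple ss); rewrite /v /=; move: h; rewrite bformBm.
by [].
Qed.

Lemma noise_probability (n p : nat) (X : T -> 'M[R]_(n, p)) (eps : T -> 'cV[R]_n)
    (sigma rho : R) :
  random_matrix X -> gaussian_noise_given P X sigma eps -> 0 < sigma -> (0 < n)%N -> 0 <= rho ->
  let E := [set w | (forall k, sqnorm2 (col k (X w)) <= 2 * n%:R) /\
     (exists k, 4 * sigma * rho < `|((eps w)^T *m X w) 0 k / n%:R|)] in
  measurable E /\ (P E <= (p%:R * (2 * Phi (- (rho * Num.sqrt (8 * n%:R)))))%:E)%E.
Proof.
move=> rX [gE iXe] s0 n0 rho0 E; have re : random_matrix eps by case: gE.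
have nR : 0 < n%:R :> R by rewrite ltr0n.
pose A : set (mxT R n p) := [set M | forall k, sqnorm2 (col k M) <= 2 * n%:R].
pose D : set (mxT R n p * mxT R n 1) :=
  [set z | exists k, 4 * sigma * rho < `|(z.2^T *m z.1) 0 k / n%:R|].
have mA : measurable A.
  rewrite (_ : A = \bigcap_(k in [set: 'I_p]) [set M | sqnorm2 (col k M) <= 2 * n%:R]).
    apply: fin_bigcap_measurable => // k _; apply: measurable_fun_ler_set => //.
    by apply: measurable_sqnorm2; apply: measurable_colmx; exact: measurable_id.
  by apply/seteqP; split => [M H k _|M H k]; exact: H.
have mD : measurable D.
  rewrite (_ : D = \bigcup_(k in [set: 'I_p]) [set z | 4 * sigma * rho < `|(z.2^T *m z.1) 0 k / n%:R|]).
    apply: fin_bigcup_measurable => // k _; apply: measurable_fun_ltr_set => //.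
    apply: measurableT_comp => //; apply: measurable_funM => //.
    have mm := @measurable_mulmx R _ (mxT R n p * mxT R n 1)%type _ _ _
      (fun z => (z.2)^T) (fun z => z.1) (measurable_trmx measurable_snd) measurable_fst.
    by move/measurable_mxP : mm; exact.
  by apply/seteqP; split => z [k]; [exists k|exists k].
have q0 : 0 <= p%:R * (2 * Phi (- (rho * Num.sqrt (8 * n%:R)))) by rewrite mulr_ge0// mulr_ge0// Phi_ge0.
have := @independent_cond_bound R _ T P n p n 1 X eps A D _ q0 rX re iXe mA mD.
apply => M AM; rewrite /D /=.
have b0 : 0 < Num.sqrt (2 * n%:R) :> R by rewrite sqrtr_gt0 mulr_gt0.
have b2 : Num.sqrt (2 * n%:R) ^+ 2 = 2 * n%:R :> R by rewrite sqr_sqrtr// mulr_ge0// ltW.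
have t0 : 0 <= rho * Num.sqrt (8 * n%:R) by rewrite mulr_ge0 ?sqrtr_ge0.
have H k := @gaussian_vector_tail n eps sigma (col k M) (Num.sqrt (2 * n%:R)) _ gE s0
  (ltac:(rewrite b2; exact: AM)) b0 t0.
have [_ PE] := finite_union_bound (fun k => (H k).1) (fun k => (H k).2).
move: PE; rewrite card_ord; apply: le_trans.
have s8 : Num.sqrt (8 * n%:R) = 2 * Num.sqrt (2 * n%:R) :> R.
  have -> : 8 * n%:R = 2 ^+ 2 * (2 * n%:R) :> R by ring.
  by rewrite (sqrtrM _ (sqr_ge0 2)) sqrtr_sqr ger0_norm.
have sE : sigma * Num.sqrt (2 * n%:R) * (rho * Num.sqrt (8 * n%:R)) = 4 * sigma * rho * n%:R.
  rewrite s8; transitivity (2 * sigma * rho * Num.sqrt (2 * n%:R) ^+ 2); first by ring.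
  by rewrite b2; ring.
have tE w k : ((col k M)^T *m eps w) 0 0 = ((eps w)^T *m M) 0 k.
  by rewrite !mxE; apply: eq_bigr => i _; rewrite !mxE mulrC.
have iE w k : (4 * sigma * rho < `|((eps w)^T *m M) 0 k / n%:R|) =
    (sigma * Num.sqrt (2 * n%:R) * (rho * Num.sqrt (8 * n%:R)) < `|((col k M)^T *m eps w) 0 0|).
  by rewrite sE tE normrM normfV (ger0_norm (ltW nR)) ltr_pdivlMr.
rewrite le_eqVlt; apply/orP; left; apply/eqP; congr (P _).
by apply/seteqP; split => w [k h]; exists k; move: h; rewrite /= iE.
Qed.

End ProbabilityBounds.

Section ResidualCounts.
Context (R : realType) (d : measure_display) (T : measurableType d)
  (P : probability T R).

Definition score_stat (n p : nat) (sigma : R) (M : 'M[R]_(n, p)) (e : 'cV[R]_n) (j : 'I_p) : R :=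
  ((col j M)^T *m e) 0 0 / (sigma * Num.sqrt (sqnorm2 (col j M))).

Definition score_count (n p : nat) (sigma : R) (J : pred 'I_p) (t : R) (M : 'M[R]_(n, p))
    (e : 'cV[R]_n) : R :=
  \sum_(j | J j) (t < `|score_stat sigma M e j|)%R%:R.

Variables (n p : nat) (V : T -> 'M[R]_(n, p)) (eps : T -> 'cV[R]_n).
Variables (sigma a0 B t : R) (J : pred 'I_p).
Hypotheses (n0 : (0 < n)%N) (s0 : 0 < sigma) (a00 : 0 < a0) (B0 : 0 <= B) (t0 : 0 <= t).
Hypotheses (rV : random_matrix V) (gE : gaussian_vector P eps (sigma ^+ 2)%:M).
Hypothesis iVe : independent P V eps.
Let mu : R := 2 * Phi (- t).

Definition well_spread (a0 B : R) (M : 'M[R]_(n, p)) : Prop :=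
  (forall j, a0 * n%:R <= sqnorm2 (col j M)) /\
  \sum_j \sum_(k | k != j) (((col j M)^T *m col k M) 0 0 / n%:R) ^+ 2 <= B.

Let nR : 0 < n%:R :> R. Proof. by rewrite ltr0n. Qed.

Let re : random_matrix eps. Proof. by case: gE. Qed.

Let measurable_spread : measurable (well_spread a0 B : set (mxT R n p)).
Proof.
rewrite (_ : (well_spread a0 B : set (mxT R n p)) =
  (\bigcap_(j in [set: 'I_p]) [set M : mxT R n p | a0 * n%:R <= sqnorm2 (col j M)]) `&`
  [set M : mxT R n p | \sum_j \sum_(k | k != j) (((col j M)^T *m col k M) 0 0 / n%:R) ^+ 2 <= B]).
  apply: measurableI.
    apply: fin_bigcap_measurable => // j _; apply: measurable_fun_ler_set => //.
    by apply: measurable_sqnorm2; apply: measurable_colmx; exact: measurable_id.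
  apply: measurable_fun_ler_set => //; apply: measurable_fun_bigsum => j.
  apply: measurable_fun_bigsum => k; apply: measurable_funX; apply: measurable_funM => //.
  have mc i : measurable_fun setT ((fun M : mxT R n p => col i M) : mxT R n p -> mxT R n 1).
    by apply: measurable_colmx; exact: measurable_id.
  have mm := measurable_mulmx (measurable_trmx (mc j)) (mc k).
  by move/measurable_mxP : mm; exact.
by apply/seteqP; split => M [H1 H2]; split => // j; [move=> _|]; exact: H1.
Qed.

Let measurable_score j : measurable_fun setT
  (fun z : mxT R n p * mxT R n 1 => score_stat sigma z.1 z.2 j).
Proof.
have mc : measurable_fun setT ((fun z : mxT R n p * mxT R n 1 => col j z.1) : _ -> mxT R n 1).
  by apply: measurable_colmx; exact: measurable_fst.
apply: measurable_funM.
  have mm := measurable_mulmx (measurable_trmx mc) measurable_snd.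
  by move/measurable_mxP : mm; exact.
apply: measurable_fun_inv; apply: measurable_funM => //; apply: measurable_fun_sqrt.
exact: measurable_sqnorm2.
Qed.

Let measurable_count : measurable_fun setT
  (fun z : mxT R n p * mxT R n 1 => score_count sigma J t z.1 z.2).
Proof.
apply: measurable_fun_bigsum => j; apply: measurable_fun_ltr_nat => //.
exact: measurableT_comp.
Qed.

Section FixedMatrix.
Variable M : 'M[R]_(n, p).
Hypothesis AM : well_spread a0 B M.
Let u j : 'cV[R]_n := (Num.sqrt (sqnorm2 (col j M)))^-1 *: col j M.
Let U j w := score_stat sigma M (eps w) j.
Let rho j k : R := ((u j)^T *m u k) 0 0.

Let sq_pos j : 0 < sqnorm2 (col j M).
Proof. by case: AM => H _; apply: lt_le_trans (H j); rewrite mulr_gt0. Qed.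

Let sqrt_pos j : 0 < Num.sqrt (sqnorm2 (col j M)). Proof. by rewrite sqrtr_gt0. Qed.

Let sqrt_sq j : Num.sqrt (sqnorm2 (col j M)) ^+ 2 = sqnorm2 (col j M).
Proof. by rewrite sqr_sqrtr// ltW. Qed.

Let unit_u j : sqnorm2 (u j) = 1.
Proof.
have -> : sqnorm2 (u j) = (Num.sqrt (sqnorm2 (col j M)))^-1 ^+ 2 * sqnorm2 (col j M).
  by rewrite /sqnorm2 mulr_sumr; apply: eq_bigr => i _; rewrite mxE exprMn.
by rewrite -[X in _ * X]sqrt_sq; field; rewrite gt_eqF.
Qed.

Let UE j w : U j w = ((sigma^-1 *: u j)^T *m eps w) 0 0.
Proof.
rewrite /U /score_stat /u scalerA; set q := Num.sqrt _.
have -> : ((sigma^-1 / q) *: col j M)^T = (sigma^-1 / q) *: (col j M)^T by rewrite linearZ.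
by rewrite -scalemxAl [RHS]mxE invfM mulrC.
Qed.

Let mU j : measurable_fun setT (U j).
Proof.
have me : measurable_fun setT (eps : T -> mxT R n 1) by exact/random_matrixP.
rewrite (_ : U j = fun w => ((sigma^-1 *: u j)^T *m eps w) 0 0); last first.
  by apply/funext => w; exact: UE.
have := @measurable_mulmx R _ T _ _ _ (cst (sigma^-1 *: u j)^T) _ (measurable_cst _) me.
by move=> /measurable_mxP H; exact: H.
Qed.

Let law2 j k (a b : R) : a ^+ 2 + b ^+ 2 + 2 * rho j k * a * b = 1 ->
  forall D : set (measurableTypeR R), measurable D ->
  P [set w | D (a * U j w + b * U k w)] = normal_prob 0 1 D.
Proof.
move=> ab D mD; pose v := sigma^-1 *: (a *: u j + b *: u k).
have v1 : (v^T *m (sigma ^+ 2)%:M *m v) 0 0 = 1.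
  rewrite -/(bform _ v v) -scalemx1 bformZm /v (bformZl _ sigma^-1) (bformZr _ sigma^-1).
  rewrite bform_sq_add ?tr_scalar_mx// !(bformZl _ a) !(bformZr _ a) !(bformZl _ b) !(bformZr _ b).
  rewrite !bform1 !unit_u.
  have -> : bform 1%:M (u j) (u k) = rho j k by rewrite /bform mulmx1.
  have -> : sigma ^+ 2 * (sigma^-1 * (sigma^-1 * (a * (a * 1) +
      2 * (a * (b * rho j k)) + b * (b * 1)))) = a ^+ 2 + b ^+ 2 + 2 * rho j k * a * b.
    by field; rewrite gt_eqF.
  by [].
rewrite -(gaussian_vector_std gE v1 mD); congr (P _); apply/seteqP; split => w /=.
  all: have -> : (v^T *m eps w) 0 0 = a * U j w + b * U k w; last by [].
  all: rewrite !UE /v; have E (z : 'cV[R]_n) : (z^T *m eps w) 0 0 = bform 1%:M z (eps w)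
    by rewrite /bform mulmx1.
  all: by rewrite !E !(bformZl _ sigma^-1) bformDl (bformZl _ a) (bformZl _ b); ring.
Qed.

Let law1 j : J j -> forall D : set (measurableTypeR R), measurable D ->
  P [set w | D (U j w)] = normal_prob 0 1 D.
Proof.
move=> _ D mD; have H : (1 : R) ^+ 2 + 0 ^+ 2 + 2 * rho j j * 1 * 0 = 1 by ring.
rewrite -(law2 H mD); congr (P _); apply/seteqP.
by split => w /=; rewrite mul1r mul0r addr0.
Qed.

Let rho1 j k : j != k -> `|rho j k| <= 1.
Proof.
move=> _; have := sqnorm2_ge0 (u j - u k); have := sqnorm2_ge0 (u j - (- u k)).
rewrite !sqnorm2B mulmxN unit_u unit_u.
have -> : sqnorm2 (- u k) = 1.
  by rewrite -(unit_u k); apply: eq_bigr => i _; rewrite mxE sqrrN.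
have N00 (Z : 'M[R]_1) : (- Z) 0 0 = - Z 0 0 by rewrite mxE.
rewrite N00 -/(rho j k) ler_norml => h1 h2; apply/andP; split; lra.
Qed.

Let rho_sum : \sum_j \sum_(k | k != j) rho j k ^+ 2 <= B / a0 ^+ 2.
Proof.
case: AM => H HB; rewrite ler_pdivlMr ?exprn_gt0//; apply: le_trans HB.
rewrite mulr_suml; apply: ler_sum => j _; rewrite mulr_suml; apply: ler_sum => k _.
set q := ((col j M)^T *m col k M) 0 0.
have -> : rho j k = q / (Num.sqrt (sqnorm2 (col j M)) * Num.sqrt (sqnorm2 (col k M))).
  rewrite /rho -(mulmx1 ((u j)^T)) -/(bform 1%:M (u j) (u k)) /u bformZl bformZr.
  have -> : bform 1%:M (col j M) (col k M) = q by rewrite /bform mulmx1.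
  by field; rewrite !gt_eqF.
rewrite !exprMn !exprVn exprMn !sqrt_sq -mulrA; apply: ler_wpM2l; first exact: sqr_ge0.
have jk := mulr_gt0 (sq_pos j) (sq_pos k).
rewrite mulrC ler_pdivrMr// mulrC ler_pdivlMr ?exprn_gt0//.
have -> : a0 ^+ 2 * n%:R ^+ 2 = (a0 * n%:R) * (a0 * n%:R) by ring.
by apply: ler_pM => //; rewrite mulr_ge0 ?ltW.
Qed.

Lemma fixed_count_chebyshev (y : R) : 0 < y ->
  (P [set w | (y < `|score_count sigma J t M (eps w) - #|J|%:R * mu|)%R] <=
    ((#|J|%:R * mu + 160 * (B / a0 ^+ 2) * ((1 + t ^+ 2) ^+ 2 * expR (- (t ^+ 2 / 2)))) / y ^+ 2)%:E)%E.
Proof.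
move=> y0; exact: (tail_count_chebyshev mU t0 law1 rho1
  (fun i j _ _ _ a b H => @law2 i j a b H) y0 rho_sum).
Qed.

Lemma fixed_count_markov (y : R) : 0 < y ->
  (P [set w | (y < score_count sigma J t M (eps w))%R] <= (#|J|%:R * mu / y)%:E)%E.
Proof. by move=> y0; exact: (tail_count_markov mU t0 law1 y0). Qed.

End FixedMatrix.

Lemma score_count_chebyshev (y : R) : 0 < y ->
  let E := [set w | well_spread a0 B (V w) /\
    (y < `|score_count sigma J t (V w) (eps w) - #|J|%:R * mu|)%R] in
  measurable E /\ (P E <= ((#|J|%:R * mu +
    160 * (B / a0 ^+ 2) * ((1 + t ^+ 2) ^+ 2 * expR (- (t ^+ 2 / 2)))) / y ^+ 2)%:E)%E.
Proof.
move=> y0 E.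
pose D : set (mxT R n p * mxT R n 1) :=
  [set z | y < `|score_count sigma J t z.1 z.2 - #|J|%:R * mu|].
have mD : measurable D.
  apply: measurable_fun_ltr_set => //; apply: measurableT_comp => //.
  exact: measurable_funB.
have c0 : 0 <= (#|J|%:R * mu +
    160 * (B / a0 ^+ 2) * ((1 + t ^+ 2) ^+ 2 * expR (- (t ^+ 2 / 2)))) / y ^+ 2.
  apply: divr_ge0; last exact: sqr_ge0.
  apply: addr_ge0; first by rewrite mulr_ge0// mulr_ge0// Phi_ge0.
  apply: mulr_ge0; last by rewrite mulr_ge0 ?sqr_ge0 ?expR_ge0.
  by rewrite mulr_ge0// divr_ge0// sqr_ge0.
apply: (@independent_cond_bound R _ T P n p n 1 V eps _ D _ c0 rV re iVe measurable_spread mD).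
by move=> M AM; exact: fixed_count_chebyshev.
Qed.

Lemma score_count_markov (y : R) : 0 < y ->
  let E := [set w | well_spread a0 B (V w) /\ (y < score_count sigma J t (V w) (eps w))%R] in
  measurable E /\ (P E <= (#|J|%:R * mu / y)%:E)%E.
Proof.
move=> y0 E.
pose D : set (mxT R n p * mxT R n 1) := [set z | y < score_count sigma J t z.1 z.2].
have mD : measurable D by exact: measurable_fun_ltr_set.
have c0 : 0 <= #|J|%:R * mu / y.
  by apply: divr_ge0; [rewrite mulr_ge0// mulr_ge0// Phi_ge0|exact: ltW].
apply: (@independent_cond_bound R _ T P n p n 1 V eps _ D _ c0 rV re iVe measurable_spread mD).
by move=> M AM; exact: fixed_count_markov.
Qed.

End ResidualCounts.

Section Sandwich.
Context (R : realType) (p : nat).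

Lemma count_sandwich (J E1 E2 : pred 'I_p) (z u : 'I_p -> R) (t del : R) :
  (forall j, J j -> ~~ E1 j -> ~~ E2 j -> `|z j - u j| <= del) ->
  \sum_(j | J j) ((t < `|z j|)%R%:R : R) <=
    \sum_(j | J j) ((t - del < `|u j|)%R%:R : R) + (#|E1|%:R + #|E2|%:R) /\
  \sum_(j | J j) ((t + del < `|u j|)%R%:R : R) <=
    \sum_(j | J j) ((t < `|z j|)%R%:R : R) + (#|E1|%:R + #|E2|%:R).
Proof.
move=> H; have cE (E : pred 'I_p) : \sum_(j | J j) ((E j)%:R : R) <= #|E|%:R.
  rewrite -sum1_card natr_sum [leRHS]big_mkcond [leLHS]big_mkcond; apply: ler_sum => j _.
  by rewrite unfold_in; case: (J j); case: (E j).
have T (f g : 'I_p -> bool) : (forall j, J j -> ~~ E1 j -> ~~ E2 j -> f j -> g j) ->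
    \sum_(j | J j) ((f j)%:R : R) <= \sum_(j | J j) ((g j)%:R : R) + (#|E1|%:R + #|E2|%:R).
  move=> fg; apply: (@le_trans _ _ (\sum_(j | J j) ((g j)%:R + ((E1 j)%:R + (E2 j)%:R)))).
    apply: ler_sum => j Jj; have [ff|_] := boolP (f j); last by rewrite !addr_ge0.
    have [gg|ng] := boolP (g j); first by rewrite lerDl addr_ge0.
    have [e1|ne1] := boolP (E1 j); first by rewrite add0r lerDl.
    have [e2|ne2] := boolP (E2 j); first by rewrite !add0r.
    by move: ng; rewrite fg.
  by rewrite !big_split /=; apply: lerD => //; apply: lerD; exact: cE.
split; apply: T => j Jj e1 e2; have := H j Jj e1 e2 => h.
  have := ler_distD 0 (z j) (u j); rewrite subr0 sub0r normrN => _ tz.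
  have := ler_normD (z j - u j) (u j); rewrite subrK; lra.
move=> tu; have := ler_normD (u j - z j) (z j); rewrite subrK distrC; lra.
Qed.

End Sandwich.

(** * Finite-sample deviation bounds *)

Section FiniteSample.
Context (R : realType) (d : measure_display) (T : measurableType d)
  (P : probability T R) (n p : nat).
Variables (X : T -> 'M[R]_(n, p)) (S : 'M[R]_p) (beta : 'cV[R]_p) (sigma : R).
Variables (eps : T -> 'cV[R]_n) (bhat : T -> 'cV[R]_p) (ghat : 'I_p -> T -> 'cV[R]_p.-1).
Variables (c kappa om : R).
Let s := #|signals beta|.
Let m := (s_max S).+1.
Let rho : R := Num.sqrt (n%:R^-1 * ln p%:R).
Let xL : R := 8 * Num.sqrt s.+1%:R * rho.
Let xN : R := 8 * Num.sqrt m.+1%:R * rho.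
Let y w := X w *m beta + eps w.
Hypotheses (n0 : (0 < n)%N) (rho0 : 0 < rho) (c0 : 0 < c) (c1 : c <= 1).
Hypotheses (sS : S^T = S) (Sc : forall v, c * sqnorm2 v <= bform S v v).
Hypothesis S1 : forall j, S j j <= 1.
Hypotheses (sigma0 : 0 < sigma) (s0 : (0 < s)%N) (kap24 : 24 <= kappa).
Hypotheses (iX : iid_gaussian_rows P X S) (gX : gaussian_noise_given P X sigma eps).
Hypotheses (rb : random_matrix bhat) (rg : forall j, random_matrix (ghat j)).
Hypothesis lb : forall w, is_lasso (y w) (X w) (8 * sigma * rho) (bhat w).
Hypothesis lg : forall j w, is_lasso (col j (X w)) (col' j (X w)) (kappa * rho) (ghat j w).
Hypotheses (rho12 : 12 * rho <= 1) (xLc : xL <= (c / 100) ^+ 2) (xNc : xN <= (c / 100) ^+ 2).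
Hypothesis mrho : m%:R * (kappa * rho) ^+ 2 <= c.
Hypotheses (om0 : 0 < om) (om1 : om <= 1).

Let K : R := 200 / (om * c ^+ 2).

Definition residual_matrix w : 'M[R]_(n, p) :=
  \matrix_(i, j) (X w *m nodewise_vec j (ghat j w)) i 0.

Definition bias_level : R := 16 * K * Num.sqrt n%:R * rho / c *
  (34 * kappa * rho * Num.sqrt m%:R / c +
   Num.min (24 * s%:R * kappa * rho / c) (xL + 12 * rho + 84 * m%:R * kappa * rho / c)).

Definition correlation_level : R :=
  592 * p%:R / c + 2308 * p%:R ^+ 2 * m%:R * (kappa * rho) ^+ 2 / c.

Definition failure_level : R :=
  (4 * p%:R) ^+ 2 * (2 * expR (- (n%:R * (12 * rho) ^+ 2 / 16))) +
  (4 * p%:R) ^+ s.+1 * (2 * expR (- (n%:R * xL ^+ 2 / 16))) +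
  (4 * p%:R) ^+ m.+1 * (2 * expR (- (n%:R * xN ^+ 2 / 16))) +
  p%:R * (2 * Phi (- (rho * Num.sqrt (8 * n%:R)))).

Let J : pred 'I_p := [pred j | j \in nulls beta].
Let FPt w t : R := (FP beta (zstat (X w) (y w) (bhat w) (kappa * rho) (fun j => ghat j w) sigma) t)%:R.
Let cnt w t : R := score_count sigma J t (residual_matrix w) (eps w).

Let col_residual w j : col j (residual_matrix w) = X w *m nodewise_vec j (ghat j w).
Proof. by apply/colP => i; rewrite !mxE. Qed.

Let lam0 : 0 < 8 * sigma * rho. Proof. by rewrite !mulr_gt0. Qed.
Let l0 : 0 < kappa * rho.
Proof. by rewrite mulr_gt0// (lt_le_trans _ kap24). Qed.
Let xL0 : 0 < xL. Proof. by rewrite !mulr_gt0// sqrtr_gt0 ltr0n. Qed.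
Let xN0 : 0 < xN. Proof. by rewrite !mulr_gt0// sqrtr_gt0 ltr0n. Qed.
Let rX : random_matrix X. Proof. by case: iX. Qed.

Let nulls0 j : J j -> beta j 0 = 0.
Proof. by rewrite /J /= inE => /eqP. Qed.

Lemma good_event : exists E : set T, [/\ measurable E, (P E <= failure_level%:E)%E &
  forall w, ~ E w -> well_spread (c / 4) correlation_level (residual_matrix w) /\
    forall t, FPt w t <= cnt w (t - bias_level) + 2 * om * s%:R /\
              cnt w (t + bias_level) <= FPt w t + 2 * om * s%:R].
Proof.
have le1 (x : R) : x <= (c / 100) ^+ 2 -> x <= 1.
  by move: c0 c1 => c0' c1'; rewrite expr2; nra.
have x2b : 0 <= 12 * rho <= 1 by rewrite rho12 mulr_ge0// ltW.
have xLb : 0 <= xL <= 1 by rewrite (ltW xL0) le1.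
have xNb : 0 <= xN <= 1 by rewrite (ltW xN0) le1.
have [E2 [mE2 PE2 H2]] := atom_sums_probability 2 (design_atom S) iX n0 x2b c0 Sc.
have [EL [mEL PEL HL]] := atom_sums_probability s.+1 (design_atom S) iX n0 xLb c0 Sc.
have [EN [mEN PEN HN]] := atom_sums_probability m.+1 (design_atom S) iX n0 xNb c0 Sc.
have [mEe PEe] := noise_probability rX gX sigma0 n0 (ltW rho0).
set Ee := [set w | _ /\ _] in mEe PEe.
have cardE : #|{: 'I_p + 'I_p}|%:R * 2 = 4 * p%:R :> R.
  by rewrite card_sum card_ord natrD; ring.
rewrite cardE in PE2 PEL PEN.
exists (E2 `|` EL `|` EN `|` Ee); split.
- by apply: measurableU => //; apply: measurableU => //; exact: measurableU.
- rewrite /failure_level !EFinD; apply: le_trans (measureU2 _ _ _) _ => //.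
    by apply: measurableU => //; exact: measurableU.
  apply: leeD => //; apply: le_trans (measureU2 _ _ _) _ => //; first exact: measurableU.
  by apply: leeD => //; apply: le_trans (measureU2 _ _ _) _ => //; exact: leeD.
move=> w nE.
have {}H2 : atom_sums_bounded (design_atom S) S (Sigma_hat (X w) - S) 2 (12 * rho).
  by apply: H2 => h; apply: nE; left; left; left.
have {}HL : atom_sums_bounded (design_atom S) S (Sigma_hat (X w) - S) s.+1 xL.
  by apply: HL => h; apply: nE; left; left; right.
have {}HN : atom_sums_bounded (design_atom S) S (Sigma_hat (X w) - S) m.+1 xN.
  by apply: HN => h; apply: nE; left; right.
have nR : 0 < n%:R :> R by rewrite ltr0n.
have noise k : `|((eps w)^T *m X w) 0 k / n%:R| <= 8 * sigma * rho / 2.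
  rewrite leNgt; apply/negP => h; apply: nE; right; split => [j|].
    have := design_entry_le2 c0 sS Sc S1 j j x2b H2.
    rewrite bform_Sigma_hat_sq ler_norml -colE => /andP[_].
    by rewrite ler_pdivrMr.
  by exists k; apply: le_lt_trans h; rewrite le_eqVlt; apply/orP; left; apply/eqP; field.
have l2 : 2 * (12 * rho) <= kappa * rho.
  by rewrite mulrA ler_pM2r//; apply: le_trans kap24; lra.
have smm : (s_max S < m)%N by exact: ltnSn.
have m0 : (0 < m)%N by [].
have rates j := nodewise_rates c0 c1 sS Sc S1 m0 smm x2b H2 l2 l0 (ltW xN0) xNc HN mrho (lg j w).
split.
  split => [j|].
    rewrite col_residual; have [_ _ _] := rates j.
    by rewrite ler_pdivlMr.
  have := nodewise_cross_sum c0 c1 sS Sc S1 m0 smm x2b H2 l2 l0 (ltW xN0) xNc HN mrho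
    (g := fun j => ghat j w) (fun j => lg j w).
  apply: le_trans; apply: ler_sum => j _; apply: ler_sum => k _.
  by rewrite bform_Sigma_hat !col_residual.
move=> t.
have K24 : 24 / (om * c) <= K.
  have omc : 0 < om * c by rewrite mulr_gt0.
  have -> : 24 / (om * c) = 24 * c / (om * c ^+ 2) by field; rewrite !gt_eqF.
  rewrite /K; apply: ler_wpM2r; first by rewrite invr_ge0 mulr_ge0 ?sqr_ge0// ltW.
  by move: c1; lra.
have K1 : 1 <= K.
  rewrite /K ler_pdivlMr ?mulr_gt0 ?exprn_gt0// mul1r.
  have : om * c ^+ 2 <= 1 by apply: mulr_ile1; rewrite ?(ltW om0) ?sqr_ge0 ?expr_le1 ?(ltW c0).
  lra.
have om01 : 0 < om <= 1 by rewrite om0.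
have c1E := lasso_large_coords c0 c1 sS Sc S1 s0 lam0 xL0 xLc HL (lb w) noise om0 K24.
have c2E := lasso_large_scores c0 c1 sS Sc S1 s0 lam0 xL0 xLc HL (lb w) noise om01 (lexx K).
have FPE t' : FPt w t' = \sum_(j | J j)
   (t' < `|zstat (X w) (y w) (bhat w) (kappa * rho) (fun j => ghat j w) sigma j|)%R%:R.
  by rewrite /FPt /FP natr_sum.
have ex : #|[pred j | K * (8 * sigma * rho) < `|(bhat w - beta) j 0|]|%:R +
    #|[pred j | K * xL * (8 * sigma * rho) <
      `|bform (Sigma_hat (X w) - S) (pop_vec S j) (bhat w - beta)|]|%:R <= 2 * om * s%:R.
  by move: c1E c2E; lra.
have key j : J j -> ~~ [pred j | K * (8 * sigma * rho) < `|(bhat w - beta) j 0|] j ->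
    ~~ [pred j | K * xL * (8 * sigma * rho) <
      `|bform (Sigma_hat (X w) - S) (pop_vec S j) (bhat w - beta)|] j ->
    `|zstat (X w) (y w) (bhat w) (kappa * rho) (fun j => ghat j w) sigma j -
      score_stat sigma (residual_matrix w) (eps w) j| <= bias_level.
  move=> Jj; rewrite /= -!leNgt => h1 h2.
  have [_ _ _ rj] := rates j.
  set u := nodewise_vec j (ghat j w) in rj.
  have r0 : 0 < sqnorm2 (X w *m u).
    have c4 : 0 < c / 4 by rewrite divr_gt0.
    by have := lt_le_trans c4 rj; rewrite pmulr_lgt0 ?invr_gt0.
  have bias := bias_bound c0 c1 sS Sc S1 s0 lam0 xL0 xLc HL (lb w) noise m0 smm x2b H2 l2 l0
    (ltW xN0) xNc HN mrho K1 (erefl u) (lg j w) h1 h2.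
  have zd := @zstat_decomposition R n p (X w) beta (bhat w) (eps w) (kappa * rho) sigma
    (fun j => ghat j w) j n0 sigma0 (ltW l0) r0 (nulls0 Jj) (lg j w).
  rewrite /y zd.
  rewrite -/u /score_stat col_residual -/u addrC addKr.
  set b := _ - _ in bias *; set rr := sqnorm2 (X w *m u) / n%:R in rj *.
  have sr : c / 2 <= Num.sqrt rr.
    have -> : c / 2 = Num.sqrt ((c / 2) ^+ 2) by rewrite sqrtr_sqr ger0_norm// divr_ge0// ltW.
    apply: ler_wsqrtr; apply: le_trans rj.
    have -> : (c / 2) ^+ 2 = c / 4 * c by field.
    by rewrite ler_piMr// divr_ge0// ltW.
  have sr0 : 0 < Num.sqrt rr by apply: lt_le_trans sr; rewrite divr_gt0.
  rewrite normrM (ger0_norm (_ : 0 <= Num.sqrt n%:R / (sigma * Num.sqrt rr))); last first.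
    by rewrite divr_ge0 ?sqrtr_ge0// mulr_ge0 ?sqrtr_ge0// ltW.
  apply: (@le_trans _ _ (Num.sqrt n%:R / (sigma * (c / 2)) *
    (K * (8 * sigma * rho) * (34 * (kappa * rho) * Num.sqrt m%:R / c +
      Num.min (24 * s%:R * (kappa * rho) / c) (xL + 12 * rho + 84 * m%:R * (kappa * rho) / c))))).
    apply: ler_pM => //; first by rewrite divr_ge0 ?sqrtr_ge0// mulr_ge0 ?sqrtr_ge0// ltW.
    apply: ler_wpM2l; first exact: sqrtr_ge0.
    rewrite lef_pV2 ?posrE ?mulr_gt0 ?divr_gt0//; exact: ler_wpM2l (ltW sigma0) _ _ sr.
  rewrite /bias_level !mulrA; set Z := Num.min _ _; rewrite le_eqVlt; apply/orP; left; apply/eqP.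
  by field; rewrite !gt_eqF.
have [q1 q2] := count_sandwich t key.
rewrite FPE /cnt /score_count; split.
  by apply: (le_trans q1); rewrite lerD2l.
by apply: (le_trans q2); rewrite lerD2l.
Qed.

Let p0 : R := #|nulls beta|%:R.
Let mu (tau : R) : R := 2 * Phi (- tau).

Definition variance_level (e tau : R) : R :=
  (#|nulls beta|%:R * (2 * Phi (- tau)) + 160 * (correlation_level / (c / 4) ^+ 2) *
    ((1 + tau ^+ 2) ^+ 2 * expR (- (tau ^+ 2 / 2)))) / (e / 2 * s%:R) ^+ 2.

Let re : random_matrix eps. Proof. by case: gX => -[]. Qed.

Let residual_factor : random_matrix residual_matrix /\ independent P residual_matrix eps.
Proof.
apply: (independent_continuous_factor rX); last by case: gX.
move=> i j; rewrite (_ : (fun w => _) = (fun w => (X w *m nodewise_vec j (ghat j w)) i 0)).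
  by apply: (lasso_residual_continuous n0 l0) => w; exact: lg.
by apply/funext => w; rewrite mxE.
Qed.

Let bias_ge0 : 0 <= bias_level.
Proof.
have K0 : 0 <= K by rewrite /K divr_ge0// mulr_ge0 ?sqr_ge0// ltW.
have kr := ltW l0.
have mk (a b : R) : 0 <= a -> 0 <= b -> 0 <= Num.min a b by move=> ? ?; rewrite le_min; apply/andP.
rewrite /bias_level; apply: mulr_ge0.
  apply: divr_ge0; last exact: ltW.
  apply: mulr_ge0; last exact: ltW.
  apply: mulr_ge0; last exact: sqrtr_ge0.
  by apply: mulr_ge0; first exact: ler0n.
apply: addr_ge0.
  by rewrite divr_ge0 ?(ltW c0)// mulr_ge0 ?sqrtr_ge0// -mulrA mulr_ge0.
apply: mk; first by rewrite divr_ge0 ?(ltW c0)// -mulrA mulr_ge0// mulr_ge0.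
apply: addr_ge0; first by rewrite addr_ge0 ?(ltW xL0)// mulr_ge0// ltW.
by rewrite divr_ge0 ?(ltW c0)// -mulrA mulr_ge0// mulr_ge0.
Qed.

Let corr_ge0 : 0 <= correlation_level.
Proof.
rewrite /correlation_level; apply: addr_ge0; (apply: divr_ge0; last exact: (ltW c0)).
  by apply: mulr_ge0; apply: ler0n.
apply: mulr_ge0; last exact: sqr_ge0.
apply: mulr_ge0; last exact: ler0n.
by apply: mulr_ge0; [apply: ler0n|exact: sqr_ge0].
Qed.

Variables (e t : R).
Hypotheses (e0 : 0 < e) (ome : 8 * om <= e) (tb : bias_level <= t).

Let F := [set w | e < s%:R^-1 * `|FPt w t - 2 * p0 * Phi (- t)|].

Let measurable_F : measurable F.
Proof.
have ry : random_matrix y.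
  apply/random_matrixP; apply: measurable_addmx; last exact/random_matrixP.
  by apply: measurable_mulmx => //; exact/random_matrixP.
apply: measurable_fun_ltr_set => //; apply: measurable_funM => //.
apply: measurableT_comp => //; apply: measurable_funB => //.
exact: (measurable_FP (kappa * rho) sigma rX ry rb rg beta t).
Qed.

Let sp : 0 < s%:R :> R. Proof. by rewrite ltr0n. Qed.
Let y0 : 0 < e / 2 * s%:R. Proof. by rewrite mulr_gt0// divr_gt0. Qed.
Let c4 : 0 < c / 4. Proof. by rewrite divr_gt0. Qed.
Let tm : 0 <= t - bias_level. Proof. by rewrite subr_ge0. Qed.
Let tp : 0 <= t + bias_level. Proof. by rewrite addr_ge0// (le_trans bias_ge0). Qed.
Let exc : 2 * om * s%:R <= e / 4 * s%:R.
Proof. by apply: ler_wpM2r; [exact: ltW|move: ome; lra]. Qed.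

Let in_F w : F w -> e * s%:R < `|FPt w t - p0 * mu t|.
Proof.
rewrite /F /= mulrC ltr_pdivlMr//.
by have -> : 2 * p0 * Phi (- t) = p0 * mu t by rewrite /mu; ring.
Qed.

Let mu_mono : p0 * mu (t + bias_level) <= p0 * mu t <= p0 * mu (t - bias_level).
Proof.
have t0 : 0 <= t by rewrite (le_trans bias_ge0).
apply/andP; split; apply: ler_wpM2l => //; rewrite /mu ler_pM2l//; apply: Phi_nondecreasing.
  by rewrite t0 lerDl.
by rewrite tm gerBl.
Qed.

Let cardJ : #|J| = #|nulls beta|. Proof. by apply: eq_card => j; rewrite !inE. Qed.

Lemma finite_sample_chebyshev :
  p0 * mu (t - bias_level) - p0 * mu (t + bias_level) <= e / 4 * s%:R ->
  (P F <= (failure_level + (variance_level e (t - bias_level) +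
    variance_level e (t + bias_level)))%:E)%E.
Proof.
move=> hd; have [E [mE PE HE]] := good_event; have [rV iV] := residual_factor.
have [gE _] := gX.
have [m1 p1] := score_count_chebyshev J n0 sigma0 c4 corr_ge0 tm rV gE iV y0.
have [m2 p2] := score_count_chebyshev J n0 sigma0 c4 corr_ge0 tp rV gE iV y0.
rewrite cardJ in m1 p1 m2 p2.
set E1 := [set w | _] in m1 p1; set E2 := [set w | _] in m2 p2.
apply: (@le_trans _ _ (P (E `|` (E1 `|` E2)))).
  apply: le_measure; rewrite ?inE//.
    by apply: measurableU => //; exact: measurableU.
  move=> w Fw; have [Ew|nE] := pselect (E w); [by left|right].
  have [ws /(_ t)[q1 q2]] := HE w nE; move: (in_F Fw) mu_mono exc hd => h /andP[h1 h2] h3 h4.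
  have [d0|d0] := lerP 0 (FPt w t - p0 * mu t).
    left; split => //; rewrite ger0_norm// in h.
    by apply: lt_le_trans (ler_norm _); rewrite -/(cnt w _) -/(mu _) -/p0; lra.
  right; split => //; rewrite ltr0_norm// in h.
  by rewrite -normrN; apply: lt_le_trans (ler_norm _); rewrite -/(cnt w _) -/(mu _) -/p0; lra.
apply: le_trans (measureU2 _ mE (measurableU _ _ m1 m2)) _; rewrite EFinD; apply: leeD => //.
by apply: le_trans (measureU2 _ m1 m2) _; rewrite EFinD; apply: leeD.
Qed.

Lemma finite_sample_markov :
  p0 * mu (t - bias_level) <= e / 4 * s%:R ->
  (P F <= (failure_level + p0 * mu (t - bias_level) / (e / 2 * s%:R))%:E)%E.
Proof.
move=> hd; have [E [mE PE HE]] := good_event; have [rV iV] := residual_factor.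
have [gE _] := gX.
have [m1 p1] := score_count_markov correlation_level J n0 sigma0 c4 tm rV gE iV y0.
rewrite cardJ in m1 p1.
set E1 := [set w | _] in m1 p1.
apply: (@le_trans _ _ (P (E `|` E1))).
  apply: le_measure; rewrite ?inE//; first exact: measurableU.
  move=> w Fw; have [Ew|nE] := pselect (E w); [by left|right].
  have [ws /(_ t)[q1 _]] := HE w nE; move: (in_F Fw) mu_mono exc hd => h /andP[_ h2] h3 h4.
  have F0 : 0 <= FPt w t by [].
  have mu0 : 0 <= p0 * mu t by rewrite mulr_ge0// /mu mulr_ge0// Phi_ge0.
  have es0 : 0 < e * s%:R by rewrite mulr_gt0.
  split => //; rewrite -/(cnt w _).
  have [d0|d0] := lerP 0 (FPt w t - p0 * mu t).
    by rewrite ger0_norm// in h; lra.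
  by rewrite ltr0_norm// in h; lra.
apply: le_trans (measureU2 _ mE m1) _; rewrite EFinD; exact: leeD.
Qed.

End FiniteSample.

(** * Asymptotics *)

Section ExponentialScales.
Context (R : realType).

Lemma pow_exp_small (k : nat) (a eps : R) : 0 < a -> 0 < eps ->
  exists2 L0, 1 <= L0 & forall L, L0 <= L -> L ^+ k * expR (- (a * L)) <= eps.
Proof.
move=> a0 e0; pose N : R := k.+1%:R; have N0 : 0 < N by rewrite ltr0n.
pose C := (N / a) ^+ k.+1; have C0 : 0 < C by rewrite exprn_gt0// divr_gt0.
exists (1 + C / eps); first by rewrite lerDl divr_ge0// ltW.
move=> L hL; have ce : 0 < C / eps by rewrite divr_gt0.
have L0 : 0 < L by lra.
have h : (a * L / N) ^+ k.+1 <= expR (a * L).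
  have -> : expR (a * L) = expR (a * L / N) ^+ k.+1.
    by rewrite -expRM_natr; congr expR; field; rewrite gt_eqF.
  rewrite lerXn2r ?nnegrE ?expR_ge0 ?divr_ge0 ?mulr_ge0 ?(ltW a0) ?(ltW L0) ?(ltW N0)//.
  by apply: le_trans (expR_ge1Dx _); rewrite lerDr.
rewrite expRN ler_pdivrMr ?expR_gt0//; apply: (@le_trans _ _ (eps * (a * L / N) ^+ k.+1)); last first.
  by rewrite ler_pM2l.
have -> : eps * (a * L / N) ^+ k.+1 = L ^+ k * (eps * L / C).
  have Ci : C^-1 = (a / N) ^+ k.+1 by rewrite /C -exprVn invf_div.
  have -> : a * L / N = a / N * L by ring.
  by rewrite Ci exprMn [L ^+ k.+1]exprS; ring.
rewrite ler_peMr ?exprn_ge0 ?(ltW L0)// ler_pdivlMr// mul1r.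
by have : C / eps <= L; [lra|rewrite ler_pdivrMr// mulrC].
Qed.

Lemma tail_shift_bound (t b : R) : 0 <= b <= t ->
  expR (- ((t - b) ^+ 2 / 2)) <= expR (- (t ^+ 2 / 2)) * expR (t * b).
Proof. by move=> _; rewrite -expRD ler_expR; have := sqr_ge0 b; rewrite !expr2; lra. Qed.

Lemma Phi_shift_bound (t b : R) : 0 <= b <= t ->
  2 * Phi (- (t - b)) - 2 * Phi (- (t + b)) <=
    4 * b * (expR (- (t ^+ 2 / 2)) * expR (t * b)).
Proof.
move=> /[dup] tb /andP[b0 bt].
have h1 : 0 <= t - b by rewrite subr_ge0.
have h2 : t - b <= t + b by lra.
have /andP[_] := Phi_lipschitz h1 h2.
have -> : t + b - (t - b) = 2 * b by ring.
have := ler_wpM2l (mulr_ge0 (ler0n _ 2) b0) (tail_shift_bound tb).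
move: (expR (- (t ^+ 2 / 2)) * expR (t * b)) (expR (- ((t - b) ^+ 2 / 2))) => A B.
by move: (Phi (- (t - b))) (Phi (- (t + b))) => ? ? ? ?; lra.
Qed.

End ExponentialScales.

Section FixedSizeEstimates.
Context (R : realType) (n p : nat) (S : 'M[R]_p) (beta : 'cV[R]_p) (c kappa om : R).
Let L : R := ln p%:R.
Let N : R := n%:R.
Let s : R := #|signals beta|%:R.
Let Sm : R := (s_max S)%:R.
Let rho : R := Num.sqrt (n%:R^-1 * ln p%:R).
Hypotheses (n0 : (0 < n)%N) (s0 : (0 < #|signals beta|)%N) (L1 : 1 <= L).
Hypotheses (c0 : 0 < c) (c1 : c <= 1) (kap24 : 24 <= kappa) (om0 : 0 < om) (om1 : om <= 1).

Let N0 : 0 < N. Proof. by rewrite ltr0n. Qed.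
Let L0 : 0 < L. Proof. by apply: lt_le_trans L1. Qed.
Let s1 : 1 <= s. Proof. by rewrite ler1n. Qed.
Let Sm0 : 0 <= Sm. Proof. by []. Qed.
Let rho2 : rho ^+ 2 = L / N.
Proof. by rewrite sqr_sqrtr ?mulr_ge0 ?invr_ge0 ?(ltW N0) ?(ltW L0)// mulrC. Qed.
Let rho0 : 0 < rho. Proof. by rewrite sqrtr_gt0 mulr_gt0 ?invr_gt0. Qed.
Let sN0 : 0 < Num.sqrt N. Proof. by rewrite sqrtr_gt0. Qed.
Let sN2 : Num.sqrt N ^+ 2 = N. Proof. by rewrite sqr_sqrtr// ltW. Qed.
Let Nrho : n%:R * rho ^+ 2 = L. Proof. by rewrite rho2; field; rewrite gt_eqF. Qed.

Let p0 : 0 < p%:R :> R.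
Proof.
rewrite ltr0n lt0n; apply/eqP => p0; move: L1; rewrite /L p0 ln0 // => h.
by move: h; rewrite ler10.
Qed.
Let expL : expR L = p%:R. Proof. by rewrite /L lnK// posrE. Qed.
Let expNL : expR (- L) = p%:R^-1. Proof. by rewrite expRN expL. Qed.

Let expNkL k : expR (- (k%:R * L)) = p%:R^-1 ^+ k.
Proof. by rewrite -mulrN mulrC expRM_natr expNL. Qed.

Lemma failure_level_le : failure_level n S beta <= 1700 * p%:R^-1.
Proof.
set q := p%:R^-1; have q0 : 0 < q by rewrite invr_gt0.
have pq : p%:R * q = 1 by rewrite mulfV// gt_eqF.
have p2 : 2 <= p%:R :> R.
  rewrite -expL; apply: le_trans (expR_ge1Dx _); move: L1; lra.
have q2 : q <= 1 / 2 by rewrite /q -[1/2]invrK lef_pV2 ?posrE// ?invr_gt0 ?divr_gt0// div1r invrK.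
have q3 : q ^+ 2 <= q * (1 / 2) by rewrite expr2; apply: ler_wpM2l => //; exact: ltW.
have q2p : 0 <= q ^+ 2 by exact: sqr_ge0.
have T1 : (4 * p%:R) ^+ 2 * (2 * expR (- (n%:R * (12 * rho) ^+ 2 / 16))) <= 32 * q.
  have -> : n%:R * (12 * rho) ^+ 2 / 16 = 9%:R * L by rewrite -Nrho; field.
  rewrite expNkL -/q; have -> : (4 * p%:R) ^+ 2 * (2 * q ^+ 9) = 32 * q * ((p%:R * q) ^+ 2 * q ^+ 6) by ring.
  rewrite pq expr1n mul1r ler_piMr ?mulr_ge0 ?(ltW q0)//.
  by rewrite exprn_ile1// ?(ltW q0)//; lra.
have T2 j : (0 < j)%N -> (4 * p%:R) ^+ j *
    (2 * expR (- (n%:R * (8 * Num.sqrt j%:R * rho) ^+ 2 / 16))) <= 8 * q.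
  move=> j0; have -> : n%:R * (8 * Num.sqrt j%:R * rho) ^+ 2 / 16 = (4 * j)%:R * L.
    by rewrite !exprMn sqr_sqrtr// -Nrho natrM; field.
  rewrite expNkL -/q exprM.
  have -> : (4 * p%:R) ^+ j * (2 * (q ^+ 4) ^+ j) = 2 * (4 * q ^+ 3 * (p%:R * q)) ^+ j.
    by rewrite mulrCA -exprMn; congr (_ * _ ^+ _); ring.
  rewrite pq mulr1; have q4 : 4 * q ^+ 3 <= 4 * q by rewrite exprS; nra.
  have q5 : 4 * q ^+ 3 <= 1 by rewrite exprS; nra.
  case: j j0 => // j _; rewrite exprS.
  have : (4 * q ^+ 3) ^+ j <= 1 by rewrite exprn_ile1// mulr_ge0 ?exprn_ge0 ?(ltW q0).
  have : 0 <= 4 * q ^+ 3 by rewrite mulr_ge0 ?exprn_ge0 ?(ltW q0).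
  move: (4 * q ^+ 3) q4 => z z4 z0; move: (z ^+ j) => y y1; nra.
have T3 : p%:R * (2 * Phi (- (rho * Num.sqrt (8 * n%:R)))) <= 1620 * q.
  have t0 : 0 <= rho * Num.sqrt (8 * n%:R) by rewrite mulr_ge0 ?sqrtr_ge0// ltW.
  have t2 : (rho * Num.sqrt (8 * n%:R)) ^+ 2 = 8 * L.
    have s8 : Num.sqrt (8 * n%:R) ^+ 2 = 8 * n%:R :> R by rewrite sqr_sqrtr// mulr_ge0.
    by rewrite exprMn s8 -Nrho; ring.
  apply: (@le_trans _ _ (p%:R * (20 * (1 + 8 * L) ^+ 2 * q ^+ 4))).
    apply: ler_wpM2l; first exact: ltW.
    apply: le_trans (Phi_tail t0) _; rewrite t2.
    have -> : 8 * L / 2 = 4%:R * L by field.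
    by rewrite expNkL.
  have -> : p%:R * (20 * (1 + 8 * L) ^+ 2 * q ^+ 4) = 20 * q * ((1 + 8 * L) * q) ^+ 2 * (p%:R * q) by ring.
  rewrite pq mulr1.
  have Lp : L <= p%:R - 1 by rewrite -expL; have := expR_ge1Dx L; lra.
  have : (1 + 8 * L) * q <= 9.
    have : (1 + 8 * L) * q <= (9 * p%:R) * q by apply: ler_wpM2r; [exact: ltW|lra].
    by rewrite -mulrA pq mulr1.
  have : 0 <= (1 + 8 * L) * q by apply: mulr_ge0; [move: L1; lra|exact: ltW].
  move: ((1 + 8 * L) * q) => z z0 z9.
  have : z ^+ 2 <= 81 by rewrite expr2; nra.
  move=> z81; have -> : 1620 * q = 20 * q * 81 by ring.
  by apply: ler_wpM2l => //; rewrite mulr_ge0// ltW.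
have T2a := T2 _ (ltn0Sn #|signals beta|); have T2b := T2 _ (ltn0Sn (s_max S).+1).
rewrite /failure_level -/rho; apply: le_trans (lerD (lerD (lerD T1 T2a) T2b) T3) _.
by rewrite -!mulrDl ler_pM2r// -!natrD ler_nat.
Qed.

Lemma bias_level_le : bias_level n S beta c kappa om <=
  1920 * (200 / (om * c ^+ 2)) * kappa / c ^+ 2 *
  (L / Num.sqrt N * (Num.sqrt Sm + Num.sqrt s + Num.min s Sm)).
Proof.
set K := 200 / (om * c ^+ 2).
have K0 : 0 < K by rewrite divr_gt0// mulr_gt0// exprn_gt0.
have kap0 : 0 < kappa by apply: lt_le_trans kap24.
have sq (x : R) : 0 <= x -> Num.sqrt (x + 1) <= Num.sqrt x + 1.
  move=> x0; rewrite -(@ler_pXn2r _ 2) ?nnegrE ?sqrtr_ge0 ?addr_ge0 ?sqrtr_ge0//.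
  rewrite sqr_sqrtr ?addr_ge0// sqrrD sqr_sqrtr// expr1n mulr1 lerD2r lerDl.
  by rewrite mulrn_wge0 ?sqrtr_ge0.
have ss1 : 1 <= Num.sqrt s by rewrite -sqrtr1; apply: ler_wsqrtr.
have mE : (s_max S).+1%:R = Sm + 1 :> R by rewrite -natr1.
have sE : #|signals beta|.+1%:R = s + 1 :> R by rewrite -natr1.
have sm := sq _ Sm0; have sqs := sq s (le_trans ler01 s1).
have sS0 : 0 <= Num.sqrt Sm by exact: sqrtr_ge0.
set U := Num.sqrt Sm + Num.sqrt s + Num.min s Sm.
have min0 : 0 <= Num.min s Sm by rewrite le_min Sm0 (le_trans ler01 s1).
rewrite /bias_level -/rho -/K mE sE -/s.
have kc : 1 <= kappa / c by rewrite ler_pdivlMr// mul1r; move: c1 kap24; lra.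
have k24 : 24 <= kappa / c.
  by rewrite ler_pdivlMr//; move: c1 c0 kap24; nra.
set kr := kappa / c in kc k24.
have h1 : 34 * kappa * rho * Num.sqrt (Sm + 1) / c <= rho * kr * (34 * (Num.sqrt Sm + Num.sqrt s)).
  have -> : 34 * kappa * rho * Num.sqrt (Sm + 1) / c = rho * kr * (34 * Num.sqrt (Sm + 1)).
    by rewrite /kr; ring.
  apply: ler_wpM2l; first by rewrite mulr_ge0 ?(ltW rho0)// divr_ge0 ?ltW.
  by rewrite ler_pM2l//; lra.
have h2 : Num.min (24 * s * kappa * rho / c)
    (8 * Num.sqrt (s + 1) * rho + 12 * rho + 84 * (Sm + 1) * kappa * rho / c) <=
    rho * kr * (86 * Num.sqrt s + 84 * Num.min s Sm).
  have kr0 : 0 <= rho * kr by rewrite mulr_ge0 ?(ltW rho0)// divr_ge0 ?ltW.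
  have [sS|Ss] := leP s Sm.
    rewrite ge_min; apply/orP; left.
    have -> : 24 * s * kappa * rho / c = rho * kr * (24 * s) by rewrite /kr; ring.
    by apply: ler_wpM2l => //; move: s1; lra.
  rewrite ge_min; apply/orP; right.
  have -> : 84 * (Sm + 1) * kappa * rho / c = rho * kr * (84 * (Sm + 1)) by rewrite /kr; ring.
  have e1 : 8 * Num.sqrt (s + 1) * rho + 12 * rho <= rho * kr * (2 * Num.sqrt s).
    have e2 : 8 * Num.sqrt (s + 1) + 12 <= kr * (2 * Num.sqrt s).
      have := ler_wpM2r (_ : 0 <= 2 * Num.sqrt s) k24; rewrite mulr_ge0 ?sqrtr_ge0// => /(_ isT); lra.
    by have := ler_wpM2l (ltW rho0) e2; lra.
  have e3 : rho * kr * (84 * (Sm + 1)) <= rho * kr * (84 * Sm + 84 * Num.sqrt s).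
    by apply: ler_wpM2l => //; lra.
  lra.
have h3 : 34 * kappa * rho * Num.sqrt (Sm + 1) / c + Num.min (24 * s * kappa * rho / c)
    (8 * Num.sqrt (s + 1) * rho + 12 * rho + 84 * (Sm + 1) * kappa * rho / c) <=
    rho * kr * (120 * U).
  apply: (le_trans (lerD h1 h2)); rewrite -mulrDr; apply: ler_wpM2l.
    by rewrite mulr_ge0 ?(ltW rho0)// divr_ge0 ?ltW.
  by rewrite /U; lra.
have pre : 0 <= 16 * K * Num.sqrt n%:R * rho / c.
  apply: divr_ge0; last exact: ltW.
  apply: mulr_ge0; last exact: ltW.
  by apply: mulr_ge0; [apply: mulr_ge0; [apply: ler0n|exact: ltW]|exact: sqrtr_ge0].
apply: le_trans (ler_wpM2l pre h3) _; rewrite le_eqVlt; apply/orP; left; apply/eqP.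
have sr : Num.sqrt n%:R * rho * rho = L / Num.sqrt N.
  rewrite -mulrA -expr2 rho2 -/N -[X in _ * (_ / X)]sN2; field; exact: lt0r_neq0.
transitivity (16 * K / c * (Num.sqrt n%:R * rho * rho) * kr * (120 * U)); first by ring.
by rewrite sr /kr; field; rewrite !gt_eqF.
Qed.

Lemma bias_scale_le (e0 : R) : 0 < e0 <= 1 ->
  Num.max s Sm <= e0 * (N / L) -> Num.min s Sm <= e0 * (Num.sqrt N / L) ->
  L / Num.sqrt N * (Num.sqrt Sm + Num.sqrt s + Num.min s Sm) <= 3 * Num.sqrt e0 * Num.sqrt L.
Proof.
move=> /andP[e00 e01] hmax hmin.
have LN : 0 < L / Num.sqrt N by rewrite divr_gt0.
have se : e0 <= Num.sqrt e0.
  rewrite -{1}(sqr_sqrtr (ltW e00)) expr2 ler_piMl ?sqrtr_ge0//.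
  by rewrite -sqrtr1; apply: ler_wsqrtr.
have sL : 1 <= Num.sqrt L by rewrite -sqrtr1; apply: ler_wsqrtr.
have sL2 : Num.sqrt L ^+ 2 = L by rewrite sqr_sqrtr// ltW.
have key x : 0 <= x -> x <= Num.max s Sm -> L / Num.sqrt N * Num.sqrt x <= Num.sqrt e0 * Num.sqrt L.
  move=> x0 xm; have : Num.sqrt x <= Num.sqrt e0 * (Num.sqrt N / Num.sqrt L).
    have -> : Num.sqrt e0 * (Num.sqrt N / Num.sqrt L) = Num.sqrt (e0 * (N / L)).
      by rewrite sqrtrM ?(ltW e00)// sqrtrM ?(ltW N0)// sqrtrV ?(ltW L0).
    by apply: ler_wsqrtr; exact: le_trans xm hmax.
  move=> /(ler_wpM2l (ltW LN)) /le_trans; apply; rewrite le_eqVlt; apply/orP; left; apply/eqP.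
  rewrite -[in X in X / _]sL2; field; apply/andP; split; apply: lt0r_neq0 => //.
  by apply: lt_le_trans sL.
have k1 := key _ Sm0 (_ : Sm <= Num.max s Sm); have k2 := key s (le_trans ler01 s1) (_ : s <= Num.max s Sm).
have {}k1 := k1 (ltac:(by rewrite le_max lexx orbT)).
have {}k2 := k2 (ltac:(by rewrite le_max lexx)).
have k3 : L / Num.sqrt N * Num.min s Sm <= Num.sqrt e0 * Num.sqrt L.
  apply: le_trans (ler_wpM2l (ltW LN) hmin) _.
  have -> : L / Num.sqrt N * (e0 * (Num.sqrt N / L)) = e0 by field; rewrite !gt_eqF.
  by apply: le_trans se _; rewrite ler_peMr ?sqrtr_ge0.
by rewrite !mulrDr; lra.
Qed.

Lemma sample_size_conditions (e0 : R) : 0 < e0 <= 1 -> Num.max s Sm <= e0 * (N / L) ->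
  24 * Num.sqrt e0 <= (c / 100) ^+ 2 -> 2 * kappa ^+ 2 * e0 <= c ->
  [/\ 0 < rho, 12 * rho <= 1,
      8 * Num.sqrt #|signals beta|.+1%:R * rho <= (c / 100) ^+ 2,
      8 * Num.sqrt (s_max S).+2%:R * rho <= (c / 100) ^+ 2 &
      (s_max S).+1%:R * (kappa * rho) ^+ 2 <= c].
Proof.
move=> /andP[e00 e01] hmax h24 hk.
have m1 : 1 <= Num.max s Sm by rewrite le_max s1.
have mE : (s_max S).+1%:R = Sm + 1 :> R by rewrite -natr1.
have mE2 : (s_max S).+2%:R = Sm + 2 :> R by rewrite -natr1 -natr1 -addrA.
have sE : #|signals beta|.+1%:R = s + 1 :> R by rewrite -natr1.
have sm : s <= Num.max s Sm by rewrite le_max lexx.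
have Sm' : Sm <= Num.max s Sm by rewrite le_max lexx orbT.
have bound x : 0 <= x -> x <= 3 * Num.max s Sm -> 8 * Num.sqrt x * rho <= 24 * Num.sqrt e0.
  move=> x0 xm; rewrite -mulrA.
  have -> : Num.sqrt x * rho = Num.sqrt (x * (n%:R^-1 * ln p%:R)) by rewrite sqrtrM.
  have h : x * (n%:R^-1 * ln p%:R) <= 9 * e0.
    have LN : 0 <= L / N by rewrite divr_ge0 ?ltW.
    have := ler_wpM2r LN xm; have := ler_wpM2r LN hmax.
    have -> : e0 * (N / L) * (L / N) = e0 by field; rewrite !gt_eqF.
    have -> : x * (n%:R^-1 * ln p%:R) = x * (L / N) by rewrite /L /N mulrC; ring.
    rewrite -(mulrA 3); move: (Num.max s Sm * (L / N)) (x * (L / N)) => u v; move: e00; lra.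
  have -> : 24 * Num.sqrt e0 = 8 * (3 * Num.sqrt e0) by ring.
  rewrite ler_pM2l//.
  have -> : 3 * Num.sqrt e0 = Num.sqrt (9 * e0).
    have -> : 9 * e0 = 3 ^+ 2 * e0 by ring.
    by rewrite (sqrtrM _ (sqr_ge0 3)) sqrtr_sqr ger0_norm.
  exact: ler_wsqrtr.
split => //.
- have := bound 1 ler01; rewrite sqrtr1 mulr1 => h.
  have {}h : 8 * rho <= (c / 100) ^+ 2 by apply: le_trans h24; apply: h; lra.
  have : (c / 100) ^+ 2 <= 1 / 100.
    by move: c0 c1; rewrite expr2; nra.
  lra.
- by apply: le_trans h24; apply: bound; rewrite sE; move: s1 Sm0; lra.
- by apply: le_trans h24; apply: bound; rewrite mE2; move: s1 Sm0; lra.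
- apply: le_trans hk; rewrite exprMn rho2 mE.
  have -> : (Sm + 1) * (kappa ^+ 2 * (L / N)) = kappa ^+ 2 * ((Sm + 1) * (L / N)) by ring.
  have -> : 2 * kappa ^+ 2 * e0 = kappa ^+ 2 * (2 * e0) by ring.
  apply: ler_wpM2l; first exact: sqr_ge0.
  have LN : 0 <= L / N by rewrite divr_ge0 ?ltW.
  have := ler_wpM2r LN hmax.
  have -> : e0 * (N / L) * (L / N) = e0 by field; rewrite !gt_eqF.
  have : (Sm + 1) * (L / N) <= 2 * (Num.max s Sm * (L / N)).
    by rewrite [leRHS]mulrA; apply: ler_wpM2r => //; lra.
  lra.
Qed.

End FixedSizeEstimates.

Ltac nonneg := lazymatch goal with
  | |- is_true (@Order.le _ _ _ ?x) =>
    first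
    [ match goal with
      | H : is_true (@Order.le _ _ _ ?y) |- _ => constr_eq x y; exact H
      | H : is_true (@Order.lt _ _ _ ?y) |- _ => constr_eq x y; exact (ltW H)
      end
    | lazymatch x with
      | _^-1 => rewrite invr_ge0; nonneg
      | _ * _ => apply: mulr_ge0; nonneg
      | _ + _ => apply: addr_ge0; nonneg
      | _ ^+ 2 => exact: sqr_ge0
      | _ ^+ _ => apply: exprn_ge0; nonneg
      | Num.sqrt _ => exact: sqrtr_ge0
      | expR _ => exact: expR_ge0
      | _%:R => exact: ler0n
      end
    | idtac ]
  end.

Section Asymptotics.
Context (R : realType).

Let exp_ge0 (x : R) : 0 <= expR x. Proof. exact: expR_ge0. Qed.

Let t_levelE (xi : R) p : 0 < xi -> 0 <= ln p%:R :> R ->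
  t_level xi p = Num.sqrt (2 * xi) * Num.sqrt (ln p%:R).
Proof. by move=> x0 L0; rewrite /t_level sqrtrM ?mulr_ge0// ltW. Qed.

Let expR_ln_nat p : 1 <= ln p%:R :> R -> expR (ln p%:R) = p%:R :> R.
Proof.
move=> h; rewrite lnK// posrE ltr0n lt0n; apply/eqP => pz.
by move: h; rewrite pz ln0// ler10.
Qed.

Lemma bias_level_ge0 (n p : nat) (S : 'M[R]_p) (beta : 'cV[R]_p) (c kappa om : R) :
  0 < c -> 24 <= kappa -> 0 < om -> 0 <= bias_level n S beta c kappa om.
Proof.
move=> c0 k24 om0; have k0 : 0 <= kappa by lra.
have c2 := ltW c0; have N24 : 0 <= 24 :> R := ler0n _ _.
rewrite /bias_level; move: (Num.sqrt (_ * ln _)) (sqrtr_ge0 (n%:R^-1 * ln p%:R : R)) => rho rho0.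
have q0 (x : R) := sqrtr_ge0 x.
have n0 (i : nat) : 0 <= i%:R :> R := ler0n _ _.
have o0 : 0 <= om * c ^+ 2 by apply: mulr_ge0; [exact: ltW|exact: sqr_ge0].
have mk (a b : R) : 0 <= a -> 0 <= b -> 0 <= Num.min a b by move=> ? ?; rewrite le_min; apply/andP.
apply: mulr_ge0; [|apply: addr_ge0; [|apply: mk]].
- by nonneg.
- by nonneg.
- by nonneg.
- by nonneg.
Qed.

(* For [eta < 1 / 2] the sparsity terms are beaten by [sqrt N], which is large
   because of [gamma2]; otherwise [min s S <= sqrt (s S)] and [gamma1] are used. *)
Lemma bias_scale_decay (eta xi L N s S : R) : xi <= eta -> 1 <= L -> 0 < N -> 1 <= s -> 0 <= S ->
  expR ((2 * eta - xi) * L) * Num.sqrt (Num.max 1 S / N) <= 1 ->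
  expR ((2 - 2 * eta - xi) * L) <= Num.sqrt N ->
  s <= 2 * expR ((1 - eta) * L) ->
  L / Num.sqrt N * (Num.sqrt S + Num.sqrt s + Num.min s S) * Num.sqrt L * expR ((eta - xi) * L) <=
  L ^+ 2 * (expR (- (eta * L)) +
    4 * expR (- ((if eta < 1 / 2 then 1 - 2 * eta else (3 * eta - 1) / 2) * L))).
Proof.
move=> xe L1 N0 s1 S0 h2 h3 hs.
set M := Num.max 1 S; have M1 : 1 <= M by rewrite le_max lexx.
have SM : S <= M by rewrite le_max lexx orbT.
have M0 : 0 <= M := le_trans ler01 M1; have L0 : 0 <= L := le_trans ler01 L1.
have s0 : 0 <= s := le_trans ler01 s1.
have sN0 : 0 < Num.sqrt N by rewrite sqrtr_gt0.
set E := expR ((eta - xi) * L); have E0 : 0 <= E by exact: expR_ge0.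
have MN : Num.sqrt (M / N) = Num.sqrt M / Num.sqrt N by rewrite sqrtrM// sqrtrV// ltW.
have hM : Num.sqrt M / Num.sqrt N * E <= expR (- (eta * L)).
  have -> : expR (- (eta * L)) = expR (- ((2 * eta - xi) * L)) * E.
    by rewrite -expRD; congr expR; ring.
  by apply: ler_wpM2r => //; rewrite expRN -MN ler_pdivlMr ?expR_gt0// mul1r mulrC || rewrite expRN -MN -[leRHS]mul1r ler_pdivlMr ?expR_gt0// mulrC.
have hS : Num.sqrt S / Num.sqrt N * E <= expR (- (eta * L)).
  apply: le_trans hM; apply: ler_wpM2r => //; apply: ler_wpM2r; first by rewrite invr_ge0 ltW.
  by rewrite ler_sqrt.
have hE : (Num.sqrt s + Num.min s S) / Num.sqrt N * E <=
    4 * expR (- ((if eta < 1 / 2 then 1 - 2 * eta else (3 * eta - 1) / 2) * L)).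
  case: ifP => _.
    have q1 : Num.sqrt s + Num.min s S <= 4 * expR ((1 - eta) * L).
      have a1 : Num.sqrt s <= s.
        rewrite -{2}(sqr_sqrtr s0) expr2 ler_peMr ?sqrtr_ge0//.
        by rewrite -[leLHS]sqrtr1 ler_sqrt.
      have a2 : Num.min s S <= s by rewrite ge_min lexx.
      by move: a1 a2 hs; lra.
    have q2 : (Num.sqrt N)^-1 <= expR (- ((2 - 2 * eta - xi) * L)).
      by rewrite expRN lef_pV2 ?posrE ?expR_gt0.
    have -> : 4 * expR (- ((1 - 2 * eta) * L)) =
        4 * expR ((1 - eta) * L) * expR (- ((2 - 2 * eta - xi) * L)) * E.
      by rewrite -!mulrA -!expRD; congr (_ * expR _); ring.
    have m0 : 0 <= Num.min s S by rewrite le_min s0.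
    by apply: ler_wpM2r; [exact: E0|apply: ler_pM; [nonneg|nonneg|exact: q1|exact: q2]].
  have q1 : Num.sqrt s + Num.min s S <= 2 * Num.sqrt s * Num.sqrt M.
    have M1' : 1 <= Num.sqrt M by rewrite -[leLHS]sqrtr1 ler_sqrt.
    have a1 : Num.sqrt s <= Num.sqrt s * Num.sqrt M by rewrite ler_peMr ?sqrtr_ge0.
    have a2 : Num.min s S <= Num.sqrt s * Num.sqrt M.
      have m0 : 0 <= Num.min s S by rewrite le_min s0.
      rewrite -sqrtrM// -[leLHS](ger0_norm m0) -sqrtr_sqr ler_sqrt ?mulr_ge0//.
      rewrite expr2; apply: ler_pM => //; first by rewrite ge_min lexx.
      by apply: le_trans SM; rewrite ge_min lexx orbT.
    by rewrite -[leRHS]mulrA mulr_natl mulr2n; apply: lerD.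
  have q2 : Num.sqrt s <= 2 * expR ((1 - eta) / 2 * L).
    have x0 := expR_ge0 ((1 - eta) / 2 * L).
    rewrite -[leRHS]ger0_norm ?mulr_ge0// -sqrtr_sqr ler_sqrt ?sqr_ge0//.
    apply: (le_trans hs); have -> : (2 * expR ((1 - eta) / 2 * L)) ^+ 2 = 4 * expR ((1 - eta) * L).
      by rewrite exprMn [expR _ ^+ 2]expr2 -expRD; congr (_ * expR _); [ring|field].
    by apply: ler_wpM2r; [exact: expR_ge0|rewrite ler_nat].
  have -> : 4 * expR (- ((3 * eta - 1) / 2 * L)) =
      2 * (2 * expR ((1 - eta) / 2 * L)) * expR (- (eta * L)).
    have -> : 2 * (2 * expR ((1 - eta) / 2 * L)) * expR (- (eta * L)) =
      4 * (expR ((1 - eta) / 2 * L) * expR (- (eta * L))) by ring.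
    by rewrite -expRD; congr (_ * expR _); field.
  apply: (@le_trans _ _ (2 * Num.sqrt s * (Num.sqrt M / Num.sqrt N * E))).
    rewrite [leRHS](_ : _ = 2 * Num.sqrt s * Num.sqrt M / Num.sqrt N * E); last by ring.
    by apply: ler_wpM2r => //; apply: ler_wpM2r; first by rewrite invr_ge0 ltW.
  by apply: ler_pM; [nonneg|nonneg|apply: ler_wpM2l; [nonneg|]|exact: hM].
have lL : L * Num.sqrt L <= L ^+ 2.
  rewrite expr2; apply: ler_wpM2l => //.
  rewrite -{2}(sqr_sqrtr L0) expr2 ler_peMr ?sqrtr_ge0//.
  by rewrite -[leLHS]sqrtr1 ler_sqrt.
have -> : L / Num.sqrt N * (Num.sqrt S + Num.sqrt s + Num.min s S) * Num.sqrt L * E =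
  L * Num.sqrt L * (Num.sqrt S / Num.sqrt N * E + (Num.sqrt s + Num.min s S) / Num.sqrt N * E) by ring.
have m0 : 0 <= Num.min s S by rewrite le_min s0.
have nv : 0 <= (Num.sqrt N)^-1 by rewrite invr_ge0 ltW.
apply: ler_pM => //.
- by apply: mulr_ge0 => //; apply: sqrtr_ge0.
- by nonneg.
- exact: lerD.
Qed.

Lemma tail_weight_le (r b L xi t tau : R) : 0 <= r -> 0 <= b -> 1 <= L ->
  b <= Num.sqrt L -> t = r * Num.sqrt L -> t * b <= 1 -> t ^+ 2 / 2 = xi * L -> b <= t ->
  t - b <= tau <= t + b -> tau = t - b \/ t <= tau ->
  (1 + tau ^+ 2) ^+ 2 * expR (- (tau ^+ 2 / 2)) <=
  (1 + (r + 1) ^+ 2) ^+ 2 * expR 1 * (L ^+ 2 * expR (- (xi * L))).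
Proof.
move=> r0 b0 L1 bL tE tb tt bt /andP[ta tu] tor.
have L0 : 0 <= L := le_trans ler01 L1.
have t0 : 0 <= t := le_trans b0 bt.
have tau0 : 0 <= tau by apply: le_trans ta; rewrite subr_ge0.
have sL : Num.sqrt L ^+ 2 = L := sqr_sqrtr L0.
have w1 : 1 + tau ^+ 2 <= (1 + (r + 1) ^+ 2) * L.
  have : tau <= (r + 1) * Num.sqrt L by rewrite mulrDl mul1r -tE; apply: (le_trans tu); rewrite lerD2l.
  move=> h; have : tau ^+ 2 <= ((r + 1) * Num.sqrt L) ^+ 2.
    by rewrite lerXn2r ?nnegrE// mulr_ge0 ?sqrtr_ge0// addr_ge0.
  by rewrite exprMn sL => h2; rewrite mulrDl mul1r; apply: lerD.
have w2 : expR (- (tau ^+ 2 / 2)) <= expR 1 * expR (- (xi * L)).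
  rewrite -tt; case: tor => [->|tg].
    have bb : 0 <= b <= t by rewrite b0.
    apply: (le_trans (tail_shift_bound bb)); rewrite mulrC; apply: ler_wpM2r; first exact: exp_ge0.
    by rewrite ler_expR.
  apply: (@le_trans _ _ (1 * expR (- (t ^+ 2 / 2)))).
    rewrite mul1r ler_expR lerN2; apply: ler_wpM2r; first by rewrite invr_ge0 ler0n.
    by rewrite lerXn2r ?nnegrE.
  by apply: ler_wpM2r; [exact: exp_ge0|rewrite -[leLHS]expR0 ler_expR ler01].
have -> : (1 + (r + 1) ^+ 2) ^+ 2 * expR 1 * (L ^+ 2 * expR (- (xi * L))) =
  ((1 + (r + 1) ^+ 2) * L) ^+ 2 * (expR 1 * expR (- (xi * L))) by rewrite exprMn; ring.
have p1 : 0 <= 1 + tau ^+ 2 by apply: addr_ge0 => //; exact: sqr_ge0.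
apply: ler_pM => //; first exact: sqr_ge0.
by rewrite lerXn2r ?nnegrE//; apply: le_trans w1.
Qed.

Lemma variance_level_decay (n p : nat) (S : 'M[R]_p) (beta : 'cV[R]_p)
    (c kappa e tau A eta xi : R) :
  let L := ln p%:R : R in let s := #|signals beta|%:R : R in let Sm := (s_max S)%:R : R in
  (0 < n)%N -> 1 <= L -> 0 < c -> 0 < e -> 0 <= tau -> xi <= eta -> 0 <= A ->
  expR ((2 * eta - xi) * L) * Num.sqrt (Num.max 1 Sm / n%:R) <= 1 ->
  expR ((1 - eta) * L) <= 2 * s ->
  (1 + tau ^+ 2) ^+ 2 * expR (- (tau ^+ 2 / 2)) <= A * (L ^+ 2 * expR (- (xi * L))) ->
  variance_level n S beta c kappa e tau <=
  16 / e ^+ 2 * (20 + 2560 / c ^+ 2 * (592 / c + 4616 * kappa ^+ 2 / c)) * A *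
   (L ^+ 2 * expR (- ((1 + xi - 2 * eta) * L)) + L ^+ 3 * expR (- (eta * L))).
Proof.
move=> L s Sm n0 L1 c0 e0 tau0 xe A0 h2 hs hW.
have L0 : 0 <= L := le_trans ler01 L1.
set M := Num.max 1 Sm; have M1 : 1 <= M by rewrite le_max lexx.
have SM : Sm <= M by rewrite le_max lexx orbT.
have M0 : 0 <= M := le_trans ler01 M1.
have N0 : 0 < n%:R :> R by rewrite ltr0n.
have pE : expR L = p%:R := expR_ln_nat L1.
have P0 : 0 <= p%:R :> R := ler0n _ _.
rewrite /variance_level; set W := (1 + tau ^+ 2) ^+ 2 * _ in hW *.
have W0 : 0 <= W by apply: mulr_ge0; [exact: sqr_ge0|exact: exp_ge0].
set Cv := 20 + _.
have np : #|nulls beta|%:R <= p%:R :> R by rewrite ler_nat -[leqRHS]card_ord; exact: max_card.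
have k0 : 0 <= kappa ^+ 2 := sqr_ge0 _.
have ci : 0 <= c^-1 by rewrite invr_ge0 ltW.
have ci2 : 0 <= 2560 / c ^+ 2 by nonneg.
set V := p%:R ^+ 2 * (M / n%:R) * L.
have V0 : 0 <= V by rewrite /V; nonneg.
have hc : correlation_level n S c kappa <= (592 / c + 4616 * kappa ^+ 2 / c) * (p%:R + V).
  rewrite /correlation_level exprMn sqr_sqrtr; last by apply: mulr_ge0 => //; rewrite invr_ge0 ltW.
  have hm : (s_max S).+1%:R <= 2 * M :> R by rewrite -natr1 -/Sm; clear -SM M1; lra.
  have t1 : 2308 * p%:R ^+ 2 * (s_max S).+1%:R * (kappa ^+ 2 * (n%:R^-1 * ln p%:R)) / c <=
      4616 * kappa ^+ 2 / c * V.
    rewrite [leLHS](_ : _ = 2308 * kappa ^+ 2 / c * (p%:R ^+ 2 * (L / n%:R)) * (s_max S).+1%:R); last by rewrite /L; ring.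
    rewrite [leRHS](_ : _ = 2308 * kappa ^+ 2 / c * (p%:R ^+ 2 * (L / n%:R)) * (2 * M)); last by rewrite /V; ring.
    by apply: ler_wpM2l; [nonneg|exact: hm].
  have u1 : 0 <= 4616 * kappa ^+ 2 / c * p%:R by nonneg.
  have u2 : 0 <= 592 / c * V by nonneg.
  have -> : (592 / c + 4616 * kappa ^+ 2 / c) * (p%:R + V) =
    592 * p%:R / c + 4616 * kappa ^+ 2 / c * V + (4616 * kappa ^+ 2 / c * p%:R + 592 / c * V) by ring.
  apply: (@le_trans _ _ (592 * p%:R / c + 4616 * kappa ^+ 2 / c * V)); first exact: lerD.
  by rewrite lerDl addr_ge0.
have pV : 0 <= p%:R + V by exact: addr_ge0.
have num : #|nulls beta|%:R * (2 * Phi (- tau)) + 160 * (correlation_level n S c kappa / (c / 4) ^+ 2) * W <=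
    Cv * (p%:R + V) * W.
  have z1 : #|nulls beta|%:R * (2 * Phi (- tau)) <= 20 * (p%:R + V) * W.
    rewrite [leRHS](_ : _ = (p%:R + V) * (20 * W)); last by ring.
    apply: ler_pM => //.
    - by apply: mulr_ge0; [exact: ler0n|exact: Phi_ge0].
    - by apply: (le_trans np); rewrite lerDl.
    - by rewrite /W mulrA; exact: Phi_tail.
  have z2 : 160 * (correlation_level n S c kappa / (c / 4) ^+ 2) * W <=
      2560 / c ^+ 2 * (592 / c + 4616 * kappa ^+ 2 / c) * (p%:R + V) * W.
    apply: ler_wpM2r => //.
    have -> : 160 * (correlation_level n S c kappa / (c / 4) ^+ 2) = 2560 / c ^+ 2 * correlation_level n S c kappa.
      by field; rewrite gt_eqF.
    by rewrite -[leRHS]mulrA; apply: ler_wpM2l; [exact: ci2|exact: hc].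
  have -> : Cv * (p%:R + V) * W = 20 * (p%:R + V) * W +
    2560 / c ^+ 2 * (592 / c + 4616 * kappa ^+ 2 / c) * (p%:R + V) * W by rewrite /Cv; ring.
  exact: lerD.
have Cv0 : 0 <= Cv.
  by rewrite /Cv; nonneg.
have den : e ^+ 2 / 16 * expR ((2 - 2 * eta) * L) <= (e / 2 * s) ^+ 2.
  have -> : e ^+ 2 / 16 * expR ((2 - 2 * eta) * L) = (e / 4 * expR ((1 - eta) * L)) ^+ 2.
    rewrite exprMn [expR _ ^+ 2]expr2 -expRD; congr (_ * expR _); first by field.
    by ring.
  have e4 : 0 <= e / 4 by apply: divr_ge0; [exact: ltW|exact: ler0n].
  have b1 : e / 4 * expR ((1 - eta) * L) <= e / 2 * s.
    by apply: (le_trans (ler_wpM2l e4 hs)); rewrite le_eqVlt; apply/orP; left; apply/eqP; field.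
  have b2 : 0 <= e / 4 * expR ((1 - eta) * L) by apply: mulr_ge0 => //; exact: exp_ge0.
  by rewrite lerXn2r ?nnegrE//; apply: le_trans b1.
have dp : 0 < e ^+ 2 / 16 * expR ((2 - 2 * eta) * L).
  by apply: mulr_gt0; [apply: divr_gt0; [exact: exprn_gt0|exact: ltr0n]|exact: expR_gt0].
rewrite ler_pdivrMr; last exact: lt_le_trans den.
apply: (le_trans num).
have AL : 0 <= A * (L ^+ 2 * expR (- (xi * L))).
  by apply: mulr_ge0 => //; apply: mulr_ge0; [exact: sqr_ge0|exact: exp_ge0].
apply: (@le_trans _ _ (Cv * (p%:R + V) * (A * (L ^+ 2 * expR (- (xi * L)))))).
  by apply: ler_wpM2l => //; exact: mulr_ge0.
set G := L ^+ 2 * expR _ + _.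
have G0 : 0 <= G.
  by apply: addr_ge0; apply: mulr_ge0; [exact: sqr_ge0|exact: exp_ge0|exact: exprn_ge0|exact: exp_ge0].
have F0 : 0 <= 16 / e ^+ 2 * Cv * A * G.
  by nonneg.
apply: le_trans (ler_wpM2l F0 den).
have -> : 16 / e ^+ 2 * Cv * A * G * (e ^+ 2 / 16 * expR ((2 - 2 * eta) * L)) =
    Cv * A * (G * expR ((2 - 2 * eta) * L)) by field; rewrite gt_eqF.
have -> : Cv * (p%:R + V) * (A * (L ^+ 2 * expR (- (xi * L)))) =
    Cv * A * ((p%:R + V) * (L ^+ 2 * expR (- (xi * L)))) by ring.
apply: ler_wpM2l; first exact: mulr_ge0.
rewrite /G [leLHS]mulrDl [leRHS]mulrDl; apply: lerD.
  rewrite le_eqVlt; apply/orP; left; apply/eqP.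
  rewrite -pE -mulrA -expRD mulrCA -expRD; congr (_ * expR _); ring.
have hM : M / n%:R <= expR (- (2 * (2 * eta - xi) * L)).
  have a0 : 0 <= M / n%:R by apply: divr_ge0 => //; exact: ltW.
  have : Num.sqrt (M / n%:R) <= expR (- ((2 * eta - xi) * L)).
    by rewrite expRN -[leRHS]mul1r ler_pdivlMr ?expR_gt0// mulrC.
  move=> h; rewrite -[leLHS](sqr_sqrtr a0).
  have -> : expR (- (2 * (2 * eta - xi) * L)) = expR (- ((2 * eta - xi) * L)) ^+ 2.
    by rewrite expr2 -expRD; congr expR; ring.
  by rewrite lerXn2r ?nnegrE ?sqrtr_ge0 ?exp_ge0.
rewrite /V.
apply: (@le_trans _ _ (p%:R ^+ 2 * expR (- (2 * (2 * eta - xi) * L)) * L * (L ^+ 2 * expR (- (xi * L))))).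
  apply: ler_wpM2r; first by apply: mulr_ge0; [exact: sqr_ge0|exact: exp_ge0].
  by apply: ler_wpM2r => //; apply: ler_wpM2l => //; exact: sqr_ge0.
rewrite -pE expr2 -!expRD.
have -> : expR (L + L - 2 * (2 * eta - xi) * L) * L * (L ^+ 2 * expR (- (xi * L))) =
  L ^+ 3 * (expR (L + L - 2 * (2 * eta - xi) * L) * expR (- (xi * L))) by ring.
rewrite -[leRHS]mulrA; apply: ler_wpM2l; first exact: exprn_ge0.
rewrite -!expRD ler_expR -subr_ge0.
have -> : - (eta * L) + (2 - 2 * eta) * L - (L + L - 2 * (2 * eta - xi) * L - xi * L) = (eta - xi) * L by ring.
by apply: mulr_ge0 => //; rewrite subr_ge0.
Qed.

Lemma asymptotic_markov (c kappa om e e' eta xi : R) :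
  0 < c -> c <= 1 -> 24 <= kappa -> 0 < om -> om <= 1 -> 0 < e -> 0 < e' ->
  0 < eta < xi ->
  exists e0 L0 : R, [/\ 0 < e0 <= 1, 1 <= L0 &
  forall (n p : nat) (S : 'M[R]_p) (beta : 'cV[R]_p),
    let L := ln p%:R : R in let s := #|signals beta|%:R : R in
    let Sm := (s_max S)%:R : R in let t := t_level xi p in
    let b := bias_level n S beta c kappa om in
    let q := #|nulls beta|%:R * (2 * Phi (- (t - b))) in
    (0 < n)%N -> (0 < #|signals beta|)%N -> L0 <= L -> expR ((1 - eta) * L) <= 2 * s ->
    Num.max s Sm <= e0 * (n%:R / L) -> Num.min s Sm <= e0 * (Num.sqrt n%:R / L) ->
    0 <= b -> [/\ b <= t, q <= e / 4 * s &
      failure_level n S beta + q / (e / 2 * s) <= e']].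
Proof.
move=> c0 c1 kap24 om0 om1 e00 e'0 /andP[eta0 exi].
have xi0 : 0 < xi by lra.
pose Cb := 1920 * (200 / (om * c ^+ 2)) * kappa / c ^+ 2.
have Cb0 : 0 <= Cb.
  have k0 : 0 <= kappa by lra.
  by rewrite /Cb; nonneg.
pose r := Num.sqrt (2 * xi); have r0 : 0 < r by rewrite sqrtr_gt0 mulr_gt0.
have r2 : r ^+ 2 = 2 * xi by rewrite sqr_sqrtr// mulr_ge0// ltW.
pose e1 := Num.min r ((xi - eta) / (2 * r)).
have e10 : 0 < e1 by rewrite lt_min r0 divr_gt0 ?mulr_gt0// subr_gt0.
pose z := Num.min 1 (e1 / (3 * Cb + 1)).
have Cb1 : 0 < 3 * Cb + 1 by rewrite ltr_wpDl// mulr_ge0.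
have z0 : 0 < z by rewrite lt_min ltr01 divr_gt0.
have z1 : z <= 1 by rewrite ge_min lexx.
have ze : 3 * Cb * z <= e1.
  have : z <= e1 / (3 * Cb + 1) by rewrite ge_min lexx orbT.
  by rewrite ler_pdivlMr//; have := z0; lra.
have a0 : 0 < (xi - eta) / 2 by rewrite divr_gt0// subr_gt0.
pose B := 40 * (1 + 2 * xi) ^+ 2.
have B0 : 0 < B by rewrite mulr_gt0// exprn_gt0//; lra.
pose y := Num.min (e / 4) (e' * e / 4).
have y0 : 0 < y by rewrite lt_min !divr_gt0// mulr_gt0.
have [L1 L11 HL1] := pow_exp_small 2 a0 (divr_gt0 y0 B0).
have [L2 L21 HL2] := pow_exp_small 0 ltr01 (divr_gt0 (divr_gt0 e'0 (ltr0n R 2)) (ltr0n R 1700)).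
exists (z ^+ 2), (Num.max L1 L2); split.
- by rewrite exprn_gt0//= expr_le1// ltW.
- by rewrite le_max L11.
move=> n p S beta L s Sm t b q n0 s0 hL hs hmax hmin b0.
have [hL1 hL2] : L1 <= L /\ L2 <= L by move: hL; rewrite ge_max => /andP[].
have L1' : 1 <= L := le_trans L11 hL1.
have Lp : 0 < L := lt_le_trans ltr01 L1'.
have sL0 : 0 < Num.sqrt L by rewrite sqrtr_gt0.
have sL2 : Num.sqrt L ^+ 2 = L by rewrite sqr_sqrtr// ltW.
have zz : 0 < z ^+ 2 <= 1 by rewrite exprn_gt0//= expr_le1// ltW.
have tE : t = r * Num.sqrt L by rewrite /t t_levelE// ltW.
have be : b <= e1 * Num.sqrt L.
  have hb := @bias_level_le R n p S beta c kappa om n0 s0 L1' c0 c1 kap24 om0.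
  have := @bias_scale_le R n p S beta n0 s0 L1' _ zz hmax hmin.
  rewrite sqrtr_sqr (ger0_norm (ltW z0)) => /(ler_wpM2l Cb0) h2.
  apply: (le_trans hb); rewrite -/Cb; apply: (le_trans h2).
  have -> : Cb * (3 * z * Num.sqrt L) = 3 * Cb * z * Num.sqrt L by ring.
  by apply: ler_wpM2r => //; exact: ltW.
have bt : b <= t.
  apply: (le_trans be); rewrite tE; apply: ler_wpM2r; first exact: ltW.
  by rewrite /e1 ge_min lexx.
have tb : t * b <= (xi - eta) / 2 * L.
  have e1r : e1 * (2 * r) <= xi - eta.
    by rewrite -ler_pdivlMr ?mulr_gt0// /e1 ge_min lexx orbT.
  have t0 : 0 <= t by rewrite tE mulr_ge0// ltW.
  have := ler_wpM2l t0 be; rewrite {2}tE.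
  have -> : r * Num.sqrt L * (e1 * Num.sqrt L) = e1 * r * L by rewrite -[in RHS]sL2; ring.
  move=> /le_trans; apply; apply: ler_wpM2r; first exact: ltW.
  lra.
have tt : t ^+ 2 / 2 = xi * L by rewrite tE exprMn r2 sL2; field.
have sp : 0 < s by rewrite ltr0n.
have qle : q <= y * s.
  have tm : 0 <= t - b by rewrite subr_ge0.
  have P1 := Phi_tail tm.
  have bb : 0 <= b <= t by rewrite b0.
  have P2 := tail_shift_bound bb; rewrite tt in P2.
  have P3 : expR (- (xi * L)) * expR (t * b) <= expR (- (xi * L)) * expR ((xi - eta) / 2 * L).
    by apply: ler_wpM2l => //; rewrite ler_expR.
  have P4 : (1 + (t - b) ^+ 2) ^+ 2 <= (1 + 2 * xi) ^+ 2 * L ^+ 2.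
    have h : (t - b) ^+ 2 <= 2 * xi * L.
      have -> : 2 * xi * L = t ^+ 2 by rewrite tE exprMn r2 sL2.
      by rewrite lerXn2r ?nnegrE//; [exact: le_trans bt|rewrite gerBl].
    have h' : 1 + (t - b) ^+ 2 <= (1 + 2 * xi) * L by rewrite mulrDl mul1r; exact: lerD.
    have p0 : 0 <= 1 + (t - b) ^+ 2 by nonneg.
    by rewrite -exprMn lerXn2r ?nnegrE//; exact: le_trans h'.
  have pE : expR L = p%:R := expR_ln_nat L1'.
  have np : #|nulls beta|%:R <= expR L by rewrite pE ler_nat -[leqRHS]card_ord; exact: max_card.
  have P5 : 2 * Phi (- (t - b)) <= 20 * ((1 + 2 * xi) ^+ 2 * L ^+ 2) *
      (expR (- (xi * L)) * expR ((xi - eta) / 2 * L)).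
    apply: (le_trans P1); apply: ler_pM => //; first by rewrite mulr_ge0 ?sqr_ge0.
      by apply: ler_wpM2l; [exact: ler0n|exact: P4].
    exact: le_trans P2 P3.
  apply: (@le_trans _ _ (expR L * (20 * ((1 + 2 * xi) ^+ 2 * L ^+ 2) *
      (expR (- (xi * L)) * expR ((xi - eta) / 2 * L))))).
    by apply: ler_pM => //; rewrite mulr_ge0 ?Phi_ge0.
  have -> : expR L * (20 * ((1 + 2 * xi) ^+ 2 * L ^+ 2) *
      (expR (- (xi * L)) * expR ((xi - eta) / 2 * L))) =
      B * (L ^+ 2 * expR (- ((xi - eta) / 2 * L))) * (expR ((1 - eta) * L) / 2).
    have -> : expR L * (20 * ((1 + 2 * xi) ^+ 2 * L ^+ 2) *
      (expR (- (xi * L)) * expR ((xi - eta) / 2 * L))) =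
      20 * ((1 + 2 * xi) ^+ 2 * L ^+ 2) * (expR L * (expR (- (xi * L)) * expR ((xi - eta) / 2 * L))) by ring.
    rewrite -!expRD /B.
    have -> : 40 * (1 + 2 * xi) ^+ 2 * (L ^+ 2 * expR (- ((xi - eta) / 2 * L))) *
      (expR ((1 - eta) * L) / 2) = 20 * ((1 + 2 * xi) ^+ 2 * L ^+ 2) *
      (expR (- ((xi - eta) / 2 * L)) * expR ((1 - eta) * L)) by field.
    by rewrite -expRD; congr (_ * expR _); field.
  apply: ler_pM.
  - by rewrite mulr_ge0 ?(ltW B0)// mulr_ge0 ?exprn_ge0 ?(ltW Lp).
  - by rewrite divr_ge0.
  - by rewrite mulrC -ler_pdivlMr//; exact: HL1.
  - by rewrite ler_pdivrMr// [leRHS]mulrC.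
split => //.
  by apply: (le_trans qle); apply: ler_wpM2r; [exact: ltW|rewrite /y ge_min lexx].
have F1 := @failure_level_le R n p S beta n0 L1'.
have F2 : 1700 * p%:R^-1 <= e' / 2.
  have := HL2 L hL2; rewrite expr0 mul1r mul1r expRN.
  rewrite (expR_ln_nat L1').
  by rewrite ler_pdivlMr ?ltr0n// mulrC.
have F3 : q / (e / 2 * s) <= e' / 2.
  rewrite ler_pdivrMr ?mulr_gt0 ?divr_gt0//; apply: (le_trans qle).
  have -> : e' / 2 * (e / 2 * s) = e' * e / 4 * s by field.
  by apply: ler_wpM2r; [exact: ltW|rewrite /y ge_min lexx orbT].
have -> : e' = e' / 2 + e' / 2 by field.
by apply: lerD; [exact: le_trans F1 F2|exact: F3].
Qed.

Lemma asymptotic_chebyshev (c kappa om e e' eta xi : R) :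
  0 < c -> c <= 1 -> 24 <= kappa -> 0 < om -> 0 < e -> 0 < e' ->
  0 < eta < 1 -> 0 < xi -> xi <= eta -> 2 * eta - 1 < xi ->
  exists2 L0 : R, 1 <= L0 &
  forall (n p : nat) (S : 'M[R]_p) (beta : 'cV[R]_p),
    let L := ln p%:R : R in let s := #|signals beta|%:R : R in
    let Sm := (s_max S)%:R : R in let t := t_level xi p in
    let b := bias_level n S beta c kappa om in
    (0 < n)%N -> (0 < #|signals beta|)%N -> L0 <= L -> expR ((1 - eta) * L) <= 2 * s ->
    s <= 2 * expR ((1 - eta) * L) ->
    expR ((2 * eta - xi) * L) * Num.sqrt (Num.max 1 Sm / n%:R) <= 1 ->
    expR ((2 - 2 * eta - xi) * L) <= Num.sqrt n%:R ->
    [/\ b <= t, #|nulls beta|%:R * (2 * Phi (- (t - b))) - #|nulls beta|%:R * (2 * Phi (- (t + b))) <= e / 4 * s &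
      failure_level n S beta + (variance_level n S beta c kappa e (t - b) +
        variance_level n S beta c kappa e (t + b)) <= e'].
Proof.
move=> c0 c1 kap24 om0 ep e'0 /andP[eta0 eta1] xi0 xe xe1.
pose Cb := 1920 * (200 / (om * c ^+ 2)) * kappa / c ^+ 2.
have Cb0 : 0 <= Cb.
  have k0 : 0 <= kappa by lra.
  by rewrite /Cb; nonneg.
pose r := Num.sqrt (2 * xi); have r0 : 0 < r by rewrite sqrtr_gt0 mulr_gt0.
have r2 : r ^+ 2 = 2 * xi by rewrite sqr_sqrtr// mulr_ge0// ltW.
pose E : R := expR 1; have E0 : 0 < E by exact: expR_gt0.
pose dl := Num.min (Num.min 1 r) (Num.min (r^-1) (e / (32 * E))).
have E32 : 0 < 32 * E by apply: mulr_gt0.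
have dl0 : 0 < dl by rewrite !lt_min ltr01 r0 invr_gt0 r0 divr_gt0.
have [d1 d2 d3 d4] : [/\ dl <= 1, dl <= r, dl <= r^-1 & dl <= e / (32 * E)].
  by rewrite /dl; split; rewrite !ge_min lexx ?orbT.
pose a : R := if eta < 1 / 2 then 1 - 2 * eta else (3 * eta - 1) / 2.
have a0 : 0 < a.
  rewrite /a; case: (ltP eta (1 / 2)) => h.
    by move: h; lra.
  by move: h; lra.
have Cp : 0 < Cb + 1 by rewrite ltr_wpDl.
have u0 : 0 < dl / (Cb + 1) / 2 by apply: divr_gt0 => //; apply: divr_gt0.
have u1 : 0 < dl / (Cb + 1) / 2 / 4 by apply: divr_gt0.
have [L1 L11 HL1] := pow_exp_small 2 eta0 u0.
have [L2 _ HL2] := pow_exp_small 2 a0 u1.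
pose A := (1 + (r + 1) ^+ 2) ^+ 2 * expR 1.
have A0 : 0 <= A by apply: mulr_ge0; [exact: sqr_ge0|exact: exp_ge0].
pose D := 16 / e ^+ 2 * (20 + 2560 / c ^+ 2 * (592 / c + 4616 * kappa ^+ 2 / c)) * A.
have ci : 0 <= c^-1 by rewrite invr_ge0 ltW.
have D0 : 0 <= D.
  by rewrite /D; nonneg.
have Dp : 0 < D + 1 by rewrite ltr_wpDl.
have v0 : 0 < e' / 8 / (D + 1) by apply: divr_gt0 => //; apply: divr_gt0.
have a30 : 0 < 1 + xi - 2 * eta by clear -xe1; lra.
have [L3 _ HL3] := pow_exp_small 2 a30 v0.
have [L4 _ HL4] := pow_exp_small 3 eta0 v0.
have [L5 _ HL5] := pow_exp_small 0 ltr01 (divr_gt0 (divr_gt0 e'0 (ltr0n R 2)) (ltr0n R 1700)).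
exists (Num.max (Num.max L1 L2) (Num.max L3 (Num.max L4 L5))).
  by rewrite !le_max L11.
move=> n p S beta L s Sm t b n0 s0 hL hs hs2 h2 h3.
move: hL; rewrite !ge_max => /andP[/andP[hL1 hL2] /and3P[hL3 hL4 hL5]].
have L1' : 1 <= L := le_trans L11 hL1.
have Lp : 0 < L := lt_le_trans ltr01 L1'.
have L0 : 0 <= L := ltW Lp.
have sL1 : 1 <= Num.sqrt L by rewrite -[leLHS]sqrtr1 ler_sqrt.
have sL0 : 0 < Num.sqrt L := lt_le_trans ltr01 sL1.
have sL2 : Num.sqrt L ^+ 2 = L by rewrite sqr_sqrtr// ltW.
have tE : t = r * Num.sqrt L by rewrite /t t_levelE// ltW.
have N0 : 0 < n%:R :> R by rewrite ltr0n.
have s1 : 1 <= s by rewrite ler1n.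
have Sm0 : 0 <= Sm by exact: ler0n.
have b0 : 0 <= b := bias_level_ge0 n S beta c0 kap24 om0.
set X := expR ((eta - xi) * L).
have X1 : 1 <= X by rewrite -expR0 ler_expR; apply: mulr_ge0; [rewrite subr_ge0|exact: ltW].
have X0 : 0 <= X := le_trans ler01 X1.
have bd : b * Num.sqrt L * X <= dl.
  have hb := @bias_level_le R n p S beta c kappa om n0 s0 L1' c0 c1 kap24 om0.
  have hd := bias_scale_decay xe L1' N0 s1 Sm0 h2 h3 hs2.
  have g1 := HL1 L hL1; have g2 := HL2 L hL2; rewrite -/a in hd.
  apply: (@le_trans _ _ (Cb * (L / Num.sqrt n%:R * (Num.sqrt Sm + Num.sqrt s + Num.min s Sm)) * Num.sqrt L * X)).
    by apply: ler_wpM2r => //; apply: ler_wpM2r; [exact: ltW|exact: hb].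
  apply: (@le_trans _ _ (Cb * (dl / (Cb + 1)))).
    set Y := L / _ * _ in hd *.
    rewrite (_ : Cb * Y * Num.sqrt L * X = Cb * (Y * Num.sqrt L * X)); last by ring.
    apply: ler_wpM2l; first exact: Cb0.
    apply: (le_trans hd).
    rewrite mulrDr; move: g1 g2; move: (expR _) (expR _) => x y g1 g2.
    rewrite (_ : L ^+ 2 * (4 * x) = 4 * (L ^+ 2 * x)); last by ring.
    move: g1 g2; move: (L ^+ 2 * x) (L ^+ 2 * y) (dl / _) => u v w g1 g2; clear -g1 g2; lra.
  rewrite mulrA ler_pdivrMr// mulrC; apply: ler_wpM2l; first exact: ltW.
  by rewrite lerDl.
have bd1 : b * Num.sqrt L <= dl.
  by apply: le_trans bd; rewrite ler_peMr//; apply: mulr_ge0 => //; exact: ltW.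
have bd2 : b <= dl by apply: le_trans bd1; rewrite ler_peMr.
have bX : b * X <= dl.
  apply: le_trans bd; rewrite -mulrA; apply: ler_wpM2l => //.
  by rewrite ler_peMl.
have bt : b <= t.
  by apply: (le_trans bd2); apply: (le_trans d2); rewrite tE ler_peMr// ltW.
have bL : b <= Num.sqrt L by apply: (le_trans bd2); apply: (le_trans d1).
have tb : t * b <= 1.
  have -> : t * b = r * (b * Num.sqrt L) by rewrite tE; ring.
  apply: (@le_trans _ _ (r * r^-1)); last by rewrite mulfV ?gt_eqF.
  by apply: ler_wpM2l; [exact: ltW|exact: le_trans d3].
have tt : t ^+ 2 / 2 = xi * L by rewrite tE exprMn r2 sL2; field.
have t0 : 0 <= t := le_trans b0 bt.
have bb : 0 <= b <= t by rewrite b0.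
have pE : expR L = p%:R := expR_ln_nat L1'.
have np : #|nulls beta|%:R <= expR L by rewrite pE ler_nat -[leqRHS]card_ord; exact: max_card.
split => //.
  have P1 := Phi_shift_bound bb; rewrite tt in P1; rewrite -mulrBr.
  have b4 : 0 <= 4 * b by apply: mulr_ge0 => //; exact: ler0n.
  have P2 : 4 * b * (expR (- (xi * L)) * expR (t * b)) <= 4 * b * (expR (- (xi * L)) * E).
    by apply: ler_wpM2l => //; apply: ler_wpM2l; [exact: exp_ge0|rewrite ler_expR].
  have P3 : 0 <= 4 * b * (expR (- (xi * L)) * E).
    by apply: mulr_ge0 => //; apply: mulr_ge0; [exact: exp_ge0|exact: ltW].
  apply: (@le_trans _ _ (expR L * (4 * b * (expR (- (xi * L)) * E)))).
    apply: (le_trans (ler_wpM2l (ler0n _ _) (le_trans P1 P2))); exact: ler_wpM2r.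
  have -> : expR L * (4 * b * (expR (- (xi * L)) * E)) = 4 * E * (b * X) * expR ((1 - eta) * L).
    have -> : 4 * E * (b * X) * expR ((1 - eta) * L) = 4 * E * b * (X * expR ((1 - eta) * L)) by ring.
    have -> : expR L * (4 * b * (expR (- (xi * L)) * E)) = 4 * E * b * (expR L * expR (- (xi * L))) by ring.
    by rewrite -!expRD; congr (_ * expR _); ring.
  have P4 : 4 * E * (b * X) <= e / 8.
    have E4 : 0 <= 4 * E by apply: mulr_ge0; [exact: ler0n|exact: ltW].
    apply: (le_trans (ler_wpM2l E4 (le_trans bX d4))).
    by rewrite le_eqVlt; apply/orP; left; apply/eqP; field; rewrite gt_eqF.
  have e8 : 0 <= e / 8 by apply: divr_ge0; [exact: ltW|exact: ler0n].
  apply: (le_trans (ler_wpM2r (exp_ge0 _) P4)).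
  apply: (le_trans (ler_wpM2l e8 hs)).
  by rewrite le_eqVlt; apply/orP; left; apply/eqP; field.
have F1 := @failure_level_le R n p S beta n0 L1'.
have F2 : 1700 / p%:R <= e' / 2.
  have := HL5 L hL5; rewrite expr0 mul1r mul1r expRN (expR_ln_nat L1').
  by rewrite ler_pdivlMr ?ltr0n// mulrC.
have VG tau : t - b <= tau <= t + b -> tau = t - b \/ t <= tau ->
    variance_level n S beta c kappa e tau <= e' / 4.
  move=> h1 h4; have w := tail_weight_le (ltW r0) b0 L1' bL tE tb tt bt h1 h4.
  have tau0 : 0 <= tau by case/andP: h1 => h _; apply: le_trans h; rewrite subr_ge0.
  apply: (le_trans (variance_level_decay kappa n0 L1' c0 ep tau0 xe A0 h2 hs w)).
  rewrite -/D; apply: (@le_trans _ _ (D * (e' / 8 / (D + 1) + e' / 8 / (D + 1)))).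
    by apply: ler_wpM2l => //; apply: lerD; [exact: HL3|exact: HL4].
  have -> : D * (e' / 8 / (D + 1) + e' / 8 / (D + 1)) = e' / 4 * D / (D + 1) by field; rewrite gt_eqF.
  rewrite ler_pdivrMr//; apply: ler_wpM2l; last by rewrite lerDl.
  by apply: divr_ge0; [exact: ltW|exact: ler0n].
have V1 : variance_level n S beta c kappa e (t - b) <= e' / 4.
  by apply: VG; [rewrite lexx/= lerD2l; apply: (le_trans _ b0); rewrite oppr_le0|left].
have V2 : variance_level n S beta c kappa e (t + b) <= e' / 4.
  by apply: VG; [rewrite lexx andbT lerD2l; apply: (le_trans _ b0); rewrite oppr_le0|right; rewrite lerDl].
have -> : e' = e' / 2 + (e' / 4 + e' / 4) by field.
by apply: lerD; [exact: le_trans F1 F2|exact: lerD].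
Qed.

End Asymptotics.

Section DeviationProbability.
Context (R : realType).

Let maxn_natr (a b : nat) : (maxn a b)%:R = Num.max a%:R b%:R :> R.
Proof.
by case: (leqP a b) => h; [rewrite max_r ?ler_nat|rewrite max_l ?ler_nat ?(ltnW h)].
Qed.

Let minn_natr (a b : nat) : (minn a b)%:R = Num.min a%:R b%:R :> R.
Proof.
by case: (leqP a b) => h; [rewrite min_l ?ler_nat|rewrite min_r ?ler_nat ?(ltnW h)].
Qed.

Lemma gamma_star_exponents (eta xi : R) (p n smax : nat) :
  let L := ln p%:R : R in
  (0 < n)%N -> 1 <= L -> gamma_star eta p n smax < xi ->
  [/\ 2 * eta - 1 < xi,
      expR ((2 * eta - xi) * L) * Num.sqrt (Num.max 1 smax%:R / n%:R) <= 1 &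
      expR ((2 - 2 * eta - xi) * L) <= Num.sqrt n%:R].
Proof.
move=> L n0 L1; rewrite /gamma_star gt_max /gamma1 /gamma2 maxn_natr => /andP[].
set M := Num.max 1 _; set N : R := n%:R.
have Lp : 0 < L := lt_le_trans ltr01 L1; have L2 : 0 < 2 * L by rewrite mulr_gt0.
have M0 : 0 < M by rewrite lt_max ltr01.
have N0 : 0 < N by rewrite ltr0n.
have expK (x y : R) : 0 < y -> x * (2 * L) <= ln y -> expR (x * L) <= Num.sqrt y.
  move=> y0 h; have e0 := expR_ge0 (x * L).
  rewrite -[leLHS](ger0_norm e0) -sqrtr_sqr ler_sqrt; last exact: ltW.
  rewrite expr2 -expRD -[leRHS](lnK y0) ler_expR; apply: le_trans h.
  by rewrite le_eqVlt; apply/orP; left; apply/eqP; ring.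
move=> g1 g2; split.
- apply: le_lt_trans g1; rewrite lerD2l lerN2; first by rewrite ge_min lexx.
- have h : (2 * eta - xi) * (2 * L) <= ln (N / M).
    rewrite -ler_pdivlMr//; apply/ltW.
    apply: (@lt_le_trans _ _ (Num.min 1 (ln (N / M) / (2 * L)))); last by rewrite ge_min lexx orbT.
    by rewrite ltrBlDr [ltRHS]addrC -ltrBlDr.
  have NM0 : 0 < N / M by rewrite divr_gt0.
  apply: (le_trans (ler_wpM2r (sqrtr_ge0 _) (expK _ _ NM0 h))).
  rewrite -sqrtrM; last exact: ltW.
  have -> : N / M * (M / N) = 1 by field; rewrite !gt_eqF.
  by rewrite sqrtr1.
- apply: expK => //; rewrite -ler_pdivlMr//; apply/ltW.
  by rewrite ltrBlDr [ltRHS]addrC -ltrBlDr.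
Qed.

Lemma asymptotic_levels (c kappa om e e' eta xi : R) :
  0 < c -> c <= 1 -> 24 <= kappa -> 0 < om -> om <= 1 -> 0 < e -> 0 < e' ->
  0 < eta < 1 -> 0 < xi ->
  exists e0 L0 : R, [/\ 0 < e0 <= 1, 1 <= L0 &
  forall (n p : nat) (S : 'M[R]_p) (beta : 'cV[R]_p),
    let L := ln p%:R : R in let s := #|signals beta|%:R : R in
    let Sm := (s_max S)%:R : R in let t := t_level xi p in
    let b := bias_level n S beta c kappa om in
    let mu tau := #|nulls beta|%:R * (2 * Phi (- tau)) in
    (0 < n)%N -> (0 < #|signals beta|)%N -> L0 <= L ->
    expR ((1 - eta) * L) <= 2 * s -> s <= 2 * expR ((1 - eta) * L) ->
    Num.max s Sm <= e0 * (n%:R / L) -> Num.min s Sm <= e0 * (Num.sqrt n%:R / L) ->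
    Num.min eta (gamma_star eta p n (s_max S)) < xi ->
    b <= t /\
    ((mu (t - b) <= e / 4 * s /\
      failure_level n S beta + mu (t - b) / (e / 2 * s) <= e') \/
     (mu (t - b) - mu (t + b) <= e / 4 * s /\
      failure_level n S beta + (variance_level n S beta c kappa e (t - b) +
        variance_level n S beta c kappa e (t + b)) <= e'))].
Proof.
move=> c0 c1 k24 om0 om1 ep e'0 eta01 xi0; case/andP: (eta01) => eta0 eta1.
have [exi|xe] := ltP eta xi.
  have eta0xi : 0 < eta < xi by rewrite eta0.
  have [e0 [L0 [he0 hL0 H]]] := asymptotic_markov c0 c1 k24 om0 om1 ep e'0 eta0xi.
  exists e0, L0; split=> // n p S beta L s Sm t b mu n0 s0 hL hs _ hmax hmin _.
  have [h1 h2 h3] := H n p S beta n0 s0 hL hs hmax hmin (bias_level_ge0 n S beta c0 k24 om0).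
  by split=> //; left.
have [xe1|xe1] := ltP (2 * eta - 1) xi; last first.
  exists 1, 1; split; [by rewrite ltr01 lexx|by []|].
  move=> n p S beta L s Sm t b mu n0 s0 hL _ _ _ _; rewrite gt_min ltNge xe /= => hg.
  have [h _ _] := gamma_star_exponents n0 hL hg.
  by move: h; rewrite ltNge xe1.
have [L0 hL0 H] := asymptotic_chebyshev c0 c1 k24 om0 ep e'0 eta01 xi0 xe xe1.
exists 1, L0; split; [by rewrite ltr01 lexx|by []|].
move=> n p S beta L s Sm t b mu n0 s0 hL hs hs2 _ _; rewrite gt_min ltNge xe /= => hg.
have [_ g1 g2] := gamma_star_exponents n0 (le_trans hL0 hL) hg.
have [h1 h2 h3] := H n p S beta n0 s0 hL hs hs2 g1 g2.
by split=> //; right.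
Qed.

Lemma asymptotic_deviation (kappa Cmin Cmax rho e e' eta xi : R) :
  0 < Cmin -> 24 <= kappa -> 0 < e -> 0 < e' -> 0 < eta < 1 -> 0 < xi ->
  exists e0 L0 : R, [/\ 0 < e0, 1 <= L0 &
  forall (d : measure_display) (T : measurableType d) (P : probability T R)
    (n p : nat) (S : 'M[R]_p) (beta : 'cV[R]_p) (sigma : R)
    (X : T -> 'M[R]_(n, p)) (eps : T -> 'cV[R]_n) (bhat : T -> 'cV[R]_p)
    (ghat : 'I_p -> T -> 'cV[R]_(p.-1)),
    let L := ln p%:R : R in let s := #|signals beta| in let smax := s_max S in
    let y w := X w *m beta + eps w in
    let z w := zstat (X w) (y w) (bhat w) (tuning kappa n p) (fun j => ghat j w) sigma in
    0 < sigma -> gaussian_noise_given P X sigma eps -> iid_gaussian_rows P X S ->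
    covariance_condition Cmin Cmax rho s S ->
    random_matrix bhat /\ (forall w, is_lasso (y w) (X w) (tuning (8 * sigma) n p) (bhat w)) ->
    (forall j, random_matrix (ghat j) /\ forall w,
       is_lasso (col j (X w)) (col' j (X w)) (tuning kappa n p) (ghat j w)) ->
    (0 < n)%N -> (0 < s)%N -> L0 <= L ->
    expR ((1 - eta) * L) <= 2 * s%:R -> s%:R <= 2 * expR ((1 - eta) * L) ->
    (maxn s smax)%:R <= e0 * (n%:R / L) -> (minn smax s)%:R <= e0 * (Num.sqrt n%:R / L) ->
    Num.min eta (gamma_star eta p n smax) < xi ->
    (P [set w | (e < s%:R^-1 * `|(FP beta (z w) (t_level xi p))%:R -
       2 * #|nulls beta|%:R * Phi (- t_level xi p)|)%R] <= e'%:E)%E].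
Proof.
move=> Cm0 k24 ep e'0 eta01 xi0.
pose c := Num.min 1 Cmin; pose om := Num.min 1 (e / 8).
have c0 : 0 < c by rewrite lt_min ltr01.
have c1 : c <= 1 by rewrite ge_min lexx.
have cC : c <= Cmin by rewrite ge_min lexx orbT.
have om0 : 0 < om by rewrite lt_min ltr01 divr_gt0.
have om1 : om <= 1 by rewrite ge_min lexx.
have ome : 8 * om <= e by rewrite mulrC -ler_pdivlMr// ge_min lexx orbT.
have [e1 [L0 [/andP[e10 e11] hL0 H]]] := asymptotic_levels c0 c1 k24 om0 om1 ep e'0 eta01 xi0.
have k0 : 0 < kappa := lt_le_trans (ltr0n _ 24) k24.
have k2 : 0 < 2 * kappa ^+ 2 by rewrite mulr_gt0// exprn_gt0.
have c10 : 0 < (c / 100) ^+ 2 by rewrite exprn_gt0// divr_gt0.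
have c24 : 0 < (c / 100) ^+ 2 / 24 by rewrite divr_gt0.
pose e0 := Num.min e1 (Num.min (((c / 100) ^+ 2 / 24) ^+ 2) (c / (2 * kappa ^+ 2))).
have e00 : 0 < e0 by rewrite !lt_min e10 exprn_gt0//= divr_gt0.
have [d1 d2 d3] : [/\ e0 <= e1, e0 <= ((c / 100) ^+ 2 / 24) ^+ 2 & e0 <= c / (2 * kappa ^+ 2)].
  by rewrite /e0; split; rewrite !ge_min lexx ?orbT.
exists e0, L0; split=> // d T P n p S beta sigma X eps bhat ghat L s smax y z.
move=> sig0 gX iX [S1 Se _] [rb lb] hg n0 s0 hL hs hs2 hmax hmin hgam.
have L1 : 1 <= L := le_trans hL0 hL; have Lp : 0 < L := lt_le_trans ltr01 L1.
have hmax0 : Num.max s%:R smax%:R <= e0 * (n%:R / L) by rewrite -maxn_natr.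
have hmin0 : Num.min s%:R smax%:R <= e0 * (Num.sqrt n%:R / L) by rewrite -minn_natr minnC.
have hmax1 : Num.max s%:R smax%:R <= e1 * (n%:R / L).
  by apply: (le_trans hmax0); apply: ler_wpM2r => //; apply: divr_ge0; [exact: ler0n|exact: ltW].
have hmin1 : Num.min s%:R smax%:R <= e1 * (Num.sqrt n%:R / L).
  by apply: (le_trans hmin0); apply: ler_wpM2r => //; apply: divr_ge0; [exact: sqrtr_ge0|exact: ltW].
have he0 : 0 < e0 <= 1 by rewrite e00 (le_trans d1).
have q1 : 24 * Num.sqrt e0 <= (c / 100) ^+ 2.
  rewrite mulrC -ler_pdivlMr// -[leRHS](ger0_norm (ltW c24)) -sqrtr_sqr ler_sqrt//.
  exact: sqr_ge0.
have q2 : 2 * kappa ^+ 2 * e0 <= c by rewrite mulrC -ler_pdivlMr.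
have [rho0 rho12 xL xN mrho] := @sample_size_conditions R n p S beta c kappa n0 s0 L1 c0 c1 e0 he0 hmax0 q1 q2.
have sS : S^T = S by case: iX => _ /(_ (Ordinal n0)) [].
have Sc v : c * sqnorm2 v <= bform S v v.
  by apply: eigenvalue_lower_bound => // a /Se /andP[h _]; exact: le_trans h.
have rg j := (hg j).1; have lg j w := (hg j).2 w.
have [bt [[g1 g2]|[g1 g2]]] := H n p S beta n0 s0 hL hs hs2 hmax1 hmin1 hgam.
  apply: (@le_trans _ _ (failure_level n S beta + #|nulls beta|%:R * (2 * Phi (- (t_level xi p -
    bias_level n S beta c kappa om))) / (e / 2 * s%:R))%:E); last by rewrite lee_fin.
  exact: (finite_sample_markov n0 rho0 c0 c1 sS Sc S1 sig0 s0 k24 iX gX rb rg lb lg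
    rho12 xL xN mrho om0 om1 ep ome bt g1).
apply: (@le_trans _ _ (failure_level n S beta + (variance_level n S beta c kappa e (t_level xi p -
    bias_level n S beta c kappa om) + variance_level n S beta c kappa e (t_level xi p +
    bias_level n S beta c kappa om)))%:E); last by rewrite lee_fin.
exact: (finite_sample_chebyshev n0 rho0 c0 c1 sS Sc S1 sig0 s0 k24 iX gX rb rg lb lg
    rho12 xL xN mrho om0 om1 ep ome bt g1).
Qed.

End DeviationProbability.

Theorem theorem2p1 (R : realType) :
  exists kappa0 : R, 0 < kappa0 /\
  forall (kappa : R) (Cmin Cmax rho eta xi : R)
    (d : nat -> measure_display) (T : forall p, measurableType (d p))
    (P : forall p, probability (T p) R)
    (n : nat -> nat) (Sigma : forall p, 'M[R]_p) (beta : forall p, 'cV[R]_p)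
    (sigma : nat -> R)
    (X : forall p, T p -> 'M[R]_(n p, p)) (eps : forall p, T p -> 'cV[R]_(n p))
    (bhat : forall p, T p -> 'cV[R]_p)
    (ghat : forall p, 'I_p -> T p -> 'cV[R]_(p.-1)),
  let s p := #|signals (beta p)| in
  let p0 p := #|nulls (beta p)| in
  let smax p := s_max (Sigma p) in
  let y p w := X p w *m beta p + eps p w in
  let lambda p := tuning (8 * sigma p) (n p) p in
  let lambdaj p := tuning kappa (n p) p in
  let z p w := zstat (X p w) (y p w) (bhat p w) (lambdaj p)
                     (fun j => ghat p j w) (sigma p) in
  kappa0 <= kappa ->
  0 < Cmin -> Cmin <= Cmax -> 0 < rho ->
  (* the model and condition A1 *)
  (\forall p \near \oo, 0 < sigma p) ->
  (fun p => sigma p ^+ 2) =O_\oo (fun=> 1 : R) ->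
  (\forall p \near \oo, gaussian_noise_given (P p) (X p) (sigma p) (eps p)) ->
  (\forall p \near \oo, iid_gaussian_rows (P p) (X p) (Sigma p)) ->
  (\forall p \near \oo, covariance_condition Cmin Cmax rho (s p) (Sigma p)) ->
  (* the Lasso estimators, with the tuning parameters of A2 *)
  (\forall p \near \oo, random_matrix (bhat p) /\
     forall w, is_lasso (y p w) (X p w) (lambda p) (bhat p w)) ->
  (\forall p \near \oo, forall j : 'I_p, random_matrix (ghat p j) /\
     forall w, is_lasso (col j (X p w)) (col' j (X p w)) (lambdaj p)
                        (ghat p j w)) ->
  (* condition A3 *)
  (fun p => (maxn (s p) (smax p))%:R : R) =o_\oo
    (fun p => (n p)%:R / ln p%:R : R) ->
  (fun p => (minn (smax p) (s p))%:R : R) =o_\oo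
    (fun p => Num.sqrt (n p)%:R / ln p%:R : R) ->
  (fun p => (s p)%:R : R) =o_\oo (fun p => (n p)%:R / ln p%:R ^+ 2 : R) ->
  (* s = p^(1 - eta), up to the rounding needed for s to be an integer *)
  0 < eta < 1 ->
  (s p)%:R / p%:R `^ (1 - eta) @[p --> \oo] --> (1 : R) ->
  0 < xi ->
  (\forall p \near \oo,
     Num.min eta (gamma_star eta p (n p) (smax p)) < xi) ->
  oP1 P (fun p w =>
    (s p)%:R^-1 * `|(FP (beta p) (z p w) (t_level xi p))%:R
                    - 2 * (p0 p)%:R * Phi (- t_level xi p)|).
Proof.
exists 24; split; first exact: ltr0n.
move=> kappa Cmin Cmax rho eta xi d T P n Sigma beta sigma X eps bhat ghat s p0 smax y lambda
  lambdaj z k24 Cm0 _ _ sig0 _ heps hX hcov hb hg A3a A3b _ eta01 hs xi0 hgam e e0.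
pose F p := [set w | e < `|(s p)%:R^-1 * `|(FP (beta p) (z p w) (t_level xi p))%:R
  - 2 * (p0 p)%:R * Phi (- t_level xi p)| |].
have H e' : 0 < e' -> \forall p \near \oo, (P p (F p) <= e'%:E)%E.
  move=> e'0.
  have [e1 [L0 [e10 L01 HD]]] :=
    asymptotic_deviation Cmax rho Cm0 k24 e0 e'0 eta01 xi0.
  have hA := (eqoP _ _ _).1 A3a e1 e10.
  have hB := (eqoP _ _ _).1 A3b e1 e10.
  move/cvgrPdist_lt: (hs) => /(_ _ (divr_gt0 ltr01 (ltr0n R 2))) hS.
  have hp := nbhs_infty_ger (expR L0).
  have I A B : (\forall q \near \oo, A q) -> (\forall q \near \oo, B q) ->
    \forall q \near \oo, A q /\ B q by exact: filterI.
  have := I _ _ sig0 (I _ _ heps (I _ _ hX (I _ _ hcov (I _ _ hb (I _ _ hg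
    (I _ _ hA (I _ _ hB (I _ _ hS (I _ _ hp hgam))))))))).
  apply: filterS => p [h1 [h2 [h3 [h4 [h5 [h6 [hmax [hmin [hsp [hpL hga]]]]]]]]]].
  have pp : 0 < p%:R :> R := lt_le_trans (expR_gt0 _) hpL.
  have hL : L0 <= ln p%:R by rewrite -[leLHS]expRK ler_ln// posrE expR_gt0.
  have Lp : 0 < ln p%:R :> R := lt_le_trans ltr01 (le_trans L01 hL).
  have QE : p%:R `^ (1 - eta) = expR ((1 - eta) * ln p%:R) by rewrite /powR gt_eqF.
  rewrite QE in hsp; have Q0 := expR_gt0 ((1 - eta) * ln p%:R).
  move: hsp; rewrite ltr_norml => /andP[hs1 hs2].
  have k1 : (s p)%:R <= 2 * expR ((1 - eta) * ln p%:R).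
    by rewrite -ler_pdivrMr//; move: hs1; move: (_ / _) => r ?; lra.
  have k2 : expR ((1 - eta) * ln p%:R) <= 2 * (s p)%:R.
    have : 1 / 2 <= (s p)%:R / expR ((1 - eta) * ln p%:R).
      by move: hs2; move: (_%:R / expR _) => r ?; lra.
    by rewrite ler_pdivlMr//; move: (expR _) => q ?; lra.
  have s0 : (0 < s p)%N.
    by rewrite -(ltr0n R); move: (lt_le_trans Q0 k2); rewrite pmulr_rgt0.
  have nL0 (x : R) : 0 <= x -> `|x / ln p%:R| = x / ln p%:R.
    by move=> x0; rewrite ger0_norm// divr_ge0// ltW.
  have nn (i : nat) : `|i%:R| = i%:R :> R by rewrite ger0_norm.
  rewrite nn nL0// in hmax; rewrite nn nL0 ?sqrtr_ge0// in hmin.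
  have n0 : (0 < n p)%N.
    rewrite lt0n; apply/eqP => nz; move: hmax; rewrite nz mul0r mulr0 => h.
    have : (maxn (s p) (smax p))%:R <= 0 :> R by exact: h.
    by rewrite lern0 -leqn0 geq_max leqn0 eqn0Ngt s0.
  have nE (i : nat) (x : R) : `|i%:R^-1 * `|x| | = i%:R^-1 * `|x|.
    by rewrite ger0_norm// mulr_ge0// invr_ge0.
  have -> : F p = [set w | e < (s p)%:R^-1 * `|(FP (beta p) (z p w) (t_level xi p))%:R
      - 2 * (p0 p)%:R * Phi (- t_level xi p)|].
    by apply/seteqP; split=> w; rewrite /F /= nE.
  exact: (HD _ _ (P p) _ _ _ _ _ _ _ _ _ h1 h2 h3 h4 h5 h6 n0 s0 hL k2 k1 hmax hmin hga).
have fin p (a : R) : (P p (F p) <= a%:E)%E -> P p (F p) \is a fin_num.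
  by move=> h; rewrite ge0_fin_numE//; exact: (le_lt_trans h (ltry _)).
apply/fine_cvgP; split.
  by apply: filterS (H _ ltr01) => p h; exact: (fin _ _ h).
apply/cvgrPdist_le => e' e'0; apply: filterS (H _ e'0) => p h.
rewrite /= sub0r normrN ger0_norm ?fine_ge0// -lee_fin fineK//.
exact: (fin _ _ h).
Qed.
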